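(* Let $\lambda\ge 1$. For $f$ on $\mathbb{R}^m\times\mathbb{T}_\lambda^n$, let $U_\lambda(t)f$ denote the solution $u(x,y,t)$ of the linear Schrödinger equation $iu_t+\Delta_{x,y}u=0$ on $\mathbb{R}^m\times\mathbb{T}_\lambda^n$ with $u(x,y,0)=f(x,y)$. Let $N_1\ge N_2\ge 1$ be dyadic numbers. (i) If $m=1$ and $n=1$, then for all $f,g\in L^2(\mathbb{R}\times\mathbb{T}_\lambda)$, $$\| U_{\lambda}(t) P_{N_1}f \; U_{\lambda}(t) P_{N_2}g \|_{L_{x,y,t}^2(\mathbb{R}\times \mathbb{T}_{\lambda} \times [0,1])} \lesssim \left(\frac{1}{\lambda} +\frac{N_2}{N_1} \right)^{\frac{1}{2}} \|f\|_{L^2} \|g\|_{L^2}.$$ (ii) If $m\ge 2$ and $n\ge 1$, with $d=m+n$, then for all $f,g\in L^2(\mathbb{R}^m\times\mathbb{T}_\lambda^n)$, $$\| U_{\lambda}(t) P_{N_1}f \; U_{\lambda}(t) P_{N_2}g \|_{L_{x,y,t}^2(\mathbb{R}^{m}\times \mathbb{T}^{n}_{\lambda} \times [0,\infty))} \lesssim \left( \frac{N_2^{d-3}}{\lambda} +\frac{N_2^{d-1}}{N_1} \right)^{\frac{1}{2}} \|f\|_{L_{x,y}^2} \|g\|_{L_{x,y}^2}.$$ The implicit constants are independent of $\lambda,N_1,N_2,f,g$.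
   Context: $\mathbb{T}_\lambda=\lambda\mathbb{T}$ is the rescaled torus, identified with $[0,\lambda]$ with endpoints identified ($\mathbb{T}$ being $[0,1]$). Points of $\mathbb{R}^m\times\mathbb{T}_\lambda^n$ are written $z=(x,y)$, $x\in\mathbb{R}^m$, $y\in\mathbb{T}_\lambda^n$. The Fourier transform is $\mathcal{F}f(\xi)=\hat f(\xi)=\int_{\mathbb{R}^m\times\mathbb{T}_\lambda^n}f(z)e^{-2\pi i z\cdot\xi}\,dz$ for $\xi\in\mathbb{R}^m\times\mathbb{Z}_{1/\lambda}^n$, where $\mathbb{Z}_{1/\lambda}=\frac1\lambda\mathbb{Z}$. Littlewood–Paley projections: fix a smooth even $\eta_1:\mathbb{R}\to[0,1]$ with $\eta_1(r)=1$ for $|r|\le1$ and $\eta_1(r)=0$ for $|r|\ge 2$; put $\eta^d(\xi)=\eta_1(\xi_1)\cdots\eta_1(\xi_d)$, $d=m+n$. For a dyadic number $N=2^j$ define $\mathcal{F}(P_{\le N}f)(\xi)=\eta^d(\xi/N)\mathcal{F}f(\xi)$ and $P_N=P_{\le N}-P_{\le N/2}$. $A\lesssim B$ means $A\le CB$ for some constant $C$ (which may depend on the dimensions and the fixed cutoff). *)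

(* Defs.v *)
From HB Require Import structures.
From mathcomp Require Import all_boot all_order all_algebra.
From mathcomp Require Import all_classical all_reals all_analysis.
From mathcomp Require Import complex.

Set Implicit Arguments.
Unset Strict Implicit.
Unset Printing Implicit Defensive.

Import Order.TTheory GRing.Theory Num.Theory.
Import numFieldNormedType.Exports.

Local Open Scope classical_set_scope.
Local Open Scope ring_scope.
Local Open Scope complex_scope.

Definition cons_tuple (T : Type) (n : nat) (p : T * n.-tuple T) :
  n.+1.-tuple T := [the n.+1.-tuple T of p.1 :: p.2].

Lemma measurable_cons_tuple d (T : measurableType d) (n : nat) :
  measurable_fun [set: T * n.-tuple T] (@cons_tuple T n).
Proof. exact: measurable_cons. Qed.

(* [(mu \x nu)%E] has no usable [sigma_finite_measure] instance for general
   sigma-finite factors (the canonical projection is taken by probability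
   products), hence this wrapper. *)
Section prod_measure.
Context d1 d2 (T1 : measurableType d1) (T2 : measurableType d2) (R : realType).
Variables (mu : {sigma_finite_measure set T1 -> \bar R})
  (nu : {sigma_finite_measure set T2 -> \bar R}).

Definition prod_measure : set (T1 * T2) -> \bar R := (mu \x nu)%E.

HB.instance Definition _ := Measure.copy prod_measure (mu \x nu)%E.

Let prod_measure_sigma_finite : sigma_finite setT prod_measure.
Proof.
have /sigma_finiteP[F [TF ndF Foo]] := sigma_finiteT mu.
have /sigma_finiteP[G [TG ndG Goo]] := sigma_finiteT nu.
exists (fun k => F k `*` G k) => [|k].
  rewrite -setXTT TF TG predeqE => -[x y]; split => [|[k _ [? ?]]].
    move=> [/= [i _ Fix] [j _ Gjy]]; exists (maxn i j) => //; split.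
    - by move: x Fix; exact/subsetPset/ndF/leq_maxl.
    - by move: y Gjy; exact/subsetPset/ndG/leq_maxr.
  by split; exists k.
have [? ?] := Foo k; have [? ?] := Goo k.
split; first exact: measurableX.
by rewrite /prod_measure product_measure1E// lte_mul_pinfty// ge0_fin_numE.
Qed.

HB.instance Definition _ := Measure_isSigmaFinite.Build _ _ _ prod_measure
  prod_measure_sigma_finite.

End prod_measure.

Section cons_measure.
Context d (T : measurableType d) (R : realType) (n : nat).
Variables (mu : {sigma_finite_measure set T -> \bar R})
  (nu : {sigma_finite_measure set (n.-tuple T) -> \bar R}).

Definition cons_measure : set (n.+1.-tuple T) -> \bar R :=
  pushforward (prod_measure mu nu) (@cons_tuple T n).

Let mcons := @measurable_cons_tuple d T n.

Let cons_measure0 : cons_measure set0 = 0%E.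
Proof. by rewrite /cons_measure /pushforward preimage_set0 measure0. Qed.

Let cons_measure_ge0 A : (0 <= cons_measure A)%E.
Proof. exact: measure_ge0. Qed.

Let cons_measure_sigma_additive : semi_sigma_additive cons_measure.
Proof. by apply: measure_semi_sigma_additive; exact: mcons. Qed.

HB.instance Definition _ := isMeasure.Build _ _ _ cons_measure
  cons_measure0 cons_measure_ge0 cons_measure_sigma_additive.

Let uncons (t : n.+1.-tuple T) : T * n.-tuple T :=
  (thead t, [tuple of behead t]).

Let muncons : measurable_fun setT uncons.
Proof.
apply/measurable_fun_pairP; split => /=; first exact: measurable_tnth.
exact: measurable_behead.
Qed.

Let cons_measure_sigma_finite : sigma_finite setT cons_measure.
Proof.
have [F UF mF] := sigma_finiteT (prod_measure mu nu).
exists (fun k => uncons @^-1` F k) => [|k].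
  by rewrite -preimage_bigcup -UF preimage_setT.
have [mFk Fkoo] := mF k; split.
  by rewrite -[X in measurable X]setTI; exact: muncons.
rewrite /cons_measure /pushforward -comp_preimage.
suff -> : (uncons \o @cons_tuple T n) = id by [].
by apply/funext => -[x t]; congr pair; exact/val_inj.
Qed.

HB.instance Definition _ := Measure_isSigmaFinite.Build _ _ _ cons_measure
  cons_measure_sigma_finite.

End cons_measure.

Fixpoint power_measure d (T : measurableType d) (R : realType)
    (mu : {sigma_finite_measure set T -> \bar R}) (n : nat) :
    {sigma_finite_measure set (n.-tuple T) -> \bar R} :=
  match n with
  | 0 => \d_ [tuple]
  | n'.+1 => cons_measure mu (power_measure mu n')
  end.

(* [mrestr] with its [sigma_finite_measure] instance, again because the
   canonical projection is taken by restrictions of finite mass. *)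
Section restr_measure.
Context d (T : measurableType d) (R : realType).
Variables (mu : {sigma_finite_measure set T -> \bar R}).
Variables (D : set T) (mD : measurable D).

Definition restr_measure : set T -> \bar R := mrestr mu mD.

HB.instance Definition _ := Measure.copy restr_measure (mrestr mu mD).

Let restr_measure_sigma_finite : sigma_finite setT restr_measure.
Proof.
have [F UF mF] := sigma_finiteT mu; exists F => // k.
have [mFk Fkoo] := mF k; split => //; apply: le_lt_trans Fkoo.
by rewrite /restr_measure /mrestr le_measure ?inE//; exact: measurableI.
Qed.

HB.instance Definition _ := Measure_isSigmaFinite.Build _ _ _ restr_measure
  restr_measure_sigma_finite.

End restr_measure.

Section complex_valued.
Context d (X : measurableType d) (R : realType).
Variable mu : {measure set X -> \bar R}.

Definition cis (theta : R) : R[i] := cos theta +i* sin theta.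

Definition cmeasurable (f : X -> R[i]) : Prop :=
  measurable_fun setT (fun z => complex.Re (f z)) /\
  measurable_fun setT (fun z => complex.Im (f z)).

Definition cintegral (f : X -> R[i]) : R[i] :=
  (\int[mu]_z complex.Re (f z)) +i* (\int[mu]_z complex.Im (f z)).

Definition L2norm (f : X -> R[i]) : \bar R :=
  Lnorm mu 2%:E (fun z => (Normc.normc (f z))%:E).

Definition in_L2 (f : X -> R[i]) : Prop :=
  cmeasurable f /\ (L2norm f < +oo)%E.

End complex_valued.

(* A point z = (x, y) of R^m x T_lam^n, with y taken in the fundamental domain
   [0, lam]^n; what a function does for y outside of it is never looked at,
   because [waveguide] below gives no mass there. *)
Notation phys_point R m n :=
  (m.-tuple (measurableTypeR R) * n.-tuple (measurableTypeR R))%type.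

Section waveguide.
Variables (R : realType) (m n : nat) (lam : R).
Local Notation leb := (@lebesgue_measure R).
Local Notation X := (phys_point R m n).
Local Notation C := R[i].

Definition interval_measure (I : interval R) :
    {sigma_finite_measure set (measurableTypeR R) -> \bar R} :=
  restr_measure leb (measurable_itv I).

Definition waveguide : {sigma_finite_measure set X -> \bar R} :=
  prod_measure (power_measure leb m)
    (power_measure (interval_measure `[0, lam]) n).

Definition spacetime (I : interval R) :
    {sigma_finite_measure set (measurableTypeR R * X)%type -> \bar R} :=
  prod_measure (interval_measure I) waveguide.

(* A frequency xi in R^m x (Z_{1/lam})^n is given by [zeta : m.-tuple R] and
   [k : n.-tuple int], standing for xi = (zeta, k / lam). *)
Local Notation freq_fun := (m.-tuple (measurableTypeR R) -> n.-tuple int -> C).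

Definition freq_dot (z : X) (zeta : m.-tuple R) (k : n.-tuple int) : R :=
  \sum_(i < m) tnth z.1 i * tnth zeta i +
  \sum_(j < n) tnth z.2 j * ((tnth k j)%:~R / lam).

(* Frequencies carry Lebesgue measure times 1/lam^n times counting measure, the
   normalization for which the Fourier transform is an L^2 isometry. *)
Definition freq_norm_sq (F : freq_fun) : \bar R :=
  \esum_(k in [set: n.-tuple int])
    ((lam ^- n)%:E * \int[power_measure leb m]_zeta
                       (Normc.normc (F zeta k) ^+ 2)%:E)%E.

Definition freq_in_L2 (F : freq_fun) : Prop :=
  (forall k, cmeasurable (F ^~ k)) /\ (freq_norm_sq F < +oo)%E.

Definition fourier_integral (f : X -> C) : freq_fun := fun zeta k =>
  cintegral waveguide (fun z => f z * cis (- (2 * pi * freq_dot z zeta k))).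

Definition truncate (r : R) (f : X -> C) : X -> C := fun z =>
  if [forall i, `|tnth z.1 i| <= r] then f z else 0.

(* [F] is the Fourier transform of f in L^2: the limit in L^2, as r tends to
   infinity, of the transforms of the integrable functions f 1_{|x_i| <= r}. *)
Definition is_fourier (f : X -> C) (F : freq_fun) : Prop :=
  freq_in_L2 F /\
  freq_norm_sq (fun zeta k => F zeta k - fourier_integral (truncate r f) zeta k)
    @[r --> +oo] --> 0%E.

Definition is_cutoff (eta : R -> R) : Prop :=
  [/\ forall (k : nat) (r : R), derivable (derive1n k eta) r 1,
      forall r, eta (- r) = eta r,
      forall r, 0 <= eta r <= 1,
      forall r, `|r| <= 1 -> eta r = 1 &
      forall r, 2 <= `|r| -> eta r = 0].

(* eta^d(xi / N) at the frequency xi = (zeta, k / lam) *)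
Definition cutoff_symbol (eta : R -> R) (N : R)
    (zeta : m.-tuple R) (k : n.-tuple int) : R :=
  (\prod_(i < m) eta (tnth zeta i / N)) *
  (\prod_(j < n) eta ((tnth k j)%:~R / lam / N)).

Definition is_LP_le (eta : R -> R) (N : R) (f h : X -> C) : Prop :=
  in_L2 waveguide h /\
  exists F, is_fourier f F /\
    is_fourier h (fun zeta k => (cutoff_symbol eta N zeta k)%:C * F zeta k).

(* [h] is (a representative of) P_N f = P_{<= N} f - P_{<= N/2} f. *)
Definition is_LP (eta : R -> R) (N : R) (f h : X -> C) : Prop :=
  exists h1 h2, [/\ is_LP_le eta N f h1, is_LP_le eta (N / 2) f h2 &
    h = (fun z => h1 z - h2 z)].

Section test_functions.
Local Notation V := 'rV[R]_(m + n).

Definition coord_vec (i : 'I_(m + n)) : V := delta_mx 0 i.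

Definition partial (i : 'I_(m + n)) (phi : V -> R) : V -> R :=
  fun v => 'D_(coord_vec i) phi v.

Definition smooth (phi : V -> R) : Prop := forall s : seq 'I_(m + n),
  let psi := foldr partial phi s in
  continuous psi /\ forall i v, derivable psi v (coord_vec i).

Definition laplacian (phi : V -> R) : V -> R :=
  fun v => \sum_(i < m + n) partial i (partial i phi) v.

(* C_c^oo(R^m x T_lam^n; R): smooth functions on R^(m+n) that are
   lam-periodic in each y_j and vanish for x outside of a bounded set *)
Definition test_function (phi : V -> R) : Prop :=
  [/\ smooth phi,
      forall (j : 'I_n) (v : V), phi (v + lam *: coord_vec (rshift m j)) = phi v &
      exists K : R, forall (v : V) (i : 'I_m), K < `|v 0 (lshift n i)| -> phi v = 0].

End test_functions.

Definition coordinates (z : X) : 'rV[R]_(m + n) :=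
  row_mx (\row_i tnth z.1 i) (\row_j tnth z.2 j).

Definition pairing (h : X -> C) (phi : 'rV[R]_(m + n) -> R) : C :=
  cintegral waveguide (fun z => h z * (phi (coordinates z))%:C).

(* [u t z] is the solution of i u_t + Delta u = 0 with u(0) = f, in the usual
   sense for L^2 data: u is in C(R; L^2), solves the equation weakly in space
   for every time, and has initial value f.  Such a u is unique up to null
   sets at each time, and is what is written U_lam(t) f. *)
Record schrodinger_solution (f : X -> C) (u : R -> X -> C) : Prop := {
  solution_measurable :
    cmeasurable (fun tz : measurableTypeR R * X => u tz.1 tz.2);
  solution_L2 : forall t, in_L2 waveguide (u t);
  solution_continuous : forall t,
    L2norm waveguide (fun z => u s z - u t z) @[s --> t] --> 0%E;
  solution_equation : forall phi, test_function phi -> forall t,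
    let w s := pairing (u s) phi in
    [/\ derivable (fun s => complex.Re (w s)) t 1, derivable (fun s => complex.Im (w s)) t 1 &
      (0 +i* 1) * (derive1 (fun s => complex.Re (w s)) t +i*
              derive1 (fun s => complex.Im (w s)) t)
        + pairing (u t) (laplacian phi) = 0];
  solution_initial : {ae waveguide, forall z, u 0 z = f z} }.

End waveguide.

Definition is_dyadic (R : realType) (N : R) : Prop := exists j : int, N = 2 ^ j.

(* Main.v *)
(** The product of two free solutions is an oscillatory integral over pairs of
    frequencies, with phase the space-time character of their sum.  Its
    weighted L2 norm is estimated by Schur's test: with Fejer-type weights in
    time and in the unbounded space directions the Schur kernel is explicit,
    nonnegative and concentrated, and the bound reduces to estimating the
    measure of the frequencies [xi] of size at most [2 N2], with [w - xi] of
    size at least [N1 / 2], for which [|w - xi|^2 + |xi|^2] lies in a window of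
    given width.  Only one-sided (Bessel) inequalities are used for the
    transform, never Plancherel's identity.

    A weak solution is identified with the free evolution by pairing it with
    windowed plane waves: the pairing solves the ordinary differential equation
    of the frequency up to an error that is small in L2 as the window grows.
    The solution is then recovered from its transform up to the constant factor
    [fejc ^ m], the m-th power of the mass of the Fejer kernel, by comparing
    integrals over boxes; the value of [fejc] is irrelevant. *)
Require Import Defs.
From HB Require Import structures.
From mathcomp Require Import all_boot all_order all_algebra.
From mathcomp Require Import all_classical all_reals all_analysis.
From mathcomp Require Import complex measurable_realfun.
From mathcomp Require Import ring lra zify.

Set Implicit Arguments.
Unset Strict Implicit.
Unset Printing Implicit Defensive.

Import Order.TTheory GRing.Theory Num.Theory.
Import numFieldNormedType.Exports.

Local Open Scope classical_set_scope.
Local Open Scope ring_scope.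

Local Notation lebesgue R :=
  (@lebesgue_measure R : {sigma_finite_measure set (measurableTypeR R) -> \bar R}).
Local Notation frequency R m n := (m.-tuple (measurableTypeR R) * n.-tuple int)%type.
Local Notation measT := (measurable_fun setT).
Local Notation "mu .-intT f" := (mu.-integrable setT (EFin \o f))
  (at level 2, f at level 1, format "mu .-intT  f").

(** What separates the two cases is how thin a resonance window may be. The Fejer weight of size
    [T0] in time tests windows of size [2 ^+ j / T0]. When [m >= 2], two continuous coordinates make
    the measure of a shell linear in its thickness at every scale, so [T0] may tend to infinity.
    When [m = n = 1], a slice of a shell can be as long as the square root of the thickness;
    linearity survives only for thickness at least 1, and the time interval stays bounded. The gain
    over the trivial bound is transversality. If [N1] is much larger than [N2], the centre of the
    shell, half the sum of the two frequencies, is at distance of order [N1] from [xi] in some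
    coordinate, and slices along that coordinate have length of order [de / N1]. When it is a
    lattice coordinate, one lattice point always survives; its mass [1 / lam] is the first term of
    the bound. All integrals are real: an exponential is a cosine with a free shift, and complex
    data are split into real and imaginary parts. *)

Lemma eq_le d (T : porderType d) (x y : T) : x = y -> (x <= y)%O.
Proof. by move=> ->. Qed.

(** Every set of integers is declared measurable, so that functions of lattice frequencies are
    measurable for free and lattice coordinates enter product measures on the same footing as
    continuous ones. *)
HB.instance Definition _ := isPointed.Build int 0.

HB.instance Definition _ := @isMeasurable.Build default_measure_display
  int (@discrete_measurable int) (@discrete_measurable0 int)
  (@discrete_measurableC int) (@discrete_measurableU int).

(** * Integrals of real functions and iterated integrals *)

Section tools.
Context d (T : measurableType d) (R : realType) (mu : {measure set T -> \bar R}).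

Lemma integrable_dom (f g : T -> R) : measT f ->
  mu.-intT (g) -> (forall x, `|f x| <= `|g x|) ->
  mu.-intT (f).
Proof.
move=> mf ig fg; apply: le_integrable ig => //.
  exact/measurable_EFinP.
by move=> x _ /=; rewrite lee_fin.
Qed.

Lemma EFinRint (f : T -> R) : mu.-intT (f) ->
  ((\int[mu]_x f x)%:E = \int[mu]_x (f x)%:E)%E.
Proof. by move=> fi; rewrite /Rintegral fineK//; exact: integrable_fin_num. Qed.

Lemma ge0_intZl (r : R) (f : T -> R) : 0 <= r -> measT f ->
  (forall x, 0 <= f x) ->
  (\int[mu]_x (r * f x)%:E = r%:E * \int[mu]_x (f x)%:E)%E.
Proof.
move=> r0 mf f0; under eq_integral do rewrite EFinM.
rewrite ge0_integralZl//.
- exact/measurable_EFinP.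
- by move=> x _; rewrite lee_fin.
Qed.

Lemma ge0_intD (f g : T -> R) : measT f -> measT g ->
  (forall x, 0 <= f x) -> (forall x, 0 <= g x) ->
  (\int[mu]_x (f x + g x)%:E = \int[mu]_x (f x)%:E + \int[mu]_x (g x)%:E)%E.
Proof.
move=> mf mg f0 g0; under eq_integral do rewrite EFinD.
rewrite ge0_integralD//.
- by move=> x _; rewrite lee_fin.
- exact/measurable_EFinP.
- by move=> x _; rewrite lee_fin.
- exact/measurable_EFinP.
Qed.

Lemma ge0_le_int (f g : T -> R) : measT f -> measT g ->
  (forall x, 0 <= f x) -> (forall x, f x <= g x) ->
  (\int[mu]_x (f x)%:E <= \int[mu]_x (g x)%:E)%E.
Proof.
move=> mf mg f0 fg; apply: ge0_le_integral => //.
- by move=> x _; rewrite lee_fin.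
- exact/measurable_EFinP.
- exact/measurable_EFinP.
- by move=> x _; rewrite lee_fin.
Qed.

End tools.

Lemma measurable_pairT d d1 d2 (T : measurableType d) (T1 : measurableType d1)
    (T2 : measurableType d2) (f : T -> T1) (g : T -> T2) :
  measT f -> measT g ->
  measT (fun x => (f x, g x)).
Proof. by move=> mf mg; apply/measurable_fun_pairP; split. Qed.

Ltac mproj := first
  [ assumption | exact: measurable_id | exact: measurable_cst
  | exact: measurable_fst | exact: measurable_snd
  | apply: measurable_pairT; mproj
  | apply: (measurableT_comp measurable_fst); mproj
  | apply: (measurableT_comp measurable_snd); mproj ].

Ltac pos := intros; rewrite ?lee_fin; repeat first
  [ done | exact: sqr_ge0 | exact: normr_ge0 | apply: mulr_ge0 | apply: addr_ge0
  | rewrite invr_ge0 | apply: exprn_ge0 ].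

Section prod_tools.
Context d1 d2 (X : measurableType d1) (Y : measurableType d2) (R : realType).
Variables (mu : {sigma_finite_measure set X -> \bar R}).
Variables (nu : {sigma_finite_measure set Y -> \bar R}).

Lemma prod_tonelli (f : X * Y -> \bar R) : measT f ->
  (forall z, 0 <= f z)%E ->
  (\int[prod_measure mu nu]_z f z = \int[mu]_x \int[nu]_y f (x, y))%E.
Proof. by move=> mf f0; exact: fubini_tonelli1. Qed.

Lemma prod_tonelli2 (f : X * Y -> \bar R) : measT f ->
  (forall z, 0 <= f z)%E ->
  (\int[prod_measure mu nu]_z f z = \int[nu]_y \int[mu]_x f (x, y))%E.
Proof. by move=> mf f0; exact: fubini_tonelli2. Qed.

Lemma integrable_tensor (f : X -> R) (g : Y -> R) :
  mu.-intT (f) -> nu.-intT (g) ->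
  (prod_measure mu nu).-intT ((fun z => f z.1 * g z.2)).
Proof.
move=> /integrableP[mf fi] /integrableP[mg gi].
have mfg : measT (EFin \o (fun z : X * Y => f z.1 * g z.2)).
  apply/measurable_EFinP; apply: measurable_funM.
    by apply: measurableT_comp => //; apply/measurable_EFinP.
  by apply: measurableT_comp => //; apply/measurable_EFinP.
apply/integrableP; split => //.
rewrite prod_tonelli//; last exact: measurableT_comp.
under eq_integral => x _.
  rewrite (_ : (\int[nu]_y _)%E = (`|f x|%:E * \int[nu]_y `|(g y)%:E|)%E); last first.
    rewrite -ge0_integralZl//; last exact: measurableT_comp.
    by apply: eq_integral => y _; rewrite /= normrM.
  over.
rewrite /= ge0_integralZr//.
- apply: lte_mul_pinfty => //; first exact: integral_ge0.
  by rewrite ge0_fin_numE//; exact: integral_ge0.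
- by apply/measurable_EFinP; apply: measurableT_comp => //; exact/measurable_EFinP.
- exact: integral_ge0.
Qed.

Lemma prod_fubini (f : X * Y -> R) :
  (prod_measure mu nu).-intT (f) ->
  (\int[prod_measure mu nu]_z (f z)%:E = \int[mu]_x \int[nu]_y (f (x, y))%:E)%E.
Proof. by move=> fi; rewrite -(integral12_prod_meas1 fi). Qed.

Lemma prod_fubini2 (f : X * Y -> R) :
  (prod_measure mu nu).-intT (f) ->
  (\int[prod_measure mu nu]_z (f z)%:E = \int[nu]_y \int[mu]_x (f (x, y))%:E)%E.
Proof. by move=> fi; rewrite -(integral21_prod_meas1 fi). Qed.

Lemma measurable_param_integral (f : X * Y -> \bar R) : measT f ->
  measT (fun x => \int[nu]_y f (x, y))%E.
Proof.
move=> mf.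
have -> : (fun x => \int[nu]_y f (x, y))%E =
    (fun x => \int[nu]_y (f^\+ (x, y)) - \int[nu]_y (f^\- (x, y)))%E.
  apply/funext => x; rewrite [LHS]integralE.
  by congr (_ - _)%E; apply: eq_integral => y _; rewrite ?funeposE ?funenegE.
apply: emeasurable_funB; apply: measurable_fun_fubini_tonelli_F => //.
  exact: measurable_funepos.
exact: measurable_funeneg.
Qed.

Lemma measurable_param_Rintegral (f : X * Y -> R) : measT f ->
  measT (fun x => \int[nu]_y f (x, y)).
Proof.
move=> mf; apply: measurableT_comp; first exact: fine_measurable.
apply: (@measurable_param_integral (EFin \o f)).
exact/measurable_EFinP.
Qed.

End prod_tools.

(** * Transforms of weights against real phases *)

Section oscillatory.
Context (R : realType).

(* The transform of [k] against the phase [a], required to be real: both the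
   cosine and the sine parts are recorded by quantifying over the shift [c]. *)
Definition oscint d (X : measurableType d) (mu : {measure set X -> \bar R})
    (k a : X -> R) (K : R) : Prop :=
  [/\ mu.-intT (k), measT a &
      forall c, (\int[mu]_x (k x * cos (a x + c))%:E = (K * cos c)%:E)%E].

Lemma measurable_cosD d (X : measurableType d) (f : X -> R) :
  measT f -> measT (fun x => cos (f x)).
Proof.
move=> mf; apply: (measurableT_comp _ mf).
exact: (continuous_measurable_fun (@continuous_cos R)).
Qed.

Lemma integrable_mulcos d (X : measurableType d) (mu : {measure set X -> \bar R})
    (k a : X -> R) : mu.-intT (k) -> measT a ->
  mu.-intT ((fun x => k x * cos (a x))).
Proof.
move=> ik ma; apply: (integrable_dom _ ik).
  apply: measurable_funM; last exact: measurable_cosD.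
  by move/integrableP : ik => [/measurable_EFinP].
move=> x; rewrite normrM ler_piMr// ler_norml; apply/andP; split.
  exact: cos_geN1.
exact: cos_le1.
Qed.

Lemma measurable_sinD d (X : measurableType d) (f : X -> R) :
  measT f -> measT (fun x => sin (f x)).
Proof.
move=> mf; apply: (measurableT_comp _ mf).
exact: (continuous_measurable_fun (@continuous_sin R)).
Qed.

Lemma integrable_mulsin d (X : measurableType d) (mu : {measure set X -> \bar R})
    (k a : X -> R) : mu.-intT (k) -> measT a ->
  mu.-intT ((fun x => k x * sin (a x))).
Proof.
move=> ik ma; apply: (integrable_dom _ ik).
  apply: measurable_funM; last exact: measurable_sinD.
  by move/integrableP : ik => [/measurable_EFinP].
move=> x; rewrite normrM ler_piMr// ler_norml; apply/andP; split.
  exact: sin_geN1.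
exact: sin_le1.
Qed.

(** The free shift is what makes transforms multiply: the inner integral, taken with shift
    [a1 x + c], returns [K2 * cos (a1 x + c)], which is again an integrand of the first transform
    with shift [c]. No sine integral has to be carried along. *)
Lemma oscint_prod d1 d2 (X : measurableType d1) (Y : measurableType d2)
    (mu : {sigma_finite_measure set X -> \bar R})
    (nu : {sigma_finite_measure set Y -> \bar R}) k1 a1 K1 k2 a2 K2 :
  oscint mu k1 a1 K1 -> oscint nu k2 a2 K2 ->
  oscint (prod_measure mu nu) (fun z => k1 z.1 * k2 z.2)
    (fun z => a1 z.1 + a2 z.2) (K1 * K2).
Proof.
move=> [i1 m1 e1] [i2 m2 e2].
have ma : measT (fun z : X * Y => a1 z.1 + a2 z.2).
  by apply: measurable_funD; exact: measurableT_comp.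
split => [||c] //; first exact: integrable_tensor.
rewrite prod_fubini; last first.
  apply: integrable_mulcos; first exact: integrable_tensor.
  by apply: measurable_funD => //; exact: measurable_cst.
transitivity (\int[mu]_x (K2 * (k1 x * cos (a1 x + c)))%:E)%E.
  apply: eq_integral => x _.
  transitivity ((k1 x)%:E * \int[nu]_y (k2 y * cos (a2 y + (a1 x + c)))%:E)%E.
    rewrite -integralZl//; last first.
      apply: integrable_mulcos => //.
      by apply: measurable_funD => //; exact: measurable_cst.
    apply: eq_integral => y _ /=; rewrite -EFinM; congr EFin.
    by rewrite -mulrA; congr (_ * (_ * cos _)); ring.
  by rewrite e2 -EFinM; congr EFin; ring.
under eq_integral do rewrite EFinM.
rewrite integralZl//; last first.
  apply: integrable_mulcos => //.
  by apply: measurable_funD => //; exact: measurable_cst.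
by rewrite e1 -EFinM; congr EFin; ring.
Qed.

Lemma cons_tonelli d (T : measurableType d) n
    (mu : {sigma_finite_measure set T -> \bar R}) (f : n.+1.-tuple T -> \bar R) :
  measT f -> (forall t, 0 <= f t)%E ->
  (\int[power_measure mu n.+1]_t f t =
   \int[mu]_x \int[power_measure mu n]_t f (Defs.cons_tuple (x, t)))%E.
Proof.
move=> mf f0.
rewrite [LHS](ge0_integral_pushforward (@measurable_cons_tuple _ T n))//.
rewrite preimage_setT [LHS]prod_tonelli//=.
exact: (measurableT_comp mf (@measurable_cons_tuple _ T n)).
Qed.

Lemma cons_tonelli2 d (T : measurableType d) n
    (mu : {sigma_finite_measure set T -> \bar R}) (f : n.+1.-tuple T -> \bar R) :
  measT f -> (forall t, 0 <= f t)%E ->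
  (\int[power_measure mu n.+1]_t f t =
   \int[power_measure mu n]_t \int[mu]_x f (Defs.cons_tuple (x, t)))%E.
Proof.
move=> mf f0.
rewrite [LHS](ge0_integral_pushforward (@measurable_cons_tuple _ T n))//.
rewrite preimage_setT [LHS]prod_tonelli2//=.
exact: (measurableT_comp mf (@measurable_cons_tuple _ T n)).
Qed.

Lemma power0_integral d (T : measurableType d)
    (mu : {sigma_finite_measure set T -> \bar R}) (f : 0.-tuple T -> \bar R) :
  (\int[power_measure mu 0]_t f t = f [tuple])%E.
Proof.
rewrite /= integral_dirac//; first by rewrite diracT mul1e.
move=> _ Y _; rewrite setTI; have [h|h] := pselect (Y (f [tuple])).
  rewrite (_ : _ @^-1` _ = setT); first exact: measurableT.
  by apply/seteqP; split => // t _ /=; rewrite (tuple0 t).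
rewrite (_ : _ @^-1` _ = set0); first exact: measurable0.
by apply/seteqP; split => // t /=; rewrite (tuple0 t).
Qed.

Lemma oscint_power d (T : measurableType d)
    (mu : {sigma_finite_measure set T -> \bar R}) n
    (k a : 'I_n -> T -> R) (K : 'I_n -> R) :
  (forall i, oscint mu (k i) (a i) (K i)) ->
  oscint (power_measure mu n) (fun t => \prod_(i < n) k i (tnth t i))
    (fun t => \sum_(i < n) a i (tnth t i)) (\prod_(i < n) K i).
Proof.
elim: n k a K => [|n ih] k a K h.
  split.
  - apply/integrableP; split.
      apply/measurable_EFinP => /=.
      under eq_fun do rewrite big_ord0.
      exact: measurable_cst.
    by rewrite power0_integral /= big_ord0 ltry.
  - under eq_fun do rewrite big_ord0.
    exact: measurable_cst.
  - by move=> c; rewrite power0_integral !big_ord0 add0r.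
have /(oscint_prod (h ord0)) := ih (fun i => k (lift ord0 i)) (fun i => a (lift ord0 i))
  (fun i => K (lift ord0 i)) (fun i => h (lift ord0 i)).
have tl i x (t : n.-tuple T) : tnth (Defs.cons_tuple (x, t)) (lift ord0 i) = tnth t i.
  by rewrite /Defs.cons_tuple /= tnthS.
have kE z : \prod_(i < n.+1) k i (tnth (Defs.cons_tuple z) i) =
    k ord0 z.1 * \prod_(i < n) k (lift ord0 i) (tnth z.2 i).
  by case: z => x t; rewrite big_ord_recl; congr (_ * _); apply: eq_bigr => i _; rewrite tl.
have aE z : \sum_(i < n.+1) a i (tnth (Defs.cons_tuple z) i) =
    a ord0 z.1 + \sum_(i < n) a (lift ord0 i) (tnth z.2 i).
  by case: z => x t; rewrite big_ord_recl; congr (_ + _); apply: eq_bigr => i _; rewrite tl.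
have ma : measT (fun t : n.+1.-tuple T => \sum_(i < n.+1) a i (tnth t i)).
  apply: measurable_sum => i; apply: measurableT_comp; first by case: (h i).
  exact: measurable_tnth.
have mk : measT (fun t : n.+1.-tuple T => \prod_(i < n.+1) k i (tnth t i)).
  apply: measurable_prod => i _; apply: measurableT_comp; last exact: measurable_tnth.
  by case: (h i) => /integrableP[/measurable_EFinP].
move=> [i1 m1 e1]; rewrite big_ord_recl.
have ik : (power_measure mu n.+1).-intT ((fun t => \prod_(i < n.+1) k i (tnth t i))).
  apply: (integrable_pushforward (@measurable_cons_tuple _ T n)) => //.
  - exact/measurable_EFinP.
  - rewrite preimage_setT; apply: eq_integrable i1 => // z _ /=.
    by rewrite kE.
split => // c; rewrite -e1.
rewrite [LHS](integral_pushforward (@measurable_cons_tuple _ T n))//.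
- by rewrite preimage_setT; apply: eq_integral => z _ /=; rewrite kE aE.
- apply/measurable_EFinP; apply: measurable_funM => //.
  by apply: measurable_cosD; apply: measurable_funD => //; exact: measurable_cst.
- have := integrable_mulcos i1 (measurable_funD m1 (measurable_cst c)).
  rewrite preimage_setT; apply: eq_integrable => // z _.
  by rewrite [in RHS]/= kE aE.
Qed.

End oscillatory.

(** * Schur's test for oscillatory integrals *)

Section schur.
Context d1 d2 (X : measurableType d1) (Y : measurableType d2) (R : realType).
Variables (mu : {sigma_finite_measure set X -> \bar R}).
Variables (nu : {sigma_finite_measure set Y -> \bar R}).
Variables (a : X -> R) (th : X * Y -> R) (k : Y -> R) (A : set X) (M : R).
Hypotheses (ia : mu.-intT (a))
  (mth : measT th) (ik : nu.-intT (k))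
  (k0 : forall y, 0 <= k y) (mA : measurable A)
  (aA : forall x, ~ A x -> a x = 0).
Let K (x x' : X) : R := (\int[nu]_y (k y * cos (th (x, y) - th (x', y)))).
Hypothesis KM : forall x, A x ->
  (\int[mu]_(x' in A) `|K x x'|%:E <= M%:E)%E.

Let ma : measT a.
Proof. by move/integrableP : ia => [/measurable_EFinP]. Qed.
Let mk : measT k.
Proof. by move/integrableP : ik => [/measurable_EFinP]. Qed.

Let mth1 x : measT (fun y => th (x, y)).
Proof. exact: (measurableT_comp mth). Qed.
Let mth2 y : measT (fun x => th (x, y)).
Proof. exact: (measurableT_comp mth). Qed.

Let g (z : (X * X) * Y) : R :=
  a z.1.1 * a z.1.2 * k z.2 * cos (th (z.1.1, z.2) - th (z.1.2, z.2)).

Let mdth : measT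
  (fun z : (X * X) * Y => th (z.1.1, z.2) - th (z.1.2, z.2)).
Proof.
apply: measurable_funB; apply: (measurableT_comp mth); mproj.
Qed.

Let ig : (prod_measure (prod_measure mu mu) nu).-intT (g).
Proof.
apply: integrable_mulcos; last exact: mdth.
exact: (integrable_tensor (integrable_tensor ia ia) ik).
Qed.

Let Ksym x x' : K x x' = K x' x.
Proof. by apply: eq_Rintegral => y _; rewrite -cosN opprB. Qed.

Let ikc x x' : nu.-intT ((fun y => k y * cos (th (x, y) - th (x', y)))).
Proof. by apply: integrable_mulcos => //; apply: measurable_funB. Qed.

(** The squared modulus of an oscillatory integral is a double integral whose phase is the
    difference of the two phases; integrating it in [y] will produce the kernel [K]. *)
Let square_expand y : (k y * ((\int[mu]_x (a x * cos (th (x, y)))) ^+ 2 +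
    (\int[mu]_x (a x * sin (th (x, y)))) ^+ 2))%:E =
  (\int[prod_measure mu mu]_p (g (p, y))%:E)%E.
Proof.
set C := \int[mu]_x (a x * cos _); set S := \int[mu]_x (a x * sin _).
have iC : mu.-intT ((fun x => a x * cos (th (x, y)))).
  exact: integrable_mulcos.
have iS : mu.-intT ((fun x => a x * sin (th (x, y)))).
  exact: integrable_mulsin.
have iZ (f : X -> R) r : mu.-intT (f) ->
    mu.-intT ((fun x => r * f x)).
  by move=> i; exact: (integrableZl measurableT r i).
rewrite prod_fubini; last first.
  apply: (@integrable_mulcos _ _ _ _ (fun p => a p.1 * a p.2 * k y)).
    have := integrableZl measurableT (k y) (integrable_tensor ia ia).
    by apply: eq_integrable => // p _ /=; rewrite -EFinM mulrC.
  by apply: measurable_funB; apply: (measurableT_comp mth); mproj.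
transitivity (\int[mu]_x (k y * C * (a x * cos (th (x, y))) +
    k y * S * (a x * sin (th (x, y))))%:E)%E.
  rewrite -EFinRint; last first.
    exact: (integrableD measurableT (iZ _ _ iC) (iZ _ _ iS)).
  rewrite RintegralD//; [|exact: iZ|exact: iZ].
  by rewrite !RintegralZl// -/C -/S; congr EFin; ring.
apply: eq_integral => x _.
transitivity (\int[mu]_x' (k y * a x * cos (th (x, y)) * (a x' * cos (th (x', y))) +
    k y * a x * sin (th (x, y)) * (a x' * sin (th (x', y))))%:E)%E.
  rewrite -EFinRint; last first.
    exact: (integrableD measurableT (iZ _ _ iC) (iZ _ _ iS)).
  rewrite RintegralD//; [|exact: iZ|exact: iZ].
  by rewrite !RintegralZl// -/C -/S; congr EFin; ring.
by apply: eq_integral => x' _; congr EFin; rewrite /g /= cosB; ring.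
Qed.

Let mK : measT (fun p : X * X => K p.1 p.2).
Proof.
apply: (@measurable_param_Rintegral _ _ _ _ _ nu (fun z : (X * X) * Y =>
  k z.2 * cos (th (z.1.1, z.2) - th (z.1.2, z.2)))).
apply: measurable_funM; last exact: measurable_cosD.
by apply: (measurableT_comp mk); mproj.
Qed.

(** After expansion of the square, the left side is the quadratic form of the symmetric kernel [K]
    at [a]. The inequality [a a' <= (a ^+ 2 + a' ^+ 2) / 2] leaves two equal terms, each a row
    integral of [|K|] weighted by [a ^+ 2]. Rows and columns only matter on [A], outside of which
    the amplitude vanishes; this is how the frequency supports enter later. *)
Lemma schur_test :
  (\int[nu]_y (k y * ((\int[mu]_x (a x * cos (th (x, y)))) ^+ 2 +
                      (\int[mu]_x (a x * sin (th (x, y)))) ^+ 2))%:E <=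
   M%:E * \int[mu]_x (a x ^+ 2)%:E)%E.
Proof.
under eq_integral do rewrite square_expand.
rewrite -(prod_fubini2 ig) prod_fubini//.
have -> : (\int[prod_measure mu mu]_p \int[nu]_y (g (p, y))%:E =
    \int[prod_measure mu mu]_p (a p.1 * a p.2 * K p.1 p.2)%:E)%E.
  apply: eq_integral => -[x x'] _ /=; rewrite EFinM.
  have -> : (K x x')%:E = (\int[nu]_y (k y * cos (th (x, y) - th (x', y)))%:E)%E.
    by rewrite -EFinRint//; exact: ikc.
  rewrite -integralZl//; last exact: ikc.
  by apply: eq_integral => y _; rewrite -EFinM; congr EFin; rewrite /g /=; ring.
(* Row bounds are known over [A] only, so the kernel is cut to [A] in both variables. *)
pose w (p : X * X) : R := `|K p.1 p.2| * \1_A p.1 * \1_A p.2.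
have mI : measT (\1_A : X -> R) by exact: measurable_indic.
have mw : measT w.
  apply: measurable_funM; first apply: measurable_funM.
  - exact: measurableT_comp.
  - by apply: (measurableT_comp mI); mproj.
  - by apply: (measurableT_comp mI); mproj.
have w0 p : 0 <= w p by rewrite /w !mulr_ge0.
have wM x : (\int[mu]_x' (w (x, x'))%:E <= M%:E)%E \/ ~ A x.
  have [Ax|nAx] := pselect (A x); [left|by right].
  rewrite (le_trans _ (KM Ax))// le_eqVlt [in X in _ || X]integral_mkcond.
  apply/orP; left; apply/eqP; rewrite [RHS]integral_mkcond.
  apply: eq_integral => x' _; rewrite /w patchE /= !indicE mem_set//= mulr1.
  by case: (x' \in A); rewrite ?mulr1 ?mulr0.
have bound1 : (\int[prod_measure mu mu]_p (a p.1 ^+ 2 * w p)%:E <=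
    M%:E * \int[mu]_x (a x ^+ 2)%:E)%E.
  (* The sign of [M] is not assumed: a negative [M] contradicts the nonnegative row integrals unless
     [A] is empty, and then [a] is zero. *)
  have [M0|M0] := leP 0 M; last first.
    have nA x : ~ A x.
      move=> Ax; have := KM Ax; apply/negP; rewrite -ltNge (lt_le_trans (y := 0%E))//.
      exact: integral_ge0.
    rewrite !integral0_eq ?mule0// => p _; first by rewrite aA ?expr0n.
    by rewrite aA ?expr0n ?mul0r.
  rewrite prod_tonelli; last 2 first.
  - apply/measurable_EFinP; apply: measurable_funM => //; apply: measurable_funX.
    by apply: (measurableT_comp ma); mproj.
  - by move=> p; rewrite lee_fin mulr_ge0// sqr_ge0.
  rewrite -ge0_integralZl//; last 2 first.
  - by apply/measurable_EFinP; exact: measurable_funX.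
  - by move=> x _; rewrite lee_fin sqr_ge0.
  apply: ge0_le_integral => //.
  - by move=> x _; apply: integral_ge0 => y _; rewrite lee_fin mulr_ge0// sqr_ge0.
  - apply: (@measurable_param_integral _ _ _ _ _ mu (fun p => (a p.1 ^+ 2 * w p)%:E)).
    apply/measurable_EFinP; apply: measurable_funM => //; apply: measurable_funX.
    by apply: (measurableT_comp ma); mproj.
  - by apply/measurable_EFinP; apply: measurable_funM => //; exact: measurable_funX.
  move=> x _; under eq_integral do rewrite /= EFinM.
  rewrite ge0_integralZl//; last 3 first.
  - by apply/measurable_EFinP; apply: (measurableT_comp mw); mproj.
  - by move=> y _; rewrite lee_fin.
  - by rewrite lee_fin sqr_ge0.
  rewrite muleC; have [h|h] := wM x.
    by apply: lee_wpmul2r => //; rewrite lee_fin sqr_ge0.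
  by rewrite aA// expr0n/= !mule0.
have bound2 : (\int[prod_measure mu mu]_p (a p.2 ^+ 2 * w p)%:E <=
    M%:E * \int[mu]_x (a x ^+ 2)%:E)%E.
  rewrite (le_trans _ bound1)// le_eqVlt; apply/orP; left; apply/eqP.
  have m1 : measT (fun p : X * X => (a p.1 ^+ 2 * w p)%:E).
    apply/measurable_EFinP; apply: measurable_funM => //; apply: measurable_funX.
    by apply: (measurableT_comp ma); mproj.
  have m2 : measT (fun p : X * X => (a p.2 ^+ 2 * w p)%:E).
    apply/measurable_EFinP; apply: measurable_funM => //; apply: measurable_funX.
    by apply: (measurableT_comp ma); mproj.
  have p1 p : (0 <= (a p.1 ^+ 2 * w p)%:E)%E by rewrite lee_fin mulr_ge0// sqr_ge0.
  have p2 p : (0 <= (a p.2 ^+ 2 * w p)%:E)%E by rewrite lee_fin mulr_ge0// sqr_ge0.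
  rewrite (prod_tonelli mu mu m2 p2) (prod_tonelli2 mu mu m1 p1).
  apply: eq_integral => x _; apply: eq_integral => x' _ /=.
  by rewrite /w/= Ksym; congr EFin; ring.
set I := (\int[_]_x (a x ^+ 2)%:E)%E in bound1 bound2 *.
apply: (@le_trans _ _ (\int[prod_measure mu mu]_p
    (2^-1 * (a p.1 ^+ 2 * w p) + 2^-1 * (a p.2 ^+ 2 * w p))%:E)%E); last first.
  have m1 : measT (fun p : X * X => (a p.1 ^+ 2 * w p)%:E).
    apply/measurable_EFinP; apply: measurable_funM => //; apply: measurable_funX.
    by apply: (measurableT_comp ma); mproj.
  have m2 : measT (fun p : X * X => (a p.2 ^+ 2 * w p)%:E).
    apply/measurable_EFinP; apply: measurable_funM => //; apply: measurable_funX.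
    by apply: (measurableT_comp ma); mproj.
  have half (f : X * X -> R) : (forall p, 0 <= f p) ->
      measT (EFin \o f) ->
      (\int[prod_measure mu mu]_p (f p)%:E <= M%:E * I)%E ->
      (\int[prod_measure mu mu]_p (2^-1 * f p)%:E <= 2^-1%:E * (M%:E * I))%E.
    move=> f0 /measurable_EFinP mf fM; rewrite ge0_intZl ?invr_ge0//.
    by apply: lee_wpmul2l => //; rewrite lee_fin invr_ge0.
  move: (m1) (m2) => /measurable_EFinP m1' /measurable_EFinP m2'.
  rewrite ge0_intD; first last.
  - pos.
  - pos.
  - exact: measurable_funM.
  - exact: measurable_funM.
  apply: (@le_trans _ _ (2^-1%:E * (M%:E * I) + 2^-1%:E * (M%:E * I))%E).
    apply: leeD; apply: half => //.
    - by move=> p; rewrite mulr_ge0// sqr_ge0.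
    - by move=> p; rewrite mulr_ge0// sqr_ge0.
  rewrite -ge0_muleDl ?lee_fin ?invr_ge0// -EFinD.
  by rewrite (_ : 2^-1 + 2^-1 = 1 :> R) ?mul1e//; lra.
have iaK : (prod_measure mu mu).-intT ((fun p => a p.1 * a p.2 * K p.1 p.2)).
  have mp : measT (fun p : X * X => a p.1 * a p.2 * K p.1 p.2).
    apply: measurable_funM => //; apply: measurable_funM.
    - by apply: (measurableT_comp ma); mproj.
    - by apply: (measurableT_comp ma); mproj.
  (* The kernel is bounded by the mass of the weight, which gives integrability of the quadratic
     form. *)
  have KC p : `|K p.1 p.2| <= \int[nu]_y k y.
    rewrite /K (le_trans (le_normr_Rintegral _ (ikc _ _)))//.
    apply: le_Rintegral => //.
      by apply/integrable_norm/ikc.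
    move=> y _; rewrite normrM (ger0_norm (k0 y)) ler_piMr//.
    by rewrite ler_norml cos_geN1 cos_le1.
  have ig' := integrableZl measurableT (\int[nu]_y k y) (integrable_tensor ia ia).
  apply: (integrable_dom (g := fun p => (\int[nu]_y k y) * (a p.1 * a p.2)) mp ig') => p.
  rewrite !normrM mulrC ler_wpM2r ?mulr_ge0//.
  by rewrite (le_trans (KC p))// ler_norm.
rewrite -EFinRint//.
set r := \int[_]_p _.
have -> : r%:E = (\int[prod_measure mu mu]_p (a p.1 * a p.2 * K p.1 p.2)%:E)%E by rewrite EFinRint.
rewrite integralE.
apply: (@le_trans _ _ (\int[prod_measure mu mu]_p
   ((fun p => (a p.1 * a p.2 * K p.1 p.2)%:E)^\+ p))%E).
  by rewrite leeBlDr ?leeDl// ?integral_ge0// integrable_neg_fin_num.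
apply: ge0_le_integral => //.
- by apply: measurable_funepos; case/integrableP: iaK.
- apply/measurable_EFinP; apply: measurable_funD; apply: measurable_funM => //.
  + apply: measurable_funM => //; apply: measurable_funX.
    by apply: (measurableT_comp ma); mproj.
  + apply: measurable_funM => //; apply: measurable_funX.
    by apply: (measurableT_comp ma); mproj.
move=> p _; rewrite funeposE maxEle; case: ifPn => _.
  pos.
rewrite lee_fin -mulrDr -mulrDl /w.
have [h|h] := pselect (A p.1 /\ A p.2); last first.
  have -> : a p.1 * a p.2 = 0.
    have [h1|h1] := pselect (A p.1); last by rewrite aA ?mul0r.
    by rewrite [a p.2]aA ?mulr0// => h2; apply: h.
  by rewrite mul0r !mulr_ge0 ?invr_ge0// ?addr_ge0 ?sqr_ge0.
rewrite !indicE !mem_set; [|by case: h|by case: h].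
rewrite !mulr1 mulrA; apply: le_trans (ler_norm _) _; rewrite normrM ler_wpM2r//.
move: (sqr_ge0 (a p.1 + a p.2)) (sqr_ge0 (a p.1 - a p.2)).
by rewrite ler_norml; move: (a p.1) (a p.2) => u v h1 h2; apply/andP; split; lra.
Qed.

End schur.

(** * The triangle weight and the Fejer kernel on the line *)

Section fejer.
Context {R : realType}.
Local Notation leb := (@lebesgue_measure R).

Definition antiderivative (F f : R -> R) : Prop :=
  forall x, is_derive x (1 : R) F (f x).

Lemma ftc (f F : R -> R) (a b : R) : a <= b ->
  antiderivative F f -> continuous f ->
  (\int[leb]_(x in `[a, b]) (f x)%:E = (F b - F a)%:E)%E.
Proof.
rewrite le_eqVlt => /predU1P[->|ab] dF cf.
  by rewrite set_itv1 integral_set1 subrr.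
have cF x : {for x, continuous F}.
  by apply/differentiable_continuous/derivable1_diffP; exact: ex_derive.
rewrite (@continuous_FTC2 _ f F) ?EFinB//.
- exact: continuous_subspaceT.
- split.
  + by move=> x _; exact: ex_derive.
  + exact/cvg_at_right_filter/cF.
  + exact/cvg_at_left_filter/cF.
- by move=> x _; rewrite derive1E; exact: derive_val.
Qed.

Definition tri (T x : R) : R := Num.max 0 (1 - `|x| / T).

(** The Fejer kernel, equal to [T] times the square of [sin x / x] at [x = T * s / 2], with its
    removable value filled in at 0. It is the transform of [tri T]; its nonnegativity lets absolute
    values in Schur kernels be dropped. *)
Definition fej (T s : R) : R :=
  if s == 0 then T else 2 * (1 - cos (T * s)) / (T * s ^+ 2).

Lemma tri_ge0 (T x : R) : 0 <= tri T x.
Proof. by rewrite le_max lexx. Qed.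

Lemma tri_le1 (T x : R) : 0 < T -> tri T x <= 1.
Proof. by move=> T0; rewrite ge_max ler01/= gerBl divr_ge0// ltW. Qed.

Lemma tri_half (T x : R) : 0 < T -> `|x| <= T / 2 -> 2^-1 <= tri T x.
Proof.
move=> T0 xT; rewrite le_max; apply/orP; right.
have : `|x| / T <= 2^-1 by rewrite ler_pdivrMr// mulrC.
by lra.
Qed.

Lemma tri_out (T x : R) : 0 < T -> T <= `|x| -> tri T x = 0.
Proof.
move=> T0 xT; apply: max_l; rewrite subr_le0 ler_pdivlMr// mul1r//.
Qed.

Lemma tri_in (T x : R) : 0 < T -> `|x| <= T -> tri T x = 1 - `|x| / T.
Proof.
move=> T0 xT; apply: max_r; rewrite subr_ge0 ler_pdivrMr// mul1r//.
Qed.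

Lemma continuous_tri (T : R) : continuous (tri T).
Proof.
move=> x; apply: (@continuous_max _ _ (fun=> 0) (fun x => 1 - `|x| / T)).
  exact: cvg_cst.
apply: cvgB; first exact: cvg_cst.
by apply: cvgMl; apply: cvg_norm; exact: cvg_id.
Qed.

Lemma measurable_tri (T : R) : measT (tri T).
Proof. exact: continuous_measurable_fun (@continuous_tri T). Qed.

Lemma integrable_compact_supp (f : R -> R) (a b : R) : continuous f ->
  (forall x, x \notin `[a, b] -> f x = 0) ->
  leb.-intT (f).
Proof.
move=> cf f0.
have : leb.-integrable `[a, b] (EFin \o f).
  apply: continuous_compact_integrable; first exact: segment_compact.
  exact: continuous_subspaceT.
move=> h; have := (@integrable_mkcond _ (measurableTypeR R) R leb _ (EFin \o f)
  (measurable_itv `[a, b])).1 h.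
apply: eq_integrable => // x _; rewrite patchE.
by case: ifPn => // /negP; rewrite inE /= => /negP /f0 ->.
Qed.

Lemma integral_compact_supp (f : R -> R) (a b : R) :
  (forall x, x \notin `[a, b] -> f x = 0) ->
  (\int[leb]_x (f x)%:E = \int[leb]_(x in `[a, b]) (f x)%:E)%E.
Proof.
move=> f0; rewrite [RHS]integral_mkcond; apply: eq_integral => x _; rewrite patchE.
by case: ifPn => // /negP; rewrite inE /= => /negP /f0 ->.
Qed.

Lemma tri_notin (T x : R) : 0 < T -> x \notin `[- T, T] -> tri T x = 0.
Proof.
move=> T0; rewrite in_itv /= -ler_norml -ltNge => h.
by apply: tri_out => //; exact: ltW.
Qed.

Lemma integrable_tri (T : R) : 0 < T -> leb.-intT (tri T).
Proof.
move=> T0; apply: (@integrable_compact_supp _ (- T) T); first exact: continuous_tri.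
by move=> x; exact: tri_notin.
Qed.

(** The triangle has a kink at 0, so the fundamental theorem of calculus is applied on each half
    separately. *)
Lemma tri_split (T : R) (g g1 g2 : R -> R) (a1 a2 : R): 0 < T -> continuous g ->
  (forall x, 0 <= x <= T -> tri T x * g x = g2 x) ->
  (forall x, - T <= x <= 0 -> tri T x * g x = g1 x) ->
  (\int[leb]_(x in `[(- T)%R, 0%R]) (g1 x)%:E = a1%:E)%E ->
  (\int[leb]_(x in `[0%R, T]) (g2 x)%:E = a2%:E)%E ->
  (\int[leb]_x (tri T x * g x)%:E = (a1 + a2)%:E)%E.
Proof.
move=> T0 cg e2 e1 i1 i2.
have mg : measT (fun x => tri T x * g x).
  by apply: measurable_funM; [exact: measurable_tri|exact: continuous_measurable_fun].
rewrite (@integral_compact_supp _ (- T) T); last first.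
  by move=> x xT; rewrite tri_notin ?mul0r.
have -> : [set` `[- T, T]] = [set` `[- T, 0%R]] `|` [set` `]0%R, T]].
  apply: itv_bndbnd_setU; rewrite bnd_simp; last exact: ltW.
  by rewrite oppr_le0 ltW.
rewrite integral_setU_EFin//; last 2 first.
- exact: measurable_funTS.
- rewrite disj_set2E; apply/eqP; rewrite -subset0 => x /= [].
  by rewrite !in_itv/= => /andP[_ h1] /andP[h2 _]; move: (lt_le_trans h2 h1); rewrite ltxx.
rewrite EFinD -i1 -i2; congr (_ + _)%E.
  by apply: eq_integral => x; rewrite inE /= in_itv/= => h; rewrite e1.
rewrite integral_itv_obnd_cbnd; last exact/measurable_funTS/measurable_EFinP.
by apply: eq_integral => x; rewrite inE /= in_itv/= => h; rewrite e2.
Qed.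

Lemma oscint_tri (T s : R) : 0 < T -> oscint leb (tri T) (fun x => s * x) (fej T s).
Proof.
move=> T0; split.
- exact: integrable_tri.
- exact: measurable_funM.
move=> c.
have T0' : T != 0 by rewrite gt_eqF.
have ccos : continuous (fun x => cos (s * x + c)).
  move=> x; apply: continuous_comp; last exact: continuous_cos.
  apply: cvgD; last exact: cvg_cst.
  by apply: cvgMr; exact: cvg_id.
have cl1 : continuous (fun x : R => 1 - x / T).
  move=> x; apply: cvgB; first exact: cvg_cst.
  by apply: cvgMl; exact: cvg_id.
have cl2 : continuous (fun x : R => 1 + x / T).
  move=> x; apply: cvgD; first exact: cvg_cst.
  by apply: cvgMl; exact: cvg_id.
have cM (f g : R -> R) : continuous f -> continuous g -> continuous (fun x => f x * g x).
  by move=> cf cg x; apply: cvgM; [exact: cf|exact: cg].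
rewrite /fej; case: eqVneq => [->|s0].
  have h := @tri_split T (fun=> cos c) (fun x => (1 + x / T) * cos c)
    (fun x => (1 - x / T) * cos c) (T / 2 * cos c) (T / 2 * cos c) T0.
  transitivity (\int[leb]_x (tri T x * cos c)%:E)%E.
    by apply: eq_integral => x _; rewrite mul0r add0r.
  rewrite h.
  - by congr EFin; field.
  - by move=> x; exact: cvg_cst.
  - by move=> x /andP[x0 xT]; rewrite tri_in ?ger0_norm.
  - move=> x /andP[x0 xT]; rewrite tri_in ?ler0_norm//; last lra.
    by rewrite mulNr opprK.
  - rewrite (@ftc _ (fun x => (x + x ^+ 2 / (2 * T)) * cos c)).
    + by congr EFin; field.
    + lra.
    + by move=> x; apply: is_derive_eq; rewrite /= /GRing.scale /=; field.
    + by apply: cM => //; move=> ?; exact: cvg_cst.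
  - rewrite (@ftc _ (fun x => (x - x ^+ 2 / (2 * T)) * cos c)).
    + by congr EFin; field.
    + lra.
    + by move=> x; apply: is_derive_eq; rewrite /= /GRing.scale /=; field.
    + by apply: cM => //; move=> ?; exact: cvg_cst.
have hTs : T * s ^+ 2 != 0 by rewrite mulf_neq0// expf_neq0.
rewrite (@tri_split T (fun x => cos (s * x + c)) (fun x => (1 + x / T) * cos (s * x + c))
    (fun x => (1 - x / T) * cos (s * x + c))
    (sin c / s + cos c / (T * s ^+ 2) - cos (s * - T + c) / (T * s ^+ 2))
    (- cos (s * T + c) / (T * s ^+ 2) - (sin c / s - cos c / (T * s ^+ 2)))) //.
- congr EFin; rewrite !cosD mulrN cosN sinN (mulrC s T).
  by field; rewrite T0' s0.
- by move=> x /andP[x0 xT]; rewrite tri_in ?ger0_norm.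
- move=> x /andP[x0 xT]; rewrite tri_in ?ler0_norm//; last lra.
  by rewrite mulNr opprK.
(* The antiderivative comes from one integration by parts: the sine term carries the linear factor,
   the cosine term its constant slope. *)
- rewrite (@ftc _ (fun x => (1 + x / T) * sin (s * x + c) / s + cos (s * x + c) / (T * s ^+ 2))).
  + by congr EFin; rewrite mulr0 add0r; field; rewrite T0' s0.
  + lra.
  + by move=> x; apply: is_derive_eq; rewrite /= /GRing.scale /=; field; rewrite T0' s0.
  + exact: cM.
- rewrite (@ftc _ (fun x => (1 - x / T) * sin (s * x + c) / s - cos (s * x + c) / (T * s ^+ 2))).
  + by congr EFin; rewrite mulr0 add0r; field; rewrite T0' s0.
  + lra.
  + by move=> x; apply: is_derive_eq; rewrite /= /GRing.scale /=; field; rewrite T0' s0.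
  + exact: cM.
Qed.

(** A transform is at most the mass of a larger weight; the zero phase [a'] makes [K'] that mass. *)
Lemma oscint_le d (X : measurableType d) (mu : {measure set X -> \bar R}) k a K k' a' K' :
  oscint mu k a K -> oscint mu k' a' K' -> (forall x, 0 <= k x) ->
  (forall x, k x <= k' x) -> (forall x, a' x = 0) -> `|K| <= K'.
Proof.
move=> [ik ma eK] [ik' ma' eK'] k0 kk' a0.
have ic : mu.-intT ((fun x => k x * cos (a x + 0))).
  by apply: integrable_mulcos => //; apply: measurable_funD => //; exact: measurable_cst.
have ic' : mu.-intT ((fun x => k' x * cos (a' x + 0))).
  by apply: integrable_mulcos => //; apply: measurable_funD => //; exact: measurable_cst.
have := eK 0; have := eK' 0.
rewrite -!EFinRint// cos0 !mulr1 => -[<-] [<-].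
rewrite (le_trans (le_normr_Rintegral _ ic))//; apply: le_Rintegral => //.
  exact: integrable_norm.
move=> x _; have -> : a' x + 0 = 0 by rewrite a0 addr0.
rewrite cos0 mulr1 normrM (ger0_norm (k0 x)).
rewrite (le_trans _ (kk' x))// ler_piMr//.
by rewrite ler_norml cos_geN1 cos_le1.
Qed.

Lemma fej_ge0 (T s : R) : 0 < T -> 0 <= fej T s.
Proof.
move=> T0; rewrite /fej; case: ifPn => _; first exact: ltW.
apply: divr_ge0; last by pos; exact: ltW.
by pos; rewrite subr_ge0 cos_le1.
Qed.

Lemma fej_leT (T s : R) : 0 < T -> fej T s <= T.
Proof.
move=> T0.
have := oscint_le (oscint_tri s T0) (oscint_tri 0 T0) (@tri_ge0 T) (fun=> lexx _).
rewrite [fej T 0]/fej eqxx => h; apply: (le_trans (ler_norm _)); apply: h => x.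
by rewrite mul0r.
Qed.

Lemma fej_decay (T s : R) : 0 < T -> fej T s * (T * s ^+ 2) <= 4.
Proof.
move=> T0; rewrite /fej; case: eqVneq => [->|s0]; first by rewrite expr0n/= !mulr0.
rewrite divfK; last by rewrite mulf_neq0// ?expf_neq0// gt_eqF.
by have := cos_geN1 (T * s); lra.
Qed.

(** Take the least [j] that satisfies the first inequality. If [j] is positive, minimality gives
    [|s| * T > 2 ^+ j.-1], and the decay [4 / (T * s ^+ 2)] becomes [16 * T / 4 ^+ j]; if [j = 0],
    the trivial bound by [T] suffices. *)
Lemma fej_dyadic_pt (T s : R) : 0 < T -> exists j : nat,
  `|s| <= 2 ^+ j / T /\ fej T s <= 16 * T / 4 ^+ j.
Proof.
move=> T0.
have /ex_minnP[j] : exists j : nat, `|s| * T <= 2 ^+ j.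
  have b0 : 0 <= `|s| * T by rewrite mulr_ge0// ltW.
  exists (Num.bound (`|s| * T)); apply: (le_trans (ltW (archi_boundP b0))).
  by rewrite -natrX ler_nat ltnW// ltn_expl.
move=> sj jmin; exists j; split; first by rewrite ler_pdivlMr.
case: j sj jmin => [|j] sj jmin.
  by rewrite expr0 divr1 (le_trans (fej_leT _ T0))//; lra.
have h : 2 ^+ j < `|s| * T.
  by rewrite ltNge; apply/negP => /jmin; rewrite ltnn.
have h2 : 4 ^+ j <= (`|s| * T) ^+ 2.
  rewrite (_ : 4 = 2 ^+ 2 :> R); last by rewrite expr2; lra.
  by rewrite exprAC lerXn2r// ?nnegrE ?exprn_ge0// ?mulr_ge0 ?(ltW T0)// ltW.
rewrite ler_pdivlMr ?exprn_gt0// exprS.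
have := fej_decay s T0; have := fej_ge0 s T0.
move: h2; rewrite exprMn real_normK ?num_real// => h2 f0 fd.
have : fej T s * 4 ^+ j <= fej T s * (s ^+ 2 * T ^+ 2) by rewrite ler_wpM2l.
rewrite (_ : fej T s * (s ^+ 2 * T ^+ 2) = fej T s * (T * s ^+ 2) * T); last ring.
have : fej T s * (T * s ^+ 2) * T <= 4 * T by rewrite ler_wpM2r// ltW.
by lra.
Qed.

Lemma continuous_fej (T : R) : 0 < T -> measT (fej T).
Proof.
move=> T0.
have -> : fej T = fun s => \int[leb]_x (tri T x * cos (s * x + 0)).
  apply/funext => s; have [i1 m1 e1] := oscint_tri s T0.
  have := e1 0; rewrite -EFinRint.
    by rewrite cos0 mulr1 => -[->].
  by apply: integrable_mulcos => //; apply: measurable_funD => //; exact: measurable_cst.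
apply: (@measurable_param_Rintegral _ _ _ _ _ leb
  (fun z : R * R => tri T z.2 * cos (z.1 * z.2 + 0))).
apply: measurable_funM.
  by apply: measurableT_comp; first exact: measurable_tri.
by apply: measurable_cosD; apply: measurable_funD => //; exact: measurable_funM.
Qed.

(** Turns measures of windows into an integral of the Fejer kernel: the dyadic layer [j] has height
    [16 * T / 4 ^+ j] and mass [Q * 2 ^+ j / T], and the sum of [16 * Q / 2 ^+ j] is [32 * Q]. Only
    windows of size at least [1 / T] are consulted, which is decisive when the window bound fails at
    small scales. *)
Lemma fej_integral_le d (X : measurableType d) (mu : {measure set X -> \bar R})
    (S : set X) (phi : X -> R) (Q T : R) : measurable S ->
  measT phi -> 0 < T -> 0 <= Q ->
  (forall j : nat, mu (S `&` [set x | (`|phi x| <= 2 ^+ j / T)%R]) <=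
    (Q * (2 ^+ j / T))%:E)%E ->
  (\int[mu]_(x in S) (fej T (phi x))%:E <= (32 * Q)%:E)%E.
Proof.
move=> mS mphi T0 Q0 H.
pose E j := [set x | `|phi x| <= 2 ^+ j / T].
have mE j : measurable (E j).
  rewrite -[E j]setTI; apply: (@measurable_fun_le _ _ _ setT) => //.
  exact: measurableT_comp.
apply: (@le_trans _ _ (\int[mu]_(x in S)
    (\sum_(j <oo) ((16 * T / 4 ^+ j)%:E * (\1_(E j) x)%:E)))%E).
  apply: ge0_le_integral => //.
  - by move=> x _; rewrite lee_fin fej_ge0.
  - apply/measurable_EFinP/measurable_funTS.
    by apply: measurableT_comp => //; exact: continuous_fej.
  - apply: ge0_emeasurable_sum => j.
      by move=> x _ _; rewrite -EFinM lee_fin; pos; rewrite ltW.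
    move=> _; apply/measurable_EFinP; exact: measurable_funM.
  move=> x _; have [j [xj fj]] := fej_dyadic_pt (phi x) T0.
  apply: le_trans (nneseries_lim_ge (m := 0) j.+1 _); last first.
    by move=> n _ _; rewrite -EFinM lee_fin; pos; rewrite ltW.
  rewrite big_nat_recr//= indicE mem_set// mule1.
  rewrite (@le_trans _ _ (16 * T / 4 ^+ j)%:E) ?lee_fin// leeDr// sume_ge0// => i _.
  by rewrite -EFinM lee_fin; pos; rewrite ltW.
rewrite integral_nneseries//; last 2 first.
- move=> j; apply/measurable_EFinP; exact: measurable_funM.
- by move=> n x _; rewrite -EFinM lee_fin; pos; rewrite ltW.
have term j : (\int[mu]_(x in S) ((16 * T / 4 ^+ j)%:E * (\1_(E j) x)%:E) <=
    (16 * Q / 2 ^+ j)%:E)%E.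
  rewrite ge0_integralZl//; last 2 first.
  - by apply/measurable_EFinP; exact: measurable_indic.
  - by rewrite lee_fin; pos; rewrite ltW.
  rewrite integral_indic// setIC.
  apply: (@le_trans _ _ ((16 * T / 4 ^+ j)%:E * (Q * (2 ^+ j / T))%:E)%E).
    by apply: lee_wpmul2l; [rewrite lee_fin; pos; rewrite ltW|exact: H].
  rewrite -EFinM lee_fin (_ : 4 = 2 * 2 :> R); last lra.
  rewrite exprMn le_eqVlt; apply/orP; left; apply/eqP.
  have p0 : (2 : R) ^+ j != 0 by rewrite expf_neq0.
  have T0' : T != 0 by rewrite gt_eqF.
  by move: (2 ^+ j) p0 => p p0; field; rewrite ?p0 ?T0'.
apply: (@le_trans _ _ (\sum_(j <oo) (16 * Q / 2 ^+ j)%:E)%E).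
  apply: lee_nneseries => [j _ _|j _]; last exact: term.
  by apply: integral_ge0 => x _; rewrite -EFinM lee_fin; pos; rewrite ltW.
apply: lime_le.
  by apply: is_cvg_nneseries => j _ _; rewrite lee_fin; pos.
apply: nearW => n; rewrite /= sumEFin lee_fin.
have -> : \sum_(0 <= j < n) (16 * Q / 2 ^+ j) = 32 * Q * (1 - (2 ^+ n)^-1) :> R.
  elim: n => [|n ih]; first by rewrite big_nil expr0 invr1 subrr mulr0.
  rewrite big_nat_recr//= ih exprS.
  have p0 : (2 : R) ^+ n != 0 by rewrite expf_neq0.
  by move: (2 ^+ n) p0 => p p0; field.
by rewrite ler_piMr// ?gerBl ?invr_ge0 ?exprn_ge0//; lra.
Qed.

End fejer.

(** * The lattice of frequencies and its Fejer kernel *)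

Section lattice.
Context (R : realType).

(** The absolute value makes the weight nonnegative for every [lam], so that the measure structures
    depend on no hypothesis. *)
Definition lattice (lam : R) : set int -> \bar R := mscale (`|lam^-1|)%:nng (@counting int R).

HB.instance Definition _ lam := Measure.copy (lattice lam) (mscale (`|lam^-1|)%:nng (@counting int R)).

Definition ball (K : nat) : set int := [set k : int | (`|k|%N <= K)%N].

Lemma ball0 : ball 0 = [set 0].
Proof. by apply/seteqP; split => k /=; rewrite /ball /= leqn0 absz_eq0 => /eqP. Qed.

Lemma ballS K : ball K.+1 = ball K `|` ([set K.+1%:Z] `|` [set - K.+1%:Z]).
Proof.
apply/seteqP; split => k; rewrite /ball /=.
  rewrite leq_eqVlt ltnS => /orP[/eqP h|h]; [right|by left].
  by case: k h => n /= h; [left|right]; lia.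
by case=> [h|[->|->]]; lia.
Qed.

Lemma finite_ball K : finite_set (ball K).
Proof.
elim: K => [|K ih]; first by rewrite ball0.
by rewrite ballS !finite_setU.
Qed.

Lemma lattice_set1 (lam : R) (k : int) : 0 < lam -> lattice lam [set k] = (lam^-1)%:E.
Proof.
move=> l0; rewrite /lattice /mscale /= /counting asboolT; last exact: finite_set1.
by rewrite fset_set1 finmap.cardfs1 mule1 ger0_norm// invr_ge0 ltW.
Qed.

Let lattice_sigma_finite lam : sigma_finite setT (lattice lam).
Proof.
exists ball.
  by apply/seteqP; split => // k _; exists `|k|%N => //=; rewrite /ball /=.
move=> K; split => //.
rewrite /lattice /mscale /= /counting asboolT; last exact: finite_ball.
by rewrite -EFinM ltry.
Qed.

HB.instance Definition _ lam := Measure_isSigmaFinite.Build _ _ _ (lattice lam)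
  (lattice_sigma_finite lam).

Lemma measurable_on_int (d : measure_display) (T : measurableType d) (f : int -> T) :
  measT f.
Proof. by move=> _ Y _. Qed.

Definition symsum (K : nat) (g : int -> R) : R :=
  g 0 + \sum_(0 <= j < K) (g j.+1%:Z + g (- j.+1%:Z)).

Lemma integral_ball (lam : R) K (g : int -> R) : 0 < lam ->
  (\int[lattice lam]_(k in ball K) (g k)%:E = (lam^-1 * symsum K g)%:E)%E.
Proof.
move=> l0.
have i1 a : (\int[lattice lam]_(k in [set a]) (g k)%:E = (lam^-1 * g a)%:E)%E.
  rewrite (eq_integral (cst (g a)%:E)); last by move=> k; rewrite inE /= => ->.
  by rewrite integral_cst//= lattice_set1// -EFinM mulrC.
have mg A : measurable_fun A g by apply: measurable_funTS; exact: measurable_on_int.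
elim: K => [|K ih].
  by rewrite ball0 i1 /symsum big_geq// addr0.
rewrite ballS integral_setU_EFin//; last first.
  rewrite disj_set2E; apply/eqP; rewrite -subset0 => k; rewrite /ball /= => -[h1].
  by case=> h2; move: h1; rewrite h2; lia.
rewrite integral_setU_EFin//; last first.
  by rewrite disj_set2E; apply/eqP; rewrite -subset0 => k /= [->]; lia.
rewrite ih !i1 -!EFinD /symsum big_nat_recr//=; congr EFin; ring.
Qed.

Lemma lattice_integral (lam : R) K (g : int -> R) : 0 < lam ->
  (forall k : int, (K < `|k|)%N -> g k = 0) ->
  (\int[lattice lam]_k (g k)%:E = (lam^-1 * symsum K g)%:E)%E.
Proof.
move=> l0 g0; rewrite -integral_ball// [RHS]integral_mkcond.
apply: eq_integral => k _; rewrite patchE; case: ifPn => // /negP.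
by rewrite inE /ball /= => /negP; rewrite -ltnNge => /g0 ->.
Qed.

Lemma lattice_integrable (lam : R) K (g : int -> R) : 0 < lam ->
  (forall k : int, (K < `|k|)%N -> g k = 0) ->
  (lattice lam).-intT (g).
Proof.
move=> l0 g0; apply/integrableP; split; first exact: measurable_on_int.
rewrite (@lattice_integral lam K (fun k => `|g k|))// ?ltry//.
by move=> k /g0 ->; rewrite normr0.
Qed.

(** The periodic Fejer kernel, as [K^-1] times the squared modulus of the sum of [exp (i j a)] over
    [j < K]. Nonnegativity and decay are read off this form, the transform of the triangle off the
    cosine expansion [PF_sum]. *)
Definition PF (K : nat) (a : R) : R :=
  K%:R^-1 * ((\sum_(0 <= j < K) cos (j%:R * a)) ^+ 2 +
             (\sum_(0 <= j < K) sin (j%:R * a)) ^+ 2).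

Lemma PF_ge0 K (a : R) : 0 <= PF K a.
Proof. by rewrite /PF mulr_ge0 ?invr_ge0 ?addr_ge0 ?sqr_ge0. Qed.

(** By induction on [K]: the cross terms of the new exponential with the old ones have phase
    differences [(K - j) * a], which reversed run over [j.+1 * a], and each coefficient grows by
    one. *)
Lemma PF_sum K (a : R) : (\sum_(0 <= j < K) cos (j%:R * a)) ^+ 2 +
             (\sum_(0 <= j < K) sin (j%:R * a)) ^+ 2 =
  K%:R + 2 * \sum_(0 <= j < K) ((K%:R - j.+1%:R) * cos (j.+1%:R * a)).
Proof.
elim: K => [|K ih]; first by rewrite !big_geq// expr0n mulr0 !add0r.
rewrite !big_nat_recr//= !sqrrD.
set C := \sum_(0 <= j < K) cos _; set S := \sum_(0 <= j < K) sin _.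
have -> : C ^+ 2 + C * cos (K%:R * a) *+ 2 + cos (K%:R * a) ^+ 2 +
   (S ^+ 2 + S * sin (K%:R * a) *+ 2 + sin (K%:R * a) ^+ 2) =
   (C ^+ 2 + S ^+ 2) + (C * cos (K%:R * a) + S * sin (K%:R * a)) *+ 2 +
   (cos (K%:R * a) ^+ 2 + sin (K%:R * a) ^+ 2) by ring.
rewrite ih cos2Dsin2 subrr mul0r addr0.
have -> : C * cos (K%:R * a) + S * sin (K%:R * a) =
    \sum_(0 <= j < K) cos (j.+1%:R * a).
  rewrite !mulr_suml -big_split /= [RHS]big_nat_rev /= add0n.
  rewrite !big_mkord; apply: eq_bigr => j _.
  rewrite (mulrC (cos _)) (mulrC (sin _)) -cosB -mulrBl; congr (cos (_ * _)).
  by rewrite subnSK// natrB// ltnW.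
rewrite -[K.+1%:R]natr1.
have -> : \sum_(0 <= j < K) ((K%:R + 1 - j.+1%:R) * cos (j.+1%:R * a)) =
   \sum_(0 <= j < K) ((K%:R - j.+1%:R) * cos (j.+1%:R * a)) +
   \sum_(0 <= j < K) cos (j.+1%:R * a).
  by rewrite -big_split /=; apply: eq_bigr => j _; ring.
ring.
Qed.

Definition triw (K : nat) (k : int) : R := tri K%:R k%:~R.

(** The triangle sampled at the integers gives the coefficients of [PF_sum]; adding the terms at [k]
    and [- k] cancels the sine of the shift. *)
Lemma oscint_lattice K (lam a : R) : 0 < lam -> (0 < K)%N ->
  oscint (lattice lam) (triw K) (fun k => k%:~R * a) (lam^-1 * PF K a).
Proof.
move=> l0 K0.
have K0' : (0 : R) < K%:R by rewrite ltr0n.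
have w0 (k : int) : (K < `|k|)%N -> triw K k = 0.
  move=> h; apply: tri_out => //; rewrite -intr_norm -[leLHS]/(K%:~R) ler_int; lia.
split; [exact: (lattice_integrable _ w0)|exact: measurable_on_int|].
move=> c; rewrite (@lattice_integral _ K)//; last by move=> k /w0 ->; rewrite mul0r.
congr EFin; rewrite -!mulrA; congr (_ * _); rewrite /PF PF_sum /symsum.
have -> : triw K 0 = 1 by rewrite /triw tri_in ?normr0 ?mul0r ?subr0// ltW.
rewrite mul0r add0r mul1r.
have E (j : nat) : (j < K)%N -> triw K j.+1 = 1 - j.+1%:R / K%:R.
  move=> jK; rewrite /triw tri_in// ger0_norm ?ler0z//.
  by rewrite -[leLHS]/(j.+1%:R) ler_nat.
have E' (j : nat) : (j < K)%N -> triw K (- j.+1%:Z) = 1 - j.+1%:R / K%:R.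
  by move=> jK; rewrite /triw mulrNz /tri normrN -/(tri _ _) -/(triw K j.+1) E.
rewrite mulrA mulrDr mulrDl mulVf ?gt_eqF// mul1r; congr (_ + _).
rewrite mulrA mulr_sumr mulr_suml !big_mkord; apply: eq_bigr => j _.
rewrite E// E'// mulrNz mulNr.
have -> : cos (- (j.+1%:~R * a) + c) = cos (j.+1%:R * a - c).
  by rewrite -[LHS]cosN opprD opprK.
rewrite -[(Posz j.+1)%:~R]/(j.+1%:R) cosD cosB.
by field; rewrite gt_eqF.
Qed.

End lattice.

(** * Restricted measures, the torus and its characters *)

Section restr.
Context d (T : measurableType d) (R : realType).
Variables (mu : {sigma_finite_measure set T -> \bar R}) (D : set T) (mD : measurable D).

Let restrC : restr_measure mu mD (~` D) = 0%E.
Proof. by rewrite /restr_measure /mrestr setICl measure0. Qed.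

Lemma ge0_integral_restr (f : T -> \bar R) : measT f ->
  (forall x, 0 <= f x)%E ->
  (\int[restr_measure mu mD]_x f x = \int[mu]_(x in D) f x)%E.
Proof.
move=> mf f0; rewrite (@ge0_negligible_integral _ _ _ _ _ (~` D))//; last exact: measurableC.
rewrite setTD setCK; apply: eq_measure_integral => A mA AD.
by rewrite /= /restr_measure /mrestr setIidl.
Qed.

Lemma integrable_restr (f : T -> \bar R) : measT f ->
  mu.-integrable D f -> (restr_measure mu mD).-integrable setT f.
Proof.
move=> mf /integrableP[_ fD]; apply/integrableP; split => //.
by rewrite ge0_integral_restr//; exact: measurableT_comp.
Qed.

Lemma integral_restr (f : T -> \bar R) : measT f ->
  mu.-integrable D f ->
  (\int[restr_measure mu mD]_x f x = \int[mu]_(x in D) f x)%E.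
Proof.
move=> mf iD; rewrite (@negligible_integral _ _ _ _ _ (~` D))//.
- rewrite setTD setCK; apply: eq_measure_integral => A mA AD.
  by rewrite /= /restr_measure /mrestr setIidl.
- exact: measurableC.
- exact: integrable_restr.
Qed.

End restr.

Section torus.
Context (R : realType).
Local Notation leb := (@lebesgue_measure R).

(** Multiplied by [2 * sin (a / 2)], both sums telescope; the sum of the two squares is then
    [2 - 2 * cos (K * a)], at most 4. *)
Lemma PF_decay K (a : R) : (0 < K)%N -> PF K a * (K%:R * sin (a / 2) ^+ 2) <= 1.
Proof.
move=> K0; rewrite /PF; set C := \sum_(_ <= _ < _) cos _; set S := \sum_(_ <= _ < _) sin _.
have e1 : 2 * sin (a / 2) * C = sin (K%:R * a - a / 2) + sin (a / 2).
  rewrite /C; elim: K {C S K0} => [|K ih].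
    by rewrite big_geq// mul0r sub0r sinN mulr0 addNr.
  rewrite big_nat_recr//= mulrDr ih -[K.+1%:R]natr1.
  have -> : (K%:R + 1) * a - a / 2 = K%:R * a + a / 2 by field.
  rewrite !sinD sinN cosN; ring.
have e2 : 2 * sin (a / 2) * S = cos (a / 2) - cos (K%:R * a - a / 2).
  rewrite /S; elim: K {C S K0 e1} => [|K ih].
    by rewrite big_geq// mul0r sub0r cosN mulr0 subrr.
  rewrite big_nat_recr//= mulrDr ih -[K.+1%:R]natr1.
  have -> : (K%:R + 1) * a - a / 2 = K%:R * a + a / 2 by field.
  rewrite !cosD sinN cosN; ring.
have -> : K%:R^-1 * (C ^+ 2 + S ^+ 2) * (K%:R * sin (a / 2) ^+ 2) =
    ((2 * sin (a / 2) * C) ^+ 2 + (2 * sin (a / 2) * S) ^+ 2) / 4.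
  by field; rewrite pnatr_eq0 -lt0n.
rewrite e1 e2.
have := cos2Dsin2 (a / 2); have := cos2Dsin2 (K%:R * a - a / 2).
have := cos_geN1 (K%:R * a - a / 2 + a / 2); rewrite cosD.
move: (cos _) (sin _) (cos _) (sin _) => x y z w; nra.
Qed.

Lemma cos_shift (k : int) (c : R) : cos (2 * pi * k%:~R + c) = cos c.
Proof.
have E n : 2 * pi * n%:R = (pi : R) *+ 2 *+ n by rewrite mulr_natr mulr_natl.
case: k => n; first by rewrite -[n%:~R]/(n%:R) E addrC periodicn//; exact: cosD2pi.
rewrite NegzE mulrNz mulrN -[n.+1%:~R]/(n.+1%:R) E.
by rewrite -[LHS](periodicn (@cosD2pi R) n.+1) addrAC addNr add0r.
Qed.

Lemma sin_shift (k : int) (c : R) : sin (2 * pi * k%:~R + c) = sin c.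
Proof.
have E n : 2 * pi * n%:R = (pi : R) *+ 2 *+ n by rewrite mulr_natr mulr_natl.
case: k => n; first by rewrite -[n%:~R]/(n%:R) E addrC periodicn//; exact: sinD2pi.
rewrite NegzE mulrNz mulrN -[n.+1%:~R]/(n.+1%:R) E.
by rewrite -[LHS](periodicn (@sinD2pi R) n.+1) addrAC addNr add0r.
Qed.

Lemma antiderivative_sin (s c : R) : s != 0 ->
  antiderivative (fun y => sin (s * y + c) / s) (fun y => cos (s * y + c)).
Proof.
by move=> s0 x; apply: is_derive_eq; rewrite /GRing.scale /=; field.
Qed.

Lemma oscint_torus (lam : R) (k : int) : 0 < lam ->
  oscint (interval_measure `[0, lam]) (cst 1)
    (fun y => 2 * pi * (y * (k%:~R / lam))) (if k == 0 then lam else 0).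
Proof.
move=> l0.
have l0' : lam != 0 by rewrite gt_eqF.
have ci (f : R -> R) : continuous f -> leb.-integrable `[0, lam] (EFin \o f).
  move=> cf; apply: continuous_compact_integrable; first exact: segment_compact.
  exact: continuous_subspaceT.
have cc s c : continuous (fun y : R => cos (2 * pi * (y * s) + c)).
  move=> x; apply: continuous_comp; last exact: continuous_cos.
  apply: cvgD; last exact: cvg_cst.
  by apply: cvgMr; apply: cvgMl; exact: cvg_id.
split.
- apply: integrable_restr; first exact/measurable_EFinP/measurable_cst.
  by apply: ci => x; exact: cvg_cst.
- by apply: measurable_funM => //; exact: measurable_funM.
move=> c; rewrite integral_restr; last 2 first.
- apply/measurable_EFinP/measurable_funM; first exact: measurable_cst.
  exact: continuous_measurable_fun.
- by apply: ci => x; apply: cvgM; [exact: cvg_cst|exact: cc].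
under eq_integral do rewrite mul1r.
have [->|k0] := eqVneq k 0.
  rewrite (@ftc _ _ (fun y => y * cos c)).
  - by congr EFin; rewrite mul0r subr0.
  - exact: ltW.
  - move=> x; apply: is_derive_eq; rewrite /GRing.scale /= mul0r !mulr0 add0r.
    by rewrite mulr1 add0r.
  - exact: cc.
have k0' : (k%:~R : R) != 0 by rewrite intr_eq0.
have pi0 : (pi : R) != 0 by rewrite gt_eqF ?pi_gt0.
rewrite (@ftc _ _ (fun y => sin (2 * pi * (y * (k%:~R / lam)) + c) / (2 * pi * (k%:~R / lam)))).
- rewrite mul0r !mulr0 add0r mul0r -mulrBl.
  have -> : lam * (k%:~R / lam) = k%:~R by field.
  have -> : sin (2 * pi * k%:~R + c) = sin c.
    exact: sin_shift.
  by rewrite subrr mul0r.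
- exact: ltW.
- have s0 : 2 * pi * (k%:~R / lam) != 0.
    by rewrite !mulf_neq0// ?invr_eq0// pnatr_eq0.
  have := antiderivative_sin c s0; congr antiderivative; apply/funext => y.
    by congr (sin (_ + _) / _); ring.
  by congr (cos (_ + _)); ring.
- exact: cc.
Qed.

(** In the cosine expansion every nonzero character integrates to zero over a period, so only the
    constant 1 contributes, whatever [K] and [y'] are. *)
Lemma torus_PF_mass (lam y' : R) K : 0 < lam -> (0 < K)%N ->
  (\int[interval_measure `[0%R, lam]]_y (PF K (2 * pi * ((y - y') / lam)))%:E = lam%:E)%E.
Proof.
move=> l0 K0.
have K0' : (0 : R) < K%:R by rewrite ltr0n.
pose mu := interval_measure `[0, lam].
have osc k := oscint_torus k l0.
have ic (k : int) c : mu.-intT ((fun y => cst 1 y * cos (2 * pi * (y * (k%:~R / lam)) + c))).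
  have [i1 m1 _] := osc k; apply: integrable_mulcos => //.
  by apply: measurable_funD => //; exact: measurable_cst.
pose w (j : nat) : R := 2 * K%:R^-1 * (K%:R - j.+1%:R).
pose c (j : nat) : R := - (2 * pi * (y' * (j.+1%:~R / lam))).
have E y : PF K (2 * pi * ((y - y') / lam)) = cst 1 y * cos (2 * pi * (y * (0%:~R / lam)) + 0) +
    \sum_(j < K) w j * (cst 1 y * cos (2 * pi * (y * (j.+1%:~R / lam)) + c j)).
  rewrite mul0r mulr0 mulr0 addr0 cos0 /PF PF_sum mulrDr mulVf ?gt_eqF// mulr1; congr (_ + _).
  rewrite mulrA mulr_sumr big_mkord; apply: eq_bigr => j _; rewrite /w /c !mul1r.
  rewrite [LHS]mulrA [_ * 2]mulrC; congr (_ * cos _).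
  by rewrite -[j.+1%:~R]/(j.+1%:R : R); field; rewrite gt_eqF.
under eq_integral do rewrite E EFinD.
have iw (j : nat) : mu.-intT ((fun y =>
    w j * (cst 1 y * cos (2 * pi * (y * (j.+1%:~R / lam)) + c j)))).
  by have := integrableZl measurableT (w j) (ic j.+1 (c j)).
rewrite integralD_EFin//; last first.
  apply: (@eq_integrable _ _ _ mu _ measurableT (fun y => (\sum_(j < K)
    (w j * (cst 1 y * cos (2 * pi * (y * (j.+1%:~R / lam)) + c j)))%:E)%E)).
    by move=> y _; rewrite sumEFin.
  by apply: integrable_sum => // j _; exact: iw.
rewrite [X in (X + _)%E](_ : _ = lam%:E); last first.
  by have [_ _ h] := osc 0; have := h 0; rewrite eqxx cos0 mulr1.
under eq_integral do rewrite /= -sumEFin.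
rewrite integral_sum//; last by move=> j; exact: iw.
rewrite big1 ?adde0// => j _.
under eq_integral do rewrite EFinM.
rewrite integralZl//; last exact: ic.
by have [_ _ ->] := osc j.+1; rewrite /= mul0r mule0.
Qed.

End torus.

Ltac mea := repeat first
  [ assumption | exact: measurable_cst | exact: measurable_id
  | exact: measurable_fst | exact: measurable_snd | exact: measurable_tnth
  | apply: measurable_funM | apply: measurable_funB | apply: measurable_funD
  | apply: measurable_funX | apply: measurable_cosD | apply: measurable_sinD
  | apply: measurable_pairT
  | apply: (measurableT_comp (measurable_tnth _))
  | apply: (measurableT_comp measurable_fst)
  | apply: (measurableT_comp measurable_snd) ].

(** * Tensor products of functions of one coordinate *)

Section tensor.
Context d (T : measurableType d) (R : realType).
Variable mu : {sigma_finite_measure set T -> \bar R}.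

Lemma measurable_tensor n (f : 'I_n -> T -> R) :
  (forall i, measT (f i)) ->
  measT (fun t : n.-tuple T => \prod_(i < n) f i (tnth t i)).
Proof.
move=> mf; apply: measurable_prod => i _.
by apply: measurableT_comp; [exact: mf|exact: measurable_tnth].
Qed.

Lemma tensorS n (f : 'I_n.+1 -> T -> R) (x : T) (t : n.-tuple T) :
  \prod_(i < n.+1) f i (tnth (Defs.cons_tuple (x, t)) i) =
  f ord0 x * \prod_(i < n) f (lift ord0 i) (tnth t i).
Proof.
rewrite big_ord_recl; congr (_ * _); apply: eq_bigr => i _.
by rewrite /Defs.cons_tuple /= tnthS.
Qed.

Lemma power_tensor_le n (f : 'I_n -> T -> R) (c : 'I_n -> R) :
  (forall i, measT (f i)) -> (forall i x, 0 <= f i x) ->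
  (forall i, 0 <= c i) ->
  (forall i, \int[mu]_x (f i x)%:E <= (c i)%:E)%E ->
  (\int[power_measure mu n]_t (\prod_(i < n) f i (tnth t i))%:E <=
   (\prod_(i < n) c i)%:E)%E.
Proof.
elim: n f c => [|n ih] f c mf f0 c0 fc; first by rewrite power0_integral !big_ord0.
rewrite cons_tonelli; last 2 first.
- by apply/measurable_EFinP; exact: measurable_tensor.
- by move=> t; rewrite lee_fin prodr_ge0.
under eq_integral => x _.
  under eq_integral do rewrite tensorS.
  rewrite ge0_intZl//; last 2 first.
  + by apply: (@measurable_tensor n (fun i => f (lift ord0 i))) => i.
  + by move=> t; rewrite prodr_ge0.
  over.
rewrite /= ge0_integralZr//; last 3 first.
- exact/measurable_EFinP.
- by move=> x _; rewrite lee_fin.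
- by apply: integral_ge0 => t _; rewrite lee_fin prodr_ge0.
rewrite big_ord_recl EFinM; apply: lee_pmul => //.
- by apply: integral_ge0 => x _; rewrite lee_fin.
- by apply: integral_ge0 => t _; rewrite lee_fin prodr_ge0.
- by apply: (ih (fun i => f (lift ord0 i)) (fun i => c (lift ord0 i))).
Qed.

End tensor.

Lemma prod_tensor_le d1 d2 (X : measurableType d1) (Y : measurableType d2) (R : realType)
  (mu : {sigma_finite_measure set X -> \bar R})
  (nu : {sigma_finite_measure set Y -> \bar R}) (f : X -> R) (g : Y -> R) (a b : R) :
  measT f -> measT g ->
  (forall x, 0 <= f x) -> (forall y, 0 <= g y) ->
  (\int[mu]_x (f x)%:E <= a%:E)%E -> (\int[nu]_y (g y)%:E <= b%:E)%E ->
  (\int[prod_measure mu nu]_z (f z.1 * g z.2)%:E <= (a * b)%:E)%E.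
Proof.
move=> mf mg f0 g0 fa gb.
rewrite prod_tonelli; last 2 first.
- by apply/measurable_EFinP; apply: measurable_funM; apply: measurableT_comp.
- by move=> z; pos.
under eq_integral do rewrite /= ge0_intZl//.
rewrite ge0_integralZr//; last 3 first.
- exact/measurable_EFinP.
- by move=> x _; rewrite lee_fin.
- by apply: integral_ge0 => t _; rewrite lee_fin.
by rewrite EFinM; apply: lee_pmul => //; apply: integral_ge0 => t _; rewrite lee_fin.
Qed.

Lemma fejN (R : realType) (T s : R) : fej T (- s) = fej T s.
Proof. by rewrite /fej oppr_eq0 mulrN cosN sqrrN. Qed.

Lemma PFN (R : realType) K (a : R) : PF K (- a) = PF K a.
Proof.
rewrite /PF; congr (_ * (_ + _)).
  by congr (_ ^+ 2); apply: eq_bigr => j _; rewrite mulrN cosN.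
rewrite -[RHS]sqrrN -sumrN; congr (_ ^+ 2); apply: eq_bigr => j _.
by rewrite mulrN sinN.
Qed.

(** * Bessel's inequality for the transform *)

Section bessel.
Context (R : realType) (m n : nat) (lam : R).
Hypothesis l0 : 0 < lam.
Local Notation leb := (@lebesgue_measure R).
Local Notation X := (phys_point R m n).
Local Notation Fq := (frequency R m n).

(** The integer vector is kept as such and stands for the frequency [k / lam]; the weight [1 / lam]
    per lattice coordinate is its spacing. *)
Definition freqm : {sigma_finite_measure set Fq -> \bar R} :=
  prod_measure (power_measure leb m) (power_measure (lattice lam) n).

Definition phase (z : X) (xi : Fq) : R := 2 * pi * freq_dot lam z xi.1 xi.2.

Lemma measurable_phase : measT (fun p : X * Fq => phase p.1 p.2).
Proof.
apply: measurable_funM => //; apply: measurable_funD.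
  apply: measurable_sum => i; apply: measurable_funM.
    by apply: (measurableT_comp (measurable_tnth i)); mproj.
  by apply: (measurableT_comp (measurable_tnth i)); mproj.
apply: measurable_sum => j; apply: measurable_funM.
  by apply: (measurableT_comp (measurable_tnth j)); mproj.
apply: measurable_funM => //.
apply: (measurableT_comp (@measurable_on_int _ (measurableTypeR R) (fun k : int => k%:~R : R))).
by apply: (measurableT_comp (measurable_tnth j)); mproj.
Qed.

Lemma measurable_phase2 : measT (fun p : Fq * X => phase p.2 p.1).
Proof.
have h : measT (fun p : Fq * X => (p.2, p.1)) by mea.
exact: (measurableT_comp measurable_phase h).
Qed.

(** The lattice factor cuts the integer [k], not the frequency [k / lam]. Its transform [fkernel] is
    a product of Fejer kernels on the line and on the torus. *)
Definition fweight (K : nat) (xi : Fq) : R :=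
  (\prod_(i < m) tri K%:R (tnth xi.1 i)) * (\prod_(j < n) triw R K (tnth xi.2 j)).

Definition fkernel (K : nat) (z z' : X) : R :=
  (\prod_(i < m) fej K%:R (2 * pi * (tnth z.1 i - tnth z'.1 i))) *
  (\prod_(j < n) (lam^-1 * PF K (2 * pi * ((tnth z.2 j - tnth z'.2 j) / lam)))).

Lemma oscint_fweight (K : nat) (z z' : X) : (0 < K)%N ->
  oscint freqm (fweight K) (fun xi => phase z xi - phase z' xi) (fkernel K z z').
Proof.
move=> K0; have K0' : (0 : R) < K%:R by rewrite ltr0n.
have h1 := oscint_power (fun i : 'I_m =>
  oscint_tri (2 * pi * (tnth z.1 i - tnth z'.1 i)) K0').
have h2 := oscint_power (fun j : 'I_n =>
  oscint_lattice (2 * pi * ((tnth z.2 j - tnth z'.2 j) / lam)) l0 K0).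
have := oscint_prod h1 h2; congr oscint; apply/funext => xi.
rewrite /phase /freq_dot -mulrBr opprD addrACA -!sumrB [RHS]mulrDr !mulr_sumr.
by congr (_ + _); apply: eq_bigr => i _; ring.
Qed.

(** The case [Q = 1] of [fej_integral_le]: since [2 * pi >= 2], the points with
    [|2 * pi * (x - x')| <= e] lie in an interval of length [e]. What matters is that the bound is
    uniform in [T]. *)
Lemma fej_mass (T x' : R) : 0 < T ->
  (\int[leb]_x (fej T (2 * pi * (x - x')))%:E <= 32%:E)%E.
Proof.
move=> T0; rewrite -[32]mulr1.
apply: fej_integral_le => //.
  by apply: measurable_funM => //; exact: measurable_funB.
move=> j; rewrite setTI mul1r.
set e := 2 ^+ j / T.
have e0 : 0 <= e by rewrite divr_ge0// ?exprn_ge0// ltW.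
apply: (@le_trans _ _ (leb `[x' - e / 2, x' + e / 2]%classic)).
  apply: le_measure; rewrite ?inE.
  - rewrite -[X in measurable X]setTI; apply: (@measurable_fun_le _ _ _ setT) => //.
    apply: measurableT_comp => //.
    by apply: measurable_funM => //; exact: measurable_funB.
  - exact: measurable_itv.
  move=> x /=; rewrite normrM [`|2 * pi|]ger0_norm; last by rewrite mulr_ge0// pi_ge0.
  rewrite in_itv /= -ler_distl => h.
  have : 2 * pi * `|x - x'| >= 2 * `|x - x'|.
    by rewrite ler_wpM2r// ler_peMr//; have := pi_ge2 R; lra.
  by rewrite -/e in h; lra.
rewrite lebesgue_measure_itv /= lte_fin; case: ifPn => _; last by rewrite lee_fin.
by rewrite -EFinB lee_fin; lra.
Qed.

Lemma fkernel_ge0 K z z' : (0 < K)%N -> 0 <= fkernel K z z'.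
Proof.
move=> K0; apply: mulr_ge0; apply: prodr_ge0 => i _.
  by apply: fej_ge0; rewrite ltr0n.
by rewrite mulr_ge0 ?PF_ge0// invr_ge0 ltW.
Qed.

Lemma measurable_PF K : measT (@PF R K).
Proof.
apply: measurable_funM => //; apply: measurable_funD; apply: measurable_funX;
  apply: measurable_sum => j.
  by apply: measurable_cosD; apply: measurable_funM.
by apply: measurable_sinD; apply: measurable_funM.
Qed.

(** Each continuous coordinate costs the factor 32 of [fej_mass]; torus coordinates have mass
    exactly 1 once divided by [lam]. *)
Lemma fkernel_mass K z : (0 < K)%N ->
  (\int[waveguide m n lam]_z' (fkernel K z z')%:E <= (32 ^+ m)%:E)%E.
Proof.
move=> K0; have K0' : (0 : R) < K%:R by rewrite ltr0n.
have -> : 32 ^+ m = 32 ^+ m * 1 :> R by rewrite mulr1.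
have ml (x : R) : measT (fun x' : R => x - x').
  by apply: measurable_funB => //; exact: measurable_cst.
apply: (@prod_tensor_le _ _ _ _ _ (power_measure leb m)
    (power_measure (interval_measure `[0, lam]) n)
  (fun x' => \prod_(i < m) fej K%:R (2 * pi * (tnth z.1 i - tnth x' i)))
  (fun y' => \prod_(j < n) (lam^-1 * PF K (2 * pi * ((tnth z.2 j - tnth y' j) / lam))))).
- apply: (@measurable_tensor _ (measurableTypeR R) _ _ (fun i x => fej K%:R (2 * pi * (tnth z.1 i - x)))) => i.
  by apply: measurableT_comp; [exact: continuous_fej|mea].
- apply: (@measurable_tensor _ (measurableTypeR R) _ _ (fun i y => lam^-1 * PF K (2 * pi * ((tnth z.2 i - y) / lam)))) => i.
  by apply: measurable_funM => //; apply: measurableT_comp; [exact: measurable_PF|mea].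
- by move=> x; apply: prodr_ge0 => i _; exact: fej_ge0.
- by move=> y; apply: prodr_ge0 => i _; rewrite mulr_ge0 ?PF_ge0// invr_ge0 ltW.
- have -> : 32 ^+ m = \prod_(i < m) (32 : R) by rewrite prodr_const card_ord.
  apply: (@power_tensor_le _ (measurableTypeR R) _ _ _ (fun i x => fej K%:R (2 * pi * (tnth z.1 i - x)))) => //.
  + by move=> i; apply: measurableT_comp; [exact: continuous_fej|mea].
  + by move=> i x; exact: fej_ge0.
  + move=> i; have := fej_mass (tnth z.1 i) K0'.
    apply: le_trans; apply: eq_le.
    apply: eq_integral => x _; congr EFin.
    by rewrite -opprB mulrN fejN.
- rewrite [X in (_ <= X)%E](_ : _ = (\prod_(j < n) (1 : R))%:E); last by rewrite big1.
  apply: (@power_tensor_le _ (measurableTypeR R) _ _ _ (fun i y => lam^-1 * PF K (2 * pi * ((tnth z.2 i - y) / lam)))) => //.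
  + move=> i; apply: measurable_funM => //.
    by apply: measurableT_comp; [exact: measurable_PF|mea].
  + by move=> i y; rewrite mulr_ge0 ?PF_ge0// invr_ge0 ltW.
  + move=> i; rewrite ge0_intZl ?invr_ge0 ?(ltW l0)//; last 2 first.
    * by apply: measurableT_comp; [exact: measurable_PF|mea].
    * by move=> y; exact: PF_ge0.
    under eq_integral do rewrite -opprB mulNr mulrN PFN.
    by rewrite torus_PF_mass// -EFinM mulVf// gt_eqF.
Qed.

Definition fbox (B : R) : set Fq :=
  [set xi | (forall i, `|tnth xi.1 i| <= B) /\ (forall j, `|(tnth xi.2 j)%:~R| <= B)].

Lemma measurable_fbox B : measurable (fbox B).
Proof.
have -> : fbox B = (\bigcap_(i in [set: 'I_m]) [set xi : Fq | `|tnth xi.1 i| <= B]) `&`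
    (\bigcap_(j in [set: 'I_n]) [set xi : Fq | `|(tnth xi.2 j)%:~R : R| <= B]).
  apply/seteqP; split => xi /=.
    by move=> [h1 h2]; split => i _ /=.
  by move=> [h1 h2]; split => i; [exact: (h1 i)|exact: (h2 i)].
have mle (f : Fq -> R) : measT f -> measurable [set xi | `|f xi| <= B].
  move=> mf; rewrite -[X in measurable X]setTI; apply: (@measurable_fun_le _ _ _ setT) => //.
  exact: measurableT_comp.
apply: measurableI; apply: fin_bigcap_measurable => // i _; apply: mle.
  by mea.
by apply: (measurableT_comp (@measurable_on_int _ (measurableTypeR R) (fun k : int => k%:~R : R))); mea.
Qed.

(** The Fourier transform of a real [v] is [ctr v - i * str v]. *)
Definition ctr (v : X -> R) (xi : Fq) : R :=
  \int[waveguide m n lam]_z (v z * cos (phase z xi)).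
Definition str (v : X -> R) (xi : Fq) : R :=
  \int[waveguide m n lam]_z (v z * sin (phase z xi)).

Lemma measurable_ctr (v : X -> R) : measT v -> measT (ctr v).
Proof.
move=> mv; apply: (@measurable_param_Rintegral _ _ _ _ _ _ (fun p : Fq * X => v p.2 * cos (phase p.2 p.1))).
apply: measurable_funM; first exact: measurableT_comp.
by apply: measurable_cosD; exact: measurable_phase2.
Qed.

Lemma measurable_str (v : X -> R) : measT v -> measT (str v).
Proof.
move=> mv; apply: (@measurable_param_Rintegral _ _ _ _ _ _ (fun p : Fq * X => v p.2 * sin (phase p.2 p.1))).
apply: measurable_funM; first exact: measurableT_comp.
by apply: measurable_sinD; exact: measurable_phase2.
Qed.

(** Schur's test with the roles of space and frequency exchanged: the amplitude is [v], the weight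
    is [fweight K], and the rows of the kernel are bounded by [fkernel_mass]. With [K >= 2 * B] each
    triangle is at least 1/2 on the box, which costs [2 ^+ (m + n)]; the constant does not depend on
    [B]. *)
Theorem bessel (v : X -> R) (B : R) :
  (waveguide m n lam).-intT (v) ->
  (\int[freqm]_(xi in fbox B)
     (ctr v xi ^+ 2 + str v xi ^+ 2)%:E <=
   (2 ^+ (m + n) * 32 ^+ m)%:E * \int[waveguide m n lam]_z (v z ^+ 2)%:E)%E.
Proof.
move=> iv; pose K := (Num.bound (2 * `|B|)).+1.
have K0 : (0 < K)%N by [].
have KB : B <= K%:R / 2.
  have := @archi_boundP R (2 * `|B|) (mulr_ge0 (ler0n _ _) (normr_ge0 _)).
  have -> : K%:R = (Num.bound (2 * `|B|))%:R + 1 :> R by rewrite natr1.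
  by have := ler_norm B; lra.
have K0' : (0 : R) < K%:R by rewrite ltr0n.
pose g xi := ctr v xi ^+ 2 + str v xi ^+ 2.
have mv : measT v by case/integrableP : iv => /measurable_EFinP.
have mg : measT g.
  by rewrite /g; have := measurable_ctr mv; have := measurable_str mv => ? ?; mea.
have g0 xi : 0 <= g xi by rewrite addr_ge0// sqr_ge0.
pose z0 : X := (nseq_tuple m (0:R), nseq_tuple n (0:R)).
have [ik _ _] := oscint_fweight z0 z0 K0.
have w0 xi : 0 <= fweight K xi.
  by apply: mulr_ge0; apply: prodr_ge0 => i _; exact: tri_ge0.
have mw : measT (fweight K) by case/integrableP : ik => /measurable_EFinP.
have KE z z' : \int[freqm]_xi (fweight K xi * cos (phase z xi - phase z' xi)) = fkernel K z z'.
  have [ikk mk /(_ 0)] := oscint_fweight z z' K0.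
  rewrite -EFinRint; last first.
    by apply: integrable_mulcos => //; apply: measurable_funD => //; exact: measurable_cst.
  by rewrite cos0 mulr1 => -[<-]; apply: eq_Rintegral => xi _; rewrite addr0.
have KM z : [set: X] z -> (\int[waveguide m n lam]_(z' in setT)
    `|(\int[freqm]_xi (fweight K xi * cos (phase z xi - phase z' xi)))%R|%:E <= (32 ^+ m)%:E)%E.
  move=> _; under eq_integral do rewrite KE ger0_norm ?fkernel_ge0//.
  exact: fkernel_mass.
have S := @schur_test _ _ _ _ R (waveguide m n lam) freqm v (fun p => phase p.1 p.2)
  (fweight K) setT (32 ^+ m) iv measurable_phase ik w0 measurableT (fun x h => False_ind _ (h Logic.I)) KM.
rewrite [X in (X%:E * _)%E]mulrC [X in (_ <= X * _)%E]EFinM.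
rewrite [X in (_ <= X * _)%E]muleC -muleA.
apply: (@le_trans _ _ ((2 ^+ (m + n))%:E * \int[freqm]_xi (fweight K xi * g xi)%:E)%E); last first.
  by apply: lee_wpmul2l; [rewrite lee_fin exprn_ge0|exact: S].
rewrite -ge0_intZl ?exprn_ge0//; last 2 first.
- exact: measurable_funM.
- by move=> xi; rewrite mulr_ge0.
rewrite [leLHS]integral_mkcond; apply: ge0_le_integral => //.
- by move=> xi _; rewrite patchE; case: ifP => // _; rewrite lee_fin (g0 xi).
- by apply/(measurable_restrictT _ (measurable_fbox B)); apply: measurable_funTS; apply/measurable_EFinP.
- by apply/measurable_EFinP; do 2! apply: measurable_funM => //.
move=> xi _; rewrite patchE; case: ifPn => [|_]; last by rewrite lee_fin; pos.
rewrite inE /fbox /= => -[h1 h2]; rewrite lee_fin mulrA ler_peMl//; first exact: (g0 xi).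
have tri_K (s : R) : `|s| <= B -> 1 <= 2 * tri K%:R s.
  move=> sB; have : 2^-1 <= tri K%:R s by apply: tri_half => //; apply: (le_trans sB).
  by lra.
rewrite exprD /fweight mulrACA.
have -> : 2 ^+ m = \prod_(i < m) (2 : R) by rewrite prodr_const card_ord.
have -> : 2 ^+ n = \prod_(i < n) (2 : R) by rewrite prodr_const card_ord.
rewrite -!big_split /=.
have prod1 (I : finType) (f : I -> R) : (forall i, 1 <= f i) -> 1 <= \prod_(i : I) f i.
  move=> f1; rewrite -[leLHS](_ : \prod_(i : I) 1 = 1); last by rewrite big1.
  by apply: ler_prod => i _; rewrite ler01 f1.
by rewrite mulr_ege1//; apply: prod1 => i; apply: tri_K; [exact: h1|exact: h2].
Qed.

End bessel.

(** * Measures of shells in low dimension *)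

Section measure_misc.
Context d (T : measurableType d) (R : realType) (mu : {measure set T -> \bar R}).

Lemma measurable_set_le (f g : T -> R) : measT f -> measT g ->
  measurable [set x | f x <= g x].
Proof.
by move=> mf mg; rewrite -[X in measurable X]setTI; exact: measurable_fun_le.
Qed.

Lemma measure_le_union (A B C : set T) (b c : R) : measurable A -> measurable B ->
  measurable C -> A `<=` B `|` C -> (mu B <= b%:E)%E -> (mu C <= c%:E)%E ->
  (mu A <= (b + c)%:E)%E.
Proof.
move=> mA mB mC ABC Bb Cc; apply: (@le_trans _ _ (mu (B `|` C))).
  by apply: le_measure; rewrite ?inE//; exact: measurableU.
by rewrite EFinD; apply: (le_trans (measureU2 _ _ _)) => //; exact: leeD.
Qed.

Lemma measure_le_sub (A B : set T) (b : R) : measurable A -> measurable B ->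
  A `<=` B -> (mu B <= b%:E)%E -> (mu A <= b%:E)%E.
Proof. by move=> mA mB AB; apply: le_trans; apply: le_measure; rewrite ?inE. Qed.

End measure_misc.

Section low_dim.
Context (R : realType).
Local Notation leb := (@lebesgue_measure R).

Lemma itv_leb (a b : R) : a <= b -> leb `[a, b]%classic = (b - a)%:E.
Proof.
move=> ab; rewrite lebesgue_measure_itv /= lte_fin; case: ifPn => [_|]; first by rewrite -EFinB.
by rewrite -leNgt => ba; have -> : b = a; [by apply/le_anti/andP|rewrite subrr].
Qed.

Lemma itv_leb_le (a b c : R) : a <= b -> b - a <= c ->
  (leb `[a, b]%classic <= c%:E)%E.
Proof. by move=> ab bc; rewrite itv_leb// lee_fin. Qed.

Lemma diam_leb (A : set (measurableTypeR R)) (w : R) : measurable A -> 0 <= w ->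
  (forall x y, A x -> A y -> `|x - y| <= w) -> (leb A <= (2 * w)%:E)%E.
Proof.
move=> mA w0 Aw; have [->|/set0P[x0 Ax0]] := eqVneq A set0.
  by rewrite measure0 lee_fin mulr_ge0.
apply: (@measure_le_sub _ (measurableTypeR R) R leb _ `[x0 - w, x0 + w]%classic) => //.
  by move=> x Ax /=; rewrite in_itv /= -ler_distl; exact: Aw.
by apply: itv_leb_le; lra.
Qed.

(** Seen from one of its points, the set lies among [2 * floor w + 1] consecutive integers. *)
Lemma diam_lattice (lam : R) (A : set int) (w : R) : 0 < lam -> 0 <= w ->
  (forall k l : int, A k -> A l -> `|k%:~R - l%:~R : R| <= w) ->
  (lattice lam A <= (lam^-1 * (2 * w + 1))%:E)%E.
Proof.
move=> l0 w0 Aw; have [->|/set0P[k0 Ak0]] := eqVneq A set0.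
  by rewrite measure0 lee_fin; pos; rewrite ltW.
pose W := `|Num.floor w|%N.
have Ww : (W%:R : R) <= w.
  rewrite /W natr_absz ger0_norm ?floor_ge0//; exact: Num.Theory.floor_le.
pose B n := [set k : int | (`|k - k0|%N <= n)%N].
have AB : A `<=` B W.
  move=> k Ak; rewrite /B /=; have := Aw _ _ Ak Ak0.
  rewrite -intrB -intr_norm => h.
  have : (`|k - k0| <= Num.floor w)%R by rewrite floor_ge_int.
  by rewrite /W; lia.
have L1 k : (lattice lam [set k] <= (lam^-1)%:E)%E by rewrite lattice_set1.
have Bn n : (lattice lam (B n) <= (lam^-1 * (2 * n%:R + 1))%:E)%E.
  elim: n => [|n ih].
    rewrite mulr0 add0r mulr1 (_ : B 0%N = [set k0]) ?lattice_set1//.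
    by apply/seteqP; split => k; rewrite /B /=; lia.
  have -> : lam^-1 * (2 * n.+1%:R + 1) = lam^-1 * (2 * n%:R + 1) + (lam^-1 + lam^-1).
    by rewrite -[n.+1%:R]natr1; ring.
  apply: (@measure_le_union _ _ _ _ _ (B n) ([set k0 + n.+1%:Z] `|` [set k0 - n.+1%:Z])) => //.
    by move=> k; rewrite /B /=; lia.
  apply: (@measure_le_union _ _ _ _ _ ([set k0 + n.+1%:Z]) ([set k0 - n.+1%:Z])) => //.
    exact: L1.
  exact: L1.
apply: (@measure_le_sub _ _ _ _ _ (B W)) => //.
apply: (le_trans (Bn W)); rewrite lee_fin ler_wpM2l ?invr_ge0 ?(ltW l0)//; lra.
Qed.

Definition shell (b s de : R) : set (measurableTypeR R) := [set x | `|(x - b) ^+ 2 - s| <= de].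

Lemma measurable_shell b s de : measurable (shell b s de).
Proof.
apply: (measurable_set_le (f := fun x : measurableTypeR R => `|(x - b) ^+ 2 - s|)
  (g := fun=> de)) => //.
by apply: measurableT_comp => //; mea.
Qed.

(** [|u - v| * (u + v)] is the difference of two squares that are both within [de] of [s], while
    [u + v >= 2 * r]. *)
Lemma sqr_diam (r de s u v : R) : 0 < r -> r <= u -> r <= v ->
  `|u ^+ 2 - s| <= de -> `|v ^+ 2 - s| <= de -> `|u - v| <= de / r.
Proof.
move=> r0 ru rv hu hv; rewrite ler_pdivlMr//.
have h : `|u - v| * (u + v) <= 2 * de.
  have -> : `|u - v| * (u + v) = `|(u ^+ 2 - s) - (v ^+ 2 - s)|.
    rewrite -[X in _ * X]ger0_norm -?normrM; last lra.
    by congr (`|_|); ring.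
  apply: (le_trans (ler_normB _ _)); lra.
have : `|u - v| * (2 * r) <= `|u - v| * (u + v) by rewrite ler_wpM2l//; lra.
lra.
Qed.

(** On each side of [b] the set has diameter at most [de / r] by [sqr_diam]. *)
Lemma annulus1d (b s de r : R) : 0 < r -> 0 <= de ->
  (leb ([set x | (r <= `|x - b|)%R] `&` shell b s de) <= (4 * de / r)%:E)%E.
Proof.
move=> r0 de0.
have mp : measurable [set x : measurableTypeR R | r <= x - b].
  by apply: (measurable_set_le (f := fun=> r) (g := fun x : measurableTypeR R => x - b)); mea.
have mn : measurable [set x : measurableTypeR R | r <= b - x].
  by apply: (measurable_set_le (f := fun=> r) (g := fun x : measurableTypeR R => b - x)); mea.
have ms := measurable_shell b s de.
have -> : 4 * de / r = 2 * (de / r) + 2 * (de / r) by field; rewrite gt_eqF.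
apply: (@measure_le_union _ (measurableTypeR R) R leb _ ([set x | r <= x - b] `&` shell b s de)
  ([set x | r <= b - x] `&` shell b s de)).
- apply: measurableI => //.
  apply: (measurable_set_le (f := fun=> r) (g := fun x : measurableTypeR R => `|x - b|)); first mea.
  by apply: measurableT_comp => //; mea.
- exact: measurableI.
- exact: measurableI.
- move=> x /= [h1 h2]; have [h|h] := leP 0 (x - b).
    by left; split => //; rewrite ger0_norm in h1.
  by right; split => //; rewrite ler0_norm ?(ltW h)// opprB in h1.
- apply: diam_leb; [exact: measurableI|by rewrite divr_ge0// ltW|].
  move=> x y [/= h1 h2] [/= h3 h4].
  have -> : x - y = (x - b) - (y - b) by ring.
  exact: (@sqr_diam _ _ s).
- apply: diam_leb; [exact: measurableI|by rewrite divr_ge0// ltW|].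
  move=> x y [/= h1 h2] [/= h3 h4].
  have -> : x - y = (b - y) - (b - x) by ring.
  by apply: (@sqr_diam _ _ s) => //; rewrite -sqrrN opprB.
Qed.

(** If [s >= 2 * de], the shell stays at distance [Num.sqrt de] from [b] and [annulus1d] applies
    with that [r]; otherwise it lies within [2 * Num.sqrt de] of [b]. The square root is the price
    of allowing points near the centre. *)
Lemma shell_sqrt (b s de : R) : 0 < de -> (leb (shell b s de) <= (4 * Num.sqrt de)%:E)%E.
Proof.
move=> de0; have sde : 0 < Num.sqrt de by rewrite sqrtr_gt0.
have sde2 : Num.sqrt de ^+ 2 = de by rewrite sqr_sqrtr// ltW.
have [h|h] := leP (2 * de) s.
  apply: (@measure_le_sub _ (measurableTypeR R) R leb _ ([set x | (Num.sqrt de <= `|x - b|)%R] `&` shell b s de)).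
  - exact: measurable_shell.
  - apply: measurableI; last exact: measurable_shell.
    apply: (measurable_set_le (f := fun=> Num.sqrt de) (g := fun x : measurableTypeR R => `|x - b|)); first mea.
    by apply: measurableT_comp => //; mea.
  - move=> x sx; split => //=; move: sx; rewrite /shell /= ler_distl => /andP[h1 h2].
    by rewrite -(@ler_pXn2r _ 2)// ?nnegrE ?(ltW sde)// sde2 real_normK ?num_real//; lra.
  - apply: (le_trans (annulus1d b s sde (ltW de0))).
    by rewrite lee_fin -[X in 4 * X / _]sde2; apply: eq_le; field; rewrite gt_eqF.
apply: (@measure_le_sub _ (measurableTypeR R) R leb _ `[b - 2 * Num.sqrt de, b + 2 * Num.sqrt de]%classic).
- exact: measurable_shell.
- exact: measurable_itv.
- move=> x; rewrite /shell /= ler_distl => /andP[h1 h2].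
  rewrite in_itv /= -ler_distl -(@ler_pXn2r _ 2)// ?nnegrE ?mulr_ge0 ?(ltW sde)//.
  by rewrite real_normK ?num_real// exprMn sde2; lra.
- by apply: itv_leb_le; lra.
Qed.

End low_dim.

(** * Measures through slices *)

Section sections.
Context d1 d2 (X : measurableType d1) (Y : measurableType d2) (R : realType).
Variables (mu : {sigma_finite_measure set X -> \bar R}).
Variables (nu : {sigma_finite_measure set Y -> \bar R}).

Lemma measurable_sec1 (A : set (X * Y)) x : measurable A -> measurable [set y | A (x, y)].
Proof.
move=> mA; have h : measT (fun y : Y => (x, y)) by mea.
by rewrite -[X in measurable X]setTI; exact: h.
Qed.

Lemma measurable_sec2 (A : set (X * Y)) y : measurable A -> measurable [set x | A (x, y)].
Proof.
move=> mA; have h : measT (fun x : X => (x, y)) by mea.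
by rewrite -[X in measurable X]setTI; exact: h.
Qed.

Lemma prod_sec1 (A : set (X * Y)) : measurable A ->
  (prod_measure mu nu A = \int[mu]_x nu [set y | A (x, y)])%E.
Proof.
move=> mA; rewrite -[A in LHS]setIT -integral_indic//.
rewrite prod_tonelli//; last by apply/measurable_EFinP; exact: measurable_indic.
apply: eq_integral => x _; rewrite -[X in _ = nu X]setIT -integral_indic//.
exact: measurable_sec1.
Qed.

Lemma prod_sec2 (A : set (X * Y)) : measurable A ->
  (prod_measure mu nu A = \int[nu]_y mu [set x | A (x, y)])%E.
Proof.
move=> mA; rewrite -[A in LHS]setIT -integral_indic//.
rewrite prod_tonelli2//; last by apply/measurable_EFinP; exact: measurable_indic.
apply: eq_integral => y _; rewrite -[X in _ = mu X]setIT -integral_indic//.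
exact: measurable_sec2.
Qed.

Lemma measurable_secfun1 (A : set (X * Y)) : measurable A ->
  measT (fun x => nu [set y | A (x, y)]).
Proof.
move=> mA.
have -> : (fun x => nu [set y | A (x, y)]) = (fun x => \int[nu]_y (\1_A (x, y))%:E)%E.
  apply/funext => x; rewrite -[X in nu X]setIT -integral_indic//.
  exact: measurable_sec1.
apply: (@measurable_param_integral _ _ _ _ _ nu (fun p => (\1_A p)%:E)).
by apply/measurable_EFinP; exact: measurable_indic.
Qed.

Lemma measurable_secfun2 (A : set (X * Y)) : measurable A ->
  measT (fun y => mu [set x | A (x, y)]).
Proof.
move=> mA.
have -> : (fun y => mu [set x | A (x, y)]) = (fun y => \int[mu]_x (\1_A (x, y))%:E)%E.
  apply/funext => y; rewrite -[X in mu X]setIT -integral_indic//.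
  exact: measurable_sec2.
apply: (@measurable_param_integral _ _ _ _ _ mu (fun p => (\1_A (p.2, p.1))%:E)).
apply/measurable_EFinP.
have h : measT (fun p : Y * X => (p.2, p.1)) by mea.
have hA : measT (\1_A : X * Y -> R) by exact: measurable_indic.
exact: (measurableT_comp hA h).
Qed.

Lemma integral_le_box (f : X -> \bar R) (E : set X) (c e : R) : measT f ->
  measurable E -> (forall x, 0 <= f x)%E -> (forall x, E x -> f x <= c%:E)%E ->
  (forall x, ~ E x -> f x = 0)%E -> 0 <= c -> (mu E <= e%:E)%E ->
  (\int[mu]_x f x <= (c * e)%:E)%E.
Proof.
move=> mf mE f0 fc fE c0 Ee.
apply: (@le_trans _ _ (\int[mu]_x (c%:E * (\1_E x)%:E))%E).
  apply: ge0_le_integral => //.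
    by apply/measurable_EFinP; apply: measurable_funM => //; exact: measurable_indic.
  move=> x _; rewrite indicE; have [Ex|nEx] := pselect (E x).
    by rewrite mem_set// mule1 fc.
  by rewrite memNset// mule0 fE.
rewrite ge0_integralZl//; last by apply/measurable_EFinP; exact: measurable_indic.
by rewrite integral_indic// setIT EFinM; apply: lee_wpmul2l.
Qed.

Lemma prod_le_sec1 (A : set (X * Y)) (E : set X) (c e : R) : measurable A -> measurable E ->
  (forall x y, A (x, y) -> E x) -> (forall x, E x -> nu [set y | A (x, y)] <= c%:E)%E ->
  0 <= c -> (mu E <= e%:E)%E -> (prod_measure mu nu A <= (c * e)%:E)%E.
Proof.
move=> mA mE AE Ac c0 Ee; rewrite prod_sec1//.
apply: (@integral_le_box _ E) => //; first exact: measurable_secfun1.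
move=> x nE; rewrite (_ : [set y | _] = set0) ?measure0//.
by apply/seteqP; split => // y /= /AE.
Qed.

End sections.

Lemma prod_le_sec2 d1 d2 (X : measurableType d1) (Y : measurableType d2) (R : realType)
    (mu : {sigma_finite_measure set X -> \bar R})
    (nu : {sigma_finite_measure set Y -> \bar R})
    (A : set (X * Y)) (E : set Y) (c e : R) : measurable A -> measurable E ->
  (forall x y, A (x, y) -> E y) -> (forall y, E y -> mu [set x | A (x, y)] <= c%:E)%E ->
  0 <= c -> (nu E <= e%:E)%E -> (prod_measure mu nu A <= (c * e)%:E)%E.
Proof.
move=> mA mE AE Ac c0 Ee; rewrite prod_sec2//.
apply: (@integral_le_box _ _ _ _ _ E) => //; first exact: measurable_secfun2.
move=> y nE; rewrite (_ : [set x | _] = set0) ?measure0//.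
by apply/seteqP; split => // x /= /AE.
Qed.

Section slices.
Context d (T : measurableType d) (R : realType).
Variable mu : {sigma_finite_measure set T -> \bar R}.

Definition upd n (t : n.-tuple T) (j : 'I_n) (x : T) : n.-tuple T :=
  [tuple if i == j then x else tnth t i | i < n].

Lemma power_box n (I : set T) (e : R) : measurable I -> (mu I <= e%:E)%E ->
  0 <= e -> (power_measure mu n [set t | forall i, I (tnth t i)] <= (e ^+ n)%:E)%E.
Proof.
move=> mI Ie e0; elim: n => [|n ih].
  rewrite /= diracE expr0 lee_fin; by case: (_ \in _).
have mB k : measurable [set t : k.-tuple T | forall i, I (tnth t i)].
  have -> : [set t : k.-tuple T | forall i, I (tnth t i)] =
     \bigcap_(i in [set: 'I_k]) ((fun t : k.-tuple T => tnth t i) @^-1` I).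
    by apply/seteqP; split => t /= h i => [_|]; [exact: h|exact: (h i)].
  apply: fin_bigcap_measurable => // i _; rewrite -[X in measurable X]setTI.
  exact: measurable_tnth.
rewrite [leLHS](_ : _ = prod_measure mu (power_measure mu n)
   (I `*` [set t | forall i, I (tnth t i)]))//; last first.
  rewrite /= /cons_measure /pushforward; congr (prod_measure _ _ _).
  apply/seteqP; split => -[x t] /=.
    move=> h; split; first exact: (h ord0).
    by move=> i; have := h (lift ord0 i); rewrite /Defs.cons_tuple /= tnthS.
  move=> [h1 h2] i; case: (unliftP ord0 i) => [k ->|->//].
  by rewrite /Defs.cons_tuple /= tnthS.
rewrite [leLHS]product_measure1E//; last exact: mB.
by rewrite exprS EFinM; apply: lee_pmul.
Qed.

(** One chosen coordinate is estimated with the others frozen, and every frozen coordinate costs the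
    measure of [I]. Replacing an entry with [upd] avoids permuting the tuple; the induction moves
    the chosen coordinate to the head. *)
Lemma slice_le n (j : 'I_n.+1) (g : n.+1.-tuple T -> \bar R) (I : set T) (c e : R) :
  measT g -> (forall t, 0 <= g t)%E -> measurable I -> (mu I <= e%:E)%E ->
  0 <= c -> 0 <= e -> (forall t, ~ (forall i, I (tnth t i)) -> g t = 0)%E ->
  (forall t, \int[mu]_x g (upd t j x) <= c%:E)%E ->
  (\int[power_measure mu n.+1]_t g t <= (c * e ^+ n)%:E)%E.
Proof.
move=> + + mI Ie c0 e0.
have mcons k : measT (@Defs.cons_tuple T k) by exact: measurable_cons_tuple.
have mB k : measurable [set t : k.-tuple T | forall i, I (tnth t i)].
  have -> : [set t : k.-tuple T | forall i, I (tnth t i)] =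
     \bigcap_(i in [set: 'I_k]) ((fun t : k.-tuple T => tnth t i) @^-1` I).
    by apply/seteqP; split => t /= h i => [_|]; [exact: h|exact: (h i)].
  apply: fin_bigcap_measurable => // i _; rewrite -[X in measurable X]setTI.
  exact: measurable_tnth.
have upd0 k x (t : k.-tuple T) y : upd (Defs.cons_tuple (y, t)) ord0 x = Defs.cons_tuple (x, t).
  apply: eq_from_tnth => i; rewrite tnth_mktuple.
  by case: (unliftP ord0 i) => [l ->|->]; rewrite ?eqxx// /Defs.cons_tuple /= !tnthS.
have updS k (l : 'I_k) x (t : k.-tuple T) y :
    upd (Defs.cons_tuple (y, t)) (lift ord0 l) x = Defs.cons_tuple (y, upd t l x).
  apply: eq_from_tnth => i; rewrite tnth_mktuple.
  case: (unliftP ord0 i) => [i' ->|->]; last by rewrite /Defs.cons_tuple.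
  by rewrite (inj_eq lift_inj) /Defs.cons_tuple /= !tnthS tnth_mktuple.
elim: n j g => [|n ih] j g mg g0 gI gc.
  rewrite cons_tonelli2// power0_integral expr0 mulr1 (ord1 j) in gc *.
  (* [upd] needs a tuple to modify, hence a point of [T]; over an empty [T] the integral is zero. *)
  have [T0|nT] := pselect (exists y : T, True); last first.
    by rewrite integral0_eq ?lee_fin// => x _; exfalso; apply: nT; exists x.
  have [y _] := T0; have := gc (Defs.cons_tuple (y, [tuple])).
  by under eq_integral do rewrite upd0.
have mg2 : measT (fun p : T * n.+1.-tuple T => g (Defs.cons_tuple p)).
  exact: (measurableT_comp mg (mcons n.+1)).
case: (unliftP ord0 j) gc => [l ->|->] gc.
  rewrite cons_tonelli//.
  rewrite exprS mulrCA mulrC.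
  apply: (@integral_le_box _ _ _ mu _ I) => //.
  - by apply: (@measurable_param_integral _ _ _ _ _ (power_measure mu n.+1) (fun p => g (Defs.cons_tuple p))).
  - by move=> x; apply: integral_ge0.
  - move=> x Ix; apply: (ih l (fun t => g (Defs.cons_tuple (x, t)))) => //.
    + have h : measT (fun t : n.+1.-tuple T => (x, t)) by mea.
      exact: (measurableT_comp mg2 h).
    + move=> t h; apply: gI => h'; apply: h => i.
      by have := h' (lift ord0 i); rewrite /Defs.cons_tuple /= tnthS.
    + move=> t; have := gc (Defs.cons_tuple (x, t)).
      by under eq_integral do rewrite updS.
  - move=> x nIx; apply: integral0_eq => t _; apply: gI => h.
    by apply: nIx; exact: (h ord0).
  - by rewrite mulr_ge0// exprn_ge0.
rewrite cons_tonelli2//.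
apply: (@integral_le_box _ _ _ (power_measure mu n.+1) _ [set t | forall i, I (tnth t i)]) => //.
- apply: (@measurable_param_integral _ _ _ _ _ mu (fun p : n.+1.-tuple T * T => g (Defs.cons_tuple (p.2, p.1)))).
  have h : measT (fun p : n.+1.-tuple T * T => (p.2, p.1)) by mea.
  exact: (measurableT_comp mg2 h).
- exact: mB.
- by move=> t; apply: integral_ge0.
- move=> t _; have [T0|nT] := pselect (exists y : T, True); last first.
    by rewrite integral0_eq ?lee_fin// => x _; exfalso; apply: nT; exists x.
  have [y _] := T0; have := gc (Defs.cons_tuple (y, t)).
  by under eq_integral do rewrite upd0.
- move=> t nt; apply: integral0_eq => x _; apply: gI => h; apply: nt => i.
  by have := h (lift ord0 i); rewrite /Defs.cons_tuple /= tnthS.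
- exact: power_box.
Qed.

End slices.

(** * Shells in two continuous coordinates, with or without a lattice one *)

Section low_dim2.
Context (R : realType).
Local Notation leb := (lebesgue R).
Local Notation Rm := (measurableTypeR R).

Lemma measurable_normr d (T : measurableType d) (f : T -> R) :
  measT f -> measT (fun x => `|f x|).
Proof. by move=> mf; apply: measurableT_comp. Qed.

Definition band (b r : R) : set Rm := [set x | `|x - b| <= r].

Lemma measurable_band b r : measurable (band b r).
Proof.
apply: (measurable_set_le (f := fun x : Rm => `|x - b|) (g := fun=> r)); last mea.
by apply: measurable_normr; mea.
Qed.

Lemma band_le b r : 0 <= r -> (leb (band b r) <= (2 * r)%:E)%E.
Proof.
move=> r0; apply: (@measure_le_sub _ Rm R leb _ `[b - r, b + r]%classic) => //.
- exact: measurable_band.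
- by move=> x; rewrite /band /= in_itv /= -ler_distl.
- by apply: itv_leb_le; lra.
Qed.

Lemma sqr_le_norm (x y : R) : 0 <= y -> x ^+ 2 <= y ^+ 2 -> `|x| <= y.
Proof.
by move=> y0 h; rewrite -(@ler_pXn2r _ 2)// ?nnegrE// real_normK ?num_real.
Qed.

Lemma sqr_ge_norm (x y : R) : 0 <= y -> y ^+ 2 <= x ^+ 2 -> y <= `|x|.
Proof.
by move=> y0 h; rewrite -(@ler_pXn2r _ 2)// ?nnegrE// real_normK ?num_real.
Qed.

(** A planar annulus has area linear in its thickness, whatever its radius. If [s >= 2 * de], the
    larger coordinate is at least half the radius [q], so its slices have length of order [de / q],
    while the other coordinate ranges over length [2 * q]; the radius cancels. If [s < 2 * de], the
    set lies in a square of side [2 * Num.sqrt (3 * de)]. No lower bound on [de] is needed, which is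
    what permits infinite time when [m >= 2]. *)
Lemma annulus2d (b1 b2 s de : R) : 0 < de ->
  (prod_measure leb leb [set p : Rm * Rm | (`|(p.1 - b1) ^+ 2 + (p.2 - b2) ^+ 2 - s| <= de)%R]
   <= (32 * de)%:E)%E.
Proof.
move=> de0; set A := [set p : Rm * Rm | _].
have mA : measurable A.
  apply: (measurable_set_le (f := fun p : Rm * Rm => `|(p.1 - b1) ^+ 2 + (p.2 - b2) ^+ 2 - s|)
    (g := fun=> de)); last mea.
  by apply: measurable_normr; mea.
have [h|h] := leP (2 * de) s; last first.
  pose q := Num.sqrt (3 * de).
  have q2 : q ^+ 2 = 3 * de by rewrite sqr_sqrtr//; lra.
  have q0 : 0 <= q by exact: sqrtr_ge0.
  apply: (@le_trans _ _ (2 * q * (2 * q))%:E); last first.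
    by rewrite lee_fin (_ : _ * _ = 4 * q ^+ 2); [rewrite q2; lra|ring].
  have B1 p : A p -> `|p.1 - b1| <= q /\ `|p.2 - b2| <= q.
    rewrite /A /= ler_distl => /andP[h1 h2].
    have := sqr_ge0 (p.1 - b1); have := sqr_ge0 (p.2 - b2) => ? ?.
    by split; apply: sqr_le_norm => //; rewrite q2; lra.
  apply: (@prod_le_sec1 _ _ _ _ _ leb leb A (band b1 q)) => //.
  - exact: measurable_band.
  - by move=> x y /B1[].
  - move=> x _; apply: (@measure_le_sub _ Rm R leb _ (band b2 q)).
    + exact: measurable_sec1.
    + exact: measurable_band.
    + by move=> y /B1[].
    + exact: band_le.
  - by rewrite mulr_ge0.
  - exact: band_le.
have s0 : 0 < s by lra.
pose q := Num.sqrt s.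
have q2 : q ^+ 2 = s by rewrite sqr_sqrtr// ltW.
have q0 : 0 < q by rewrite sqrtr_gt0.
have bnd (u v : R) : `|u ^+ 2 + v ^+ 2 - s| <= de -> v ^+ 2 <= u ^+ 2 ->
    q / 2 <= `|u| /\ `|v| <= q.
  rewrite ler_distl => /andP[h1 h2] vu; split.
    by apply: sqr_ge_norm; rewrite ?expr_div_n ?q2; lra.
  by apply: sqr_le_norm; rewrite ?q2; lra.
have half (b b' : R) (y : R) : (leb ([set x | (q / 2 <= `|x - b|)%R] `&`
    shell b (s - (y - b') ^+ 2) de) <= (8 * de / q)%:E)%E.
  have -> : 8 * de / q = 4 * de / (q / 2) by field; rewrite gt_eqF.
  by apply: annulus1d; [lra|exact: ltW].
have mhalf (b : R) : measurable [set x : Rm | q / 2 <= `|x - b|].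
  apply: (measurable_set_le (f := fun=> q / 2) (g := fun x : Rm => `|x - b|)); first mea.
  by apply: measurable_normr; mea.
pose A1 := A `&` [set p : Rm * Rm | (p.2 - b2) ^+ 2 <= (p.1 - b1) ^+ 2].
pose A2 := A `&` [set p : Rm * Rm | (p.1 - b1) ^+ 2 <= (p.2 - b2) ^+ 2].
have mA1 : measurable A1.
  apply: measurableI => //.
  by apply: (measurable_set_le (f := fun p : Rm * Rm => (p.2 - b2) ^+ 2) (g := fun p : Rm * Rm => (p.1 - b1) ^+ 2)); mea.
have mA2 : measurable A2.
  apply: measurableI => //.
  by apply: (measurable_set_le (f := fun p : Rm * Rm => (p.1 - b1) ^+ 2) (g := fun p : Rm * Rm => (p.2 - b2) ^+ 2)); mea.
have -> : 32 * de = 8 * de / q * (2 * q) + 8 * de / q * (2 * q).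
  by field; rewrite gt_eqF.
apply: (@measure_le_union _ _ _ _ _ A1 A2) => //.
- move=> p Ap; have [hh|hh] := leP ((p.2 - b2) ^+ 2) ((p.1 - b1) ^+ 2); [by left|right].
  by split => //=; exact: ltW.
- apply: (@prod_le_sec2 _ _ _ _ _ leb leb A1 (band b2 q)) => //.
  + exact: measurable_band.
  + by move=> x y [/= hA hl]; have [] := bnd _ _ hA hl.
  + move=> y _; apply: (measure_le_sub _ _ _ (half b1 b2 y)).
    * exact: measurable_sec2.
    * by apply: measurableI; [exact: mhalf|exact: measurable_shell].
    * move=> x [/= hA hl]; have [h1 _] := bnd _ _ hA hl; split => //.
      by rewrite /shell /=; move: hA; rewrite /A /=; congr (`|_| <= _); ring.
  + by rewrite divr_ge0 ?mulr_ge0 ?(ltW q0)// ltW.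
  + by apply: band_le; exact: ltW.
- apply: (@prod_le_sec1 _ _ _ _ _ leb leb A2 (band b1 q)) => //.
  + exact: measurable_band.
  + move=> x y [/= hA hl]; rewrite /A /= in hA.
    have hA' : `|(y - b2) ^+ 2 + (x - b1) ^+ 2 - s| <= de.
      by move: hA; congr (`|_| <= _); ring.
    by have [] := bnd _ _ hA' hl.
  + move=> x _; apply: (measure_le_sub _ _ _ (half b2 b1 x)).
    * exact: measurable_sec1.
    * by apply: measurableI; [exact: mhalf|exact: measurable_shell].
    * move=> y [/= hA hl]; rewrite /A /= in hA.
      have hA' : `|(y - b2) ^+ 2 + (x - b1) ^+ 2 - s| <= de.
        by move: hA; congr (`|_| <= _); ring.
      have [h1 _] := bnd _ _ hA' hl; split => //.
      by rewrite /shell /=; move: hA; congr (`|_| <= _); ring.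
  + by rewrite divr_ge0 ?mulr_ge0 ?(ltW q0)// ltW.
  + by apply: band_le; exact: ltW.
Qed.

(** On each side of [b], [sqr_diam] confines [k] to a set of diameter [lam * D / r], hence of mass
    at most [2 * D / r + 1 / lam]; the last term is the point that no smallness of [D] removes. The
    slices over the remaining variables cost [c]. *)
Lemma lattice_shell_count d (W : measurableType d)
    (om : {sigma_finite_measure set W -> \bar R}) (lam r b s D c : R) (A : set (W * int)) :
  0 < lam -> 0 < r -> 0 <= D -> 0 <= c -> measurable A ->
  (forall w k, A (w, k) -> r <= `|k%:~R / lam - b| /\ `|(k%:~R / lam - b) ^+ 2 - s| <= D) ->
  (forall k, om [set w | A (w, k)] <= c%:E)%E ->
  (prod_measure om (lattice lam) A <= (c * (2 / lam + 4 * D / r))%:E)%E.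
Proof.
move=> l0 r0 D0 c0 mA Ar Ac.
pose eta (k : int) : R := k%:~R / lam - b.
have Dr : 0 <= D / r by rewrite divr_ge0// ltW.
pose e := lam^-1 * (2 * (lam * (D / r)) + 1).
have lw : 0 <= lam * (D / r) by rewrite mulr_ge0// ltW.
have etaB k l : k%:~R - l%:~R = lam * (eta k - eta l) by rewrite /eta; field; rewrite gt_eqF.
have meta : measT (fun p : W * int => eta p.2).
  apply: (measurableT_comp (@measurable_on_int _ Rm eta)); mea.
have mAp : measurable (A `&` [set p : W * int | r <= eta p.2]).
  by apply: measurableI => //; apply: measurable_set_le; first mea.
have mAm : measurable (A `&` [set p : W * int | r <= - eta p.2]).
  apply: measurableI => //; apply: (measurable_set_le (f := fun=> r)
    (g := fun p : W * int => - eta p.2)); first mea.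
  exact: measurableT_comp.
have -> : c * (2 / lam + 4 * D / r) = c * e + c * e.
  by rewrite /e; field; rewrite !gt_eqF.
apply: (@measure_le_union _ _ _ _ _ (A `&` [set p : W * int | r <= eta p.2])
    (A `&` [set p : W * int | r <= - eta p.2])) => //.
- move=> -[w k] Ap; have [h _] := Ar _ _ Ap; have [hh|hh] := leP 0 (eta k).
    by left; split => //=; rewrite -/(eta _) ger0_norm in h.
  by right; split => //=; rewrite -/(eta _) ler0_norm ?(ltW hh) in h.
- apply: (@prod_le_sec2 _ _ _ _ _ om (lattice lam) _
      [set k | r <= eta k /\ `|eta k ^+ 2 - s| <= D]) => //.
  + by move=> w k [/Ar[_ h1] /= h2].
  + move=> k _; apply: (measure_le_sub _ _ _ (Ac k)) => //; last by move=> w [].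
      exact: (measurable_sec2 k mAp).
    exact: (measurable_sec2 k mA).
  + apply: diam_lattice => // k l [hk hk'] [hl hl'].
    by rewrite etaB normrM (ger0_norm (ltW l0)) ler_pM2l//; exact: (@sqr_diam _ _ _ s).
- apply: (@prod_le_sec2 _ _ _ _ _ om (lattice lam) _
      [set k | r <= - eta k /\ `|eta k ^+ 2 - s| <= D]) => //.
  + by move=> w k [/Ar[_ h1] /= h2].
  + move=> k _; apply: (measure_le_sub _ _ _ (Ac k)) => //; last by move=> w [].
      exact: (measurable_sec2 k mAm).
    exact: (measurable_sec2 k mA).
  + apply: diam_lattice => // k l [hk hk'] [hl hl'].
    rewrite etaB normrM (ger0_norm (ltW l0)) ler_pM2l//.
    have -> : eta k - eta l = - eta l - - eta k by ring.
    by apply: (@sqr_diam _ _ _ s); rewrite ?sqrrN.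
Qed.

(* Two continuous coordinates and one lattice coordinate, the latter far from
   the centre of the shell. *)
Lemma shell_lattice2 (lam N r b0 b1 b2 s de : R) : 0 < lam -> 0 < N -> 0 < r -> 0 < de ->
  (prod_measure (prod_measure leb leb) (lattice lam)
    [set p : (Rm * Rm) * int | [/\ (`|p.1.1| <= 2 * N)%R, (`|p.1.2| <= 2 * N)%R,
       (r <= `|p.2%:~R / lam - b2|)%R &
       (`|(p.1.1 - b0) ^+ 2 + (p.1.2 - b1) ^+ 2 + (p.2%:~R / lam - b2) ^+ 2 - s| <= de)%R]]
   <= (8192 * de * (lam^-1 + N ^+ 2 / r))%:E)%E.
Proof.
move=> l0 N0 r0 de0; set A := [set p | _].
pose eta (k : int) : R := k%:~R / lam - b2.
(* [be] is the distance of the planar centre from the origin, kept above [4 * N] so that it also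
   serves when the centre is near the box. *)
pose be := Num.max (Num.max `|b0| `|b1|) (4 * N).
have be4 : 4 * N <= be by rewrite le_max lexx orbT.
have be0 : `|b0| <= be by rewrite !le_max lexx.
have be1 : `|b1| <= be by rewrite !le_max lexx orbT.
have bep : 0 < be by lra.
have mk d (T : measurableType d) (f : T -> int) : measT f ->
    measT (fun x => (f x)%:~R : R).
  by move=> mf; apply: (measurableT_comp (@measurable_on_int _ Rm (fun k => k%:~R))).
have mA : measurable A.
  have -> : A = [set p : (Rm * Rm) * int | `|p.1.1| <= 2 * N] `&`
      [set p | `|p.1.2| <= 2 * N] `&` [set p | r <= `|p.2%:~R / lam - b2|] `&`
      [set p | `|(p.1.1 - b0) ^+ 2 + (p.1.2 - b1) ^+ 2 + (p.2%:~R / lam - b2) ^+ 2 - s| <= de].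
    by apply/seteqP; split => p /=; [case|case=> -[[]]].
  have m2 : measT (fun p : (Rm * Rm) * int => p.2%:~R / lam - b2).
    by apply: measurable_funB; [apply: measurable_funM; [exact: mk|mea]|mea].
  apply: measurableI; first apply: measurableI; first apply: measurableI.
  - by apply: measurable_set_le; [apply: measurable_normr|]; mea.
  - by apply: measurable_set_le; [apply: measurable_normr|]; mea.
  - by apply: (measurable_set_le (f := fun=> r) (g := fun p : (Rm * Rm) * int => `|p.2%:~R / lam - b2|)); [mea|apply: measurable_normr].
  - by apply: measurable_set_le; [apply: measurable_normr|]; mea.
(* Two bounds for the planar slice at fixed [k]: [c1] uses the thickness of the shell, [c2] is the
   area of the whole square. Both are needed at the end: [c1] pays for the lattice point and for the
   term [N * be] of [D], and [c2] for the term [de] of [D]. *)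
pose c1 := 128 * de * N / be.
pose c2 := 16 * N ^+ 2.
have c10 : 0 <= c1 by rewrite /c1 divr_ge0 ?mulr_ge0// ltW.
have c20 : 0 <= c2 by rewrite mulr_ge0 ?sqr_ge0.
have mAk k : measurable [set p : Rm * Rm | A (p, k)] by exact: measurable_sec2.
have far (b x : R) : `|b| = be -> 4 * N < be -> `|x| <= 2 * N -> be / 2 <= `|x - b|.
  move=> hb h hx; rewrite distrC.
  by have := lerB_dist b x; rewrite hb; lra.
have mfar (b q : R) : measurable [set x : Rm | q <= `|x - b|].
  apply: (measurable_set_le (f := fun=> q) (g := fun x : Rm => `|x - b|)); first mea.
  by apply: measurable_normr; mea.
have band0 x : band 0 (2 * N) x <-> `|x| <= 2 * N by rewrite /band /= subr0.
have slice1 k : (prod_measure leb leb [set p | A (p, k)] <= c1%:E)%E.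
  (* For [be = 4 * N] the bound [c1] is the [32 * de] of [annulus2d]. Otherwise the coordinate that
     realizes [be] stays at distance [be / 2] from its centre, which gives short slices over a band
     of length [4 * N]. *)
  have [h4|h4] := leP be (4 * N).
    apply: (measure_le_sub _ _ _ (le_trans (annulus2d b0 b1 (s - eta k ^+ 2) de0) _)) => //.
    - apply: (measurable_set_le (f := fun p : Rm * Rm => `|(p.1 - b0) ^+ 2 + (p.2 - b1) ^+ 2 - (s - eta k ^+ 2)|) (g := fun=> de)); last mea.
      by apply: measurable_normr; mea.
    - move=> p [_ _ _] /=; congr (`|_| <= _); rewrite /eta; ring.
    - rewrite lee_fin /c1 (_ : be = 4 * N); last by apply/le_anti/andP.
      by apply: eq_le; field; rewrite gt_eqF.
  have -> : c1 = (32 * de / be) * (4 * N) by rewrite /c1; field; rewrite gt_eqF.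
  have cc : 0 <= 32 * de / be by rewrite divr_ge0 ?mulr_ge0// ltW.
  have e4 : 4 * N = 2 * (2 * N) by ring.
  have : `|b0| = be \/ `|b1| = be.
    have [e|e] := leP `|b1| `|b0|; [left|right]; apply/le_anti; rewrite ?be0 ?be1 /=;
      move: h4; rewrite /be ?(max_l e) ?(max_r (ltW e)) lt_max ltxx orbF => h4;
      by rewrite ge_max lexx ltW.
  have le832 : 4 * de / (be / 2) <= 32 * de / be.
    rewrite (_ : _ / (be / 2) = 8 * de / be); last by field; rewrite gt_eqF.
    by rewrite ler_pM2r ?invr_gt0//; lra.
  have be20 : 0 < be / 2 by lra.
  case=> hb.
  - apply: (@prod_le_sec2 _ _ _ _ _ leb leb _ (band 0 (2 * N))) => //.
    + exact: measurable_band.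
    + by move=> x y [_ h _ _]; apply/band0.
    + move=> y _; apply: (@measure_le_sub _ Rm R leb _ ([set x | (be / 2 <= `|x - b0|)%R] `&`
         shell b0 (s - eta k ^+ 2 - (y - b1) ^+ 2) de)).
      * exact: (measurable_sec2 y (mAk k)).
      * by apply: measurableI; [exact: mfar|exact: measurable_shell].
      * move=> x [/= hx _ _ hs]; split => /=; first exact: far.
        by rewrite /shell /=; move: hs; congr (`|_| <= _); rewrite /eta; ring.
      * by apply: (le_trans (annulus1d _ _ be20 (ltW de0))); rewrite lee_fin.
    + by rewrite e4; apply: band_le; lra.
  - apply: (@prod_le_sec1 _ _ _ _ _ leb leb _ (band 0 (2 * N))) => //.
    + exact: measurable_band.
    + by move=> x y [h _ _ _]; apply/band0.
    + move=> x _; apply: (@measure_le_sub _ Rm R leb _ ([set y | (be / 2 <= `|y - b1|)%R] `&`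
         shell b1 (s - eta k ^+ 2 - (x - b0) ^+ 2) de)).
      * exact: (measurable_sec1 x (mAk k)).
      * by apply: measurableI; [exact: mfar|exact: measurable_shell].
      * move=> y [/= _ hy _ hs]; split => /=; first exact: far.
        by rewrite /shell /=; move: hs; congr (`|_| <= _); rewrite /eta; ring.
      * by apply: (le_trans (annulus1d _ _ be20 (ltW de0))); rewrite lee_fin.
    + by rewrite e4; apply: band_le; lra.
have slice2 k : (prod_measure leb leb [set p | A (p, k)] <= c2%:E)%E.
  have -> : c2 = 2 * (2 * N) * (2 * (2 * N)) by rewrite /c2; ring.
  have N2 : 0 <= 2 * N by lra.
  apply: (@prod_le_sec1 _ _ _ _ _ leb leb _ (band 0 (2 * N))) => //.
  - exact: measurable_band.
  - by move=> x y [h _ _ _]; apply/band0.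
  - move=> x _; apply: (measure_le_sub _ _ _ (band_le 0 N2)).
    + exact: (measurable_sec1 x (mAk k)).
    + exact: measurable_band.
    + by move=> y [_ h _ _]; apply/band0.
  - lra.
  - exact: band_le.
pose c := Num.min c1 c2.
have c0 : 0 <= c by rewrite le_min c10 c20.
have cc1 : c <= c1 by rewrite ge_min lexx.
have cc2 : c <= c2 by rewrite ge_min lexx orbT.
have slice k : (prod_measure leb leb [set p | A (p, k)] <= c%:E)%E.
  by rewrite /c /Num.min; case: ifP.
(* On the box each [(x - b) ^+ 2] differs from [b ^+ 2] by at most [5 * N * be]; freezing both at
   the origin leaves a shell condition on the lattice coordinate alone, of half-width [D]. *)
pose D := de + 10 * N * be.
have D0 : 0 < D by rewrite addr_gt0// !mulr_gt0.
have var (b x : R) : `|b| <= be -> `|x| <= 2 * N -> `|(x - b) ^+ 2 - b ^+ 2| <= 5 * N * be.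
  move=> hb hx; have -> : (x - b) ^+ 2 - b ^+ 2 = x * (x - 2 * b) by ring.
  rewrite normrM; have : `|x - 2 * b| <= 2 * N + 2 * be.
    by apply: (le_trans (ler_normB _ _)); rewrite normrM (ger0_norm (ler0n R 2)); lra.
  move=> h; apply: (@le_trans _ _ (2 * N * (2 * N + 2 * be))).
    by apply: ler_pM.
  have : N * (4 * N) <= N * be by rewrite ler_pM2l.
  lra.
pose s' := s - b0 ^+ 2 - b1 ^+ 2.
have cen p k : A (p, k) -> `|eta k ^+ 2 - s'| <= D.
  move=> [h1 h2 _ h3] /=.
  have -> : eta k ^+ 2 - s' = ((p.1 - b0) ^+ 2 + (p.2 - b1) ^+ 2 + eta k ^+ 2 - s) -
     ((p.1 - b0) ^+ 2 - b0 ^+ 2) - ((p.2 - b1) ^+ 2 - b1 ^+ 2) by rewrite /s'; ring.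
  have v0 := var _ _ be0 h1; have v1 := var _ _ be1 h2.
  apply: (le_trans (ler_normB _ _)); apply: (@le_trans _ _ (de + 5 * N * be + 5 * N * be)).
    by apply: lerD => //; apply: (le_trans (ler_normB _ _)); apply: lerD.
  by rewrite /D; lra.
apply: (@le_trans _ _ (c * (2 / lam + 4 * D / r))%:E).
  apply: (@lattice_shell_count _ _ _ _ _ b2 s') => //; first exact: ltW.
  by move=> p k Ap; split; [case: Ap|exact: (cen p)].
rewrite lee_fin.
have -> : c * (2 / lam + 4 * D / r) =
    2 * c / lam + 4 * c * de / r + 40 * c * (N * be) / r.
  by rewrite /D; field; rewrite !gt_eqF.
have t1 : c / lam <= 32 * de / lam.
  rewrite ler_pM2r ?invr_gt0//; apply: (le_trans cc1).
  rewrite /c1 ler_pdivrMr//.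
  have : 4 * (de * N) <= de * be by rewrite mulrCA ler_pM2l.
  lra.
have t2 : c * de / r <= 16 * N ^+ 2 * de / r.
  by rewrite ler_pM2r ?invr_gt0// ler_pM2r.
have t3 : c * (N * be) / r <= 128 * de * N ^+ 2 / r.
  rewrite ler_pM2r ?invr_gt0//; apply: (@le_trans _ _ (c1 * (N * be))).
    by rewrite ler_pM2r// mulr_gt0.
  by rewrite /c1 le_eqVlt; apply/orP; left; apply/eqP; field; rewrite gt_eqF.
have p1 : 0 <= de / lam by rewrite divr_ge0// ltW.
have p2 : 0 <= N ^+ 2 * de / r by rewrite divr_ge0 ?mulr_ge0 ?sqr_ge0// ltW.
have -> : 8192 * de * (lam^-1 + N ^+ 2 / r) = 8192 * (de / lam) + 8192 * (N ^+ 2 * de / r) by ring.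
have -> : 2 * c / lam + 4 * c * de / r + 40 * c * (N * be) / r =
  2 * (c / lam) + 4 * (c * de / r) + 40 * (c * (N * be) / r) by ring.
lra.
Qed.

End low_dim2.

Lemma int_dist_ge1 (R : realType) (k l : int) : k != l -> 1 <= `|k%:~R - l%:~R : R|.
Proof.
move=> kl; have : 0 < `|k - l| by rewrite normr_gt0 subr_eq0.
by rewrite gtz0_ge1 -(ler_int R) intr_norm intrB.
Qed.

(** * Shells in one continuous and one lattice coordinate *)

Section shell_line.
Context (R : realType).
Local Notation leb := (lebesgue R).
Local Notation Rm := (measurableTypeR R).

Section fixed.
Variables (lam b1 b2 s de : R).
Hypotheses (l0 : 0 < lam) (de0 : 0 < de).

Definition shell1 : set (Rm * int) :=
  [set p | `|(p.1 - b1) ^+ 2 + (p.2%:~R / lam - b2) ^+ 2 - s| <= de].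

Lemma measurable_lat_shift d (T : measurableType d) (f : T -> int) : measT f ->
  measT (fun x => (f x)%:~R / lam - b2).
Proof.
move=> mf; apply: measurable_funB; last mea.
apply: measurable_funM; last mea.
by apply: (measurableT_comp (@measurable_on_int _ Rm (fun k => k%:~R))).
Qed.

Lemma measurable_shell1 : measurable shell1.
Proof.
apply: measurable_set_le; last mea; apply: measurable_normr.
apply: measurable_funB; last mea; apply: measurable_funD; first mea.
by apply: measurable_funX; apply: measurable_lat_shift; mea.
Qed.

Lemma measurable_lat_ge (r : R) : measurable [set p : Rm * int | r <= `|p.2%:~R / lam - b2|].
Proof.
apply: (measurable_set_le (f := fun=> r) (g := fun p : Rm * int => `|p.2%:~R / lam - b2|)); first mea.
by apply: measurable_normr; apply: measurable_lat_shift; mea.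
Qed.

Lemma shell1_slice p k : shell1 (p, k) <-> shell b1 (s - (k%:~R / lam - b2) ^+ 2) de p.
Proof. by rewrite /shell1 /shell /=; split; congr (`|_| <= _); ring. Qed.

(** The argument of [shell_lattice2] with one continuous coordinate: a far centre [b1] makes slices
    of length at most [8 * de / |b1|], and this pays for the term [5 * N * |b1|] in the width left
    to the lattice coordinate. *)
Lemma shell_lattice1_far (N r : R) : 0 < N -> 0 < r -> 4 * N <= `|b1| ->
  (prod_measure leb (lattice lam) (shell1 `&` [set p | (`|p.1| <= 2 * N)%R] `&`
     [set p | (r <= `|p.2%:~R / lam - b2|)%R]) <= (200 * de * (lam^-1 / N + N / r))%:E)%E.
Proof.
move=> N0 r0 hb; set A := _ `&` _.
have bp : 0 < `|b1| by lra.
have mA : measurable A.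
  apply: measurableI; last exact: measurable_lat_ge.
  apply: measurableI; first exact: measurable_shell1.
  by apply: measurable_set_le; [apply: measurable_normr|]; mea.
pose c1 := 8 * de / `|b1|.
pose c := Num.min c1 (4 * N).
have c10 : 0 <= c1 by rewrite divr_ge0 ?mulr_ge0// ltW.
have c0 : 0 <= c by rewrite le_min c10 /=; lra.
have cc1 : c <= c1 by rewrite ge_min lexx.
have cc2 : c <= 4 * N by rewrite ge_min lexx orbT.
have slice k : (leb [set x | A (x, k)] <= c%:E)%E.
  have mk : measurable [set x : Rm | A (x, k)] by exact: (measurable_sec2 k mA).
  have h1 : (leb [set x | A (x, k)] <= c1%:E)%E.
    have b20 : 0 < `|b1| / 2 by lra.
    rewrite (_ : c1 = 4 * de / (`|b1| / 2)); last by rewrite /c1; field; rewrite gt_eqF.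
    apply: (@measure_le_sub _ Rm R leb _ ([set x | (`|b1| / 2 <= `|x - b1|)%R] `&`
       shell b1 (s - (k%:~R / lam - b2) ^+ 2) de)) => //.
    - apply: measurableI; last exact: measurable_shell.
      apply: (measurable_set_le (f := fun=> `|b1| / 2) (g := fun x : Rm => `|x - b1|)); first mea.
      by apply: measurable_normr; mea.
    - move=> x [[/shell1_slice h1 h2] _]; split => //=; rewrite distrC.
      by rewrite /= in h2; have := lerB_dist b1 x; lra.
    - exact: (annulus1d _ _ b20 (ltW de0)).
  have h2 : (leb [set x | A (x, k)] <= (4 * N)%:E)%E.
    rewrite (_ : 4 * N = 2 * (2 * N)); last ring.
    have N2 : 0 <= 2 * N by lra.
    apply: (measure_le_sub _ _ _ (band_le 0 N2)) => //; first exact: measurable_band.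
    by move=> x [[_ h] _]; rewrite /band /= subr0.
  by rewrite /c /Num.min; case: ifP.
pose D := de + 5 * N * `|b1|.
have D0 : 0 < D by rewrite addr_gt0// !mulr_gt0.
have cen x k : A (x, k) -> `|(k%:~R / lam - b2) ^+ 2 - (s - b1 ^+ 2)| <= D.
  move=> [[h1 h2] _]; rewrite /shell1 /= in h1 h2.
  have -> : (k%:~R / lam - b2) ^+ 2 - (s - b1 ^+ 2) =
     ((x - b1) ^+ 2 + (k%:~R / lam - b2) ^+ 2 - s) - x * (x - 2 * b1) by ring.
  apply: (le_trans (ler_normB _ _)); apply: lerD => //.
  rewrite normrM; have : `|x - 2 * b1| <= 2 * N + 2 * `|b1|.
    by apply: (le_trans (ler_normB _ _)); rewrite normrM (ger0_norm (ler0n R 2)); lra.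
  move=> h; apply: (@le_trans _ _ (2 * N * (2 * N + 2 * `|b1|))); first exact: ler_pM.
  have : N * (4 * N) <= N * `|b1| by rewrite ler_pM2l.
  lra.
apply: (@le_trans _ _ (c * (2 / lam + 4 * D / r))%:E).
  apply: (lattice_shell_count (b := b2) (s := s - b1 ^+ 2)) => //; first exact: ltW.
  by move=> p k Ap; split; [case: Ap|exact: (cen p)].
rewrite lee_fin.
have -> : c * (2 / lam + 4 * D / r) = 2 * (c / lam) + 4 * (c * de / r) + 20 * (c * (N * `|b1|) / r).
  by rewrite /D; field; rewrite !gt_eqF.
have t1 : c / lam <= 2 * de / N / lam.
  rewrite ler_pM2r ?invr_gt0//; apply: (le_trans cc1); rewrite /c1 ler_pdivrMr//.
  rewrite (_ : 2 * de / N * _ = 2 * de * `|b1| / N); last ring.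
  rewrite ler_pdivlMr//.
  have : de * (4 * N) <= de * `|b1| by rewrite ler_pM2l.
  lra.
have t2 : c * de / r <= 4 * N * de / r by rewrite ler_pM2r ?invr_gt0// ler_pM2r.
have t3 : c * (N * `|b1|) / r <= 8 * de * N / r.
  rewrite ler_pM2r ?invr_gt0//; apply: (@le_trans _ _ (c1 * (N * `|b1|))).
    by rewrite ler_pM2r// mulr_gt0.
  by rewrite /c1 le_eqVlt; apply/orP; left; apply/eqP; field; rewrite gt_eqF.
have p1 : 0 <= de / N / lam by rewrite !divr_ge0// ltW.
have p2 : 0 <= N * de / r by rewrite divr_ge0 ?mulr_ge0// ltW.
lra.
Qed.

(* Far from the centre the points of the lattice have squares that are
   [2 r / lam]-separated, so the slices of the shell can be compared with
   disjoint subintervals of [0, sqrt (2 S)]. *)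
Lemma shell_lattice1 (r S w : R) (I : set Rm) : 0 < r -> 0 <= S -> 0 <= w ->
  measurable I -> (forall x, I x -> (x - b1) ^+ 2 <= S) ->
  (forall q, leb (I `&` shell b1 q de) <= w%:E)%E ->
  (prod_measure leb (lattice lam) (shell1 `&` [set p | I p.1] `&`
     [set p | (r <= `|p.2%:~R / lam - b2|)%R]) <=
   (6 * w / lam + 6 * w * de / r + 24 * de * Num.sqrt (2 * S) / r)%:E)%E.
Proof.
move=> r0 S0 w0 mI IS Iw; set A := _ `&` _.
pose eta (k : int) : R := k%:~R / lam - b2.
(* [h] is the least gap between the squares of distinct points on one side, at distance at least [r]
   from the centre. *)
have [h hE] : {h | h = 2 * r / lam} by exists (2 * r / lam).
have h0 : 0 < h by rewrite hE divr_gt0 ?mulr_gt0.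
(* [M] separates the lattice points near the turning point, where [s - eta k ^+ 2] is small and
   slices are only bounded by [w], from the others. Above it, [2 * de <= M] keeps the slice away
   from [b1], and [h <= M] leaves room for the comparison interval. *)
have [M [Mh Md MM]] : exists M, [/\ h <= M, 2 * de <= M & M <= h + 2 * de].
  exists (Num.max h (2 * de)).
  by rewrite !le_max !lexx orbT ge_max lerDl lerDr (ltW h0) mulr_ge0// ltW.
have mA : measurable A.
  apply: measurableI; last exact: measurable_lat_ge.
  apply: measurableI; first exact: measurable_shell1.
  have mf : measT (fun p : Rm * int => p.1) by mea.
  by have := mf measurableT _ mI; rewrite setTI.
have meta : measT (fun p : Rm * int => eta p.2).
  by apply: measurable_lat_shift; mea.
pose A1 := A `&` [set p | s - eta p.2 ^+ 2 <= M].
pose A2 := A `&` [set p | M <= s - eta p.2 ^+ 2].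
have mA1 : measurable A1.
  by apply: measurableI => //; apply: measurable_set_le; mea.
have mA2 : measurable A2.
  apply: measurableI => //.
  by apply: (measurable_set_le (f := fun=> M) (g := fun p : Rm * int => s - eta p.2 ^+ 2)); mea.
have -> : 6 * w / lam + 6 * w * de / r + 24 * de * Num.sqrt (2 * S) / r =
   w * (2 / lam + 4 * ((h + 3 * de) / 2) / r) + 24 * de * Num.sqrt (2 * S) / r.
  by rewrite hE; field; rewrite !gt_eqF.
have sl k : (leb [set x | A (x, k)] <= w%:E)%E.
  apply: (measure_le_sub _ _ _ (Iw (s - eta k ^+ 2))) => //.
  - exact: (measurable_sec2 k mA).
  - by apply: measurableI => //; exact: measurable_shell.
  - by move=> x [[/shell1_slice ? ?] _].
apply: (@measure_le_union _ _ _ _ _ A1 A2) => //.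
- by move=> p Ap; have [hM|hM] := leP (s - eta p.2 ^+ 2) M; [left|right; split => //=; exact: ltW].
(* Nonnegativity of [(x - b1) ^+ 2] gives the upper end [s + de] for [eta k ^+ 2], the case
   hypothesis the lower end [s - M]; the midpoint of this window is the shifted [s]. *)
- apply: (lattice_shell_count (b := b2) (s := s + (de - M) / 2)) => //.
  + by rewrite divr_ge0// addr_ge0 ?mulr_ge0 ?(ltW h0) ?(ltW de0).
  + move=> x k [[[h1 _] h2] h3]; split => //; rewrite /shell1 /= in h1 h3.
    move: h1; rewrite !ler_distl -/(eta k) => /andP[h1 h1'].
    have := sqr_ge0 (x - b1); rewrite -/(eta k) in h3 * => h4.
    by apply/andP; split; lra.
  + move=> k; apply: (measure_le_sub _ _ _ (sl k)); last by move=> x [].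
      exact: (measurable_sec2 k mA1).
    exact: (measurable_sec2 k mA).
(* Each [k] receives the interval of [x >= 0] whose square lies in the window of length [h / 2]
   below [s - eta k ^+ 2]. On each side of [b2] these intervals are disjoint, and all of them lie in
   [[0, q]]. *)
pose B := [set p : Rm * int | [/\ 0 <= p.1, r <= `|eta p.2|,
   M <= s - eta p.2 ^+ 2, s - eta p.2 ^+ 2 <= 2 * S &
   (s - eta p.2 ^+ 2 - h / 2 <= p.1 ^+ 2) && (p.1 ^+ 2 <= s - eta p.2 ^+ 2)]].
have mB : measurable B.
  have -> : B = [set p : Rm * int | 0 <= p.1] `&` [set p : Rm * int | r <= `|eta p.2|] `&`
     [set p : Rm * int | M <= s - eta p.2 ^+ 2] `&` [set p : Rm * int | s - eta p.2 ^+ 2 <= 2 * S] `&`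
     [set p : Rm * int | s - eta p.2 ^+ 2 - h / 2 <= p.1 ^+ 2] `&`
     [set p : Rm * int | p.1 ^+ 2 <= s - eta p.2 ^+ 2].
    apply/seteqP; split => p /=.
      by move=> [? ? ? ? /andP[? ?]].
    by move=> [[[[[? ?] ?] ?] ?] ?]; split => //; apply/andP.
  repeat apply: measurableI.
  - by apply: (measurable_set_le (f := fun=> 0) (g := fun p : Rm * int => p.1)); mea.
  - apply: (measurable_set_le (f := fun=> r) (g := fun p : Rm * int => `|eta p.2|)); first mea.
    exact: measurable_normr.
  - by apply: (measurable_set_le (f := fun=> M) (g := fun p : Rm * int => s - eta p.2 ^+ 2)); mea.
  - by apply: (measurable_set_le (g := fun=> 2 * S) (f := fun p : Rm * int => s - eta p.2 ^+ 2)); mea.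
  - by apply: (measurable_set_le (f := fun p : Rm * int => s - eta p.2 ^+ 2 - h / 2) (g := fun p : Rm * int => p.1 ^+ 2)); mea.
  - by apply: (measurable_set_le (g := fun p : Rm * int => s - eta p.2 ^+ 2) (f := fun p : Rm * int => p.1 ^+ 2)); mea.
pose q := Num.sqrt (2 * S).
have q0 : 0 <= q by exact: sqrtr_ge0.
have q2 : q ^+ 2 = 2 * S by rewrite sqr_sqrtr// mulr_ge0.
have Bm : (prod_measure leb (lattice lam) B <= (2 * lam^-1 * q)%:E)%E.
  apply: (@prod_le_sec1 _ _ _ _ _ leb (lattice lam) B `[0, q]%classic) => //.
  - move=> x k [h1 _ _ h2 /andP[_ h3]] /=; rewrite in_itv /= h1 /=.
    by rewrite -(@ler_pXn2r _ 2)// ?nnegrE// q2; exact: le_trans h3 h2.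
  - move=> x _.
    (* At a given [x], two indices on one side would have squares within [h / 2], closer than the
       gap [h]; hence at most one index per side. *)
    have sep (k l : int) (sg : R) : sg ^+ 2 = 1 -> r <= sg * eta k -> r <= sg * eta l ->
        B (x, k) -> B (x, l) -> `|k%:~R - l%:~R : R| <= 0.
      move=> sg2 hk hl [_ _ _ _ /andP[k1 k2]] [_ _ _ _ /andP[l1 l2]].
      have [->|kl] := eqVneq k l; first by rewrite subrr normr0.
      exfalso.
      have d1 : 1 <= `|k%:~R - l%:~R : R|.
        exact: int_dist_ge1.
      have e1 : `|eta k ^+ 2 - eta l ^+ 2| <= h / 2 by rewrite ler_norml; apply/andP; split; lra.
      have e2 : eta k ^+ 2 - eta l ^+ 2 = (sg * eta k + sg * eta l) * (sg * (eta k - eta l)).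
        have -> : (sg * eta k + sg * eta l) * (sg * (eta k - eta l)) = sg ^+ 2 * (eta k ^+ 2 - eta l ^+ 2) by ring.
        by rewrite sg2 mul1r.
      have sg1 : `|sg| = 1.
        have : `|sg| ^+ 2 = 1 by rewrite real_normK ?num_real.
        by move/eqP; rewrite sqrf_eq1 => /orP[/eqP //|/eqP e]; have := normr_ge0 sg; rewrite e; lra.
      have e3 : `|eta k - eta l| = `|k%:~R - l%:~R : R| / lam.
        rewrite (_ : eta k - eta l = (k%:~R - l%:~R) / lam); last by rewrite /eta; field; rewrite gt_eqF.
        by rewrite normrM [`|lam^-1|]ger0_norm// invr_ge0 ltW.
      move: e1; rewrite e2 !normrM sg1 mul1r e3 (ger0_norm (x := _ + _)); last lra.
      apply/negP; rewrite -ltNge.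
      apply: (@lt_le_trans _ _ (2 * r * (1 / lam))); first by rewrite hE; have := divr_gt0 r0 l0; lra.
      apply: ler_pM => //; first lra; first by rewrite divr_ge0// ltW.
        lra.
      by rewrite ler_pM2r ?invr_gt0.
    have -> : 2 * lam^-1 = lam^-1 * (2 * 0 + 1) + lam^-1 * (2 * 0 + 1) by ring.
    apply: (@measure_le_union _ _ _ _ _ ([set k | B (x, k)] `&` [set k | r <= 1 * eta k])
      ([set k | B (x, k)] `&` [set k | r <= (-1) * eta k])) => //.
    + move=> k Bk; have [_ hk _ _ _] := Bk; rewrite /= in hk.
      have [hh|hh] := leP 0 (eta k); [left|right]; split => //=.
        by rewrite mul1r -(ger0_norm hh).
      by rewrite mulN1r -(ler0_norm (ltW hh)).
    + by apply: diam_lattice => // k l [? ?] [? ?]; apply: (sep k l 1) => //; rewrite expr1n.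
    + by apply: diam_lattice => // k l [? ?] [? ?]; apply: (sep k l (-1)) => //; rewrite sqrrN expr1n.
  - by rewrite mulr_ge0// invr_ge0 ltW.
  - by apply: itv_leb_le => //; rewrite subr0.
rewrite -[X in (X <= _)%E]/(prod_measure leb (lattice lam) A2) prod_sec2//.
(* The slice at [k] has length at most [4 * de / ka], of order [de / sg], and its interval
   [[rho, sg]] has length at least [h / (4 * sg)]: their ratio is of order [de / h], uniformly in
   [k], and the disjoint intervals do the summation. *)
apply: (@le_trans _ _ (\int[lattice lam]_k ((24 * de / h)%:E * leb [set x | B (x, k)]))%E); last first.
  rewrite ge0_integralZl//; last by rewrite lee_fin divr_ge0 ?mulr_ge0// ltW.
  rewrite -prod_sec2//.
  apply: (@le_trans _ _ ((24 * de / h)%:E * (2 * lam^-1 * q)%:E)%E).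
    by apply: lee_wpmul2l => //; rewrite lee_fin divr_ge0 ?mulr_ge0// ltW.
  rewrite -EFinM lee_fin.
  have -> : 24 * de / h * (2 * lam^-1 * q) = 24 * de * q / r by rewrite hE; field; rewrite !gt_eqF.
  exact: lexx.
apply: ge0_le_integral => // k _.
have mB' : measurable [set x : Rm | B (x, k)] by exact: (measurable_sec2 k mB).
have mA2' : measurable [set x : Rm | A2 (x, k)] by exact: (measurable_sec2 k mA2).
have [e0|/set0P[x0 [[[hx hI] hr] hM]]] := eqVneq [set x | A2 (x, k)] set0.
  by rewrite e0 measure0 mule_ge0// lee_fin divr_ge0 ?mulr_ge0// ltW.
rewrite /= in hI hr hM.
set t := s - eta k ^+ 2 in hM.
have t2S : t <= 2 * S.
  have := IS _ hI; move: hx; rewrite /shell1 /= ler_distl -/(eta k) => /andP[h1 h2].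
  by rewrite /t in hM *; lra.
have t0 : 0 < t by lra.
pose sg := Num.sqrt t; pose rho := Num.sqrt (t - h / 2); pose ka := Num.sqrt (t / 2).
have sg0 : 0 < sg by rewrite sqrtr_gt0.
have sg2 : sg ^+ 2 = t by rewrite sqr_sqrtr// ltW.
have rho0 : 0 <= rho by exact: sqrtr_ge0.
have rho2 : rho ^+ 2 = t - h / 2 by rewrite sqr_sqrtr//; lra.
have ka0 : 0 < ka by rewrite sqrtr_gt0; lra.
have ka2 : ka ^+ 2 = t / 2 by rewrite sqr_sqrtr//; lra.
have rs : rho <= sg by rewrite -(@ler_pXn2r _ 2)// ?nnegrE ?(ltW sg0)// rho2 sg2; lra.
have hs : h <= (sg - rho) * (4 * sg).
  have : (sg - rho) * (sg + rho) = h / 2 by rewrite -subr_sqr sg2 rho2; ring.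
  have : (sg - rho) * (sg + rho) <= (sg - rho) * (2 * sg) by apply: ler_wpM2l; lra.
  lra.
have sk : 2 * sg <= 3 * ka.
  by rewrite -(@ler_pXn2r _ 2)// ?nnegrE ?mulr_ge0 ?(ltW sg0) ?(ltW ka0)// !exprMn sg2 ka2; lra.
apply: (@le_trans _ _ (4 * de / ka)%:E).
  apply: (measure_le_sub _ _ _ (annulus1d b1 t ka0 (ltW de0))) => //.
    apply: measurableI; last exact: measurable_shell.
    apply: (measurable_set_le (f := fun=> ka) (g := fun x : Rm => `|x - b1|)); first mea.
    by apply: measurable_normr; mea.
  move=> x [[[/shell1_slice h1 _] _] _]; split => //=.
  apply: sqr_ge_norm; first exact: ltW.
  by move: h1; rewrite /shell /= ler_distl -/(eta k) -/t ka2 => /andP[h1 h2]; lra.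
apply: (@le_trans _ _ ((24 * de / h)%:E * leb `[rho, sg]%classic)%E).
  rewrite (_ : leb _ = (sg - rho)%:E); last exact: itv_leb.
  rewrite -EFinM lee_fin.
  have -> : 4 * de / ka = 4 * de * (h * sg) / (ka * h * sg) by field; rewrite !gt_eqF.
  have -> : 24 * de / h * (sg - rho) = 24 * de * (sg - rho) * (ka * sg) / (ka * h * sg).
    by field; rewrite !gt_eqF.
  rewrite ler_pM2r ?invr_gt0 ?mulr_gt0//.
  have : de * sg * h <= de * sg * ((sg - rho) * (4 * sg)) by rewrite ler_pM2l// mulr_gt0.
  have : (de * sg * (sg - rho)) * (2 * sg) <= (de * sg * (sg - rho)) * (3 * ka).
    by apply: ler_wpM2l => //; rewrite !mulr_ge0 ?subr_ge0// ltW.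
  lra.
apply: lee_wpmul2l; first by rewrite lee_fin divr_ge0 ?mulr_ge0// ltW.
apply: le_measure; rewrite ?inE//.
move=> x; rewrite /= in_itv /= => /andP[h1 h2]; split => //=.
- exact: le_trans h1.
- rewrite -/(eta k) -/t -rho2 -sg2.
  have x0' : 0 <= (x : R) by exact: le_trans h1.
  rewrite (@ler_pXn2r R 2)// ?nnegrE// h1 /= (@ler_pXn2r R 2)// ?nnegrE//.
  exact: ltW.
Qed.

End fixed.
End shell_line.

(** * The resonant set for one continuous and one lattice coordinate *)

Section set_bound_11.
Context (R : realType).
Local Notation leb := (lebesgue R).
Local Notation Rm := (measurableTypeR R).

Lemma lattice_band (lam b r : R) : 0 < lam -> 0 <= r ->
  (lattice lam [set k | (`|k%:~R / lam - b| <= r)%R] <= (4 * r + lam^-1)%:E)%E.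
Proof.
move=> l0 r0; have -> : 4 * r + lam^-1 = lam^-1 * (2 * (2 * r * lam) + 1).
  by field; rewrite gt_eqF.
apply: diam_lattice => //; first by rewrite !mulr_ge0// ltW.
move=> k l /= hk hl.
have -> : k%:~R - l%:~R = (k%:~R / lam - l%:~R / lam) * lam :> R by field; rewrite gt_eqF.
rewrite normrM (gtr0_norm l0) ler_pM2r//.
have -> : k%:~R / lam - l%:~R / lam = (k%:~R / lam - b) - (l%:~R / lam - b) :> R by ring.
by apply: (le_trans (ler_normB _ _)); lra.
Qed.

(** [a - b] is half the difference between [a], of size at most [N1 / 8], and [2 * b - a], of size
    at least [N1 / 2]. *)
Lemma far_center (N1 N2 a b : R) : 16 * N2 < N1 -> `|a| <= 2 * N2 ->
  N1 / 2 <= `|2 * b - a| -> N1 / 8 <= `|a - b|.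
Proof.
move=> h k1 k2; have -> : a - b = (a - (2 * b - a)) / 2 by field.
have := lerB_dist (2 * b - a) a; rewrite normrM [`|2^-1|]ger0_norm// [`|a - (_ - _)|]distrC.
have := normr_ge0 a; lra.
Qed.

Lemma sqrt_le_of_sqr (x y : R) : 0 <= y -> x <= y ^+ 2 -> Num.sqrt x <= y.
Proof. by move=> y0 h; rewrite -(ger0_norm y0) -sqrtr_sqr ler_wsqrtr. Qed.

Section fixed.
Variables (lam b1 b2 s de : R).
Hypotheses (l1 : 1 <= lam) (de1 : 1 <= de).
Let l0 : 0 < lam. Proof. exact: lt_le_trans ltr01 l1. Qed.
Let de0 : 0 < de. Proof. exact: lt_le_trans ltr01 de1. Qed.
(** Here thickness at least 1 enters: it absorbs the square root that [shell_sqrt] produces, and it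
    is the source of the restriction to unit time. *)
Let sd : Num.sqrt de <= de. Proof. by apply: sqrt_le_of_sqr; [exact: ltW|rewrite expr2 ler_peMr// ltW]. Qed.
Let li : lam^-1 <= 1. Proof. by rewrite invf_le1. Qed.

Lemma measurable_cont_ge (r : R) : measurable [set p : Rm * int | r <= `|p.1 - b1|].
Proof.
apply: (measurable_set_le (f := fun=> r) (g := fun p : Rm * int => `|p.1 - b1|)); first mea.
by apply: measurable_normr; mea.
Qed.

Lemma measurable_shell1_cont (r : R) (E : set int) :
  measurable (shell1 lam b1 b2 s de `&` [set p | (r <= `|p.1 - b1|)%R] `&` [set p | E p.2]).
Proof.
apply: measurableI.
  by apply: measurableI; [exact: measurable_shell1|exact: measurable_cont_ge].
have mf : measT (fun p : Rm * int => p.2) by mea.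
by have := mf measurableT E I; rewrite setTI.
Qed.

Lemma measurable_shell1_lat (r : R) (I : set Rm) : measurable I ->
  measurable (shell1 lam b1 b2 s de `&` [set p | I p.1] `&` [set p | (r <= `|p.2%:~R / lam - b2|)%R]).
Proof.
move=> mI; apply: measurableI; last exact: measurable_lat_ge.
apply: measurableI; first exact: measurable_shell1.
have mf : measT (fun p : Rm * int => p.1) by mea.
by have := mf measurableT I mI; rewrite setTI.
Qed.

Lemma shell1_cont (r : R) (E : set int) (e : R) : 0 < r -> (lattice lam E <= e%:E)%E ->
  (prod_measure leb (lattice lam) (shell1 lam b1 b2 s de `&` [set p | (r <= `|p.1 - b1|)%R]
     `&` [set p | E p.2]) <= (4 * de / r * e)%:E)%E.
Proof.
move=> r0 Ee.
have mA := measurable_shell1_cont r E.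
apply: (@prod_le_sec2 _ _ _ _ _ leb (lattice lam) _ E) => //.
- by move=> x k [].
- move=> k _; apply: (measure_le_sub _ _ _ (annulus1d b1 (s - (k%:~R / lam - b2) ^+ 2) r0 (ltW de0))).
  + exact: (measurable_sec2 k mA).
  + apply: measurableI; last exact: measurable_shell.
    apply: (measurable_set_le (f := fun=> r) (g := fun x : Rm => `|x - b1|)); first mea.
    by apply: measurable_normr; mea.
  + by move=> x [[/shell1_slice h1 h2] _]; split.
- by rewrite divr_ge0 ?mulr_ge0// ltW.
Qed.

(** Serves when [N1] and [N2] are comparable, so no coordinate is known to be far from the centre.
    If [s >= 2 * de], one coordinate is at least half the radius [q]; [shell1_cont] or
    [shell_lattice1] applies with [r = q / 2], and all powers of [q] cancel. Otherwise the set lies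
    in a rectangle. *)
Lemma shell1_le : (prod_measure leb (lattice lam) (shell1 lam b1 b2 s de) <= (256 * de)%:E)%E.
Proof.
move: (l1) (de1) (l0) (de0) (sd) (li) => l1' de1' l0' de0' sd' li'.
have mS := @measurable_shell1 R lam b1 b2 s de.
have [hs|hs] := ltP s (2 * de).
  pose q := Num.sqrt (3 * de).
  have q0 : 0 <= q by exact: sqrtr_ge0.
  have q2 : q ^+ 2 = 3 * de by rewrite sqr_sqrtr//; lra.
  have qd : q <= 2 * de.
    apply: sqrt_le_of_sqr; first lra.
    by have := ler_wpM2l (ltW de0) de1; rewrite exprMn !expr2; lra.
  have sub p : shell1 lam b1 b2 s de p -> `|p.1 - b1| <= q /\ `|p.2%:~R / lam - b2| <= q.
    rewrite /shell1 /= ler_distl => /andP[_ h].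
    have h1 := sqr_ge0 (p.1 - b1); have h2 := sqr_ge0 (p.2%:~R / lam - b2).
    by split; apply: sqr_le_norm => //; rewrite q2; lra.
  apply: (@le_trans _ _ (2 * q * (4 * q + lam^-1))%:E); last first.
    rewrite lee_fin.
    have := ler_wpM2l (mulr_ge0 (ler0n R 2) q0) li; move: q2; rewrite expr2; lra.
  apply: (@prod_le_sec2 _ _ _ _ _ leb (lattice lam) _ [set k | (`|k%:~R / lam - b2| <= q)%R]) => //.
  - by move=> x k /sub[].
  - move=> k _; apply: (measure_le_sub _ _ _ (band_le b1 q0)) => //.
    + exact: (measurable_sec2 k mS).
    + exact: measurable_band.
    + by move=> x /sub[].
  - by rewrite mulr_ge0.
  - exact: lattice_band.
pose q := Num.sqrt s.
have s0 : 0 < s by lra.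
have q0 : 0 < q by rewrite sqrtr_gt0.
have q2 : q ^+ 2 = s by rewrite sqr_sqrtr// ltW.
have q1 : 1 <= q by rewrite -(@ler_pXn2r _ 2)// ?nnegrE ?(ltW q0)// q2 expr1n; lra.
have qd : Num.sqrt de <= q by rewrite ler_wsqrtr//; lra.
have r0 : 0 < q / 2 by lra.
have r2 : (q / 2) ^+ 2 = s / 4 by rewrite exprMn q2; field.
pose w := 4 * Num.sqrt de.
have w0 : 0 <= w by rewrite mulr_ge0 ?sqrtr_ge0.
pose I := [set x : Rm | `|x - b1| <= 3 / 2 * q].
have mI : measurable I by exact: (measurable_band b1 (3 / 2 * q)).
have S0 : 0 <= (3 / 2 * q) ^+ 2 by exact: sqr_ge0.
have IS x : I x -> (x - b1) ^+ 2 <= (3 / 2 * q) ^+ 2.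
  by move=> h; rewrite -[(x - b1) ^+ 2]real_normK ?num_real// ler_pXn2r ?nnegrE//; lra.
have Iw z : (leb (I `&` shell b1 z de) <= w%:E)%E.
  apply: (measure_le_sub _ _ _ (shell_sqrt b1 z de0)) => //.
    by apply: measurableI => //; exact: measurable_shell.
  exact: measurable_shell.
have sub p : shell1 lam b1 b2 s de p -> [/\ `|p.1 - b1| <= 3 / 2 * q,
    `|p.2%:~R / lam - b2| <= 3 / 2 * q & q / 2 <= `|p.1 - b1| \/ q / 2 <= `|p.2%:~R / lam - b2|].
  rewrite /shell1 /= ler_distl => /andP[h h'].
  have h1 := sqr_ge0 (p.1 - b1); have h2 := sqr_ge0 (p.2%:~R / lam - b2).
  have q9 : (3 / 2 * q) ^+ 2 = 9 / 4 * s by rewrite exprMn q2; field.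
  split; [apply: sqr_le_norm; rewrite ?q9; lra|apply: sqr_le_norm; rewrite ?q9; lra|].
  have [hh|hh] := leP (s / 4) ((p.1 - b1) ^+ 2); [left|right]; apply: sqr_ge_norm; rewrite ?r2; lra.
have B1 := shell1_cont r0 (lattice_band b2 l0 (_ : 0 <= 3 / 2 * q)).
have B2 := shell_lattice1 b2 s l0 de0 r0 S0 w0 mI IS Iw.
apply: (@le_trans _ _ (4 * de / (q / 2) * (4 * (3 / 2 * q) + lam^-1) + (6 * w / lam + 6 * w * de / (q / 2) +
   24 * de * Num.sqrt (2 * (3 / 2 * q) ^+ 2) / (q / 2)))%:E).
  apply: (measure_le_union _ _ _ _ (B1 _) B2) => //.
  + exact: measurable_shell1_cont.
  + exact: measurable_shell1_lat.
  + move=> p Ap; have [? ? [?|?]] := sub _ Ap; [by left|by right].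
  + lra.
have e1 : 4 * de / (q / 2) * (4 * (3 / 2 * q) + lam^-1) <= 56 * de.
  have -> : 4 * de / (q / 2) * (4 * (3 / 2 * q) + lam^-1) = 48 * de + 8 * de * (lam^-1 / q).
    by field; rewrite !gt_eqF.
  have : lam^-1 / q <= 1 by rewrite ler_pdivrMr// mul1r (le_trans li).
  move=> h; have := ler_wpM2l (ltW de0) h; lra.
have e2 : 6 * w / lam <= 24 * de.
  have := ler_wpM2l w0 li; rewrite /w; lra.
have e3 : 6 * w * de / (q / 2) <= 48 * de.
  rewrite ler_pdivrMr// /w; have := ler_wpM2l (ltW de0) qd; lra.
have e4 : 24 * de * Num.sqrt (2 * (3 / 2 * q) ^+ 2) / (q / 2) <= 120 * de.
  have h : Num.sqrt (2 * (3 / 2 * q) ^+ 2) <= 5 / 2 * q.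
    by apply: sqrt_le_of_sqr; [lra|rewrite !exprMn q2 !expr2; lra].
  rewrite ler_pdivrMr//; have := ler_wpM2l (ltW de0) h; lra.
rewrite lee_fin; lra.
Qed.

(* The frequencies of the second factor, those of the first being [2 b - xi]. *)
Definition freq_set11 (N1 N2 : R) : set (Rm * int) :=
  [set p | [/\ `|p.1| <= 2 * N2, `|p.2%:~R / lam| <= 2 * N2,
     (N1 / 2 <= `|2 * b1 - p.1|) || (N1 / 2 <= `|2 * b2 - p.2%:~R / lam|) &
     `|(p.1 - b1) ^+ 2 + (p.2%:~R / lam - b2) ^+ 2 - s| <= de]].

(** If [N1 <= 16 * N2] the right side dominates [de] and the whole shell is small enough. Otherwise
    [far_center] puts one coordinate at distance [N1 / 8] from its centre. A far continuous
    coordinate is direct; a far lattice coordinate splits according to whether the continuous centre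
    [b1] is outside or near the band of size [N2]. *)
Lemma set_bound_11 (N1 N2 : R) : 1 <= N2 -> N2 <= N1 -> measurable (freq_set11 N1 N2) ->
  (prod_measure leb (lattice lam) (freq_set11 N1 N2) <= (4096 * de * (lam^-1 + N2 / N1))%:E)%E.
Proof.
move: (l1) (de1) (l0) (de0) (sd) (li) => l1' de1' l0' de0' sd' li'.
move=> h2 h21 mF.
have N20 : 0 < N2 by lra.
have N10 : 0 < N1 by lra.
have il : 0 < lam^-1 by rewrite invr_gt0.
have mS := @measurable_shell1 R lam b1 b2 s de.
have [h|h] := leP N1 (16 * N2).
  apply: (measure_le_sub (B := shell1 lam b1 b2 s de)) => //; first by move=> p [].
  apply: (le_trans shell1_le); rewrite lee_fin.
  have h3 : 1 / 16 <= N2 / N1 by rewrite ler_pdivlMr//; lra.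
  have := ler_wpM2l (ltW de0) (_ : 1 / 16 <= lam^-1 + N2 / N1); lra.
have r0 : 0 < N1 / 8 by lra.
have B1 := shell1_cont r0 (lattice_band 0 l0 (_ : 0 <= 2 * N2)).
have mB1 : measurable (shell1 lam b1 b2 s de `&` [set p | (N1 / 8 <= `|p.1 - b1|)%R]
     `&` [set p | (`|p.2%:~R / lam - 0| <= 2 * N2)%R]) by exact: (measurable_shell1_cont (N1 / 8) [set k | (`|k%:~R / lam - 0| <= 2 * N2)%R]).
have sub p : freq_set11 N1 N2 p -> N1 / 8 <= `|p.1 - b1| \/ N1 / 8 <= `|p.2%:~R / lam - b2|.
  by move=> [k1 k2 /orP[k3|k3] _]; [left|right]; apply: (@far_center N1 N2).
have e1 : 4 * de / (N1 / 8) * (4 * (2 * N2) + lam^-1) <= 288 * de * (N2 / N1).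
  have -> : 4 * de / (N1 / 8) * (4 * (2 * N2) + lam^-1) = 256 * de * (N2 / N1) + 32 * de * (lam^-1 / N1).
    by field; rewrite !gt_eqF.
  have : lam^-1 / N1 <= N2 / N1 by rewrite ler_pM2r ?invr_gt0// (le_trans li).
  move=> k; have := ler_wpM2l (ltW de0) k; lra.
have p1 : 0 <= de * lam^-1 by rewrite mulr_ge0// ltW.
have p2 : 0 <= de * (N2 / N1) by rewrite mulr_ge0 ?divr_ge0// ltW.
have [hb|hb] := leP (4 * N2) `|b1|.
  have B2 := shell_lattice1_far b2 s l0 de0 N20 r0 hb.
  apply: (@le_trans _ _ (4 * de / (N1 / 8) * (4 * (2 * N2) + lam^-1) +
     (200 * de * (lam^-1 / N2 + N2 / (N1 / 8))))%:E).
    apply: (measure_le_union _ _ _ _ (B1 _) B2) => //.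
    + apply: (measurable_shell1_lat (N1 / 8) (_ : measurable [set x : Rm | `|x| <= 2 * N2])).
      by apply: measurable_set_le; [apply: measurable_normr|]; mea.
    + by move=> p Ap; have [k1 k2 _ k4] := Ap; have [k|k] := sub _ Ap; [left|right]; split => //=; rewrite subr0.
    + lra.
  rewrite lee_fin.
  have i1 : lam^-1 / N2 <= lam^-1 by rewrite ler_pdivrMr// ler_peMr// ltW.
  have := ler_wpM2l (ltW de0) i1.
  have -> : N2 / (N1 / 8) = 8 * (N2 / N1) by field; rewrite gt_eqF.
  lra.
pose I := band 0 (2 * N2) : set Rm.
have mI : measurable I by exact: (measurable_band 0 (2 * N2)).
have S0 : 0 <= (6 * N2) ^+ 2 by exact: sqr_ge0.
have IS x : I x -> (x - b1) ^+ 2 <= (6 * N2) ^+ 2.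
  rewrite /I /band /= subr0 => k; rewrite -[(x - b1) ^+ 2]real_normK ?num_real// ler_pXn2r ?nnegrE//; last lra.
  by apply: (le_trans (ler_normB _ _)); lra.
(* Both slice bounds are used: the square root for the term with [1 / lam], the width of the band
   for the term with [1 / N1]. *)
pose w := Num.min (4 * Num.sqrt de) (4 * N2).
have w0 : 0 <= w by rewrite le_min mulr_ge0 ?sqrtr_ge0//=; lra.
have w1 : w <= 4 * de by apply: (@le_trans _ _ (4 * Num.sqrt de)); [rewrite ge_min lexx|lra].
have w2 : w <= 4 * N2 by rewrite ge_min lexx orbT.
have Iw z : (leb (I `&` shell b1 z de) <= w%:E)%E.
  have mIs : measurable (I `&` shell b1 z de) by apply: measurableI => //; exact: measurable_shell.
  rewrite /w /Num.min; case: ifP => _.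
    by apply: (measure_le_sub _ _ _ (shell_sqrt b1 z de0)) => //; exact: measurable_shell.
  rewrite (_ : 4 * N2 = 2 * (2 * N2)); last ring.
  by apply: (measure_le_sub _ _ _ (band_le 0 (_ : 0 <= 2 * N2))) => //; lra.
have B2 := shell_lattice1 b2 s l0 de0 r0 S0 w0 mI IS Iw.
apply: (@le_trans _ _ (4 * de / (N1 / 8) * (4 * (2 * N2) + lam^-1) +
   (6 * w / lam + 6 * w * de / (N1 / 8) + 24 * de * Num.sqrt (2 * (6 * N2) ^+ 2) / (N1 / 8)))%:E).
  apply: (measure_le_union _ _ _ _ (B1 _) B2) => //.
  + exact: measurable_shell1_lat.
  + by move=> p Ap; have [k1 k2 _ k4] := Ap; have [k|k] := sub _ Ap; [left|right]; split => //=; rewrite /I/band/= subr0.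
  + lra.
rewrite lee_fin.
have e2 : 6 * w / lam <= 24 * (de * lam^-1) by have := ler_wpM2r (ltW il) w1; lra.
have e3 : 6 * w * de / (N1 / 8) <= 192 * (de * (N2 / N1)).
  have -> : 6 * w * de / (N1 / 8) = 48 * ((de / N1) * w) by field; rewrite gt_eqF.
  have -> : de * (N2 / N1) = de / N1 * N2 by ring.
  have := ler_wpM2l (divr_ge0 (ltW de0) (ltW N10)) w2; lra.
have e4 : 24 * de * Num.sqrt (2 * (6 * N2) ^+ 2) / (N1 / 8) <= 1728 * (de * (N2 / N1)).
  have k : Num.sqrt (2 * (6 * N2) ^+ 2) <= 9 * N2.
    by apply: sqrt_le_of_sqr; [lra|rewrite !exprMn; have := sqr_ge0 N2; lra].
  have -> : 24 * de * Num.sqrt (2 * (6 * N2) ^+ 2) / (N1 / 8) = 192 * ((de / N1) * Num.sqrt (2 * (6 * N2) ^+ 2)).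
    by field; rewrite gt_eqF.
  have -> : de * (N2 / N1) = de / N1 * N2 by ring.
  have := ler_wpM2l (divr_ge0 (ltW de0) (ltW N10)) k; lra.
lra.
Qed.

End fixed.
End set_bound_11.

(** * Freezing coordinates in higher dimension *)

Section first_two.
Context (R : realType).
Local Notation leb := (lebesgue R).
Local Notation Rm := (measurableTypeR R).

Lemma measurable_all (I : finType) d (T : measurableType d) (B : I -> set T) :
  (forall i, measurable (B i)) -> measurable [set x | forall i, B i x].
Proof.
move=> mB; have -> : [set x | forall i, B i x] = \bigcap_(i in [set: I]) B i.
  by apply/seteqP; split => [x h i _|x h i]; exact: h.
by apply: fin_bigcap_measurable => //; exact: finite_finset.
Qed.

Lemma measurable_power_box d (T : measurableType d) n (I : set T) : measurable I ->
  measurable [set t : n.-tuple T | forall i, I (tnth t i)].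
Proof.
move=> mI; apply: (@measurable_all _ _ _ (fun i => [set t : n.-tuple T | I (tnth t i)])) => i.
by have := measurable_tnth i measurableT mI; rewrite setTI.
Qed.

(** Keeps the first two continuous coordinates together with [W] and freezes the other continuous
    ones, each at the cost of [e], so that the planar bounds carry over to every [m >= 2]. *)
Lemma first_two_le d (W : measurableType d) (om : {sigma_finite_measure set W -> \bar R}) (m : nat)
    (B : set (m.+2.-tuple Rm * W)) (I : set Rm) (c e : R) : measurable B -> measurable I ->
  (leb I <= e%:E)%E -> 0 <= e -> 0 <= c -> (forall t w, B (t, w) -> forall i, I (tnth t i)) ->
  (forall t : m.-tuple Rm, prod_measure (prod_measure leb leb) om
     [set p | B (Defs.cons_tuple (p.1.1, Defs.cons_tuple (p.1.2, t)), p.2)] <= c%:E)%E ->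
  (prod_measure (power_measure leb m.+2) om B <= (c * e ^+ m)%:E)%E.
Proof.
move=> mB mI Ie e0 c0 BI Bc.
rewrite prod_sec1//.
have mh := measurable_secfun1 om mB.
have mh2 : measT (fun p : m.+1.-tuple Rm * Rm => om [set w | B (Defs.cons_tuple (p.2, p.1), w)]).
  apply: (measurableT_comp mh); apply: (measurableT_comp (@measurable_cons_tuple _ _ _)); mea.
rewrite cons_tonelli2//.
rewrite cons_tonelli2//; last 2 first.
- exact: (@measurable_param_integral _ _ _ _ R leb (fun p : m.+1.-tuple Rm * Rm => om [set w | B (Defs.cons_tuple (p.2, p.1), w)]) mh2).
- by move=> t; exact: integral_ge0.
have sec t : (\int[leb]_x \int[leb]_x0 om [set y | B (Defs.cons_tuple (x0, Defs.cons_tuple (x, t)), y)] =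
  prod_measure (prod_measure leb leb) om
     [set p | B (Defs.cons_tuple (p.1.1, Defs.cons_tuple (p.1.2, t)), p.2)])%E.
  have mf : measT (fun p : (Rm * Rm) * W => (Defs.cons_tuple (p.1.1, Defs.cons_tuple (p.1.2, t)), p.2)).
    apply: measurable_pairT; last by mea.
    apply: (measurableT_comp (@measurable_cons_tuple _ _ _)); apply: measurable_pairT; first by mea.
    by apply: (measurableT_comp (@measurable_cons_tuple _ _ _)); mea.
  have mS : measurable [set p : (Rm * Rm) * W | B (Defs.cons_tuple (p.1.1, Defs.cons_tuple (p.1.2, t)), p.2)].
    by have := mf measurableT _ mB; rewrite setTI.
  rewrite prod_sec1// prod_tonelli2//.
  exact: measurable_secfun1.
apply: (@integral_le_box _ _ _ _ _ [set t | forall i, I (tnth t i)]) => //.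
- rewrite (_ : (fun t => _) = (fun t => \int[leb]_x \int[leb]_x0 om [set y | B (Defs.cons_tuple (x0, Defs.cons_tuple (x, t)), y)])%E)//.
  apply: (@measurable_param_integral _ _ _ _ R leb (fun p : m.-tuple Rm * Rm => \int[leb]_x0 om [set y | B (Defs.cons_tuple (x0, Defs.cons_tuple (p.2, p.1)), y)])%E).
  apply: (@measurable_param_integral _ _ _ _ R leb (fun q : (m.-tuple Rm * Rm) * Rm => om [set y | B (Defs.cons_tuple (q.2, Defs.cons_tuple (q.1.2, q.1.1)), y)])%E).
  apply: (measurableT_comp mh); apply: (measurableT_comp (@measurable_cons_tuple _ _ _)); apply: measurable_pairT; first by mea.
  by apply: (measurableT_comp (@measurable_cons_tuple _ _ _)); mea.
- exact: measurable_power_box.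
- by move=> t; apply: integral_ge0 => x _; exact: integral_ge0.
- by move=> t _; rewrite sec.
- move=> t nI; rewrite sec; rewrite (_ : [set p | _] = set0) ?measure0//.
  apply/seteqP; split => //= p /BI h; apply: nI => i.
  have := h (lift ord0 (lift ord0 i)).
  by rewrite /= !tnthS.
- exact: power_box.
Qed.

Lemma sumS n (f : 'I_n.+1 -> Rm -> R) (x : Rm) (t : n.-tuple Rm) :
  \sum_(i < n.+1) f i (tnth (Defs.cons_tuple (x, t)) i) =
  f ord0 x + \sum_(i < n) f (lift ord0 i) (tnth t i).
Proof. by rewrite big_ord_recl tnth0; congr (_ + _); apply: eq_bigr => i _; rewrite tnthS. Qed.

Lemma measure_le_cover d (T : measurableType d) (mu : {measure set T -> \bar R}) (I : finType)
    (A : set T) (B : I -> set T) (c : R) : measurable A -> (forall i, measurable (B i)) ->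
  (forall x, A x -> exists i, B i x) -> (forall i, mu (B i) <= c%:E)%E -> (mu A <= (#|I|%:R * c)%:E)%E.
Proof.
move=> mA mB AB Bc.
have h (r : seq I) : measurable (\big[setU/set0]_(i <- r) B i) /\
    (mu (\big[setU/set0]_(i <- r) B i) <= ((size r)%:R * c)%:E)%E.
  elim: r => [|i r [h1 h2]]; first by rewrite big_nil measure0 mul0r.
  rewrite big_cons; split; first exact: measurableU.
  rewrite /= -natr1 mulrDl mul1r addrC.
  by apply: (@measure_le_union _ _ _ _ _ (B i) (\big[setU/set0]_(i <- r) B i)) => //; exact: measurableU.
have [h1 h2] := h (enum I); rewrite -cardE in h2.
apply: (measure_le_sub _ _ _ h2) => // x /AB[i Bi].
by rewrite -bigcup_seq; exists i => //=; rewrite mem_enum.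
Qed.

Lemma measurable_some (I : finType) d (T : measurableType d) (B : I -> set T) :
  (forall i, measurable (B i)) -> measurable [set x | exists i, B i x].
Proof.
move=> mB; have -> : [set x | exists i, B i x] = \bigcup_(i in [set: I]) B i.
  by apply/seteqP; split => [x [i h]|x [i _ h]]; exists i.
by apply: fin_bigcup_measurable => //; exact: finite_finset.
Qed.
End first_two.

(** * The resonant set in general dimension *)

Section freq_set.
Context (R : realType) (m n : nat).
Local Notation Rm := (measurableTypeR R).
Local Notation Fq := (frequency R m n).
Variables (lam : R) (b : 'I_m -> R) (c : 'I_n -> R).

Definition quad (xi : Fq) : R := \sum_(i < m) (tnth xi.1 i - b i) ^+ 2 +
  \sum_(j < n) ((tnth xi.2 j)%:~R / lam - c j) ^+ 2.

Definition small_freq (N : R) : set Fq :=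
  [set xi | (forall i, `|tnth xi.1 i| <= 2 * N) /\ (forall j, `|(tnth xi.2 j)%:~R / lam| <= 2 * N)].

(* The sum of two frequencies being [2 (b, c)], the second one is [xi] and the
   first one is of size at least [N / 2] in some coordinate. *)
Definition large_freq (N : R) : set Fq :=
  [set xi | (exists i, N / 2 <= `|2 * b i - tnth xi.1 i|) \/
            (exists j, N / 2 <= `|2 * c j - (tnth xi.2 j)%:~R / lam|)].

Definition freq_set (N1 N2 s de : R) : set Fq :=
  small_freq N2 `&` large_freq N1 `&` [set xi | `|quad xi - s| <= de].

Lemma measurable_lat (j : 'I_n) : measT (fun xi : Fq => (tnth xi.2 j)%:~R / lam).
Proof.
apply: measurable_funM; last exact: measurable_cst.
by apply: (measurableT_comp (@measurable_on_int _ Rm (fun k => k%:~R))); mea.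
Qed.

Lemma measurable_quad : measT quad.
Proof.
apply: measurable_funD; apply: measurable_sum => i; apply: measurable_funX; apply: measurable_funB; try by mea.
exact: measurable_lat.
Qed.

Lemma measurable_small N : measurable (small_freq N).
Proof.
rewrite (_ : small_freq N = [set xi | forall i, `|tnth xi.1 i| <= 2 * N] `&`
   [set xi | forall j, `|(tnth xi.2 j)%:~R / lam| <= 2 * N])//.
apply: measurableI.
  apply: (@measurable_all _ _ _ (fun i => [set xi : Fq | `|tnth xi.1 i| <= 2 * N])) => i.
  by apply: measurable_set_le; [apply: measurable_normr|]; mea.
apply: (@measurable_all _ _ _ (fun j => [set xi : Fq | `|(tnth xi.2 j)%:~R / lam| <= 2 * N])) => i.
by apply: measurable_set_le; [apply: measurable_normr; exact: measurable_lat|]; mea.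
Qed.

Lemma measurable_large N : measurable (large_freq N).
Proof.
rewrite (_ : large_freq N = [set xi | exists i, N / 2 <= `|2 * b i - tnth xi.1 i|] `|`
   [set xi | exists j, N / 2 <= `|2 * c j - (tnth xi.2 j)%:~R / lam|])//.
apply: measurableU.
  apply: (@measurable_some _ _ _ (fun i => [set xi : Fq | N / 2 <= `|2 * b i - tnth xi.1 i|])) => i.
  by apply: measurable_set_le; [mea|apply: measurable_normr; mea].
apply: (@measurable_some _ _ _ (fun j => [set xi : Fq | N / 2 <= `|2 * c j - (tnth xi.2 j)%:~R / lam|])) => i.
apply: measurable_set_le; first mea; apply: measurable_normr; apply: measurable_funB; first mea.
exact: measurable_lat.
Qed.

Lemma measurable_quad_shell s de : measurable [set xi | `|quad xi - s| <= de].
Proof.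
apply: measurable_set_le; last mea; apply: measurable_normr; apply: measurable_funB; last mea.
exact: measurable_quad.
Qed.

Lemma measurable_freq_set N1 N2 s de : measurable (freq_set N1 N2 s de).
Proof.
apply: measurableI; last exact: measurable_quad_shell.
by apply: measurableI; [exact: measurable_small|exact: measurable_large].
Qed.

Lemma quad_upd1 (i : 'I_m) t k x : quad (upd t i x, k) =
  (x - b i) ^+ 2 + (\sum_(i' < m | i' != i) (tnth t i' - b i') ^+ 2 +
    \sum_(j < n) ((tnth k j)%:~R / lam - c j) ^+ 2).
Proof.
rewrite /quad /= (bigD1 i)//= tnth_mktuple eqxx -addrA; congr (_ + (_ + _)).
by apply: eq_bigr => i' /negbTE h; rewrite tnth_mktuple h.
Qed.

Lemma quad_upd2 (j : 'I_n) t k x : quad (t, upd k j x) =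
  \sum_(i < m) (tnth t i - b i) ^+ 2 + (x%:~R / lam - c j) ^+ 2 +
    \sum_(j' < n | j' != j) ((tnth k j')%:~R / lam - c j') ^+ 2.
Proof.
rewrite /quad /= [X in _ + X](bigD1 j)//= tnth_mktuple eqxx -addrA; congr (_ + (_ + _)).
by apply: eq_bigr => i' /negbTE h; rewrite tnth_mktuple h.
Qed.
End freq_set.

Section set_bound.
Context (R : realType) (m n : nat).
Local Notation leb := (lebesgue R).
Local Notation Rm := (measurableTypeR R).
Local Notation Fq := (m.+2.-tuple (measurableTypeR R) * n.+1.-tuple int)%type.
Variables (lam N1 N2 s de : R) (b : 'I_m.+2 -> R) (c : 'I_n.+1 -> R).
Hypotheses (l1 : 1 <= lam) (N21 : 1 <= N2) (N12 : N2 <= N1) (de0 : 0 < de).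
Let l0 : 0 < lam. Proof. exact: lt_le_trans ltr01 l1. Qed.
Let N20 : 0 < N2. Proof. exact: lt_le_trans ltr01 N21. Qed.
Let N10 : 0 < N1. Proof. exact: lt_le_trans N20 N12. Qed.
Let li : lam^-1 <= 1. Proof. by rewrite invf_le1. Qed.
Let band_cont : (leb (band 0 (2 * N2)) <= (9 * N2)%:E)%E.
Proof.
apply: (le_trans (band_le _ _)); first by rewrite mulr_ge0// ltW.
by rewrite lee_fin mulrA ler_pM2r//; lra.
Qed.
Let latI : set int := [set k | (`|k%:~R / lam| <= 2 * N2)%R].
Let band_lat : (lattice lam latI <= (9 * N2)%:E)%E.
Proof.
have h : 0 <= 2 * N2 by rewrite mulr_ge0// ltW.
have := lattice_band 0 l0 h; rewrite /latI.
rewrite (_ : [set k | _] = [set k : int | `|k%:~R / lam| <= 2 * N2]); last first.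
  by apply/seteqP; split => k /=; rewrite subr0.
move=> h'; apply: (le_trans h'); rewrite lee_fin.
move: (li) (N21) => ? ?; lra.
Qed.
Let Q := quad lam b c.
Let S := small_freq lam N2 `&` [set xi : Fq | `|Q xi - s| <= de].
Let mS : measurable S.
Proof. by apply: measurableI; [exact: measurable_small|exact: measurable_quad_shell]. Qed.
Let B := N2 ^+ (m + n) * (lam^-1 + N2 ^+ 2 / N1).
Let N29 : 0 <= 9 * N2. Proof. by rewrite mulr_ge0// ltW. Qed.

Lemma band0 (x : R) : `|x| <= 2 * N2 -> band 0 (2 * N2) x.
Proof. by rewrite /band /= subr0. Qed.

(** For comparable [N1] and [N2]: the planar annulus in the first two coordinates already gives
    linearity in [de], and each of the other [m + n + 1] coordinates ranges over mass [9 * N2]. *)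
Lemma shell_near : (freqm m.+2 n.+1 lam S <= (32 * de * (9 * N2) ^+ n.+1 * (9 * N2) ^+ m)%:E)%E.
Proof.
have c0 : 0 <= 32 * de by rewrite mulr_ge0// ltW.
apply: (first_two_le (I := band 0 (2 * N2))) => //.
- exact: measurable_band.
- by rewrite mulr_ge0// exprn_ge0.
- by move=> t w [[h _] _] i; apply: band0.
move=> t.
have mf : measT (fun p : (Rm * Rm) * n.+1.-tuple int => (Defs.cons_tuple (p.1.1, Defs.cons_tuple (p.1.2, t)), p.2)).
  apply: measurable_pairT; last by mea.
  apply: (measurableT_comp (@measurable_cons_tuple _ _ _)); apply: measurable_pairT; first by mea.
  by apply: (measurableT_comp (@measurable_cons_tuple _ _ _)); mea.
have mA : measurable [set p : (Rm * Rm) * n.+1.-tuple int | S (Defs.cons_tuple (p.1.1, Defs.cons_tuple (p.1.2, t)), p.2)].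
  by have := mf measurableT _ mS; rewrite setTI.
apply: (@prod_le_sec2 _ _ _ _ _ _ _ _ [set k | forall j, latI (tnth k j)]) => //.
- by apply: measurable_power_box.
- by move=> p k [[_ h] _].
- move=> k _.
  pose q := \sum_(i < m) (tnth t i - b (lift ord0 (lift ord0 i))) ^+ 2 +
     \sum_(j < n.+1) ((tnth k j)%:~R / lam - c j) ^+ 2.
  apply: (measure_le_sub _ _ _ (annulus2d (b ord0) (b (lift ord0 ord0)) (s - q) de0)).
  + exact: (measurable_sec2 k mA).
  + apply: measurable_set_le; last mea; apply: measurable_normr; mea.
  + move=> p [_] /=; rewrite /Q /quad /=.
    rewrite (sumS (fun i x => (x - b i) ^+ 2)) (sumS (fun i x => (x - b (lift ord0 i)) ^+ 2)).
    by rewrite (_ : _ + _ - (s - q) = (p.1 - b ord0) ^+ 2 + ((p.2 - b (lift ord0 ord0)) ^+ 2 +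
      \sum_(i < m) (tnth t i - b (lift ord0 (lift ord0 i))) ^+ 2) +
      \sum_(j < n.+1) ((tnth k j)%:~R / lam - c j) ^+ 2 - s)//; rewrite /q; ring.
- exact: power_box.
Qed.

Lemma shell_cont (i : 'I_m.+2) (r : R) : 0 < r ->
  (freqm m.+2 n.+1 lam (S `&` [set xi | (r <= `|tnth xi.1 i - b i|)%R]) <=
   (4 * de / r * (9 * N2) ^+ m.+1 * (9 * N2) ^+ n.+1)%:E)%E.
Proof.
move=> r0.
have c0 : 0 <= 4 * de / r by rewrite divr_ge0 ?mulr_ge0// ltW.
have mA : measurable (S `&` [set xi : Fq | (r <= `|tnth xi.1 i - b i|)%R]).
  apply: measurableI => //.
  by apply: measurable_set_le; [mea|apply: measurable_normr; mea].
apply: (@prod_le_sec2 _ _ _ _ _ _ _ _ [set k | forall j, latI (tnth k j)]) => //.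
- by apply: measurable_power_box.
- by move=> p k [[[_ h] _] _].
- move=> k _.
  have mk : measurable [set t | (S `&` [set xi : Fq | (r <= `|tnth xi.1 i - b i|)%R]) (t, k)].
    exact: (measurable_sec2 k mA).
  rewrite -(setIT [set t | _]) -integral_indic//.
  apply: (@slice_le _ _ _ _ _ i _ (band 0 (2 * N2))) => //.
  + by apply/measurable_EFinP; exact: measurable_indic.
  + exact: measurable_band.
  + move=> t h; rewrite indicE memNset// => -[[[h1 _] _] _]; apply: h => i'.
    exact: band0.
  + move=> t.
    have mu : measurable [set x | (S `&` [set xi : Fq | (r <= `|tnth xi.1 i - b i|)%R]) (upd t i x, k)].
      have mf : measT (fun x : Rm => upd t i x).
        apply/measurable_fun_tnthP => i'.
        rewrite (_ : _ \o _ = fun x : Rm => if i' == i then x else tnth t i').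
          by case: (i' == i); mea.
        by apply/funext => x /=; rewrite tnth_mktuple.
      by have := mf measurableT _ mk; rewrite setTI.
    rewrite (eq_integral (fun x => (\1_[set x | (S `&` [set xi : Fq | (r <= `|tnth xi.1 i - b i|)%R]) (upd t i x, k)] x)%:E)); last first.
      by move=> x _; rewrite !indicE.
    rewrite integral_indic// setIT.
    pose q := \sum_(i' < m.+2 | i' != i) (tnth t i' - b i') ^+ 2 +
      \sum_(j < n.+1) ((tnth k j)%:~R / lam - c j) ^+ 2.
    apply: (measure_le_sub _ _ _ (annulus1d (b i) (s - q) r0 (ltW de0))) => //.
      apply: measurableI; last exact: measurable_shell.
      by apply: (measurable_set_le (f := fun=> r) (g := fun x : Rm => `|x - b i|)); [mea|apply: measurable_normr; mea].
    move=> x [[_ h1] h2]; split; first by move: h2; rewrite /= tnth_mktuple eqxx.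
    move: h1; rewrite /= /Q quad_upd1 /shell /= -/q.
    by rewrite (_ : _ + q - s = (x - b i) ^+ 2 - (s - q))//; ring.
- by rewrite mulr_ge0// exprn_ge0.
- exact: power_box.
Qed.

(** The far lattice coordinate alone would leave a loss for thin shells; grouped with the first two
    continuous coordinates it falls under [shell_lattice2]. The other lattice coordinates are frozen
    first, then the other continuous ones. *)
Lemma shell_latt (j : 'I_n.+1) (r : R) : 0 < r ->
  (freqm m.+2 n.+1 lam (S `&` [set xi | (r <= `|(tnth xi.2 j)%:~R / lam - c j|)%R]) <=
   (8192 * de * (lam^-1 + N2 ^+ 2 / r) * (9 * N2) ^+ m * (9 * N2) ^+ n)%:E)%E.
Proof.
move=> r0.
have c0 : 0 <= 8192 * de * (lam^-1 + N2 ^+ 2 / r).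
  apply: mulr_ge0; first exact: mulr_ge0 (ler0n _ _) (ltW de0).
  by apply: addr_ge0; [rewrite invr_ge0 ltW|rewrite divr_ge0 ?sqr_ge0 ?ltW].
have [K KE] : {K | K = 8192 * de * (lam^-1 + N2 ^+ 2 / r)} by eexists.
have SL b0 b1 s' := shell_lattice2 b0 b1 (c j) s' l0 N20 r0 de0.
rewrite -KE in c0 SL *.
set A := _ `&` _.
have mA : measurable A.
  apply: measurableI => //; apply: measurable_set_le; first mea; apply: measurable_normr.
  by apply: measurable_funB; [exact: measurable_lat|mea].
rewrite [X in (X <= _)%E](prod_sec2 _ _ mA).
apply: (@slice_le _ _ _ _ _ j _ latI) => //.
- exact: (measurable_secfun2 _ mA).
- by rewrite mulr_ge0// exprn_ge0.
- move=> k h; rewrite (_ : [set x | _] = set0) ?measure0//; apply/seteqP; split => // t.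
  by move=> [[[_ h1] _] _]; apply: h.
move=> k.
have mu : measT (fun x : int => upd k j x) by exact: measurable_on_int.
pose A' := [set p : m.+2.-tuple Rm * int | A (p.1, upd k j p.2)].
have mA' : measurable A'.
  have mf : measT (fun p : m.+2.-tuple Rm * int => (p.1, upd k j p.2)).
    by apply: measurable_pairT; [mea|apply: (measurableT_comp mu); mea].
  by have := mf measurableT _ mA; rewrite setTI.
rewrite -(prod_sec2 (power_measure leb m.+2) (lattice lam) mA').
apply: (first_two_le (I := band 0 (2 * N2))) => //.
- exact: measurable_band.
- by move=> t x [[[h _] _] _] i; apply: band0.
move=> t.
have mf : measT (fun p : (Rm * Rm) * int => (Defs.cons_tuple (p.1.1, Defs.cons_tuple (p.1.2, t)), p.2)).
  apply: measurable_pairT; last by mea.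
  apply: (measurableT_comp (@measurable_cons_tuple _ _ _)); apply: measurable_pairT; first by mea.
  by apply: (measurableT_comp (@measurable_cons_tuple _ _ _)); mea.
have mAt : measurable [set p : (Rm * Rm) * int | A' (Defs.cons_tuple (p.1.1, Defs.cons_tuple (p.1.2, t)), p.2)].
  by have := mf measurableT _ mA'; rewrite setTI.
pose q := \sum_(i < m) (tnth t i - b (lift ord0 (lift ord0 i))) ^+ 2 +
   \sum_(j' < n.+1 | j' != j) ((tnth k j')%:~R / lam - c j') ^+ 2.
apply: (measure_le_sub _ _ _ (SL (b ord0) (b (lift ord0 ord0)) (s - q))) => //.
  rewrite (_ : [set p | _] = [set p : (Rm * Rm) * int | `|p.1.1| <= 2 * N2] `&` [set p | `|p.1.2| <= 2 * N2] `&`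
    [set p | r <= `|p.2%:~R / lam - c j|] `&` [set p | `|(p.1.1 - b ord0) ^+ 2 + (p.1.2 - b (lift ord0 ord0)) ^+ 2
       + (p.2%:~R / lam - c j) ^+ 2 - (s - q)| <= de]); last first.
    by apply/seteqP; split => p /=; [move=> []|move=> [[[]]]].
  have ml : measT (fun p : (Rm * Rm) * int => p.2%:~R / lam - c j).
    by apply: measurable_lat_shift; mea.
  repeat apply: measurableI.
  - by apply: measurable_set_le; [apply: measurable_normr|]; mea.
  - by apply: measurable_set_le; [apply: measurable_normr|]; mea.
  - by apply: (measurable_set_le (f := fun=> r) (g := fun p : (Rm * Rm) * int => `|p.2%:~R / lam - c j|)); [mea|apply: measurable_normr].
  - apply: measurable_set_le; last mea; apply: measurable_normr; mea.
move=> p [[[h1 _] h2] h3]; split.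
- by have := h1 ord0; rewrite /= tnth0.
- by have := h1 (lift ord0 ord0); rewrite /= tnthS tnth0.
- by move: h3; rewrite /= tnth_mktuple eqxx.
move: h2; rewrite /= /Q quad_upd2.
rewrite (sumS (fun i x => (x - b i) ^+ 2)) (sumS (fun i x => (x - b (lift ord0 i)) ^+ 2)) /=.
rewrite (_ : _ - (s - q) = (p.1.1 - b ord0) ^+ 2 + ((p.1.2 - b (lift ord0 ord0)) ^+ 2 +
      \sum_(i < m) (tnth t i - b (lift ord0 (lift ord0 i))) ^+ 2) + (p.2%:~R / lam - c j) ^+ 2 +
      \sum_(j' < n.+1 | j' != j) ((tnth k j')%:~R / lam - c j') ^+ 2 - s)//; rewrite /q; ring.
Qed.

(** There are [m + n + 3] coordinates, each of range at most [9 * N2], and as many covering sets,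
    rounded up by one. The factor [128 * 9 ^+ 3] exceeds the [8 * 8192] left by a far lattice
    coordinate at [r = N1 / 8]. *)
Definition bound_const : R := (m + n + 4)%:R * 128 * 9 ^+ (m + n + 3).

(** If [N1 <= 16 * N2], the factor [N2] of [shell_near] is at most [16 * N2 ^+ 2 / N1]. Otherwise
    the set is covered according to the coordinate that [far_center] shows to be far from its
    centre. *)
Theorem set_bound : (freqm m.+2 n.+1 lam (freq_set lam b c N1 N2 s de) <=
  (bound_const * de * (N2 ^+ (m + n) * (lam^-1 + N2 ^+ 2 / N1)))%:E)%E.
Proof.
have mF := measurable_freq_set lam b c N1 N2 s de.
have FS : freq_set lam b c N1 N2 s de `<=` S by move=> xi [[h1 h2] h3].
pose K : R := 128 * 9 ^+ (m + n + 3) * de * B.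
have N0 : 0 <= N2 ^+ (m + n) by rewrite exprn_ge0// ltW.
have l0' := l0; have N20' := N20; have N10' := N10; have de0' := de0; have li' := li.
have il : 0 <= lam^-1 by rewrite invr_ge0 ltW.
have iN : 0 <= N2 ^+ 2 / N1 by rewrite divr_ge0 ?sqr_ge0// ltW.
have B0 : 0 <= B by rewrite mulr_ge0// addr_ge0.
have Bl : N2 ^+ (m + n) * (N2 ^+ 2 / N1) <= B by rewrite ler_wpM2l// lerDr.
pose P9 : R := 9 ^+ (m + n).
have P90 : 0 <= P9 by rewrite exprn_ge0.
have KE : K = 128 * 729 * P9 * de * B by rewrite /K exprD (_ : 9 ^+ 3 = 729 :> R)//; [rewrite -/P9; ring|ring].
have powE : (9 * N2) ^+ m * (9 * N2) ^+ n = P9 * N2 ^+ (m + n) by rewrite -exprD exprMn.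
have -> : bound_const * de * (N2 ^+ (m + n) * (lam^-1 + N2 ^+ 2 / N1)) = (m + n + 4)%:R * K.
  by rewrite /bound_const /K /B; ring.
have mono : ((1 : R) <= (m + n + 4)%:R) /\ ((m + n + 3)%:R <= (m + n + 4)%:R :> R).
  by rewrite ler1n ler_nat !addnS.
have PB : 0 <= P9 * de * B by exact: mulr_ge0 (mulr_ge0 P90 (ltW de0)) B0.
have K0 : 0 <= K.
  rewrite KE (_ : _ * B = 128 * (729 * (P9 * de * B))); last by ring.
  apply: mulr_ge0; first exact: ler0n.
  by apply: mulr_ge0; first exact: ler0n.
have [h|h] := leP N1 (16 * N2).
  apply: (measure_le_sub mF mS FS); apply: (le_trans shell_near); rewrite lee_fin.
  apply: (@le_trans _ _ K); last by rewrite ler_peMl//; case: mono.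
  have -> : 32 * de * (9 * N2) ^+ n.+1 * (9 * N2) ^+ m = 288 * P9 * de * (N2 ^+ (m + n) * N2).
    rewrite exprS.
    have -> : 32 * de * (9 * N2 * (9 * N2) ^+ n) * (9 * N2) ^+ m = 288 * de * N2 * ((9 * N2) ^+ m * (9 * N2) ^+ n) by ring.
    by rewrite powE; ring.
  have h1 : N2 <= 16 * (N2 ^+ 2 / N1).
    rewrite mulrA ler_pdivlMr// expr2 mulrA [leLHS]mulrC ler_pM2r//.
  have h2 : N2 ^+ (m + n) * N2 <= 16 * B.
    by have := ler_wpM2l N0 h1; lra.
  have := ler_wpM2l (mulr_ge0 P90 (ltW de0)) h2; rewrite KE; lra.
have r0 : 0 < N1 / 8 by rewrite divr_gt0.
pose C (u : 'I_m.+2 + 'I_n.+1) := match u with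
  | inl i => S `&` [set xi : Fq | (N1 / 8 <= `|tnth xi.1 i - b i|)%R]
  | inr j => S `&` [set xi : Fq | (N1 / 8 <= `|(tnth xi.2 j)%:~R / lam - c j|)%R] end.
have mC u : measurable (C u).
  case: u => i; apply: measurableI => //.
    by apply: measurable_set_le; [mea|apply: measurable_normr; mea].
  apply: measurable_set_le; first mea; apply: measurable_normr.
  by apply: measurable_funB; [exact: measurable_lat|mea].
apply: (@le_trans _ _ (#|{: 'I_m.+2 + 'I_n.+1}|%:R * K)%:E); last first.
  rewrite lee_fin card_sum !card_ord ler_wpM2r//.
  by rewrite ler_nat !addnS !addSn ?addn0 leqnSn.
apply: (measure_le_cover (B := C)) => //.
  move=> xi Fxi; have [[[h1 h2] [[i hi]|[j hj]]] _] := Fxi.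
    by exists (inl i); split; [exact: FS|apply: (far_center h)].
  by exists (inr j); split; [exact: FS|apply: (far_center h)].
have e8 : (N1 / 8)^-1 = 8 / N1 by rewrite invf_div.
case=> i.
  apply: (le_trans (shell_cont i r0)); rewrite lee_fin.
  have -> : 4 * de / (N1 / 8) * (9 * N2) ^+ m.+1 * (9 * N2) ^+ n.+1 =
      32 * 81 * de * (N2 ^+ 2 / N1) * ((9 * N2) ^+ m * (9 * N2) ^+ n).
    by rewrite !exprS e8; ring.
  rewrite powE; have := ler_wpM2l (mulr_ge0 P90 (ltW de0)) Bl; rewrite KE; lra.
apply: (le_trans (shell_latt i r0)); rewrite lee_fin -mulrA powE e8.
have -> : 8192 * de * (lam^-1 + N2 ^+ 2 * (8 / N1)) * (P9 * N2 ^+ (m + n)) =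
   8192 * (P9 * de * (N2 ^+ (m + n) * (N2 ^+ 2 / N1))) * 7 + 8192 * (P9 * de * B).
  by rewrite /B; ring.
have := ler_wpM2l (mulr_ge0 P90 (ltW de0)) Bl; rewrite KE; lra.
Qed.
End set_bound.

(** * Invariance under reflections and translations *)

Section affine.
Context (R : realType).
Local Notation leb := (lebesgue R).
Local Notation Rm := (measurableTypeR R).

(** By uniqueness of Lebesgue measure: the scaled push-forward is compared with it on half-open
    intervals, whose preimages change their closed end when [s < 0]. *)
Lemma leb_affine (s w : R) (f : Rm -> \bar R) : s != 0 -> measT f ->
  (forall x, 0 <= f x)%E ->
  (`|s|%:E * \int[leb]_x f (s * x + w)%R = \int[leb]_x f x)%E.
Proof.
move=> s0 mf f0.
have ma : measT (fun x : Rm => (s * x + w : Rm)) by mea.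
have sp : 0 < `|s| by rewrite normr_gt0.
pose nu' := mscale (NngNum (ltW sp)) (pushforward leb (fun x : Rm => (s * x + w : Rm))).
pose nu : {measure set Rm -> \bar R} := nu' ma.
have H A : measurable A -> leb A = nu A.
  apply: (@lebesgue_measure_unique R nu) => X [[a b] _ <-].
  rewrite -[RHS]/(`|s|%:E * leb ((fun x : Rm => (s * x + w)%R) @^-1` `]a, b]%classic))%E.
  have [ab|ba] := ltP a b; last first.
    by rewrite set_itv_ge ?preimage_set0 ?measure0 ?mule0// bnd_simp -leNgt.
  rewrite lebesgue_measure_itv /= lte_fin ab.
  have [sn|s1|/eqP] := ltgtP s 0; last by rewrite (negbTE s0).
    rewrite (_ : _ @^-1` _ = `[(b - w) / s, (a - w) / s[%classic); last first.
      apply/seteqP; split => x; rewrite /= !in_itv /= => /andP[h1 h2].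
        by apply/andP; split; rewrite ?ler_ndivrMr ?ltr_ndivlMr//; lra.
      move: h1 h2; rewrite ler_ndivrMr// ltr_ndivlMr// => h1 h2.
      by apply/andP; split; lra.
    rewrite lebesgue_measure_itv /= lte_fin ltr_nM2r ?invr_lt0// ltrD2r ab.
    rewrite ltr0_norm// -!EFinB -EFinM; congr EFin; field.
    by rewrite lt_eqF.
  rewrite (_ : _ @^-1` _ = `](a - w) / s, (b - w) / s]%classic); last first.
    apply/seteqP; split => x; rewrite /= !in_itv /= => /andP[h1 h2].
      by apply/andP; split; rewrite ?ltr_pdivrMr ?ler_pdivlMr//; lra.
    move: h1 h2; rewrite ltr_pdivrMr// ler_pdivlMr// => h1 h2.
    by apply/andP; split; lra.
  rewrite lebesgue_measure_itv /= lte_fin ltr_pM2r ?invr_gt0// ltrD2r ab.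
  rewrite gtr0_norm// -!EFinB -EFinM; congr EFin; field.
  by rewrite gt_eqF.
rewrite [RHS](@eq_measure_integral _ _ _ _ nu); last by move=> A mA _; exact: H.
rewrite [RHS]ge0_integral_mscale//= [in RHS]ge0_integral_pushforward//.
Qed.

Lemma leb_reflect (w : R) (f : Rm -> \bar R) : measT f ->
  (forall x, 0 <= f x)%E -> (\int[leb]_x f (w - x)%R = \int[leb]_x f x)%E.
Proof.
move=> mf f0; rewrite -[RHS](@leb_affine (-1) w)// ?oppr_eq0 ?oner_eq0//.
rewrite normrN1 mul1e; apply: eq_integral => x _.
by congr f; ring.
Qed.

Lemma lattice_reflect (lam : R) (w : int) (f : int -> \bar R) : (forall x, 0 <= f x)%E ->
  (\int[lattice lam]_x f (w - x)%R = \int[lattice lam]_x f x)%E.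
Proof.
move=> f0; have ma : measT (fun x : int => (w - x : int)) by exact: measurable_on_int.
pose nu' := (pushforward (lattice lam) (fun x : int => (w - x : int)) : {measure set int -> \bar R}).
rewrite [RHS](@eq_measure_integral _ _ _ _ (nu' ma)).
  by rewrite [RHS]ge0_integral_pushforward//; exact: measurable_on_int.
move=> A _ _; rewrite /pushforward /= /lattice /mscale; congr (_ * _)%E.
have e (B : set int) : (fun x : int => w - x) @^-1` B = (fun x : int => w - x) @` B.
  apply/seteqP; split => [x h|_ [y By <-]]; first by exists (w - x) => //; rewrite opprB addrC subrK.
  by rewrite /preimage /= opprB addrC subrK.
have cT (B : set int) : finite_set B -> counting B = (size (finmap.enum_fset (fset_set B)))%:R%:E :> \bar R.
  by move=> fB; rewrite /counting asboolT.
have cF (B : set int) : ~ finite_set B -> counting B = +oo%E :> \bar R.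
  by move=> fB; rewrite /counting asboolF.
rewrite e; case: (pselect (finite_set A)) => fA.
  have fA' : finite_set ((fun x : int => w - x) @` A) by exact: finite_image.
  apply: (etrans (cT _ fA)); apply: etrans (esym (cT _ fA')); congr (_%:R%:E).
  rewrite fset_set_image// finmap.card_imfset//= => x y h.
  by move: h => /addrI /oppr_inj.
apply: (etrans (cF _ fA)); apply/esym/cF => h; apply: fA; have := finite_image (fun x : int => w - x) h.
rewrite -!e -comp_preimage (_ : _ \o _ = id)//.
by apply/funext => x /=; rewrite opprB addrC subrK.
Qed.
End affine.

Section tuple_reflect.
Context d (T : measurableType d) (R : realType).
Variables (mu : {sigma_finite_measure set T -> \bar R}) (op : T -> T -> T).
Hypothesis mop : measT (fun p : T * T => op p.1 p.2).
Hypothesis opE : forall x (f : T -> \bar R), measT f -> (forall y, 0 <= f y)%E ->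
  (\int[mu]_y f (op x y) = \int[mu]_y f y)%E.

Definition top n (t u : n.-tuple T) : n.-tuple T := [tuple op (tnth t i) (tnth u i) | i < n].

Lemma measurable_top n : measT (fun p : n.-tuple T * n.-tuple T => top p.1 p.2).
Proof.
apply/measurable_fun_tnthP => i.
rewrite (_ : _ \o _ = fun p : n.-tuple T * n.-tuple T => op (tnth p.1 i) (tnth p.2 i)); last first.
  by apply/funext => p /=; rewrite tnth_mktuple.
apply: (measurableT_comp mop (_ : measT
  (fun p : n.-tuple T * n.-tuple T => (tnth p.1 i, tnth p.2 i)))).
by mea.
Qed.

Lemma measurable_top2 d' (S : measurableType d') n (f g : S -> n.-tuple T) :
  measT f -> measT g -> measT (fun x => top (f x) (g x)).
Proof. by move=> mf mg; exact: (measurableT_comp (@measurable_top n) (measurable_pairT mf mg)). Qed.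

Lemma power_reflect n (w : n.-tuple T) (f : n.-tuple T -> \bar R) : measT f ->
  (forall y, 0 <= f y)%E ->
  (\int[power_measure mu n]_t f (top w t) = \int[power_measure mu n]_t f t)%E.
Proof.
elim: n w f => [|n ih] w f mf f0.
  by rewrite !power0_integral; rewrite (tuple0 (top _ _)).
have mw : measT (fun t : n.+1.-tuple T => f (top w t)).
  by apply: (measurableT_comp mf); apply: measurable_top2; mea.
rewrite cons_tonelli// [RHS]cons_tonelli//.
have mc : measT (fun p : T * n.-tuple T => f (Defs.cons_tuple p)).
  exact: (measurableT_comp mf (@measurable_cons_tuple _ T n)).
rewrite -[RHS](opE (tnth w ord0)); last 2 first.
- exact: (@measurable_param_integral _ _ _ _ R (power_measure mu n) (fun p : T * n.-tuple T => f (Defs.cons_tuple p)) mc).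
- by move=> x; exact: integral_ge0.
apply: eq_integral => x _.
pose w' : n.-tuple T := [tuple tnth w (lift ord0 i) | i < n].
rewrite -[RHS](ih w')//; last first.
  by apply: (measurableT_comp mc); mea.
apply: eq_integral => t _; congr f; apply: eq_from_tnth => i.
rewrite tnth_mktuple; have [->|[j ->]] : i = ord0 \/ exists j, i = lift ord0 j.
  by case: (unliftP ord0 i) => [j ->|->]; [right; exists j|left].
- by rewrite !tnth0.
- by rewrite !tnthS !tnth_mktuple.
Qed.
End tuple_reflect.

Section freq_reflect.
Context (R : realType) (m n : nat) (lam : R).
Hypothesis l0 : 0 < lam.
Local Notation leb := (lebesgue R).
Local Notation Rm := (measurableTypeR R).
Local Notation Fq := (frequency R m n).

Definition fsub (w xi : Fq) : Fq :=
  (top (fun x y : Rm => x - y) w.1 xi.1, top (fun x y : int => x - y) w.2 xi.2).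

Lemma measurable_subint : measT (fun p : int * int => (p.1 - p.2 : int)).
Proof.
move=> _ B _; rewrite setTI.
rewrite (_ : _ @^-1` _ = \bigcup_k ([set x : int | B (x - k)] `*` [set k])).
  by apply: countable_bigcupT_measurable => [|k]; [exact: countableP|exact: measurableX].
apply/seteqP; split => [[x k] h|[x k] [k' _ [/= h ->]]//].
by exists k.
Qed.

Lemma measurable_fsub : measT (fun p : Fq * Fq => fsub p.1 p.2).
Proof.
apply: measurable_pairT.
  by apply: (@measurable_top2 _ Rm (fun x y => x - y)); mea.
by apply: (@measurable_top2 _ int (fun x y => x - y) measurable_subint); mea.
Qed.

Lemma measurable_fsub2 d (S : measurableType d) (f g : S -> Fq) :
  measT f -> measT g -> measT (fun x => fsub (f x) (g x)).
Proof. by move=> mf mg; exact: (measurableT_comp measurable_fsub (measurable_pairT mf mg)). Qed.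

Lemma freq_reflect (w : Fq) (f : Fq -> \bar R) : measT f ->
  (forall xi, 0 <= f xi)%E ->
  (\int[freqm m n lam]_xi f (fsub w xi) = \int[freqm m n lam]_xi f xi)%E.
Proof.
move=> mf f0.
have mw : measT (fun xi : Fq => f (fsub w xi)).
  by apply: (measurableT_comp mf); apply: measurable_fsub2; mea.
rewrite [LHS]prod_tonelli// [RHS]prod_tonelli//.
rewrite -[RHS](@power_reflect _ Rm R leb (fun x y => x - y) _ _ m w.1); first last.
- by move=> t; exact: integral_ge0.
- exact: (@measurable_param_integral _ _ _ _ R _ f mf).
- by move=> x g mg g0; exact: leb_reflect.
- by mea.
apply: eq_integral => t _.
rewrite -[RHS](@power_reflect _ int R (lattice lam) (fun x y => x - y) _ _ n w.2)//.
- exact: measurable_subint.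
- by move=> x g mg g0; exact: lattice_reflect.
- by apply: (measurableT_comp mf); mea.
Qed.
End freq_reflect.

Lemma Rint_prod d1 d2 (X : measurableType d1) (Y : measurableType d2) (R : realType)
    (mu : {sigma_finite_measure set X -> \bar R})
    (nu : {sigma_finite_measure set Y -> \bar R}) (f : X -> R) (g : Y -> R) :
  mu.-intT (f) -> nu.-intT (g) ->
  \int[prod_measure mu nu]_z (f z.1 * g z.2) = (\int[mu]_x f x) * (\int[nu]_y g y).
Proof.
move=> jf jg; have jfg := integrable_tensor jf jg.
apply: EFin_inj; rewrite EFinRint// prod_fubini// EFinM EFinRint//.
rewrite muleC -integralZl//; apply: eq_integral => x _ /=.
rewrite muleC EFinRint// -integralZl//.
Qed.

Lemma ge0_int_prod d1 d2 (X : measurableType d1) (Y : measurableType d2) (R : realType)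
    (mu : {sigma_finite_measure set X -> \bar R})
    (nu : {sigma_finite_measure set Y -> \bar R}) (f : X -> R) (g : Y -> R) :
  measT f -> measT g -> (forall x, 0 <= f x) -> (forall y, 0 <= g y) ->
  (\int[prod_measure mu nu]_z (f z.1 * g z.2)%:E = (\int[mu]_x (f x)%:E) * (\int[nu]_y (g y)%:E))%E.
Proof.
move=> mf mg f0 g0; rewrite prod_tonelli; last 2 first.
- apply/measurable_EFinP; apply: measurable_funM.
    by apply: (measurableT_comp mf); mea.
  by apply: (measurableT_comp mg); mea.
- by move=> z; rewrite lee_fin mulr_ge0.
rewrite -ge0_integralZr//; last 3 first.
- exact/measurable_EFinP.
- by move=> x _; rewrite lee_fin.
- by apply: integral_ge0 => y _; rewrite lee_fin.
by apply: eq_integral => x _ /=; rewrite ge0_intZl.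
Qed.

Section integrable_lin.
Context d (T : measurableType d) (R : realType) (mu : {measure set T -> \bar R}).

Lemma integrable_D (f g : T -> R) : mu.-intT (f) ->
  mu.-intT (g) -> mu.-intT ((fun x => f x + g x)).
Proof. by move=> jf jg; exact: (integrableD measurableT jf jg). Qed.

Lemma integrable_B (f g : T -> R) : mu.-intT (f) ->
  mu.-intT (g) -> mu.-intT ((fun x => f x - g x)).
Proof. by move=> jf jg; exact: (integrableB measurableT jf jg). Qed.

Lemma RintD (f g : T -> R) : mu.-intT (f) ->
  mu.-intT (g) -> \int[mu]_x (f x + g x) = \int[mu]_x f x + \int[mu]_x g x.
Proof. by move=> jf jg; exact: (RintegralD measurableT jf jg). Qed.

Lemma RintB (f g : T -> R) : mu.-intT (f) ->
  mu.-intT (g) -> \int[mu]_x (f x - g x) = \int[mu]_x f x - \int[mu]_x g x.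
Proof. by move=> jf jg; exact: (RintegralB measurableT jf jg). Qed.

Lemma integrable_measurable (f : T -> R) : mu.-intT (f) -> measT f.
Proof. by case/integrableP => /measurable_EFinP. Qed.
End integrable_lin.

(** * The bilinear estimate for smooth weights *)

Section bilinear.
Context (R : realType) (m n : nat) (lam : R).
Hypothesis l0 : 0 < lam.
Local Notation leb := (lebesgue R).
Local Notation Rm := (measurableTypeR R).
Local Notation X := (phys_point R m n).
Local Notation Fq := (frequency R m n).
Local Notation fm := (freqm m n lam).

Definition nsq : Fq -> R := quad lam (fun=> 0) (fun=> 0).

(** The space-time phase of a free wave: with characters [exp (2 pi i z . xi)], the equation forces
    the time factor [exp (- 4 pi ^ 2 i t |xi| ^ 2)]. *)
Definition evphase (y : Rm * X) (xi : Fq) : R :=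
  phase lam y.2 xi - 4 * pi ^+ 2 * (y.1 * nsq xi).

Definition ev_re (Fr Fi : Fq -> R) (y : Rm * X) : R :=
  \int[fm]_xi (Fr xi * cos (evphase y xi) - Fi xi * sin (evphase y xi)).

Definition ev_im (Fr Fi : Fq -> R) (y : Rm * X) : R :=
  \int[fm]_xi (Fr xi * sin (evphase y xi) + Fi xi * cos (evphase y xi)).

Lemma measurable_evphase d (S : measurableType d) (f : S -> Rm * X) (g : S -> Fq) :
  measT f -> measT g ->
  measT (fun x => evphase (f x) (g x)).
Proof.
move=> mf mg; apply: measurable_funB.
  apply: (measurableT_comp (@measurable_phase R m n lam)
    (_ : measT (fun x => ((f x).2, g x)))).
  by apply: measurable_pairT => //; apply: (measurableT_comp measurable_snd).
apply: measurable_funM; first exact: measurable_cst.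
apply: measurable_funM; first by apply: (measurableT_comp measurable_fst).
exact: (measurableT_comp (measurable_quad _ _ _)).
Qed.

(** A translation is the composition of two reflections and inherits their invariance. *)
Lemma freq_translate (v : Fq) (f : Fq -> \bar R) : measT f ->
  (forall xi, 0 <= f xi)%E -> (\int[fm]_w f (fsub w v) = \int[fm]_xi f xi)%E.
Proof.
move=> mf f0.
pose o : Fq := (nseq_tuple m (0 : R), nseq_tuple n (0 : int)).
rewrite -[RHS](freq_reflect lam o)// -[RHS](freq_reflect lam v)//; last first.
  by apply: (measurableT_comp mf); apply: measurable_fsub2; mea.
apply: eq_integral => w _; congr f; rewrite /fsub /=; congr pair; apply: eq_from_tnth => i;
  by rewrite !tnth_mktuple tnth_nseq sub0r opprB.
Qed.

Section estimate.
Variables (Fr Fi Gr Gi : Fq -> R) (N1 N2 T0 T Q : R).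
Hypotheses (iFr : fm.-intT (Fr)) (iFi : fm.-intT (Fi)).
Hypotheses (iGr : fm.-intT (Gr)) (iGi : fm.-intT (Gi)).
Let large0 := large_freq lam (fun _ : 'I_m => 0) (fun _ : 'I_n => 0) N1.
Let small := @small_freq R m n lam N2.
Hypotheses (sF : forall xi, ~ large0 xi -> Fr xi = 0 /\ Fi xi = 0).
Hypotheses (sG : forall xi, ~ small xi -> Gr xi = 0 /\ Gi xi = 0).
Hypotheses (T00 : 0 < T0) (T_0 : 0 < T) (Q0 : 0 <= Q).

(** How far the pair of frequencies with sum [w] and second member [xi] is from having total energy
    [tau], in the units of the time frequency. *)
Definition offset (w : Fq) (tau : R) (xi : Fq) : R :=
  4 * pi ^+ 2 * (nsq (fsub w xi) + nsq xi - tau).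

(** The whole geometric input: windows of the resonance function, at the dyadic scales above
    [1 / T0], uniformly in the sum and the energy. *)
Hypothesis Hset : forall w tau (j : nat),
  (fm ([set xi | large0 (fsub w xi)] `&` small `&`
     [set xi | (`|offset w tau xi| <= 2 ^+ j / T0)%R]) <= (Q * (2 ^+ j / T0))%:E)%E.

Definition Theta (p : (Fq * Fq) * (Rm * X)) : R := evphase p.2 p.1.1 + evphase p.2 p.1.2.

Lemma measurable_Theta : measT Theta.
Proof. by apply: measurable_funD; apply: measurable_evphase; mea. Qed.

(** Triangles in time and in the unbounded directions; the torus has finite mass and keeps weight 1,
    which makes its characters exactly orthogonal. *)
Definition Yweight (y : Rm * X) : R :=
  tri T0 y.1 * ((\prod_(i < m) tri T (tnth y.2.1 i)) * (\prod_(j < n) cst 1 (tnth y.2.2 j))).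

Definition tau2 (p : Fq * Fq) : R := nsq p.1 + nsq p.2.
Definition Ykernel (p q : Fq * Fq) : R :=
  fej T0 (4 * pi ^+ 2 * (tau2 q - tau2 p)) *
  ((\prod_(i < m) fej T (2 * pi * (tnth p.1.1 i + tnth p.2.1 i - (tnth q.1.1 i + tnth q.2.1 i)))) *
   (\prod_(j < n) (if tnth p.1.2 j + tnth p.2.2 j - (tnth q.1.2 j + tnth q.2.2 j) == 0 then lam else 0))).

Lemma oscint_Y (p q : Fq * Fq) :
  oscint (prod_measure leb (waveguide m n lam)) Yweight
    (fun y => Theta (p, y) - Theta (q, y)) (Ykernel p q).
Proof.
have h0 := oscint_tri (4 * pi ^+ 2 * (tau2 q - tau2 p)) T00.
have h1 := oscint_power (fun i : 'I_m =>
  oscint_tri (2 * pi * (tnth p.1.1 i + tnth p.2.1 i - (tnth q.1.1 i + tnth q.2.1 i))) T_0).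
have h2 := oscint_power (fun j : 'I_n =>
  oscint_torus (tnth p.1.2 j + tnth p.2.2 j - (tnth q.1.2 j + tnth q.2.2 j)) l0).
have := oscint_prod h0 (oscint_prod h1 h2); congr oscint; apply/funext => y.
rewrite /Theta /evphase /phase /freq_dot /tau2.
set A := \sum_(i < m) (2 * pi * _ * _); set B := \sum_(i < n) (2 * pi * _).
have -> : A = 2 * pi * (\sum_(i < m) tnth y.2.1 i * tnth p.1.1 i + \sum_(i < m) tnth y.2.1 i * tnth p.2.1 i
   - (\sum_(i < m) tnth y.2.1 i * tnth q.1.1 i + \sum_(i < m) tnth y.2.1 i * tnth q.2.1 i)).
  by rewrite -!big_split -sumrB mulr_sumr; apply: eq_bigr => i _ /=; ring.
have -> : B = 2 * pi * (\sum_(i < n) tnth y.2.2 i * ((tnth p.1.2 i)%:~R / lam) + \sum_(i < n) tnth y.2.2 i * ((tnth p.2.2 i)%:~R / lam)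
   - (\sum_(i < n) tnth y.2.2 i * ((tnth q.1.2 i)%:~R / lam) + \sum_(i < n) tnth y.2.2 i * ((tnth q.2.2 i)%:~R / lam))).
  by rewrite -!big_split -sumrB mulr_sumr; apply: eq_bigr => i _ /=; rewrite intrB !intrD; ring.
ring.
Qed.

Lemma Yweight_ge0 y : 0 <= Yweight y.
Proof.
rewrite mulr_ge0 ?tri_ge0// mulr_ge0//; apply: prodr_ge0 => i _; [exact: tri_ge0|exact: ler01].
Qed.

Lemma Ykernel_ge0 p q : 0 <= Ykernel p q.
Proof.
apply: mulr_ge0; first exact: fej_ge0.
apply: mulr_ge0; apply: prodr_ge0 => i _; first exact: fej_ge0.
by case: ifP => // _; exact: ltW.
Qed.

Lemma YkernelE p q : \int[prod_measure leb (waveguide m n lam)]_y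
  (Yweight y * cos (Theta (p, y) - Theta (q, y))) = Ykernel p q.
Proof.
have [ikk mk /(_ 0)] := oscint_Y p q.
rewrite -EFinRint; last first.
  by apply: integrable_mulcos => //; apply: measurable_funD => //; exact: measurable_cst.
by rewrite cos0 mulr1 => -[<-]; apply: eq_Rintegral => y _; rewrite addr0.
Qed.

Let A : set (Fq * Fq) := [set p | large0 p.1 /\ small p.2].

Let mA : measurable A.
Proof.
rewrite (_ : A = large0 `*` small); last by apply/seteqP; split => -[].
by apply: measurableX; [exact: measurable_large|exact: measurable_small].
Qed.

(** The part of the Schur kernel that sees only the sum [w] of the second pair. It concentrates
    where [w] equals the sum of the first pair. *)
Definition shape (p w : Fq) : R :=
  (\prod_(i < m) fej T (2 * pi * (tnth p.1 i - tnth w.1 i))) *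
   (\prod_(j < n) (if tnth p.2 j - tnth w.2 j == 0 then lam else 0)).

Definition psum (p : Fq * Fq) : Fq :=
  ([tuple tnth p.1.1 i + tnth p.2.1 i | i < m], [tuple tnth p.1.2 j + tnth p.2.2 j | j < n]).

(** In the coordinates given by the sum [w] and the second member [xi], the kernel splits into a
    function of [w] and a Fejer kernel of the resonance function. *)
Lemma Ykernel_shift p w xi : Ykernel p (fsub w xi, xi) =
  fej T0 (offset w (tau2 p) xi) * shape (psum p) w.
Proof.
rewrite /Ykernel /shape /=; congr (_ * (_ * _)).
- by apply: eq_bigr => i _; rewrite !tnth_mktuple subrK.
- by apply: eq_bigr => i _; rewrite !tnth_mktuple subrK.
Qed.

Lemma shape_ge0 p w : 0 <= shape p w.
Proof.
apply: mulr_ge0; apply: prodr_ge0 => i _; first exact: fej_ge0.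
by case: ifP => // _; exact: ltW.
Qed.

Let mfejT i (x : m.-tuple Rm) : measT (fun w : Rm => fej T (2 * pi * (tnth x i - w))).
Proof. by apply: measurableT_comp; [exact: continuous_fej|mea]. Qed.

Lemma measurable_shape p : measT (shape p).
Proof.
apply: measurable_funM.
  apply: (measurableT_comp (f := fun t : m.-tuple Rm => \prod_(i < m) fej T (2 * pi * (tnth p.1 i - tnth t i)))); last by mea.
  by apply: (@measurable_tensor _ Rm _ _ (fun i w => fej T (2 * pi * (tnth p.1 i - w)))) => i; exact: mfejT.
apply: (measurableT_comp (f := fun t : n.-tuple int => \prod_(j < n) (if tnth p.2 j - tnth t j == 0 then lam else 0))); last by mea.
apply: (@measurable_tensor _ int _ _ (fun j w => if tnth p.2 j - w == 0 then lam else 0)) => j.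
exact: (@measurable_on_int _ Rm).
Qed.

(** Uniform in [T]: each continuous factor has the bounded mass of a Fejer kernel, and each lattice
    factor is [lam] at a single point of mass [1 / lam]. *)
Lemma shape_mass p : (\int[fm]_w (shape p w)%:E <= (32 ^+ m)%:E)%E.
Proof.
have -> : 32 ^+ m = 32 ^+ m * 1 :> R by rewrite mulr1.
apply: (@prod_tensor_le _ _ _ _ _ (power_measure leb m) (power_measure (lattice lam) n)
  (fun x => \prod_(i < m) fej T (2 * pi * (tnth p.1 i - tnth x i)))
  (fun k => \prod_(j < n) (if tnth p.2 j - tnth k j == 0 then lam else 0))).
- by apply: (@measurable_tensor _ Rm _ _ (fun i w => fej T (2 * pi * (tnth p.1 i - w)))) => i; exact: mfejT.
- apply: (@measurable_tensor _ int _ _ (fun j w => if tnth p.2 j - w == 0 then lam else 0)) => j.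
  exact: (@measurable_on_int _ Rm).
- by move=> x; apply: prodr_ge0 => i _; exact: fej_ge0.
- by move=> y; apply: prodr_ge0 => i _; case: ifP => // _; exact: ltW.
- have -> : 32 ^+ m = \prod_(i < m) (32 : R) by rewrite prodr_const card_ord.
  apply: (@power_tensor_le _ Rm _ _ _ (fun i w => fej T (2 * pi * (tnth p.1 i - w)))) => //.
  + by move=> i x; exact: fej_ge0.
  + move=> i; have := fej_mass (tnth p.1 i) T_0.
    apply: le_trans; apply: eq_le.
    by apply: eq_integral => x _; congr EFin; rewrite -opprB mulrN fejN.
- rewrite [X in (_ <= X)%E](_ : _ = (\prod_(j < n) (1 : R))%:E); last by rewrite big1.
  apply: (@power_tensor_le _ int _ _ _ (fun j w => if tnth p.2 j - w == 0 then lam else 0)) => //.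
  + by move=> i y; case: ifP => // _; exact: ltW.
  + move=> j.
    rewrite (eq_integral (fun k => lam%:E * (\1_[set tnth p.2 j] k)%:E)%E); last first.
      move=> k _; rewrite indicE; case: eqVneq => [/subr0_eq ->|h].
        by rewrite mem_set// mule1.
      by rewrite memNset ?mule0// => /= e; move: h; rewrite e subrr eqxx.
    rewrite ge0_integralZl//; last by rewrite lee_fin ltW.
      have e : lattice lam ([set tnth p.2 j] `&` setT) = (lam^-1)%:E by rewrite setIT lattice_set1.
      by rewrite integral_indic// [X in (_ * X)%E]e -EFinM divff// gt_eqF.
Qed.

Lemma measurable_offset d (S : measurableType d) tau (f g : S -> Fq) :
  measT f -> measT g ->
  measT (fun x => offset (f x) tau (g x)).
Proof.
move=> mf mg; apply: measurable_funM; first exact: measurable_cst.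
apply: measurable_funB; last exact: measurable_cst.
apply: measurable_funD; apply: (measurableT_comp (measurable_quad lam (fun=> 0) (fun=> 0))) => //.
exact: measurable_fsub2.
Qed.

(** For a fixed sum [w] the integral in [xi] of the Fejer kernel in time is at most [32 * Q] by
    [Hset] and [fej_integral_le]; what remains, [shape], is integrated in [w]. *)
Lemma schur_bound p : A p ->
  (\int[prod_measure fm fm]_(q in A) `|\int[prod_measure leb (waveguide m n lam)]_y
     (Yweight y * cos (Theta (p, y) - Theta (q, y)))|%:E <= (32 * Q * 32 ^+ m)%:E)%E.
Proof.
move=> Ap; under eq_integral do rewrite YkernelE ger0_norm ?Ykernel_ge0//.
rewrite integral_mkcond.
pose h (q : Fq * Fq) : \bar R := (Ykernel p q * \1_A q)%:E.
rewrite (eq_integral h); last first.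
  move=> q _; rewrite patchE /h indicE; case: ifP => _; first by rewrite mulr1.
  by rewrite mulr0.
have h0 q : (0 <= h q)%E by rewrite lee_fin mulr_ge0 ?Ykernel_ge0.
have mh : measT h.
  apply/measurable_EFinP; apply: measurable_funM; last exact: measurable_indic.
  have -> : Ykernel p = fun q => \int[prod_measure leb (waveguide m n lam)]_y
    (Yweight y * cos (Theta (p, y) - Theta (q, y))) by apply/funext => q; rewrite YkernelE.
  apply: (@measurable_param_Rintegral _ _ _ _ R (prod_measure leb (waveguide m n lam))
    (fun z : (Fq * Fq) * (Rm * X) => Yweight z.2 * cos (Theta (p, z.2) - Theta (z.1, z.2)))).
  apply: measurable_funM.
    have [ik _ _] := oscint_Y p p; have mk : measT Yweight by case/integrableP : ik => /measurable_EFinP.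
    by apply: (measurableT_comp mk); mea.
  apply: measurable_cosD; apply: measurable_funB.
    by apply: (measurableT_comp measurable_Theta); mea.
  by apply: (measurableT_comp measurable_Theta); mea.
rewrite prod_tonelli2//.
pose G (z : Fq * Fq) : \bar R := h (fsub z.1 z.2, z.2).
have mG : measT G.
  apply: (measurableT_comp mh); apply: measurable_pairT; last by mea.
  by apply: measurable_fsub2; mea.
(* For each second frequency [v], the first one is translated so that the variable becomes the sum
   of the two. *)
rewrite (eq_integral (fun v => \int[fm]_w G (w, v))%E); last first.
  move=> v _; rewrite -[LHS](freq_translate v (f := fun xi => h (xi, v)))//.
  by apply: (measurableT_comp mh); mea.
have -> : (\int[fm]_v \int[fm]_w G (w, v) = \int[fm]_w \int[fm]_v G (w, v))%E.
  have G0 z : (0 <= G z)%E by exact: h0.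
  exact: (etrans (esym (prod_tonelli2 fm fm mG G0)) (prod_tonelli fm fm mG G0)).
have bnd w : (\int[fm]_v G (w, v) <= (32 * Q)%:E * (shape (psum p) w)%:E)%E.
  rewrite muleC.
  pose S := [set xi | large0 (fsub w xi)] `&` small.
  have mS : measurable S.
    apply: measurableI; last exact: measurable_small.
    have mf : measT (fun xi : Fq => fsub w xi) by apply: measurable_fsub2; mea.
    have := mf measurableT _ (measurable_large lam (fun=> 0) (fun=> 0) N1).
    by rewrite setTI.
  have mo : measT (offset w (tau2 p)) by apply: measurable_offset; mea.
  apply: (@le_trans _ _ ((shape (psum p) w)%:E * \int[fm]_(xi in S) (fej T0 (offset w (tau2 p) xi))%:E)%E); last first.
    apply: lee_wpmul2l; first by rewrite lee_fin shape_ge0.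
    by apply: fej_integral_le => // j; exact: Hset.
  have mfj : measT (fun xi => fej T0 (offset w (tau2 p) xi)).
    by apply: (measurableT_comp (continuous_fej T00)).
  rewrite [X in (_ * X)%E]integral_mkcond -ge0_integralZl//; first last.
  - by rewrite lee_fin shape_ge0.
  - by move=> xi _; rewrite patchE; case: ifP => // _; rewrite lee_fin fej_ge0.
  - by apply/(measurable_restrictT _ mS); apply: measurable_funTS; apply/measurable_EFinP.
  apply: eq_le; apply: eq_integral => xi _.
  rewrite /G /h Ykernel_shift indicE patchE.
  have -> : ((fsub w xi, xi) \in A) = (xi \in S).
    by apply/idP/idP => /set_mem hh; apply/mem_set; exact: hh.
  case: ifP => _; first by rewrite mulr1 -EFinM mulrC.
  by rewrite mulr0 mule0.
apply: (@le_trans _ _ (\int[fm]_w ((32 * Q)%:E * (shape (psum p) w)%:E))%E).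
  apply: ge0_le_integral => //.
  - by move=> w _; apply: integral_ge0 => v _; exact: h0.
  - exact: (@measurable_param_integral _ _ _ _ R fm G mG).
  - by apply: measurable_funeM; apply/measurable_EFinP; exact: measurable_shape.
have Q32 : 0 <= 32 * Q by rewrite mulr_ge0.
rewrite ge0_integralZl//; last 2 first.
- by apply/measurable_EFinP; exact: measurable_shape.
- by move=> w _; rewrite lee_fin shape_ge0.
by rewrite [leRHS]EFinM; apply: lee_wpmul2l => //; exact: shape_mass.
Qed.

Let Hr (p : Fq * Fq) : R := Fr p.1 * Gr p.2 - Fi p.1 * Gi p.2.
Let Hi (p : Fq * Fq) : R := Fr p.1 * Gi p.2 + Fi p.1 * Gr p.2.
Let iHr : (prod_measure fm fm).-intT (Hr).
Proof. by apply: integrable_B; exact: integrable_tensor. Qed.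
Let iHi : (prod_measure fm fm).-intT (Hi).
Proof. by apply: integrable_D; exact: integrable_tensor. Qed.

Let me y : measT (evphase y).
Proof. by apply: measurable_evphase; mea. Qed.
Let mT y : measT (fun p => Theta (p, y)).
Proof. by apply: (measurableT_comp measurable_Theta); mea. Qed.

Lemma ev_mul y :
  ev_re Fr Fi y * ev_re Gr Gi y - ev_im Fr Fi y * ev_im Gr Gi y =
    \int[prod_measure fm fm]_p (Hr p * cos (Theta (p, y))) -
    \int[prod_measure fm fm]_p (Hi p * sin (Theta (p, y))) /\
  ev_re Fr Fi y * ev_im Gr Gi y + ev_im Fr Fi y * ev_re Gr Gi y =
    \int[prod_measure fm fm]_p (Hr p * sin (Theta (p, y))) +
    \int[prod_measure fm fm]_p (Hi p * cos (Theta (p, y))).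
Proof.
have rF := integrable_B (integrable_mulcos iFr (me y)) (integrable_mulsin iFi (me y)).
have rG := integrable_B (integrable_mulcos iGr (me y)) (integrable_mulsin iGi (me y)).
have jF := integrable_D (integrable_mulsin iFr (me y)) (integrable_mulcos iFi (me y)).
have jG := integrable_D (integrable_mulsin iGr (me y)) (integrable_mulcos iGi (me y)).
rewrite /ev_re /ev_im -!Rint_prod//.
rewrite -(RintB (integrable_tensor rF rG) (integrable_tensor jF jG)).
rewrite -(RintD (integrable_tensor rF jG) (integrable_tensor jF rG)).
rewrite -(RintB (integrable_mulcos iHr (mT y)) (integrable_mulsin iHi (mT y))).
rewrite -(RintD (integrable_mulsin iHr (mT y)) (integrable_mulcos iHi (mT y))).
by split; apply: eq_Rintegral => p _; rewrite /Theta (cosD (evphase y p.1)) (sinD (evphase y p.1)) /Hr /Hi /=; ring.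
Qed.

(** The product of the two evolutions has amplitude [Hr + i Hi] on pairs of frequencies. Schur's
    test is applied to [Hr] and to [Hi], the recombination costs the factor 2, and
    [Hr ^+ 2 + Hi ^+ 2] factors into the product of the squared moduli. *)
Theorem bilinear_smooth :
  (\int[prod_measure leb (waveguide m n lam)]_y (Yweight y *
     ((ev_re Fr Fi y * ev_re Gr Gi y - ev_im Fr Fi y * ev_im Gr Gi y) ^+ 2 +
      (ev_re Fr Fi y * ev_im Gr Gi y + ev_im Fr Fi y * ev_re Gr Gi y) ^+ 2))%:E <=
   (2 * (32 * Q * 32 ^+ m))%:E *
     ((\int[fm]_xi (Fr xi ^+ 2 + Fi xi ^+ 2)%:E) * (\int[fm]_xi (Gr xi ^+ 2 + Gi xi ^+ 2)%:E)))%E.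
Proof.
pose M := 32 * Q * 32 ^+ m.
have M0 : 0 <= M by rewrite mulr_ge0 ?exprn_ge0// mulr_ge0.
pose p0 : Fq * Fq := ((nseq_tuple m (0 : R), nseq_tuple n (0 : int)), (nseq_tuple m (0 : R), nseq_tuple n (0 : int))).
have [ik _ _] := oscint_Y p0 p0.
have mk := integrable_measurable ik.
have zer p : ~ A p -> Hr p = 0 /\ Hi p = 0.
  rewrite /Hr /Hi => /not_andP[/sF[-> ->]|/sG[-> ->]]; by rewrite ?mul0r ?mulr0 subr0 addr0.
have Sr := schur_test iHr measurable_Theta ik Yweight_ge0 mA (fun p h => (zer p h).1) schur_bound.
have Si := schur_test iHi measurable_Theta ik Yweight_ge0 mA (fun p h => (zer p h).2) schur_bound.
pose a y := \int[prod_measure fm fm]_p (Hr p * cos (Theta (p, y))).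
pose b y := \int[prod_measure fm fm]_p (Hr p * sin (Theta (p, y))).
pose c y := \int[prod_measure fm fm]_p (Hi p * cos (Theta (p, y))).
pose e y := \int[prod_measure fm fm]_p (Hi p * sin (Theta (p, y))).
have mHr := integrable_measurable iHr.
have mHi := integrable_measurable iHi.
have mTs : measT (fun z : (Rm * X) * (Fq * Fq) => Theta (z.2, z.1)).
  by apply: (measurableT_comp measurable_Theta); mea.
have mHr' : measT (fun z : (Rm * X) * (Fq * Fq) => Hr z.2).
  by apply: (measurableT_comp mHr); mea.
have mHi' : measT (fun z : (Rm * X) * (Fq * Fq) => Hi z.2).
  by apply: (measurableT_comp mHi); mea.
have ma : measT a.
  by apply: (@measurable_param_Rintegral _ _ _ _ R _ (fun z : (Rm * X) * (Fq * Fq) => Hr z.2 * cos (Theta (z.2, z.1)))); mea.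
have mb : measT b.
  by apply: (@measurable_param_Rintegral _ _ _ _ R _ (fun z : (Rm * X) * (Fq * Fq) => Hr z.2 * sin (Theta (z.2, z.1)))); mea.
have mc : measT c.
  by apply: (@measurable_param_Rintegral _ _ _ _ R _ (fun z : (Rm * X) * (Fq * Fq) => Hi z.2 * cos (Theta (z.2, z.1)))); mea.
have me' : measT e.
  by apply: (@measurable_param_Rintegral _ _ _ _ R _ (fun z : (Rm * X) * (Fq * Fq) => Hi z.2 * sin (Theta (z.2, z.1)))); mea.
have mFr := integrable_measurable iFr.
have mFi := integrable_measurable iFi.
have mGr := integrable_measurable iGr.
have mGi := integrable_measurable iGi.
rewrite (eq_integral (fun y => (Yweight y * ((a y - e y) ^+ 2 + (b y + c y) ^+ 2))%:E)); last first.
  by move=> y _; have [-> ->] := ev_mul y.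
have m1 : measT (fun y => Yweight y * (a y ^+ 2 + b y ^+ 2)).
  by apply: measurable_funM => //; apply: measurable_funD; exact: measurable_funX.
have m2 : measT (fun y => Yweight y * (c y ^+ 2 + e y ^+ 2)).
  by apply: measurable_funM => //; apply: measurable_funD; exact: measurable_funX.
have c2 : measT (fun _ : Rm * X => 2 : R) by exact: measurable_cst.
have m12 := measurable_funM c2 m1.
have m22 := measurable_funM c2 m2.
have pos1 y : 0 <= Yweight y * (a y ^+ 2 + b y ^+ 2).
  by rewrite mulr_ge0 ?Yweight_ge0// addr_ge0// sqr_ge0.
have pos2 y : 0 <= Yweight y * (c y ^+ 2 + e y ^+ 2).
  by rewrite mulr_ge0 ?Yweight_ge0// addr_ge0// sqr_ge0.
apply: (@le_trans _ _ (\int[prod_measure leb (waveguide m n lam)]_y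
    (2 * (Yweight y * (a y ^+ 2 + b y ^+ 2)) + 2 * (Yweight y * (c y ^+ 2 + e y ^+ 2)))%:E)%E).
  apply: ge0_le_int.
  - apply: measurable_funM => //; apply: measurable_funD; apply: measurable_funX.
      exact: measurable_funB.
    exact: measurable_funD.
  - exact: measurable_funD.
  - by move=> y; rewrite mulr_ge0 ?Yweight_ge0// addr_ge0// sqr_ge0.
  - move=> y; have w0 := Yweight_ge0 y.
    have -> : 2 * (Yweight y * (a y ^+ 2 + b y ^+ 2)) + 2 * (Yweight y * (c y ^+ 2 + e y ^+ 2)) =
      Yweight y * (2 * (a y ^+ 2 + b y ^+ 2) + 2 * (c y ^+ 2 + e y ^+ 2)) by ring.
    apply: (ler_wpM2l w0).
    move: (a y) (b y) (c y) (e y) => a' b' c' e'.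
    have := sqr_ge0 (a' + e'); have := sqr_ge0 (b' - c'); rewrite !expr2; lra.
rewrite (ge0_intD _ m12 m22); [|by move=> y; rewrite mulr_ge0|by move=> y; rewrite mulr_ge0].
rewrite (ge0_intZl _ _ m1)// (ge0_intZl _ _ m2)//.
apply: (@le_trans _ _ (2%:E * (M%:E * \int[prod_measure fm fm]_x (Hr x ^+ 2)%:E) +
   2%:E * (M%:E * \int[prod_measure fm fm]_x (Hi x ^+ 2)%:E))%E).
  by apply: leeD; apply: lee_wpmul2l.
rewrite [X in (X + _ <= _)%E]muleA [X in (_ + X <= _)%E]muleA -!EFinM -ge0_muleDr; last 2 first.
- by apply: integral_ge0 => x _; rewrite lee_fin sqr_ge0.
- by apply: integral_ge0 => x _; rewrite lee_fin sqr_ge0.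
have q1 := measurable_funX 2 mHr; have q2 := measurable_funX 2 mHi.
have q3 : measT (fun xi => Fr xi ^+ 2 + Fi xi ^+ 2).
  exact: measurable_funD (measurable_funX 2 mFr) (measurable_funX 2 mFi).
have q4 : measT (fun xi => Gr xi ^+ 2 + Gi xi ^+ 2).
  exact: measurable_funD (measurable_funX 2 mGr) (measurable_funX 2 mGi).
rewrite -(ge0_intD _ q1 q2); [|by move=> ?; exact: sqr_ge0|by move=> ?; exact: sqr_ge0].
rewrite -(ge0_int_prod fm fm q3 q4); [|by move=> x; rewrite addr_ge0// sqr_ge0|by move=> x; rewrite addr_ge0// sqr_ge0].
apply: lee_wpmul2l; first by rewrite lee_fin mulr_ge0.
apply: eq_le; apply: eq_integral => p _; congr EFin.
by rewrite /Hr /Hi; ring.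
Qed.

End estimate.
End bilinear.

(** * Derivatives of the cutoff *)

Section cutoff.
Context (R : realType) (eta : R -> R).
Hypothesis heta : is_cutoff eta.

Lemma cutoff_derive k (x : R) : is_derive x (1 : R) (derive1n k eta) (derive1n k.+1 eta x).
Proof.
have [h _ _ _ _] := heta.
by apply: DeriveDef; [exact: h|rewrite /= derive1E].
Qed.

Lemma cutoff_continuous k : continuous (derive1n k eta).
Proof.
have [h _ _ _ _] := heta => x.
by apply/differentiable_continuous/derivable1_diffP; exact: h.
Qed.

(** The condition [2 < |x|] is open, so it persists near [x] and vanishing passes from each
    derivative to the next. *)
Lemma cutoff_support k (x : R) : 2 < `|x| -> derive1n k eta x = 0.
Proof.
have [_ _ _ _ h] := heta.
elim: k x => [|k ih] x hx; first exact/h/ltW.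
rewrite /= (_ : derive1 _ x = derive1 (cst (0:R)) x).
  by rewrite derive1_cst.
rewrite !derive1E; apply: near_eq_derive.
have : \forall y \near x, 2 < `|y|.
  have := @norm_continuous R R x; move/cvgrPdist_lt/(_ (`|x| - 2)).
  rewrite subr_gt0 => /(_ hx); apply: filterS => y.
  rewrite ltr_norml => /andP[h1 h2]; lra.
by apply: filterS => y; exact: ih.
Qed.

Lemma cutoff_bounded k : exists2 M, 0 <= M & forall x, `|derive1n k eta x| <= M.
Proof.
have cf : {within `[-2, 2], continuous (fun x => `|derive1n k eta x|)}.
  apply: continuous_subspaceT => x.
  exact: (continuous_comp (@cutoff_continuous k x) (@norm_continuous R R _)).
have le2 : (-2 : R) <= 2 by lra.
have [c _ hc] := EVT_max le2 cf.
exists `|derive1n k eta c| => // x.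
have [h|h] := leP `|x| 2; last by rewrite cutoff_support// normr0.
by apply: hc; rewrite in_itv /= -ler_norml.
Qed.
End cutoff.

Lemma is_derive_line (R : realType) (V W : normedModType R) (f : V -> W) (x v : V) (df : W) :
  is_derive (0 : R) 1 (fun h : R => f (h *: v + x)) df -> is_derive x v f df.
Proof.
move=> [h1 h2]; split; first exact/derivable1P.
rewrite -h2 /derive; set g1 := fun h => h^-1 *: _; set g2 := fun h => h^-1 *: _.
suff -> : g1 = g2 by [].
by rewrite funeqE /g1 /g2 => h /=; rewrite addr0 scale0r add0r [_%:A]mulr1.
Qed.

Section continuous_pointwise.
Context (R : realType) (T : topologicalType).
Implicit Types f g : T -> R.

Lemma continuous_mulf f g : continuous f -> continuous g -> continuous (fun x => f x * g x).
Proof. by move=> cf cg x; exact: (cvgM (cf x) (cg x)). Qed.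

Lemma continuous_addf f g : continuous f -> continuous g -> continuous (fun x => f x + g x).
Proof. by move=> cf cg x; exact: (cvgD (cf x) (cg x)). Qed.

Lemma continuous_cstf (c : R) : continuous (fun _ : T => c).
Proof. by move=> x; exact: cvg_cst. Qed.
End continuous_pointwise.

(** * Windowed plane waves as test functions *)

Section test_class.
Context (R : realType) (m n : nat) (lam : R) (eta : R -> R) (r : R).
Hypotheses (l0 : 0 < lam) (r0 : 0 < r) (heta : is_cutoff eta).
Local Notation V := 'rV[R]_(m + n).
Local Notation Fq := (frequency R m n).
Variable xi : Fq.

Definition freqv (i : 'I_(m + n)) : R :=
  match fintype.split i with inl i => tnth xi.1 i | inr j => (tnth xi.2 j)%:~R / lam end.

Definition vphase (v : V) : R := 2 * pi * \sum_(i < m + n) freqv i * v 0 i.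

(* [a i] is the order of the derivative falling on the [i]-th cutoff *)
Definition window (a : 'I_m -> nat) (v : V) : R :=
  \prod_(i < m) derive1n (a i) eta (v 0 (lshift n i) / r).

(** The shift [th] covers cosine and sine at once, and differentiating the wave amounts to adding
    [pi / 2] to it. *)
Definition wave (a : 'I_m -> nat) (th : R) (v : V) : R := window a v * cos (vphase v + th).

Definition incr (a : 'I_m -> nat) (i : 'I_m) : 'I_m -> nat := fun j => if j == i then (a j).+1 else a j.

Lemma line_coord (i j : 'I_(m + n)) (h : R) (v : V) :
  (h *: coord_vec R i + v) 0 j = (j == i)%:R * h + v 0 j.
Proof. by rewrite /coord_vec !mxE eqxx /= mulrC. Qed.

Lemma vphase_line i (h : R) (v : V) : vphase (h *: coord_vec R i + v) = 2 * pi * freqv i * h + vphase v.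
Proof.
rewrite /vphase (bigD1 i)//= [in RHS](bigD1 i)//=.
rewrite line_coord eqxx mul1r.
rewrite (eq_bigr (fun j => freqv j * v 0 j)); last first.
  by move=> j /negbTE ji; rewrite line_coord ji mul0r add0r.
ring.
Qed.

Lemma wave_derive_l a th (i : 'I_m) (v : V) : is_derive v (coord_vec R (lshift n i)) (wave a th)
  (r^-1 * wave (incr a i) th v + 2 * pi * freqv (lshift n i) * wave a (th + pi / 2) v).
Proof.
apply: is_derive_line.
pose C := \prod_(j < m | j != i) derive1n (a j) eta (v 0 (lshift n j) / r).
pose w := v 0 (lshift n i); pose al := 2 * pi * freqv (lshift n i).
rewrite (_ : (fun h => _) = fun h : R => C * derive1n (a i) eta (r^-1 * h + w / r) * cos (al * h + (vphase v + th))); last first.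
  apply/funext => h; rewrite /wave vphase_line addrA; congr (_ * _).
  rewrite /window (bigD1 i)//= line_coord eqxx mul1r mulrC; congr (_ * _).
    by apply: eq_bigr => j /negbTE ji; rewrite line_coord (inj_eq (@lshift_inj _ _)) ji mul0r add0r.
  by congr (derive1n _ _ _); rewrite /w; ring.
have d1 := cutoff_derive heta (a i).
apply: is_derive_eq.
rewrite /GRing.scale /= !mulr0 !add0r mulr1 /wave /window.
rewrite (bigD1 i)//= [X in _ = _ + _ * (X * _)](bigD1 i)//= -/C -/w {1}/incr eqxx.
rewrite (_ : \prod_(j < m | j != i) derive1n (incr a i j) eta (v 0 (lshift n j) / r) = C); last first.
  by apply: eq_bigr => j /negbTE ji; rewrite /incr ji.
rewrite addrA cosDpihalf -/al -derive1nS.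
ring.
Qed.

Lemma wave_derive_r a th (j : 'I_n) (v : V) : is_derive v (coord_vec R (rshift m j)) (wave a th)
  (2 * pi * freqv (rshift m j) * wave a (th + pi / 2) v).
Proof.
apply: is_derive_line.
pose C := window a v; pose al := 2 * pi * freqv (rshift m j).
rewrite (_ : (fun h => _) = fun h : R => C * cos (al * h + (vphase v + th))); last first.
  apply/funext => h; rewrite /wave vphase_line addrA; congr (_ * _).
  by apply: eq_bigr => i _; rewrite line_coord eq_lrshift mul0r add0r.
apply: is_derive_eq.
rewrite /GRing.scale /= !mulr0 !add0r mulr1 /wave addrA cosDpihalf -/al -/C; ring.
Qed.

(** The linear span of the windowed waves. It is stable under every partial derivative, so
    smoothness to all orders reduces to continuity and derivability of its members. *)
Inductive tfun : (V -> R) -> Prop :=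
| tfun_wave a th : tfun (wave a th)
| tfun_add f g : tfun f -> tfun g -> tfun (fun v => f v + g v)
| tfun_scale c f : tfun f -> tfun (fun v => c * f v).

Lemma continuous_wave a th : continuous (wave a th).
Proof.
have cc i : continuous (fun v : V => v 0 i) by exact: coord_continuous.
have cw : continuous (window a).
  apply: (@continuous_big R _ *%R 1 predT (@mul_continuous R) V _
    (fun i v => derive1n (a i) eta (v 0 (lshift n i) / r))) => i _ v.
  apply: (@continuous_comp _ _ _ (fun v : V => v 0 (lshift n i) / r) (derive1n (a i) eta)).
    exact: (continuous_mulf (cc _) (@continuous_cstf R V r^-1)).
  exact: cutoff_continuous.
have cp : continuous vphase.
  apply: (continuous_mulf (@continuous_cstf R V (2 * pi))).
  apply: (@continuous_big R _ +%R 0 predT (@add_continuous R) V _ (fun i v => freqv i * v 0 i)) => i _.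
  exact: (continuous_mulf (@continuous_cstf R V (freqv i)) (cc i)).
apply: (continuous_mulf cw) => v.
apply: (@continuous_comp _ _ _ (fun v : V => vphase v + th) cos); last exact: continuous_cos.
exact: (continuous_addf cp (@continuous_cstf R V th)).
Qed.

Lemma tfun_continuous f : tfun f -> continuous f.
Proof.
elim=> [a th|{}f g _ cf _ cg|c {}f _ cf]; first exact: continuous_wave.
  exact: continuous_addf.
exact: (continuous_mulf (@continuous_cstf R V c) cf).
Qed.

Lemma tfun_derivable f i v : tfun f -> derivable f v (coord_vec R i).
Proof.
elim=> [a th|{}f g _ df _ dg|c {}f _ df].
- case: (fintype.splitP i) => [j|j] e.
    have -> : i = lshift n j by exact/val_inj.
    by have [] := wave_derive_l a th j v.
  have -> : i = rshift m j by exact/val_inj.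
  by have [] := wave_derive_r a th j v.
- exact: (derivableD df dg).
- exact: (derivableM (derivable_cst c v (coord_vec R i)) df).
Qed.

Lemma partial_wave_l a th (i : 'I_m) : partial (lshift n i) (wave a th) = fun v =>
  r^-1 * wave (incr a i) th v + 2 * pi * freqv (lshift n i) * wave a (th + pi / 2) v.
Proof. by apply/funext => v; have [_] := wave_derive_l a th i v. Qed.

Lemma partial_wave_r a th (j : 'I_n) : partial (rshift m j) (wave a th) = fun v =>
  2 * pi * freqv (rshift m j) * wave a (th + pi / 2) v.
Proof. by apply/funext => v; have [_] := wave_derive_r a th j v. Qed.

Lemma partialD i f g : tfun f -> tfun g ->
  partial i (fun v => f v + g v) = fun v => partial i f v + partial i g v.
Proof.
by move=> tf tg; apply/funext => v; rewrite /partial; exact: (deriveD (@tfun_derivable f i v tf) (@tfun_derivable g i v tg)).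
Qed.

Lemma partialZ i c f : tfun f -> partial i (fun v => c * f v) = fun v => c * partial i f v.
Proof. by move=> tf; apply/funext => v; rewrite /partial; exact: (deriveMl c (@tfun_derivable f i v tf)). Qed.

Lemma tfun_partial i f : tfun f -> tfun (partial i f).
Proof.
elim=> [a th|{}f g tf df tg dg|c {}f tf df].
- case: (fintype.splitP i) => [j|j] e.
    have -> : i = lshift n j by exact/val_inj.
    by rewrite partial_wave_l; apply: tfun_add; apply: tfun_scale; exact: tfun_wave.
  have -> : i = rshift m j by exact/val_inj.
  by rewrite partial_wave_r; apply: tfun_scale; exact: tfun_wave.
- by rewrite partialD//; exact: tfun_add.
- by rewrite partialZ//; exact: tfun_scale.
Qed.

Lemma tfun_smooth f : tfun f -> smooth f.
Proof.
move=> tf s; have ts : tfun (foldr (@partial R m n) f s).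
  by elim: s => //= i s ih; exact: tfun_partial.
by split; [exact: tfun_continuous|move=> i v; exact: tfun_derivable].
Qed.

(** Periodicity holds because the frequencies in the torus directions are integers over [lam];
    vanishing for large [x] comes from the window. *)
Lemma wave_test a th : test_function lam (wave a th).
Proof.
split.
- exact/tfun_smooth/tfun_wave.
- move=> j v; rewrite addrC /wave vphase_line; congr (_ * _).
    by apply: eq_bigr => i _; rewrite line_coord eq_lrshift mul0r add0r.
  rewrite /freqv (_ : fintype.split _ = inr j); last first.
    by rewrite -[rshift m j]/(unsplit (inr j)) unsplitK.
  rewrite (_ : _ * lam + _ + th = 2 * pi * (tnth xi.2 j)%:~R + (vphase v + th)).
    by rewrite cos_shift.
  by field; rewrite gt_eqF.
- exists (2 * r) => v i hi; rewrite /wave /window (bigD1 i)//= cutoff_support ?mul0r//.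
  by rewrite normrM normfV (gtr0_norm r0) ltr_pdivlMr.
Qed.

Definition cst0 : 'I_m -> nat := fun=> 0%N.
Definition bump2 (i : 'I_m) := incr (incr cst0 i) i.

Lemma wave_pi a th v : wave a (th + pi / 2 + pi / 2) v = - wave a th v.
Proof.
rewrite /wave (_ : vphase v + _ = (vphase v + th) + pi); last by field.
by rewrite cosDpi mulrN.
Qed.

Lemma laplacian_wave th : laplacian (wave cst0 th) = fun v =>
  - (4 * pi ^+ 2 * nsq lam xi) * wave cst0 th v +
  \sum_(i < m) (r ^- 2 * wave (bump2 i) th v +
     4 * pi * r^-1 * tnth xi.1 i * wave (incr cst0 i) (th + pi / 2) v).
Proof.
apply/funext => v; rewrite /laplacian big_split_ord /=.
have fl i : freqv (lshift n i) = tnth xi.1 i.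
  by rewrite /freqv -[lshift n i]/(unsplit (inl i)) unsplitK.
have fr j : freqv (rshift m j) = (tnth xi.2 j)%:~R / lam.
  by rewrite /freqv -[rshift m j]/(unsplit (inr j)) unsplitK.
rewrite (eq_bigr (fun i => (r ^- 2 * wave (bump2 i) th v +
     4 * pi * r^-1 * tnth xi.1 i * wave (incr cst0 i) (th + pi / 2) v) -
     4 * pi ^+ 2 * wave cst0 th v * tnth xi.1 i ^+ 2)); last first.
  move=> i _; rewrite partial_wave_l partialD; [|exact/tfun_scale/tfun_wave|exact/tfun_scale/tfun_wave].
  rewrite !partialZ; [|exact: tfun_wave|exact: tfun_wave].
  by rewrite !partial_wave_l wave_pi fl -/(bump2 i); field; rewrite gt_eqF.
rewrite [X in _ + X](eq_bigr (fun j => - (4 * pi ^+ 2 * wave cst0 th v * ((tnth xi.2 j)%:~R / lam) ^+ 2))); last first.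
  move=> j _; rewrite partial_wave_r partialZ; last exact: tfun_wave.
  by rewrite !partial_wave_r wave_pi fr; ring.
rewrite sumrB sumrN -!mulr_sumr /nsq /quad.
rewrite [X in _ = - (_ * (X + _)) * _ + _](eq_bigr (fun i => tnth xi.1 i ^+ 2)); last by move=> i _; rewrite subr0.
rewrite [X in _ = - (_ * (_ + X)) * _ + _](eq_bigr (fun i => ((tnth xi.2 i)%:~R / lam) ^+ 2)); last by move=> i _; rewrite subr0.
ring.
Qed.

End test_class.

(** * Square-integrable functions and convergence to zero *)

Section square_integrable.
Context d (T : measurableType d) (R : realType) (mu : {measure set T -> \bar R}).
Implicit Types f g : T -> R.

Definition sqint f : Prop := measT f /\ mu.-intT ((fun x => f x ^+ 2)).

Lemma sqint_mul f g : sqint f -> sqint g -> mu.-intT ((fun x => f x * g x)).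
Proof.
move=> [mf jf] [mg jg]; apply: (integrable_dom _ (integrable_D jf jg)); first exact: measurable_funM.
move=> x; rewrite normrM [leRHS]ger0_norm ?addr_ge0 ?sqr_ge0//.
rewrite -[f x ^+ 2]real_normK ?num_real// -[g x ^+ 2]real_normK ?num_real//.
have := sqr_ge0 (`|f x| - `|g x|); have := mulr_ge0 (normr_ge0 (f x)) (normr_ge0 (g x)).
rewrite !expr2; lra.
Qed.

Lemma sqint_add f g : sqint f -> sqint g -> sqint (fun x => f x + g x).
Proof.
move=> sf sg; have [mf jf] := sf; have [mg jg] := sg.
split; first exact: measurable_funD.
rewrite (_ : _ \o _ = EFin \o (fun x => (f x ^+ 2 + (f x * g x + f x * g x)) + g x ^+ 2)); last first.
  by apply/funext => x /=; congr EFin; ring.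
by apply: integrable_D => //; apply: integrable_D => //; apply: integrable_D; exact: sqint_mul.
Qed.

Lemma sqint_scale c f : sqint f -> sqint (fun x => c * f x).
Proof.
move=> [mf jf]; split; first by apply: measurable_funM => //; exact: measurable_cst.
rewrite (_ : _ \o _ = EFin \o (fun x => c ^+ 2 * f x ^+ 2)); last first.
  by apply/funext => x /=; congr EFin; rewrite exprMn.
exact: (integrableZl measurableT (c ^+ 2) jf).
Qed.

Lemma sqint_sub f g : sqint f -> sqint g -> sqint (fun x => f x - g x).
Proof.
move=> sf sg; rewrite (_ : (fun x => _) = fun x => f x + (-1) * g x).
  by apply: sqint_add => //; exact: sqint_scale.
by apply/funext => x; rewrite mulN1r.
Qed.

Lemma sqint_dom f g M : sqint f -> measT g -> (forall x, `|g x| <= M) ->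
  sqint (fun x => f x * g x).
Proof.
move=> [mf jf] mg gM; split; first exact: measurable_funM.
have jM := integrableZl measurableT (M ^+ 2) jf.
apply: (integrable_dom _ (g := fun x => M ^+ 2 * f x ^+ 2)) => //.
  by apply: measurable_funX; exact: measurable_funM.
move=> x; rewrite exprMn mulrC !normrM ler_wpM2r//.
by apply: ler_pM => //; apply: (le_trans (gM x)); exact: ler_norm.
Qed.

Lemma Rint_ge0 f : (forall x, 0 <= f x) -> 0 <= \int[mu]_x f x.
Proof. by move=> f0; apply: Rintegral_ge0. Qed.

Lemma cauchy_schwarz f g : sqint f -> sqint g ->
  (\int[mu]_x (f x * g x)) ^+ 2 <= (\int[mu]_x f x ^+ 2) * (\int[mu]_x g x ^+ 2).
Proof.
move=> sf sg; have [mf jf] := sf; have [mg jg] := sg; have jfg := sqint_mul sf sg.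
set a := \int[mu]_x f x ^+ 2; set b := \int[mu]_x (f x * g x); set c := \int[mu]_x g x ^+ 2.
have quadE t : 0 <= a + 2 * t * b + t ^+ 2 * c.
  have -> : a + 2 * t * b + t ^+ 2 * c = \int[mu]_x (f x + t * g x) ^+ 2.
    rewrite (_ : (fun x => (f x + t * g x) ^+ 2) = fun x => (f x ^+ 2 + 2 * t * (f x * g x)) + t ^+ 2 * g x ^+ 2); last first.
      by apply/funext => x; ring.
    have j1 := integrableZl measurableT (2 * t) jfg.
    have j2 := integrableZl measurableT (t ^+ 2) jg.
    rewrite RintD//; last exact: integrable_D.
    by rewrite RintD// !RintegralZl.
  by apply: Rint_ge0 => x; exact: sqr_ge0.
have a0 : 0 <= a by apply: Rint_ge0 => x; exact: sqr_ge0.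
have c0 : 0 <= c by apply: Rint_ge0 => x; exact: sqr_ge0.
have [cz|cn] := eqVneq c 0.
  have [->|bn] := eqVneq b 0; first by rewrite expr0n /= mulr_ge0.
  (* For [c = 0] and [b] nonzero the quadratic is affine in [t]; this [t] would give it the value
     -1. *)
  have := quadE (- (a + 1) / (2 * b)); rewrite cz mulr0 addr0.
  have -> : 2 * (- (a + 1) / (2 * b)) * b = - (a + 1) by field.
  lra.
have cp : 0 < c by rewrite lt0r cn.
have := quadE (- b / c).
have -> : a + 2 * (- b / c) * b + (- b / c) ^+ 2 * c = (a * c - b ^+ 2) / c by field.
by rewrite pmulr_lge0 ?invr_gt0// subr_ge0.
Qed.
End square_integrable.

Section L2norm_square.
Context d (T : measurableType d) (R : realType) (mu : {measure set T -> \bar R}).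
Implicit Type f : T -> R[i].

Definition n2 f : \bar R := (\int[mu]_z (complex.Re (f z) ^+ 2 + complex.Im (f z) ^+ 2)%:E)%E.

Lemma normc_sqr (z : R[i]) : Normc.normc z ^+ 2 = complex.Re z ^+ 2 + complex.Im z ^+ 2.
Proof. by case: z => a b /=; rewrite sqr_sqrtr// addr_ge0// sqr_ge0. Qed.

Lemma normc_ge0 (z : R[i]) : 0 <= Normc.normc z.
Proof. by case: z => a b /=; exact: sqrtr_ge0. Qed.

Lemma n2_ge0 f : (0 <= n2 f)%E.
Proof. by apply: integral_ge0 => z _; rewrite lee_fin addr_ge0// sqr_ge0. Qed.

Lemma L2normE f : L2norm mu f = poweR (n2 f) (2^-1).
Proof.
rewrite /L2norm unlock; congr (poweR _ _); apply: eq_integral => z _.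
rewrite gee0_abs ?lee_fin ?normc_ge0// poweR_EFin; congr EFin.
by rewrite -normc_sqr -powR_mulrn ?normc_ge0.
Qed.

Lemma L2norm_sqr f : poweR (L2norm mu f) 2 = n2 f.
Proof.
rewrite L2normE -poweRrM mulVf ?pnatr_eq0// poweRe1//; exact: n2_ge0.
Qed.

Lemma n2_lty f : (L2norm mu f < +oo)%E -> (n2 f < +oo)%E.
Proof. by rewrite -L2norm_sqr => h; rewrite poweR_lty. Qed.

Lemma in_L2_sqint f : in_L2 mu f -> [/\ sqint mu (fun z => complex.Re (f z)),
  sqint mu (fun z => complex.Im (f z)) & (n2 f < +oo)%E].
Proof.
move=> [[mr mi] /n2_lty f2].
have m2 : measT (fun z => complex.Re (f z) ^+ 2 + complex.Im (f z) ^+ 2).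
  by apply: measurable_funD; exact: measurable_funX.
have j2 : mu.-intT ((fun z => complex.Re (f z) ^+ 2 + complex.Im (f z) ^+ 2)).
  apply/integrableP; split; first exact/measurable_EFinP.
  rewrite (eq_integral (fun z => (complex.Re (f z) ^+ 2 + complex.Im (f z) ^+ 2)%:E))// => z _ /=.
  by rewrite ger0_norm// addr_ge0// sqr_ge0.
split=> //; split=> //; apply: (integrable_dom _ j2); try exact: measurable_funX.
  by move=> z; rewrite !ger0_norm ?addr_ge0 ?sqr_ge0// lerDl sqr_ge0.
by move=> z; rewrite !ger0_norm ?addr_ge0 ?sqr_ge0// lerDr sqr_ge0.
Qed.
End L2norm_square.

Section vanish.
Context (R : realType).
Implicit Types x y : nat -> \bar R.

(** For nonnegative sequences this is convergence to zero; finitely many terms may be infinite. *)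
Definition vanish x : Prop :=
  forall e : R, 0 < e -> exists K, forall k, (K <= k)%N -> (x k <= e%:E)%E.

Lemma vanish_le x y : vanish y -> (forall k, x k <= y k)%E -> vanish x.
Proof. by move=> vy xy e e0; have [K h] := vy e e0; exists K => k Kk; exact: le_trans (xy k) (h k Kk). Qed.

Lemma vanishD x y : vanish x -> vanish y -> vanish (fun k => x k + y k)%E.
Proof.
move=> vx vy e e0; have e2 : 0 < e / 2 by rewrite divr_gt0.
have [K1 h1] := vx _ e2; have [K2 h2] := vy _ e2.
exists (maxn K1 K2) => k; rewrite geq_max => /andP[k1 k2].
by rewrite [e]splitr EFinD; apply: leeD; [exact: h1|exact: h2].
Qed.

Lemma vanishZ c x : 0 <= c -> vanish x -> vanish (fun k => c%:E * x k)%E.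
Proof.
move=> c0 vx e e0; have c1 : 0 < c + 1 by lra.
have [K h] := vx _ (divr_gt0 e0 c1).
exists K => k Kk; apply: (@le_trans _ _ (c%:E * (e / (c + 1))%:E)%E).
  by apply: lee_wpmul2l => //; exact: h.
rewrite -EFinM lee_fin mulrCA ler_piMr//; first exact: ltW.
by rewrite ler_pdivrMr// mul1r; lra.
Qed.

Lemma cvg_vanish (x : R -> \bar R) : (forall r, 0 <= x r)%E -> (x r @[r --> +oo%R] --> 0)%E ->
  vanish (fun k => x k%:R).
Proof.
move=> x0 cx e e0.
have ev : \forall y \near (0%E : \bar R), (y < e%:E)%E.
  by apply: (open_nbhs_nbhs (A := [set y | (y < e%:E)%E])); split; [exact: open_ereal_lt_ereal|rewrite /= lte_fin].
have [M [Mr hM]] := cx _ ev.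
exists (Num.bound `|M|) => k Kk; apply/ltW; apply: hM.
apply: (le_lt_trans (ler_norm M)); apply: (lt_le_trans (archi_boundP (normr_ge0 M))).
by rewrite ler_nat.
Qed.

End vanish.

(** * Transforms of windowed functions *)

Section windows.
Context (R : realType) (m n : nat) (lam : R) (eta : R -> R).
Hypotheses (l0 : 0 < lam) (heta : is_cutoff eta).
Local Notation leb := (lebesgue R).
Local Notation Rm := (measurableTypeR R).
Local Notation X := (phys_point R m n).
Local Notation Fq := (frequency R m n).
Local Notation W := (waveguide m n lam).

Definition win (r : R) (a : 'I_m -> nat) (z : X) : R :=
  \prod_(i < m) derive1n (a i) eta (tnth z.1 i / r).

Lemma measurable_win r a : measT (win r a).
Proof.
apply: (measurableT_comp (f := fun t : m.-tuple Rm => \prod_(i < m) derive1n (a i) eta (tnth t i / r))); last by mea.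
apply: (@measurable_tensor _ Rm _ _ (fun i x => derive1n (a i) eta (x / r))) => i.
apply: measurableT_comp; last by mea.
apply: continuous_measurable_fun; exact: (@cutoff_continuous _ _ heta (a i)).
Qed.

Lemma win_bounded a : exists2 M, 0 <= M & forall r z, `|win r a z| <= M.
Proof.
pose P (i : 'I_m) M := 0 <= M /\ forall x, `|derive1n (a i) eta x| <= M.
have /choice[M hM] : forall i, exists M, P i M.
  by move=> i; have [M M0 h] := cutoff_bounded heta (a i); exists M.
exists (\prod_(i < m) M i) => [|r z]; first by apply: prodr_ge0 => i _; have [] := hM i.
rewrite normr_prod; apply: ler_prod => i _; rewrite normr_ge0 /=.
by have [_] := hM i; apply.
Qed.

Lemma waveguide_box (D : R) : 0 <= D ->
  (W [set z : X | forall i, (`|tnth z.1 i| <= D)%R] <= ((2 * D) ^+ m * lam ^+ n)%:E)%E.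
Proof.
move=> D0.
pose I : set Rm := band 0 D.
have mI : measurable I by exact: measurable_band.
have IE : [set z : X | forall i, `|tnth z.1 i| <= D] = [set t | forall i, I (tnth t i)] `*` setT.
  by apply/seteqP; split => z; rewrite /I /band /= => h; [split=> // i|case: h => h _ i]; have := h i; rewrite subr0.
have mB : measurable [set t : m.-tuple Rm | forall i, I (tnth t i)] by exact: measurable_power_box.
rewrite IE [X in (X <= _)%E](_ : _ = prod_measure (power_measure leb m)
  (power_measure (interval_measure `[0, lam]) n) ([set t | forall i, I (tnth t i)] `*` setT))//.
rewrite /prod_measure product_measure1E// EFinM.
apply: lee_pmul => //.
  by apply: power_box => //; [exact: band_le|rewrite mulr_ge0].
rewrite (_ : setT = [set t : n.-tuple Rm | forall i, [set: Rm] (tnth t i)]); last by apply/seteqP; split.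
apply: power_box => //; last exact: ltW.
rewrite [X in (X <= _)%E](_ : _ = leb ([set: Rm] `&` `[0, lam]%classic))//.
by rewrite setTI; apply: itv_leb_le; [exact: ltW|rewrite subr0].
Qed.

Lemma measurable_phys_box (D : R) : measurable [set z : X | forall i, `|tnth z.1 i| <= D].
Proof.
apply: (@measurable_all _ _ _ (fun i => [set z : X | `|tnth z.1 i| <= D])) => i.
by apply: measurable_set_le; [apply: measurable_normr|]; mea.
Qed.

Lemma sqint_bounded (g : X -> R) (M D : R) : measT g -> 0 <= D ->
  (forall z, `|g z| <= M) -> (forall z, ~ (forall i, `|tnth z.1 i| <= D) -> g z = 0) -> sqint W g.
Proof.
move=> mg D0 gM gD; split=> //.
apply/integrableP; split; first by apply/measurable_EFinP; exact: measurable_funX.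
apply: (@le_lt_trans _ _ (M ^+ 2 * ((2 * D) ^+ m * lam ^+ n))%:E); last exact: ltry.
apply: (@integral_le_box _ _ _ W _ [set z : X | forall i, `|tnth z.1 i| <= D]).
- by apply: measurableT_comp => //; apply/measurable_EFinP; exact: measurable_funX.
- exact: measurable_phys_box.
- by [].
- move=> z _ /=; rewrite lee_fin normrX -real_normK ?num_real// !normr_id.
  by rewrite -[leRHS]real_normK ?num_real// ler_pXn2r ?nnegrE//; apply: (le_trans (gM z)); exact: ler_norm.
- by move=> z /gD h /=; rewrite h expr0n /= normr0.
- exact: sqr_ge0.
- exact: waveguide_box.
Qed.

Lemma sqint_win r a : 0 < r -> sqint W (win r a).
Proof.
move=> r0; have [M _ hM] := win_bounded a.
apply: (@sqint_bounded _ M (2 * r)) => //; first exact: measurable_win.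
  by rewrite mulr_ge0// ltW.
move=> z /existsNP[i /negP]; rewrite -ltNge => h.
rewrite /win (bigD1 i)//= cutoff_support ?mul0r//.
by rewrite normrM normfV (gtr0_norm r0) ltr_pdivlMr.
Qed.

Lemma integrable_win r a v : 0 < r -> sqint W v -> W.-intT ((fun z => v z * win r a z)).
Proof. by move=> r0 sv; apply: sqint_mul => //; exact: sqint_win. Qed.

(** The derivatives of the cutoff are evaluated at [x / r] without the factors of the chain rule, so
    their bounds, and with them the constant, do not depend on the scale [r]. *)
Lemma bessel_win a : exists2 K, 0 <= K & forall r v B, 0 < r -> sqint W v ->
  (\int[freqm m n lam]_(xi in fbox B) (ctr lam (fun z => v z * win r a z) xi ^+ 2 +
      str lam (fun z => v z * win r a z) xi ^+ 2)%:E <= K%:E * \int[W]_z (v z ^+ 2)%:E)%E.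
Proof.
have [M M0 hM] := win_bounded a.
exists (2 ^+ (m + n) * 32 ^+ m * M ^+ 2) => [|r v B r0 sv].
  by rewrite !mulr_ge0 ?exprn_ge0.
apply: (le_trans (bessel l0 _ (integrable_win _ r0 sv))).
rewrite [(_ * M ^+ 2)%:E]EFinM -muleA; apply: lee_wpmul2l; first by rewrite lee_fin mulr_ge0 ?exprn_ge0.
have [mv _] := sv.
rewrite -ge0_intZl ?sqr_ge0//; last 2 first.
- exact: measurable_funX.
- by move=> z; exact: sqr_ge0.
apply: ge0_le_int.
- by apply: measurable_funX; apply: measurable_funM => //; exact: measurable_win.
- by apply: measurable_funM; [exact: measurable_cst|exact: measurable_funX].
- by move=> z; exact: sqr_ge0.
- move=> z; rewrite exprMn mulrC ler_wpM2r ?sqr_ge0//.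
  by rewrite -[leLHS]real_normK ?num_real// ler_pXn2r ?nnegrE.
Qed.
End windows.

Lemma sum_sqr_le (R : realType) m (y : 'I_m -> R) :
  (\sum_(i < m) y i) ^+ 2 <= 2 ^+ m * \sum_(i < m) y i ^+ 2.
Proof.
elim: m y => [|m ih] y; first by rewrite !big_ord0 expr0n mulr0.
rewrite !big_ord_recl [2 ^+ m.+1]exprS.
have := ih (fun i => y (lift ord0 i)).
set S := \sum_(i < m) _; set Q := \sum_(i < m) _ => h.
have h1 : 1 <= (2 : R) ^+ m by rewrite exprn_ege1// ler1n.
have := ler_wpM2r (sqr_ge0 (y ord0)) h1.
have := sqr_ge0 (y ord0 - S); rewrite mul1r => ? ?.
apply: (@le_trans _ _ (2 * y ord0 ^+ 2 + 2 * S ^+ 2)).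
  by rewrite -subr_ge0 (_ : _ - _ = (y ord0 - S) ^+ 2)// ; ring.
lra.
Qed.

Lemma Rint_sum d (T : measurableType d) (R : realType) (mu : {measure set T -> \bar R})
    m (f : 'I_m -> T -> R) : (forall i, mu.-intT (f i)) ->
  mu.-intT ((fun x => \sum_(i < m) f i x)) /\
  \int[mu]_x (\sum_(i < m) f i x) = \sum_(i < m) \int[mu]_x f i x.
Proof.
elim: m f => [|m ih] f jf.
  under eq_fun do rewrite big_ord0.
  rewrite big_ord0 /Rintegral integral0; split=> //.
  by rewrite (_ : _ \o _ = cst 0%E); [exact: integrable0|exact/funext].
have [j1 e1] := ih (fun i => f (lift ord0 i)) (fun i => jf _).
rewrite (_ : (fun x => _) = fun x => f ord0 x + \sum_(i < m) f (lift ord0 i) x); last first.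
  by apply/funext => x; rewrite big_ord_recl.
split; first exact: integrable_D.
by rewrite RintD// e1 big_ord_recl.
Qed.

(** * The differential equation of a windowed transform *)

Section increment.
Context (R : realType).
Local Notation leb := (lebesgue R).
Local Notation Rm := (measurableTypeR R).

(** The fundamental theorem of calculus followed by the Cauchy-Schwarz inequality against the
    constant 1. *)
Lemma increment_sqr (f F : R -> R) (t : R) : 0 <= t -> antiderivative F f -> continuous f ->
  (((F t - F 0) ^+ 2)%:E <= t%:E * \int[interval_measure `[0%R, t]]_s (f s ^+ 2)%:E)%E.
Proof.
move=> t0 dF cf; pose mu := @interval_measure R `[0, t].
have cI (g : R -> R) : continuous g -> mu.-intT ((g : Rm -> R)).
  move=> cg; apply: integrable_restr.
    by apply/measurable_EFinP; exact: continuous_measurable_fun.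
  apply: continuous_compact_integrable; first exact: segment_compact.
  exact: continuous_subspaceT.
have c2 : continuous (fun s => f s ^+ 2).
  by rewrite (_ : (fun s => _) = fun s => f s * f s)//; exact: continuous_mulf.
have sf : sqint mu (f : Rm -> R) by split; [exact: continuous_measurable_fun|exact: cI].
have s1 : sqint mu (fun _ : Rm => 1 : R).
  split; first exact: measurable_cst.
  by apply: (cI (fun=> 1 ^+ 2)); exact: continuous_cstf.
have mass : \int[mu]_x ((1 : R) ^+ 2) = t.
  have i1 := cI (fun=> 1 ^+ 2) (@continuous_cstf _ _ _).
  apply: EFin_inj; rewrite EFinRint// integral_restr//; last first.
    apply: (@continuous_compact_integrable R (fun=> 1 ^+ 2)); first exact: segment_compact.
    by apply: continuous_subspaceT; exact: continuous_cstf.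
  rewrite integral_cst// expr1n mul1e.
  by apply: (etrans (itv_leb t0)); rewrite subr0.
have inc : \int[mu]_x (f x * 1) = F t - F 0.
  under eq_Rintegral do rewrite mulr1.
  apply: EFin_inj; rewrite EFinRint; last exact: cI.
  rewrite -(ftc t0 dF cf) integral_restr//.
    by apply/measurable_EFinP; exact: continuous_measurable_fun.
  by apply: continuous_compact_integrable; [exact: segment_compact|exact: continuous_subspaceT].
have := cauchy_schwarz sf s1; rewrite inc mass => h.
have i2 : mu.-intT ((fun x => f x ^+ 2 : R)) by exact: cI.
rewrite -(EFinRint i2) -EFinM lee_fin mulrC.
exact: h.
Qed.
End increment.

Section flow.
Context (R : realType) (m n : nat) (lam : R) (eta : R -> R).
Hypotheses (l0 : 0 < lam) (heta : is_cutoff eta).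
Local Notation leb := (lebesgue R).
Local Notation Rm := (measurableTypeR R).
Local Notation X := (phys_point R m n).
Local Notation Fq := (frequency R m n).
Local Notation W := (waveguide m n lam).
Local Notation cst0 := (@cst0 m).

Definition wct (r : R) (a : 'I_m -> nat) (v : X -> R) (xi : Fq) : R := ctr lam (fun z => v z * win eta r a z) xi.
Definition wst (r : R) (a : 'I_m -> nat) (v : X -> R) (xi : Fq) : R := str lam (fun z => v z * win eta r a z) xi.

Lemma wave_coord r (xi : Fq) a th (z : X) : wave lam eta r xi a th (coordinates z) =
  win eta r a z * cos (phase lam z xi + th).
Proof.
rewrite /wave /window /win; congr (_ * cos (_ + _)).
  by apply: eq_bigr => i _; rewrite /coordinates row_mxEl mxE.
rewrite /vphase /phase /freq_dot big_split_ord; congr (_ * (_ + _)); apply: eq_bigr => i _.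
  by rewrite /coordinates row_mxEl mxE /freqv -[lshift n i]/(unsplit (inl i)) unsplitK mulrC.
by rewrite /coordinates row_mxEr mxE /freqv -[rshift m i]/(unsplit (inr i)) unsplitK mulrC.
Qed.

Section data.
Variables (r : R) (r0 : 0 < r).

Let mph (xi : Fq) : measT (fun z : X => phase lam z xi).
Proof. by apply: (measurableT_comp (@measurable_phase R m n lam) (_ : measT (fun z => (z, xi)))); mea. Qed.

Lemma integrable_wave (xi : Fq) a th v : sqint W v ->
  W.-intT ((fun z => v z * wave lam eta r xi a th (coordinates z))).
Proof.
move=> sv; rewrite (_ : _ \o _ = EFin \o (fun z => (v z * win eta r a z) * cos (phase lam z xi + th))); last first.
  by apply/funext => z /=; rewrite wave_coord mulrA.
apply: integrable_mulcos; first exact: integrable_win.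
by apply: measurable_funD; [exact: mph|exact: measurable_cst].
Qed.

Lemma pair_wave (xi : Fq) a th v : sqint W v ->
  \int[W]_z (v z * wave lam eta r xi a th (coordinates z)) =
  wct r a v xi * cos th - wst r a v xi * sin th.
Proof.
move=> sv; have iv := integrable_win l0 heta a r0 sv.
have jc := integrable_mulcos iv (mph xi); have js := integrable_mulsin iv (mph xi).
rewrite /wct /wst /ctr /str -!RintegralZr// -RintB.
- by apply: eq_Rintegral => z _; rewrite wave_coord cosD; ring.
- exact: (integrableZr measurableT _ jc).
- exact: (integrableZr measurableT _ js).
Qed.

Definition err (xi : Fq) (th : R) (v : X -> R) : R := \sum_(i < m)
  (r ^- 2 * \int[W]_z (v z * wave lam eta r xi (bump2 i) th (coordinates z)) +
   4 * pi * r^-1 * tnth xi.1 i *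
     \int[W]_z (v z * wave lam eta r xi (incr cst0 i) (th + pi / 2) (coordinates z))).

Lemma pair_laplacian (xi : Fq) th v : sqint W v ->
  \int[W]_z (v z * laplacian (wave lam eta r xi cst0 th) (coordinates z)) =
  - (4 * pi ^+ 2 * nsq lam xi) * \int[W]_z (v z * wave lam eta r xi cst0 th (coordinates z)) +
  err xi th v.
Proof.
move=> sv; rewrite laplacian_wave//.
pose g i z := r ^- 2 * (v z * wave lam eta r xi (bump2 i) th (coordinates z)) +
   4 * pi * r^-1 * tnth xi.1 i * (v z * wave lam eta r xi (incr cst0 i) (th + pi / 2) (coordinates z)).
have j1 i := integrableZl measurableT (r ^- 2) (integrable_wave xi (bump2 i) th sv).
have j2 (i : 'I_m) := integrableZl measurableT (4 * pi * r^-1 * tnth xi.1 i) (integrable_wave xi (incr cst0 i) (th + pi / 2) sv).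
have jg i : W.-intT (g i) by exact: (integrable_D (j1 i) (j2 i)).
have [js es] := Rint_sum jg.
have j0 := integrableZl measurableT (- (4 * pi ^+ 2 * nsq lam xi)) (integrable_wave xi cst0 th sv).
rewrite (_ : (fun z => _) = fun z => - (4 * pi ^+ 2 * nsq lam xi) * (v z * wave lam eta r xi cst0 th (coordinates z)) + \sum_(i < m) g i z); last first.
  apply/funext => z; rewrite mulrDr mulrCA; congr (_ + _).
  by rewrite mulr_sumr; apply: eq_bigr => i _; rewrite /g; ring.
rewrite RintD// RintegralZl; [|by []|exact: integrable_wave].
congr (_ + _); rewrite es; apply: eq_bigr => i _.
rewrite /g RintD; [|exact: j1|exact: j2].
by rewrite !RintegralZl//; exact: integrable_wave.
Qed.
End data.
End flow.

Lemma poweR_mono (R : realType) (p : R) (x y : \bar R) : 0 <= p -> (0 <= x)%E -> (x <= y)%E ->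
  (x `^ p <= y `^ p)%E.
Proof.
move=> p0 x0 xy; apply: gt0_ler_poweR => //; rewrite in_itv /= leey andbT//.
exact: le_trans xy.
Qed.

Lemma L2norm_ge0 d (T : measurableType d) (R : realType) (mu : {measure set T -> \bar R}) (f : T -> R[i]) :
  (0 <= L2norm mu f)%E.
Proof. by rewrite L2normE poweR_ge0. Qed.

Section solution.
Context (R : realType) (m n : nat) (lam : R) (eta : R -> R).
Hypotheses (l0 : 0 < lam) (heta : is_cutoff eta).
Local Notation leb := (lebesgue R).
Local Notation Rm := (measurableTypeR R).
Local Notation X := (phys_point R m n).
Local Notation Fq := (frequency R m n).
Local Notation W := (waveguide m n lam).
Local Notation fm := (freqm m n lam).
Local Notation cst0 := (@cst0 m).
Variables (f : X -> R[i]) (u : R -> X -> R[i]).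
Hypothesis Hu : schrodinger_solution lam f u.

Let ur s z := complex.Re (u s z).
Let ui s z := complex.Im (u s z).

Lemma sqint_re s : sqint W (ur s).
Proof. by have [] := in_L2_sqint (solution_L2 Hu s). Qed.
Lemma sqint_im s : sqint W (ui s).
Proof. by have [] := in_L2_sqint (solution_L2 Hu s). Qed.

Lemma Rint_fin (g : X -> R) : sqint W g -> ((\int[W]_z g z ^+ 2)%:E = \int[W]_z (g z ^+ 2)%:E)%E.
Proof. by case=> _ jg; rewrite EFinRint. Qed.

Lemma solution_near (t e : R) : 0 < e -> \forall s \near t,
  \int[W]_z (ur s z - ur t z) ^+ 2 <= e /\ \int[W]_z (ui s z - ui t z) ^+ 2 <= e.
Proof.
move=> e0; have e2 : 0 < Num.sqrt e by rewrite sqrtr_gt0.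
have ev : \forall y \near (0%E : \bar R), (y < (Num.sqrt e)%:E)%E.
  by apply: (open_nbhs_nbhs (A := [set y | (y < (Num.sqrt e)%:E)%E])); split; [exact: open_ereal_lt_ereal|rewrite /= lte_fin].
have h : \forall s \near t, (L2norm W (fun z => (u s z - u t z)%R) < (Num.sqrt e)%:E)%E.
  exact: (solution_continuous Hu t ev).
apply: filterS h => s hs.
have sr := sqint_sub (sqint_re s) (sqint_re t).
have si := sqint_sub (sqint_im s) (sqint_im t).
have n2e : (n2 W (fun z => (u s z - u t z)%R) <= e%:E)%E.
  rewrite -L2norm_sqr -[e in leRHS](sqr_sqrtr (ltW e0)) -powR_mulrn ?sqrtr_ge0// -poweR_EFin.
  by apply: poweR_mono; [exact: ler0n|exact: L2norm_ge0|exact: ltW].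
have reE z : complex.Re (u s z - u t z) = ur s z - ur t z by rewrite /ur; case: (u s z) (u t z) => a b [].
have imE z : complex.Im (u s z - u t z) = ui s z - ui t z by rewrite /ui; case: (u s z) (u t z) => a b [].
have [mr _] := sr; have [mi _] := si.
split; rewrite -lee_fin Rint_fin//; apply: (le_trans _ n2e); apply: ge0_le_int.
- exact: measurable_funX.
- by under eq_fun do rewrite reE imE; apply: measurable_funD; exact: measurable_funX.
- by move=> z; exact: sqr_ge0.
- by move=> z; rewrite reE lerDl sqr_ge0.
- exact: measurable_funX.
- by under eq_fun do rewrite reE imE; apply: measurable_funD; exact: measurable_funX.
- by move=> z; exact: sqr_ge0.
- by move=> z; rewrite imE lerDr sqr_ge0.
Qed.

Section one_part.
Variable v : R -> X -> R.
Hypotheses (sv : forall s, sqint W (v s))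
  (nv : forall (t e : R), 0 < e -> \forall s \near t, \int[W]_z (v s z - v t z) ^+ 2 <= e).

Lemma pair_continuous g : sqint W g -> continuous (fun s => \int[W]_z (v s z * g z)).
Proof.
move=> sg t; apply/cvgrPdist_lt => e e0.
pose G := \int[W]_z g z ^+ 2.
have G0 : 0 <= G by apply: Rint_ge0 => z; exact: sqr_ge0.
(* Adding 1 to the squared norm of [g] covers the case in which it is zero. *)
have d0 : 0 < e ^+ 2 / (G + 1) by rewrite divr_gt0 ?exprn_gt0// ltr_wpDl.
have := nv t d0; apply: filterS => s hs.
have sd := sqint_sub (sv s) (sv t).
have -> : \int[W]_z (v t z * g z) - \int[W]_z (v s z * g z) = - \int[W]_z ((v s z - v t z) * g z).
  rewrite -opprB; congr (- _); rewrite -RintB; [|exact: sqint_mul|exact: sqint_mul].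
  by apply: eq_Rintegral => z _; rewrite mulrBl.
rewrite normrN -(@ltr_pXn2r _ 2)// ?nnegrE ?(ltW e0)//.
rewrite real_normK ?num_real//.
apply: (le_lt_trans (cauchy_schwarz sd sg)); rewrite -/G.
apply: (@le_lt_trans _ _ (e ^+ 2 / (G + 1) * G)); first by rewrite ler_wpM2r.
rewrite mulrAC ltr_pdivrMr; last by rewrite ltr_wpDl.
by rewrite ltr_pM2l ?exprn_gt0// ltrDl.
Qed.

Lemma mass_continuous : continuous (fun s => \int[W]_z v s z ^+ 2).
Proof.
move=> t; pose p s := \int[W]_z (v s z * v t z); pose q s := \int[W]_z (v s z - v t z) ^+ 2.
have E s : \int[W]_z v s z ^+ 2 = q s + 2 * p s - \int[W]_z v t z ^+ 2.
  have j1 := (sqint_sub (sv s) (sv t)).2.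
  have j2 := integrableZl measurableT 2 (sqint_mul (sv s) (sv t)).
  rewrite /q /p -RintegralZl//; last exact: sqint_mul.
  rewrite -RintD// -RintB; [|exact: integrable_D|exact: (sv t).2].
  by apply: eq_Rintegral => z _; ring.
have cq : q s @[s --> t] --> 0.
  apply/cvgrPdist_lt => e e0; have e2 : 0 < e / 2 by rewrite divr_gt0.
  have := nv t e2; apply: filterS => s hs.
  rewrite sub0r normrN ger0_norm; last by apply: Rint_ge0 => z; exact: sqr_ge0.
  by apply: (le_lt_trans hs); lra.
have cp := @pair_continuous _ (sv t) t.
rewrite /continuous_at.
have -> : \int[W]_z v t z ^+ 2 = 0 + 2 * p t - \int[W]_z v t z ^+ 2.
  rewrite (_ : p t = \int[W]_z v t z ^+ 2); first by ring.
  by apply: eq_Rintegral => z _; rewrite expr2.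
rewrite (_ : (fun s => _) = fun s => q s + 2 * p s - \int[W]_z v t z ^+ 2); last exact/funext.
apply: cvgB; last exact: cvg_cst.
by apply: cvgD => //; apply: cvgM; [exact: cvg_cst|exact: cp].
Qed.

(** The error estimate needs only a bound on a compact time interval. Continuity in time provides
    it, without conservation of mass. *)
Lemma mass_bounded t : 0 <= t -> exists2 N, 0 <= N &
  forall s, 0 <= s <= t -> \int[W]_z v s z ^+ 2 <= N.
Proof.
move=> t0.
have [c _ hc] := EVT_max t0 (continuous_subspaceT (A := `[0, t]%classic) mass_continuous).
exists (\int[W]_z v c z ^+ 2); first by apply: Rint_ge0 => z; exact: sqr_ge0.
by move=> s hs; apply: hc; rewrite in_itv.
Qed.
End one_part.

Let nr t (e : R) (e0 : 0 < e) : \forall s \near t, \int[W]_z (ur s z - ur t z) ^+ 2 <= e.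
Proof. by have := solution_near t e0; apply: filterS => s []. Qed.
Let ni t (e : R) (e0 : 0 < e) : \forall s \near t, \int[W]_z (ui s z - ui t z) ^+ 2 <= e.
Proof. by have := solution_near t e0; apply: filterS => s []. Qed.

Section scale.
Variables (r : R) (r1 : 1 <= r).
Let r0 : 0 < r. Proof. exact: lt_le_trans ltr01 r1. Qed.

Local Notation wv xi a th := (fun z => wave lam eta r xi a th (coordinates z)).

Lemma sqint_wave (xi : Fq) a th : sqint W (wv xi a th).
Proof.
rewrite (_ : (fun z => _) = fun z => win eta r a z * cos (phase lam z xi + th)); last first.
  by apply/funext => z; rewrite wave_coord.
apply: (sqint_dom (M := 1)); first exact: sqint_win.
  apply: measurable_cosD; apply: measurable_funD; last exact: measurable_cst.
  by apply: (measurableT_comp (@measurable_phase R m n lam) (_ : measT (fun z => (z, xi)))); mea.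
by move=> z; rewrite ler_norml cos_geN1 cos_le1.
Qed.

(** Multiplication by [i] in the weak equation exchanges the parts: the derivative of the real part
    is minus the imaginary pairing with the Laplacian, and conversely up to sign. *)
Lemma pairing_derive (xi : Fq) th s :
  is_derive s (1 : R) (fun s => \int[W]_z (ur s z * wv xi cst0 th z))
    (- \int[W]_z (ui s z * laplacian (wave lam eta r xi cst0 th) (coordinates z))) /\
  is_derive s (1 : R) (fun s => \int[W]_z (ui s z * wv xi cst0 th z))
    (\int[W]_z (ur s z * laplacian (wave lam eta r xi cst0 th) (coordinates z))).
Proof.
have tst := wave_test l0 r0 heta xi cst0 th.
have pr (phi : 'rV[R]_(m + n) -> R) s' : complex.Re (pairing lam (u s') phi) = \int[W]_z (ur s' z * phi (coordinates z)).
  by apply: eq_Rintegral => z _; rewrite /ur; case: (u s' z) => a b /=; rewrite mulr0 subr0.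
have pim (phi : 'rV[R]_(m + n) -> R) s' : complex.Im (pairing lam (u s') phi) = \int[W]_z (ui s' z * phi (coordinates z)).
  by apply: eq_Rintegral => z _; rewrite /ui; case: (u s' z) => a b /=; rewrite mulr0 add0r.
pose w := wave lam eta r xi cst0 th.
have er : (fun s => \int[W]_z (ur s z * w (coordinates z))) = fun s => complex.Re (pairing lam (u s) w).
  by apply/funext => s'; rewrite pr.
have ei : (fun s => \int[W]_z (ui s z * w (coordinates z))) = fun s => complex.Im (pairing lam (u s) w).
  by apply/funext => s'; rewrite pim.
pose gr := fun s => complex.Re (pairing lam (u s) w); pose gi := fun s => complex.Im (pairing lam (u s) w).
have [d1 d2 e] : [/\ derivable gr s 1, derivable gi s 1 &
    (0 +i* 1)%C * (derive1 gr s +i* derive1 gi s)%C + pairing lam (u s) (laplacian w) = 0] :=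
  solution_equation Hu tst s.
rewrite er ei -/gr -/gi -(pr (laplacian w)) -(pim (laplacian w)).
clear er ei pr pim tst; clearbody gr gi; move: e.
case: (pairing _ _ _) => a b; rewrite !derive1E => -[e1 e2].
split; split => //.
  by move: e2; rewrite mul0r mul1r add0r => /eqP; rewrite addr_eq0 => /eqP.
by move: e1; rewrite mul0r mul1r sub0r addrC => /eqP; rewrite subr_eq0 => /eqP/esym.
Qed.

Local Notation al xi := (4 * pi ^+ 2 * nsq lam xi).
Local Notation E v th xi := (@err R m n lam eta r xi th v).

(** [fre + i * fim] is the Fourier transform of the windowed solution at time [s]. *)
Definition fre (s : R) (xi : Fq) : R := wct lam eta r cst0 (ur s) xi + wst lam eta r cst0 (ui s) xi.
Definition fim (s : R) (xi : Fq) : R := wct lam eta r cst0 (ui s) xi - wst lam eta r cst0 (ur s) xi.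

Let E1 (xi : Fq) s := - E (ui s) 0 xi + E (ur s) (- (pi / 2)) xi.
Let E2 (xi : Fq) s := E (ur s) 0 xi + E (ui s) (- (pi / 2)) xi.

Lemma fre_pair s xi : fre s xi = \int[W]_z (ur s z * wv xi cst0 0 z) + \int[W]_z (ui s z * wv xi cst0 (- (pi / 2)) z).
Proof.
rewrite (pair_wave l0 heta r0 _ _ _ (sqint_re s)) (pair_wave l0 heta r0 _ _ _ (sqint_im s)) /fre.
by rewrite cos0 sin0 cosN sinN cos_pihalf sin_pihalf; ring.
Qed.

Lemma fim_pair s xi : fim s xi = \int[W]_z (ui s z * wv xi cst0 0 z) - \int[W]_z (ur s z * wv xi cst0 (- (pi / 2)) z).
Proof.
rewrite (pair_wave l0 heta r0 _ _ _ (sqint_re s)) (pair_wave l0 heta r0 _ _ _ (sqint_im s)) /fim.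
by rewrite cos0 sin0 cosN sinN cos_pihalf sin_pihalf; ring.
Qed.

Lemma fre_derive xi s : is_derive s (1 : R) (fre ^~ xi) (al xi * fim s xi + E1 xi s).
Proof.
rewrite (_ : fre ^~ xi = fun s => \int[W]_z (ur s z * wv xi cst0 0 z) + \int[W]_z (ui s z * wv xi cst0 (- (pi / 2)) z)); last first.
  by apply/funext => s'; rewrite fre_pair.
have [d1 _] := pairing_derive xi 0 s; have [_ d2] := pairing_derive xi (- (pi / 2)) s.
apply: is_derive_eq.
have e1 := pair_laplacian l0 heta r0 xi 0 (sqint_im s).
have e2 := pair_laplacian l0 heta r0 xi (- (pi / 2)) (sqint_re s).
apply: (etrans (congr2 +%R (congr1 -%R e1) e2)).
by rewrite fim_pair /E1; ring.
Qed.

Lemma fim_derive xi s : is_derive s (1 : R) (fim ^~ xi) (- al xi * fre s xi + E2 xi s).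
Proof.
rewrite (_ : fim ^~ xi = fun s => \int[W]_z (ui s z * wv xi cst0 0 z) - \int[W]_z (ur s z * wv xi cst0 (- (pi / 2)) z)); last first.
  by apply/funext => s'; rewrite fim_pair.
have [_ d1] := pairing_derive xi 0 s; have [d2 _] := pairing_derive xi (- (pi / 2)) s.
apply: is_derive_eq.
have e1 := pair_laplacian l0 heta r0 xi 0 (sqint_re s).
have e2 := pair_laplacian l0 heta r0 xi (- (pi / 2)) (sqint_im s).
apply: (etrans (congr2 +%R e1 (congr1 -%R (congr1 -%R e2)))).
by rewrite fre_pair /E2; ring.
Qed.

(** The transform multiplied by [exp (i 4 pi ^ 2 |xi| ^ 2 s)]. For a free wave it would be constant
    in time; here only the window errors move it. *)
Definition rre xi s := fre s xi * cos (al xi * s) - fim s xi * sin (al xi * s).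
Definition rim xi s := fre s xi * sin (al xi * s) + fim s xi * cos (al xi * s).

Lemma rotated_derive xi :
  antiderivative (rre xi) (fun s => E1 xi s * cos (al xi * s) - E2 xi s * sin (al xi * s)) /\
  antiderivative (rim xi) (fun s => E1 xi s * sin (al xi * s) + E2 xi s * cos (al xi * s)).
Proof.
by split=> s; have d1 := fre_derive xi s; have d2 := fim_derive xi s; apply: is_derive_eq;
  rewrite /GRing.scale /=; ring.
Qed.

Lemma err_continuous (v : R -> X -> R) xi th : (forall s, sqint W (v s)) ->
  (forall (t e : R), 0 < e -> \forall s \near t, \int[W]_z (v s z - v t z) ^+ 2 <= e) ->
  continuous (fun s => E (v s) th xi).
Proof.
move=> sv nv.
apply: (@continuous_big R _ +%R 0 predT (@add_continuous R) R _
   (fun i s => r ^- 2 * \int[W]_z (v s z * wave lam eta r xi (bump2 i) th (coordinates z)) +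
   4 * pi * r^-1 * tnth xi.1 i *
     \int[W]_z (v s z * wave lam eta r xi (incr cst0 i) (th + pi / 2) (coordinates z)))) => i _.
have h1 := pair_continuous sv nv (sqint_wave xi (bump2 i) th).
have h2 := pair_continuous sv nv (sqint_wave xi (incr cst0 i) (th + pi / 2)).
have k1 := continuous_mulf (@continuous_cstf R R (r ^- 2)) h1.
have k2 := continuous_mulf (@continuous_cstf R R (4 * pi * r^-1 * tnth xi.1 i)) h2.
exact: (continuous_addf k1 k2).
Qed.

Lemma rotated_continuous xi :
  continuous (fun s => E1 xi s * cos (al xi * s) - E2 xi s * sin (al xi * s)) /\
  continuous (fun s => E1 xi s * sin (al xi * s) + E2 xi s * cos (al xi * s)).
Proof.
have cN (g : R -> R) : continuous g -> continuous (fun s => - g s).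
  by move=> cg; under eq_fun do rewrite -mulN1r; apply: continuous_mulf => //; exact: continuous_cstf.
have hr th : continuous (fun s => E (ur s) th xi) by exact: (err_continuous sqint_re nr).
have hi th : continuous (fun s => E (ui s) th xi) by exact: (err_continuous sqint_im ni).
have c1 : continuous (E1 xi) by exact: (continuous_addf (cN _ (hi 0)) (hr (- (pi / 2)))).
have c2 : continuous (E2 xi) by exact: (continuous_addf (hr 0) (hi (- (pi / 2)))).
have cl : continuous (fun s : R => al xi * s).
  by apply: continuous_mulf; [exact: continuous_cstf|move=> s; exact: cvg_id].
have cc : continuous (fun s : R => cos (al xi * s)).
  by move=> s; apply: (continuous_comp (cl s)); exact: continuous_cos.
have cs : continuous (fun s : R => sin (al xi * s)).
  by move=> s; apply: (continuous_comp (cl s)); exact: continuous_sin.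
split.
  exact: (continuous_addf (continuous_mulf c1 cc) (cN _ (continuous_mulf c2 cs))).
exact: (continuous_addf (continuous_mulf c1 cs) (continuous_mulf c2 cc)).
Qed.

Lemma rotation_increment xi t : 0 <= t ->
  (((rre xi t - fre 0 xi) ^+ 2 + (rim xi t - fim 0 xi) ^+ 2)%:E <=
   t%:E * \int[interval_measure `[0%R, t]]_s (E1 xi s ^+ 2 + E2 xi s ^+ 2)%:E)%E.
Proof.
move=> t0; have [d1 d2] := rotated_derive xi; have [c1 c2] := rotated_continuous xi.
have h1 := increment_sqr t0 d1 c1; have h2 := increment_sqr t0 d2 c2.
rewrite {2}/rre {2}/rim !mulr0 cos0 sin0 !mulr1 !mulr0 subr0 add0r in h1 h2.
rewrite EFinD; apply: (le_trans (leeD h1 h2)).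
rewrite -ge0_muleDr; last 2 first.
- by apply: integral_ge0 => s _; rewrite lee_fin sqr_ge0.
- by apply: integral_ge0 => s _; rewrite lee_fin sqr_ge0.
rewrite -ge0_intD; first last.
- by move=> s; exact: sqr_ge0.
- by move=> s; exact: sqr_ge0.
- by apply: measurable_funX; exact: continuous_measurable_fun.
- by apply: measurable_funX; exact: continuous_measurable_fun.
apply: eq_le; congr (_ * _)%E; apply: eq_integral => s _; congr EFin.
have := cos2Dsin2 (al xi * s) => h.
transitivity ((E1 xi s ^+ 2 + E2 xi s ^+ 2) * (cos (al xi * s) ^+ 2 + sin (al xi * s) ^+ 2)); first by ring.
by rewrite h mulr1.
Qed.
End scale.
End solution.

Lemma ge0_Rsum d (T : measurableType d) (R : realType) (mu : {measure set T -> \bar R})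
    m (g : 'I_m -> T -> R) (D : set T) : measurable D -> (forall i, measT (g i)) ->
  (forall i x, 0 <= g i x) ->
  (\int[mu]_(x in D) (\sum_(i < m) g i x)%:E = \sum_(i < m) \int[mu]_(x in D) (g i x)%:E)%E.
Proof.
move=> mD mg g0; under eq_integral do rewrite -sumEFin.
rewrite ge0_integral_sum//.
- by move=> i; apply/measurable_funTS/measurable_EFinP.
- by move=> i x _; rewrite lee_fin.
Qed.

(** * Transport of the transform in time *)

Section transport.
Context (R : realType) (m n : nat) (lam : R) (eta : R -> R).
Hypotheses (l0 : 0 < lam) (heta : is_cutoff eta).
Local Notation leb := (lebesgue R).
Local Notation Rm := (measurableTypeR R).
Local Notation X := (phys_point R m n).
Local Notation Fq := (frequency R m n).
Local Notation W := (waveguide m n lam).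
Local Notation fm := (freqm m n lam).
Local Notation cst0 := (@cst0 m).
Local Notation wct := (@wct R m n lam eta).
Local Notation wst := (@wst R m n lam eta).

Definition energy r (a : 'I_m -> nat) (v : X -> R) (xi : Fq) : R := wct r a v xi ^+ 2 + wst r a v xi ^+ 2.

Definition errmass r (v : X -> R) (xi : Fq) : R :=
  \sum_(i < m) (energy r (bump2 i) v xi + energy r (incr cst0 i) v xi).

Lemma energy_ge0 r a v xi : 0 <= energy r a v xi.
Proof. by rewrite addr_ge0// sqr_ge0. Qed.

Lemma rotate_sqr_le (c s th : R) : (c * cos th - s * sin th) ^+ 2 <= c ^+ 2 + s ^+ 2.
Proof.
have h := cos2Dsin2 th; rewrite -subr_ge0.
rewrite (_ : _ - _ = (c * sin th + s * cos th) ^+ 2 + (c ^+ 2 + s ^+ 2) * (1 - (cos th ^+ 2 + sin th ^+ 2))); last by ring.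
by rewrite h subrr mulr0 addr0 sqr_ge0.
Qed.

(** [2 ^+ m] comes from squaring a sum of [m] terms. The bracket comes from squaring
    [x / r ^+ 2 + 4 * pi * xi_i * y / r] with [|xi_i| <= B]; since [r >= 1], the factor [r ^- 4] of
    the first square is lowered to [r ^- 2]. *)
Definition errconst (B : R) : R := 2 ^+ m * (2 + 32 * pi ^+ 2 * B ^+ 2).

Lemma err_bound r B (xi : Fq) th v : 1 <= r -> fbox B xi -> sqint W v ->
  err lam eta r xi th v ^+ 2 <= errconst B * errmass r v xi / r ^+ 2.
Proof.
move=> r1 [xB _] sv; have r0 : 0 < r by exact: lt_le_trans ltr01 r1.
apply: (le_trans (sum_sqr_le _)); rewrite /errconst -!mulrA ler_wpM2l ?exprn_ge0//.
rewrite mulrCA /errmass mulrA mulr_suml mulr_sumr; apply: ler_sum => i _.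
rewrite !(pair_wave l0 heta r0)//.
set x := wct _ _ _ _ * _ - _; set y := wct _ _ _ _ * _ - _.
have hx : x ^+ 2 <= energy r (bump2 i) v xi by exact: rotate_sqr_le.
have hy : y ^+ 2 <= energy r (incr cst0 i) v xi by exact: rotate_sqr_le.
have rr : r ^- 2 <= 1 by rewrite invf_le1 ?exprn_gt0// exprn_ege1.
have ri : 0 <= r ^- 2 by rewrite invr_ge0 exprn_ge0// ltW.
have hB : tnth xi.1 i ^+ 2 <= B ^+ 2.
  rewrite -[leLHS]real_normK ?num_real// ler_pXn2r ?nnegrE//; first exact: le_trans (xB i).
have e1 := energy_ge0 r (bump2 i) v xi; have e2 := energy_ge0 r (incr cst0 i) v xi.
have p0 : 0 <= 32 * pi ^+ 2 :> R by rewrite mulr_ge0// sqr_ge0.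
apply: (@le_trans _ _ (r ^- 2 * (2 * x ^+ 2 + 32 * pi ^+ 2 * (tnth xi.1 i ^+ 2 * y ^+ 2)))).
  have -> : r ^- 2 * (2 * x ^+ 2 + 32 * pi ^+ 2 * (tnth xi.1 i ^+ 2 * y ^+ 2)) =
     2 * (r ^- 2 * x ^+ 2) + 2 * (4 * pi * r^-1 * tnth xi.1 i * y) ^+ 2 by field; rewrite gt_eqF.
  apply: (@le_trans _ _ (2 * (r ^- 2 * x) ^+ 2 + 2 * (4 * pi * r^-1 * tnth xi.1 i * y) ^+ 2)).
    rewrite -subr_ge0 (_ : _ - _ = (r ^- 2 * x - 4 * pi / r * tnth xi.1 i * y) ^+ 2) ?sqr_ge0//.
    by ring.
  rewrite lerD2r ler_pM2l// exprMn ler_wpM2r ?sqr_ge0// expr2.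
  by rewrite -[leRHS]mulr1 ler_wpM2l.
have hy2 : tnth xi.1 i ^+ 2 * y ^+ 2 <= B ^+ 2 * energy r (incr cst0 i) v xi.
  by apply: ler_pM => //; exact: sqr_ge0.
have k1 : 2 * x ^+ 2 + 32 * pi ^+ 2 * (tnth xi.1 i ^+ 2 * y ^+ 2) <=
   (2 + 32 * pi ^+ 2 * B ^+ 2) * (energy r (bump2 i) v xi + energy r (incr cst0 i) v xi).
  have := ler_wpM2l p0 hy2; have := mulr_ge0 (mulr_ge0 p0 (sqr_ge0 B)) e1; lra.
have := ler_wpM2l ri k1; rewrite -!mulrA => k2; apply: (le_trans k2).
by rewrite mulrC -!mulrA le_eqVlt; apply/orP; left; apply/eqP; ring.
Qed.

Lemma errmass_mass : exists2 K, 0 <= K & forall r v B, 0 < r -> sqint W v ->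
  (\int[fm]_(xi in fbox B) (errmass r v xi)%:E <= K%:E * \int[W]_z (v z ^+ 2)%:E)%E.
Proof.
pose P (a : 'I_m -> nat) K := 0 <= K /\ forall r v B, 0 < r -> sqint W v ->
  (\int[fm]_(xi in fbox B) (energy r a v xi)%:E <= K%:E * \int[W]_z (v z ^+ 2)%:E)%E.
have /choice[K hK] : forall a, exists K, P a K.
  by move=> a; have [K K0 h] := bessel_win n l0 heta a; exists K.
exists (\sum_(i < m) (K (bump2 i) + K (incr cst0 i))).
  by apply: sumr_ge0 => i _; rewrite addr_ge0//; [exact: (hK _).1|exact: (hK _).1].
move=> r v B r0 sv.
have me a : measT (energy r a v).
  have mv : measT (fun z => v z * win eta r a z).
    by apply: measurable_funM; [exact: sv.1|exact: measurable_win].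
  by apply: measurable_funD; apply: measurable_funX; [exact: measurable_ctr|exact: measurable_str].
have mB := @measurable_fbox R m n B.
rewrite ge0_Rsum//; last 2 first.
- by move=> i; apply: measurable_funD; exact: me.
- by move=> i xi; rewrite addr_ge0 ?energy_ge0.
rewrite -sumEFin ge0_sume_distrl; last first.
  by move=> i _; rewrite lee_fin addr_ge0//; [exact: (hK _).1|exact: (hK _).1].
apply: lee_sum => i _.
under eq_integral do rewrite EFinD.
rewrite ge0_integralD//; last 4 first.
- by move=> xi _; rewrite lee_fin energy_ge0.
- by apply/measurable_funTS/measurable_EFinP; exact: me.
- by move=> xi _; rewrite lee_fin energy_ge0.
- by apply/measurable_funTS/measurable_EFinP; exact: me.
rewrite EFinD ge0_muleDl ?lee_fin; [|exact: (hK _).1|exact: (hK _).1].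
by apply: leeD; [exact: (hK _).2|exact: (hK _).2].
Qed.

Variables (f : X -> R[i]) (u : R -> X -> R[i]).
Hypothesis Hu : schrodinger_solution lam f u.
Let ur s z := complex.Re (u s z).
Let ui s z := complex.Im (u s z).

Let measurable_wct r a (v : R -> X -> R) :
  measT (fun p : Rm * X => v p.1 p.2) ->
  measT (fun p : Rm * Fq => energy r a (v p.1) p.2).
Proof.
move=> mv.
have mp : measT (fun q : (Rm * Fq) * X => phase lam q.2 q.1.2).
  by apply: (measurableT_comp (@measurable_phase R m n lam) (_ : measT (fun q : (Rm * Fq) * X => (q.2, q.1.2)))); mea.
have mw : measT (fun q : (Rm * Fq) * X => v q.1.1 q.2 * win eta r a q.2).
  apply: measurable_funM.
    by apply: (measurableT_comp mv (_ : measT (fun q : (Rm * Fq) * X => (q.1.1, q.2)))); mea.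
  by apply: (measurableT_comp (@measurable_win R m n eta heta r a)); mea.
apply: measurable_funD; apply: measurable_funX.
  apply: (@measurable_param_Rintegral _ _ _ _ R W (fun q : (Rm * Fq) * X => v q.1.1 q.2 * win eta r a q.2 * cos (phase lam q.2 q.1.2))).
  by apply: measurable_funM => //; exact: measurable_cosD.
apply: (@measurable_param_Rintegral _ _ _ _ R W (fun q : (Rm * Fq) * X => v q.1.1 q.2 * win eta r a q.2 * sin (phase lam q.2 q.1.2))).
by apply: measurable_funM => //; exact: measurable_sinD.
Qed.

Let g r (p : Rm * Fq) : R := errmass r (ur p.1) p.2 + errmass r (ui p.1) p.2.

Let mg r : measT (g r).
Proof.
have [mr mi] := solution_measurable Hu.
apply: measurable_funD; apply: measurable_sum => i; apply: measurable_funD.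
- exact: (@measurable_wct r _ ur mr).
- exact: (@measurable_wct r _ ur mr).
- exact: (@measurable_wct r _ ui mi).
- exact: (@measurable_wct r _ ui mi).
Qed.

Lemma errmass_ge0 r v xi : 0 <= errmass r v xi.
Proof. by apply: sumr_ge0 => i _; rewrite addr_ge0 ?energy_ge0. Qed.

(** The increments are integrated over a frequency box and the order of integration is exchanged. At
    each time Bessel's inequality bounds the error by the mass of the solution, uniformly in [r],
    and the factor [r ^- 2] survives. *)
Lemma transport_bound t B : 0 <= t -> exists2 K, 0 <= K & forall r, 1 <= r ->
  (\int[fm]_(xi in fbox B) ((rre lam eta u r xi t - fre lam eta u r 0 xi) ^+ 2 +
     (rim lam eta u r xi t - fim lam eta u r 0 xi) ^+ 2)%:E <= (K / r ^+ 2)%:E)%E.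
Proof.
move=> t0; have [KG KG0 hG] := errmass_mass.
have nr s (e : R) : 0 < e -> \forall s' \near s, \int[W]_z (ur s' z - ur s z) ^+ 2 <= e.
  by move=> e0; have := solution_near Hu s e0; apply: filterS => s' [].
have ni s (e : R) : 0 < e -> \forall s' \near s, \int[W]_z (ui s' z - ui s z) ^+ 2 <= e.
  by move=> e0; have := solution_near Hu s e0; apply: filterS => s' [].
have sr := sqint_re Hu; have si := sqint_im Hu.
have [Nr Nr0 hNr] := mass_bounded sr nr t0.
have [Ni Ni0 hNi] := mass_bounded si ni t0.
(* Two squared sums of two errors each give a factor 2, and each of the real and imaginary parts
   occurs in two of the four errors. *)
pose c := 4 * errconst B.
have c0 : 0 <= c.
  by rewrite mulr_ge0// mulr_ge0 ?exprn_ge0// addr_ge0// mulr_ge0 ?sqr_ge0// mulr_ge0 ?sqr_ge0.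
exists (t * (c * (KG * (Nr + Ni)) * t)); first exact: mulr_ge0 t0 (mulr_ge0 (mulr_ge0 c0 (mulr_ge0 KG0 (addr_ge0 Nr0 Ni0))) t0).
move=> r r1; have r0 : 0 < r by exact: lt_le_trans ltr01 r1.
have r2 : 0 <= r ^- 2 by rewrite invr_ge0 exprn_ge0// ltW.
pose mu := @interval_measure R `[0, t]; have mB := @measurable_fbox R m n B.
pose nu : {sigma_finite_measure set Fq -> \bar R} := restr_measure fm mB.
have nuE (p : Fq -> \bar R) : measT p -> (forall x, 0 <= p x)%E ->
   (\int[fm]_(xi in fbox B) p xi = \int[nu]_xi p xi)%E.
  by move=> mp p0; rewrite /nu ge0_integral_restr.
have muE (p : Rm -> \bar R) : measT p -> (forall x, 0 <= p x)%E ->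
   (\int[mu]_s p s = \int[leb]_(s in `[0%R, t]) p s)%E.
  by move=> mp p0; rewrite /mu ge0_integral_restr.
pose h (p : Rm * Fq) : R := c * r ^- 2 * g r p.
have cr0 : 0 <= c * r ^- 2 by exact: mulr_ge0.
have g0 p : 0 <= g r p by rewrite addr_ge0 ?errmass_ge0.
have h0 p : 0 <= h p by rewrite mulr_ge0.
have mh : measT h by apply: measurable_funM => //; exact: measurable_cst.
apply: (@le_trans _ _ (\int[fm]_(xi in fbox B) (t%:E * \int[mu]_s (h (s, xi))%:E))%E).
  apply: ge0_le_integral => //.
  - by move=> xi _; rewrite lee_fin addr_ge0// sqr_ge0.
  - apply/measurable_funTS/measurable_EFinP.
    have mc v : sqint W v -> measT (wct r cst0 v).
      by move=> sv; apply: measurable_ctr; apply: measurable_funM; [exact: sv.1|exact: measurable_win].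
    have ms v : sqint W v -> measT (wst r cst0 v).
      by move=> sv; apply: measurable_str; apply: measurable_funM; [exact: sv.1|exact: measurable_win].
    have mfr s : measT (fre lam eta u r s) by apply: measurable_funD; [exact: mc|exact: ms].
    have mfi s : measT (fim lam eta u r s) by apply: measurable_funB; [exact: mc|exact: ms].
    have ma : measT (fun xi => 4 * pi ^+ 2 * @nsq R m n lam xi * t).
      apply: measurable_funM; last exact: measurable_cst.
      by apply: measurable_funM; [exact: measurable_cst|exact: measurable_quad].
    have mcs := measurable_cosD ma; have msn := measurable_sinD ma.
    apply: measurable_funD; apply: measurable_funX; apply: measurable_funB => //.
      by apply: measurable_funB; exact: measurable_funM.
    by apply: measurable_funD; exact: measurable_funM.
  - apply/measurable_funTS; apply: measurable_funeM.
    apply: (@measurable_param_integral _ _ _ _ R mu (fun p : Fq * Rm => (h (p.2, p.1))%:E)).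
    by apply/measurable_EFinP; apply: (measurableT_comp mh); mea.
  - move=> xi Bxi; apply: (le_trans (rotation_increment l0 heta Hu r1 xi t0)).
    apply: lee_wpmul2l => //.
    have hr th : continuous (fun s => err lam eta r xi th (ur s)) by exact: (err_continuous l0 heta r1 sr nr).
    have hi th : continuous (fun s => err lam eta r xi th (ui s)) by exact: (err_continuous l0 heta r1 si ni).
    have kr th : measT (fun s : Rm => err lam eta r xi th (ur s)) by exact: continuous_measurable_fun (hr th).
    have ki th : measT (fun s : Rm => err lam eta r xi th (ui s)) by exact: continuous_measurable_fun (hi th).
    apply: ge0_le_int.
    + apply: measurable_funD; apply: measurable_funX; apply: measurable_funD => //.
      by under eq_fun do rewrite -mulN1r; apply: measurable_funM => //; exact: measurable_cst.
    + by apply: (measurableT_comp mh); mea.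
    + by move=> s; rewrite addr_ge0// sqr_ge0.
    + move=> s.
      have b1 th := err_bound th r1 Bxi (sr s); have b2 th := err_bound th r1 Bxi (si s).
      apply: (@le_trans _ _ (2 * (err lam eta r xi 0 (ui s) ^+ 2 + err lam eta r xi (- (pi / 2)) (ur s) ^+ 2) +
         2 * (err lam eta r xi 0 (ur s) ^+ 2 + err lam eta r xi (- (pi / 2)) (ui s) ^+ 2))).
        set x1 := err _ _ _ _ _ _; set x2 := err _ _ _ _ _ _; set x3 := err _ _ _ _ _ _; set x4 := err _ _ _ _ _ _.
        rewrite -subr_ge0 (_ : _ - _ = (x1 + x2) ^+ 2 + (x3 - x4) ^+ 2); first by rewrite addr_ge0// sqr_ge0.
        by ring.
      have := b1 0; have := b1 (- (pi / 2)); have := b2 0; have := b2 (- (pi / 2)).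
      rewrite /h /g /c /=.
      rewrite -/(ur s) -/(ui s); lra.
rewrite nuE; last 2 first.
- apply: measurable_funeM.
  apply: (@measurable_param_integral _ _ _ _ R mu (fun p : Fq * Rm => (h (p.2, p.1))%:E)).
  by apply/measurable_EFinP; apply: (measurableT_comp mh); mea.
- by move=> xi; rewrite mule_ge0// integral_ge0// => s _; rewrite lee_fin.
rewrite ge0_integralZl//; last 2 first.
- apply: (@measurable_param_integral _ _ _ _ R mu (fun p : Fq * Rm => (h (p.2, p.1))%:E)).
  by apply/measurable_EFinP; apply: (measurableT_comp mh); mea.
- by move=> xi _; rewrite integral_ge0// => s _; rewrite lee_fin.
have mhE : measT (EFin \o h) by exact/measurable_EFinP.
have h0E p : (0 <= (EFin \o h) p)%E by rewrite lee_fin.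
rewrite [X in (_ * X)%E](_ : _ = \int[mu]_s \int[nu]_xi (h (s, xi))%:E)%E; last first.
  exact: (etrans (esym (prod_tonelli2 mu nu mhE h0E)) (prod_tonelli mu nu mhE h0E)).
rewrite -mulrA EFinM; apply: lee_wpmul2l => //.
rewrite muE; last 2 first.
- exact: (@measurable_param_integral _ _ _ _ R nu (EFin \o h)).
- by move=> s; apply: integral_ge0 => xi _; exact: h0E.
apply: (@le_trans _ _ (\int[leb]_(s in `[0%R, t]) (c * r ^- 2 * (KG * (Nr + Ni)))%:E)%E); last first.
  rewrite integral_cst// [X in (_ * X)%E](itv_leb t0) subr0 -EFinM lee_fin.
  by apply: eq_le; ring.
have sub s : measT (fun xi => errmass r (ur s) xi) /\ measT (fun xi => errmass r (ui s) xi).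
  have me a v : sqint W v -> measT (energy r a v).
    move=> sv; have mv : measT (fun z => v z * win eta r a z).
      by apply: measurable_funM; [exact: sv.1|exact: measurable_win].
    by apply: measurable_funD; apply: measurable_funX; [exact: measurable_ctr|exact: measurable_str].
  split; apply: measurable_sum => i; apply: measurable_funD.
  - exact: (me _ _ (sr s)).
  - exact: (me _ _ (sr s)).
  - exact: (me _ _ (si s)).
  - exact: (me _ _ (si s)).
apply: ge0_le_integral => //.
- by move=> s _; apply: integral_ge0 => xi _; exact: h0E.
- by apply/measurable_funTS; exact: (@measurable_param_integral _ _ _ _ R nu (EFin \o h)).
move=> s /=; rewrite in_itv /= => hs; have [m1 m2] := sub s.
have mg' : measT (fun xi => g r (s, xi)) by exact: measurable_funD.
rewrite (ge0_intZl _ cr0 mg')// [leRHS]EFinM; apply: lee_wpmul2l => //.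
rewrite ge0_intD//; last 2 first.
- by move=> ?; exact: errmass_ge0.
- by move=> ?; exact: errmass_ge0.
have mass0 v xi : (0 <= (errmass r v xi)%:E)%E by rewrite lee_fin errmass_ge0.
have k1 : measT (EFin \o errmass r (ur s)) by exact/measurable_EFinP.
have k2 : measT (EFin \o errmass r (ui s)) by exact/measurable_EFinP.
have e1 := esym (nuE _ k1 (mass0 (ur s))).
have e2 := esym (nuE _ k2 (mass0 (ui s))).
apply: (@le_trans _ _ (\int[fm]_(xi in fbox B) (errmass r (ur s) xi)%:E +
  \int[fm]_(xi in fbox B) (errmass r (ui s) xi)%:E)%E).
  by apply: eq_le; exact: (congr2 adde e1 e2).
rewrite mulrDr EFinD; apply: leeD.
  have q1 := hG r (ur s) B r0 (sr s).
  apply: (le_trans q1); rewrite EFinM; apply: lee_wpmul2l; first by rewrite lee_fin.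
  by rewrite -(Rint_fin (sr s)) lee_fin; exact: hNr.
have q2 := hG r (ui s) B r0 (si s).
apply: (le_trans q2); rewrite EFinM; apply: lee_wpmul2l; first by rewrite lee_fin.
by rewrite -(Rint_fin (si s)) lee_fin; exact: hNi.
Qed.

(** A description of the L2 transform adapted to the flow: smooth windows, since only these yield
    test functions, and convergence on bounded sets of frequencies, since the transport estimate
    depends on [B]. The scale [k.+1] is never zero. *)
Definition has_ft (v : X -> R[i]) (F : (Fq -> R) * (Fq -> R)) : Prop := forall B,
  vanish (fun k => \int[fm]_(xi in fbox B)
    ((wct k.+1%:R cst0 (fun z => complex.Re (v z)) xi + wst k.+1%:R cst0 (fun z => complex.Im (v z)) xi - F.1 xi) ^+ 2 +
     (wct k.+1%:R cst0 (fun z => complex.Im (v z)) xi - wst k.+1%:R cst0 (fun z => complex.Re (v z)) xi - F.2 xi) ^+ 2)%:E)%E.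

Lemma vanish_inv (K : R) : 0 <= K -> vanish (fun k => (K / k.+1%:R ^+ 2)%:E).
Proof.
move=> K0 e e0; exists (Num.bound (K / e)) => k hk; rewrite lee_fin.
have k1 : (1 : R) <= k.+1%:R by rewrite ler1n.
have kp : (0 : R) < k.+1%:R by exact: lt_le_trans ltr01 k1.
rewrite ler_pdivrMr ?exprn_gt0//.
have : K / e < k.+1%:R.
  have Ke : 0 <= K / e by rewrite divr_ge0// ltW.
  apply: (lt_le_trans (archi_boundP Ke)); rewrite ler_nat; exact: leqW.
rewrite ltr_pdivrMr// => h; apply: (le_trans (ltW h)); rewrite mulrC ler_pM2l// expr2.
by rewrite ler_peMl// ltW.
Qed.

Definition evolve (t : R) (F : (Fq -> R) * (Fq -> R)) : (Fq -> R) * (Fq -> R) :=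
  (fun xi => F.1 xi * cos (4 * pi ^+ 2 * nsq lam xi * t) + F.2 xi * sin (4 * pi ^+ 2 * nsq lam xi * t),
   fun xi => F.2 xi * cos (4 * pi ^+ 2 * nsq lam xi * t) - F.1 xi * sin (4 * pi ^+ 2 * nsq lam xi * t)).

(** A rotation preserves the modulus, so the distance from the transform at time [t] to the evolved
    [F] equals the distance from the rotated transform to [F]. This splits into the transport error,
    of order [1 / k.+1 ^+ 2], and the error at time 0. *)
Lemma ft_evolve t F : 0 <= t -> measT F.1 -> measT F.2 ->
  has_ft (u 0) F -> has_ft (u t) (evolve t F).
Proof.
move=> t0 mF1 mF2 h0 B; have [K K0 hK] := transport_bound B t0.
have mB := @measurable_fbox R m n B.
have mc r v : sqint W v -> measT (wct r cst0 v).
  by move=> sv; apply: measurable_ctr; apply: measurable_funM; [exact: sv.1|exact: measurable_win].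
have ms r v : sqint W v -> measT (wst r cst0 v).
  by move=> sv; apply: measurable_str; apply: measurable_funM; [exact: sv.1|exact: measurable_win].
have mfr r s : measT (fre lam eta u r s).
  by apply: measurable_funD; [exact: mc (sqint_re Hu s)|exact: ms (sqint_im Hu s)].
have mfi r s : measT (fim lam eta u r s).
  by apply: measurable_funB; [exact: mc (sqint_im Hu s)|exact: ms (sqint_re Hu s)].
have ma : measT (fun xi => 4 * pi ^+ 2 * @nsq R m n lam xi * t).
  apply: measurable_funM; last exact: measurable_cst.
  by apply: measurable_funM; [exact: measurable_cst|exact: measurable_quad].
have mcs := measurable_cosD ma; have msn := measurable_sinD ma.
have v1 := vanishZ (ler0n R 2) (vanish_inv K0).
have v2 := vanishZ (ler0n R 2) (h0 B).
apply: (vanish_le (vanishD v1 v2)) => k.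
have k1 : (1 : R) <= k.+1%:R by rewrite ler1n.
pose p1 xi := (rre lam eta u k.+1%:R xi t - fre lam eta u k.+1%:R 0 xi) ^+ 2 +
     (rim lam eta u k.+1%:R xi t - fim lam eta u k.+1%:R 0 xi) ^+ 2.
pose p2 xi := (fre lam eta u k.+1%:R 0 xi - F.1 xi) ^+ 2 + (fim lam eta u k.+1%:R 0 xi - F.2 xi) ^+ 2.
have mp1 : measT p1.
  apply: measurable_funD; apply: measurable_funX; apply: measurable_funB => //.
    by apply: measurable_funB; exact: measurable_funM.
  by apply: measurable_funD; exact: measurable_funM.
have mp2 : measT p2.
  by apply: measurable_funD; apply: measurable_funX; exact: measurable_funB.
have p10 xi : 0 <= p1 xi by rewrite addr_ge0// sqr_ge0.
have p20 xi : 0 <= p2 xi by rewrite addr_ge0// sqr_ge0.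
apply: (@le_trans _ _ (\int[fm]_(xi in fbox B) ((2%:E * (p1 xi)%:E) + (2%:E * (p2 xi)%:E)))%E); last first.
  rewrite ge0_integralD//; last 4 first.
  - by move=> xi _; rewrite mule_ge0// lee_fin.
  - by apply/measurable_funTS; apply: measurable_funeM; exact/measurable_EFinP.
  - by move=> xi _; rewrite mule_ge0// lee_fin.
  - by apply/measurable_funTS; apply: measurable_funeM; exact/measurable_EFinP.
  rewrite !ge0_integralZl//; last 4 first.
  - by apply/measurable_funTS/measurable_EFinP.
  - by move=> xi _; rewrite lee_fin.
  - by apply/measurable_funTS/measurable_EFinP.
  - by move=> xi _; rewrite lee_fin.
  by apply: leeD; apply: lee_wpmul2l => //; exact: hK.
apply: ge0_le_integral => //.
- by move=> xi _; rewrite lee_fin addr_ge0// sqr_ge0.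
- apply/measurable_funTS/measurable_EFinP; apply: measurable_funD; apply: measurable_funX; apply: measurable_funB.
  + exact: mfr.
  + by apply: measurable_funD; exact: measurable_funM.
  + exact: mfi.
  + by apply: measurable_funB; exact: measurable_funM.
- by apply/measurable_funTS; apply: emeasurable_funD; apply: measurable_funeM; exact/measurable_EFinP.
move=> xi _; rewrite -!EFinM -EFinD lee_fin /p1 /p2 /rre /rim.
rewrite -/(fre lam eta u k.+1%:R t xi) -/(fim lam eta u k.+1%:R t xi) /=.
move: (fre _ _ _ _ t _) (fim _ _ _ _ t _) (fre _ _ _ _ 0 _) (fim _ _ _ _ 0 _) => x y x0 y0.
move: (F.1 xi) (F.2 xi) (cos2Dsin2 (4 * pi ^+ 2 * nsq lam xi * t)) => a b.
move: (cos _) (sin _) => co si h.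
(* The correction term isolates the only use of [co ^+ 2 + si ^+ 2 = 1], leaving a polynomial
   identity. *)
have -> : (x - (a * co + b * si)) ^+ 2 + (y - (b * co - a * si)) ^+ 2 =
  (x * co - y * si - a) ^+ 2 + (x * si + y * co - b) ^+ 2 +
  (x ^+ 2 + y ^+ 2 - a ^+ 2 - b ^+ 2) * (1 - (co ^+ 2 + si ^+ 2)) by ring.
rewrite h subrr mulr0 addr0.
move: (x * co - y * si) (x * si + y * co) => p q.
rewrite -subr_ge0.
rewrite (_ : _ - _ = (p - x0 - (x0 - a)) ^+ 2 + (q - y0 - (y0 - b)) ^+ 2); first by rewrite addr_ge0// sqr_ge0.
ring.
Qed.

End transport.

(** * Lattice sums and integrals *)

Section lattice_points.
Context (R : realType) (m n : nat) (lam : R).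
Hypothesis l0 : 0 < lam.
Local Notation leb := (lebesgue R).
Local Notation Rm := (measurableTypeR R).
Local Notation lat := (power_measure (lattice lam) n).
Local Notation Fq := (frequency R m n).

Lemma measurable_lattice_point (k : n.-tuple int) : measurable [set k].
Proof.
rewrite (_ : [set k] = [set t | forall i, [set t : n.-tuple int | tnth t i = tnth k i] t]); last first.
  by apply/seteqP; split => t /= h => [i|]; [rewrite h|apply/eq_from_tnth].
apply: measurable_all => i.
rewrite (_ : [set t | _] = setT `&` (fun t : n.-tuple int => tnth t i) @^-1` [set tnth k i]); last by rewrite setTI.
exact: (measurable_tnth i measurableT).
Qed.

Lemma lattice_point_le (k : n.-tuple int) : (lat [set k] <= (lam ^- n)%:E)%E.
Proof.
pose g (i : 'I_n) (x : int) : R := \1_[set tnth k i] x.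
apply: (@le_trans _ _ (\int[lat]_t (\prod_(i < n) g i (tnth t i))%:E)%E).
  have mk := measurable_lattice_point k.
  rewrite (_ : lat [set k] = \int[lat]_t (\1_[set k] t)%:E)%E; last by rewrite integral_indic// setIT.
  apply: ge0_le_integral => //.
  - by apply/measurable_EFinP; apply: measurable_indic; exact: measurable_lattice_point.
  - apply/measurable_EFinP; apply: measurable_tensor => i; exact: measurable_on_int.
  - move=> t _; rewrite lee_fin indicE; case: (boolP (t \in [set k])) => [/set_mem /= ->|_].
      by rewrite big1// => i _; rewrite /g indicE mem_set.
    by apply: prodr_ge0 => i _; rewrite /g indicE.
apply: (le_trans (power_tensor_le (c := fun=> lam^-1) _ _ _ _)).
- by move=> i; exact: measurable_on_int.
- by move=> i x; rewrite /g indicE.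
- by move=> i; rewrite invr_ge0 ltW.
- move=> i; rewrite /g integral_indic// setIT.
  by apply: eq_le; exact: lattice_set1.
by rewrite prodr_const card_ord exprVn.
Qed.

(** The norm of a transform is defined by a sum over integer vectors, whereas iterated integration
    needs a measure. One inequality between the two is enough, and for it an upper bound on the mass
    of a point suffices. *)
Lemma lattice_integral_le (h : n.-tuple int -> \bar R) : measT h -> (forall k, 0 <= h k)%E ->
  (\int[lat]_k h k <= \esum_(k in [set: n.-tuple int]) ((lam ^- n)%:E * h k))%E.
Proof.
(* The fibres of [pickle] are empty or single points, and they partition the countable set of
   integer vectors. *)
move=> mh h0; pose F (i : nat) := [set t : n.-tuple int | pickle t = i].
have FE : \bigcup_i F i = setT by apply/seteqP; split=> // t _; exists (pickle t).
have tF : trivIset setT F by move=> i j _ _ [t [/= <- <-]].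
have ln : (0 <= (lam ^- n)%:E)%E by rewrite lee_fin invr_ge0 exprn_ge0// ltW.
have F1 i : F i = set0 \/ exists k, F i = [set k].
  have [->|/set0P[k Fk]] := eqVneq (F i) set0; [by left|right; exists k].
  apply/seteqP; split => t; rewrite /F /= in Fk *; last by move=> ->.
  by move=> ti; apply: (pcan_inj pickleK); rewrite ti Fk.
have mF i : measurable (F i) by case: (F1 i) => [->|[k ->]] //; exact: measurable_lattice_point.
rewrite -[in leLHS]FE ge0_integral_bigcup//; last by rewrite FE.
rewrite nneseries_esumT; last by move=> i; exact: integral_ge0.
rewrite -[in leRHS]FE esum_bigcupT//; last by move=> k; exact: mule_ge0.
apply: le_esum => i _; case: (F1 i) => [->|[k ->]].
  by rewrite integral_set0 esum_set0.
rewrite esum_set1; last exact: mule_ge0.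
have mk := measurable_lattice_point k.
rewrite (eq_integral (cst (h k))); last by move=> t; rewrite inE /= => ->.
rewrite integral_cst// muleC; apply: lee_wpmul2r => //; exact: lattice_point_le.
Qed.

Lemma measurable_freq_fun (F : Fq -> R) : (forall k, measT (fun x => F (x, k))) ->
  measT F.
Proof.
move=> mF _ A mA; rewrite setTI.
pose G (i : nat) : set Fq := if @unpickle (n.-tuple int) i is Some k
  then [set x | A (F (x, k))] `*` [set k] else set0.
rewrite (_ : F @^-1` A = \bigcup_i G i); last first.
  apply/seteqP; split => [[x k] /= Ax|[x k] [i _]].
    by exists (pickle k) => //; rewrite /G pickleK.
  by rewrite /G; case: (unpickle i) => // k' [/= Ax ->].
apply: bigcup_measurable => i _; rewrite /G; case: (unpickle i) => // k.
apply: measurableX; last exact: measurable_lattice_point.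
by rewrite -[X in measurable X]setTI; exact: mF.
Qed.

Lemma freq_integral_le (F : m.-tuple Rm -> n.-tuple int -> R[i]) :
  (forall k, cmeasurable (F ^~ k)) ->
  (\int[freqm m n lam]_xi (complex.Re (F xi.1 xi.2) ^+ 2 + complex.Im (F xi.1 xi.2) ^+ 2)%:E
    <= freq_norm_sq lam F)%E.
Proof.
move=> mF.
have mm : measT (fun xi : Fq => complex.Re (F xi.1 xi.2) ^+ 2 + complex.Im (F xi.1 xi.2) ^+ 2).
  by apply: measurable_freq_fun => k; have [mr mi] := mF k; apply: measurable_funD; exact: measurable_funX.
rewrite [leLHS](prod_tonelli2 (power_measure leb m) lat); last 2 first.
- exact/measurable_EFinP.
- by move=> xi; rewrite lee_fin addr_ge0// sqr_ge0.
apply: (le_trans (lattice_integral_le _ _)).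
- apply: (@measurable_param_integral _ _ _ _ R (power_measure leb m) (fun p : n.-tuple int * m.-tuple Rm => (complex.Re (F p.2 p.1) ^+ 2 + complex.Im (F p.2 p.1) ^+ 2)%:E)).
  apply/measurable_EFinP; apply: (measurableT_comp mm (_ : measT (fun p : n.-tuple int * m.-tuple Rm => (p.2, p.1)))).
  by mea.
- by move=> k; apply: integral_ge0 => x _; rewrite lee_fin addr_ge0// sqr_ge0.
apply: le_esum => k _; apply: lee_wpmul2l; first by rewrite lee_fin invr_ge0 exprn_ge0// ltW.
by apply: eq_le; apply: eq_integral => x _; rewrite normc_sqr.
Qed.
End lattice_points.

Lemma dominated_vanish d (T : measurableType d) (R : realType) (mu : {measure set T -> \bar R})
    (g : nat -> T -> R) (h : T -> R) :
  (forall k, measT (g k)) -> mu.-intT (h) ->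
  (forall k x, `|g k x| <= h x) -> {ae mu, forall x, g ^~ x @ \oo --> (0 : R)} ->
  vanish (fun k => \int[mu]_x `|g k x|%:E)%E.
Proof.
move=> mg jh gh g0.
have g0' : {ae mu, forall x, [set: T] x -> (fun k => (EFin \o g k) x) @ \oo --> (0 : \bar R)%E}.
  by apply: filterS g0 => x hx _; apply: cvg_EFin; [exact: nearW|exact: hx].
have gh' : {ae mu, forall x k, [set: T] x -> (`|(g k x)%:E| <= (h x)%:E)%E}.
  by apply: aeW => x k _; rewrite lee_fin.
have mg' k : measT (EFin \o g k) by exact/measurable_EFinP.
have [_ h0 _] := dominated_convergence measurableT mg' (@measurable_cst _ _ _ _ setT 0%E) g0' jh gh'.
move=> e e0.
have ev : \forall y \near (0%E : \bar R), (y < e%:E)%E.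
  by apply: (open_nbhs_nbhs (A := [set y | (y < e%:E)%E])); split; [exact: open_ereal_lt_ereal|rewrite /= lte_fin].
have [K _ hK] := h0 _ ev; exists K => k Kk; apply: ltW; apply: le_lt_trans (hK k Kk).
by apply: eq_le; apply: eq_integral => x _ /=; rewrite subr0.
Qed.

Lemma vanish_add_cst (R : realType) (x : nat -> \bar R) (a : \bar R) (c : \bar R) : vanish x ->
  (forall k, a <= x k + c)%E -> (a <= c)%E.
Proof.
move=> vx h; apply/lee_addgt0Pr => e e0; have [K /(_ K (leqnn _)) hK] := vx e e0.
by apply: (le_trans (h K)); rewrite addeC; apply: leeD.
Qed.

(** * The transform of a complex function in real terms *)

Section transform_pair.
Context (R : realType) (m n : nat) (lam : R).
Hypothesis l0 : 0 < lam.
Local Notation Rm := (measurableTypeR R).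
Local Notation X := (phys_point R m n).
Local Notation Fq := (frequency R m n).
Local Notation W := (waveguide m n lam).
Local Notation fm := (freqm m n lam).
Implicit Types a b : X -> R.

Definition ftr a b (xi : Fq) : R := ctr lam a xi + str lam b xi.
Definition fti a b (xi : Fq) : R := ctr lam b xi - str lam a xi.

Lemma measurable_ft a b : measT a -> measT b ->
  measT (ftr a b) /\ measT (fti a b).
Proof.
move=> ma mb; split.
  by apply: measurable_funD; [exact: measurable_ctr|exact: measurable_str].
by apply: measurable_funB; [exact: measurable_ctr|exact: measurable_str].
Qed.

Lemma measurable_phase_at (xi : Fq) : measT (fun z : X => phase lam z xi).
Proof. by apply: (measurableT_comp (@measurable_phase R m n lam) (_ : measT (fun z : X => (z, xi)))); mea. Qed.

Lemma ftB a b a' b' xi : W.-intT (a) -> W.-intT (b) ->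
  W.-intT (a') -> W.-intT (b') ->
  ftr (fun z => a z - a' z) (fun z => b z - b' z) xi = ftr a b xi - ftr a' b' xi /\
  fti (fun z => a z - a' z) (fun z => b z - b' z) xi = fti a b xi - fti a' b' xi.
Proof.
move=> ja jb ja' jb'; have mp := measurable_phase_at xi.
have cB p q : W.-intT (p) -> W.-intT (q) ->
    ctr lam (fun z => p z - q z) xi = ctr lam p xi - ctr lam q xi.
  move=> jp jq; rewrite /ctr -(RintB (integrable_mulcos jp mp) (integrable_mulcos jq mp)).
  by congr Rintegral; apply/funext => z; rewrite mulrBl.
have sB p q : W.-intT (p) -> W.-intT (q) ->
    str lam (fun z => p z - q z) xi = str lam p xi - str lam q xi.
  move=> jp jq; rewrite /str -(RintB (integrable_mulsin jp mp) (integrable_mulsin jq mp)).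
  by congr Rintegral; apply/funext => z; rewrite mulrBl.
by rewrite /ftr /fti !cB// !sB//; split; ring.
Qed.

Definition bessel_const : R := 4 * (2 ^+ (m + n) * 32 ^+ m).

Lemma bessel_const_ge0 : 0 <= bessel_const.
Proof. by rewrite !mulr_ge0 ?exprn_ge0. Qed.

Lemma bessel_pair a b B : W.-intT (a) -> W.-intT (b) ->
  (\int[fm]_(xi in fbox B) (ftr a b xi ^+ 2 + fti a b xi ^+ 2)%:E <=
   bessel_const%:E * (\int[W]_z (a z ^+ 2)%:E + \int[W]_z (b z ^+ 2)%:E))%E.
Proof.
move=> ja jb; have mB := @measurable_fbox R m n B.
have ma := integrable_measurable ja; have mb := integrable_measurable jb.
have e0 c xi : 0 <= ctr lam c xi ^+ 2 + str lam c xi ^+ 2 :> R by rewrite addr_ge0// sqr_ge0.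
have me c : measT c -> measurable_fun (fbox B) (EFin \o (fun xi : Fq => ctr lam c xi ^+ 2 + str lam c xi ^+ 2)).
  move=> mc; apply/measurable_funTS/measurable_EFinP.
  by apply: measurable_funD; apply: measurable_funX; [exact: measurable_ctr|exact: measurable_str].
have [m1 m2] := measurable_ft ma mb.
apply: (@le_trans _ _ (\int[fm]_(xi in fbox B) (2%:E * ((ctr lam a xi ^+ 2 + str lam a xi ^+ 2)%:E +
    (ctr lam b xi ^+ 2 + str lam b xi ^+ 2)%:E)))%E).
  apply: ge0_le_integral => //.
  - by move=> xi _; rewrite lee_fin addr_ge0// sqr_ge0.
  - by apply/measurable_funTS/measurable_EFinP; apply: measurable_funD; exact: measurable_funX.
  - by apply: measurable_funeM; apply: emeasurable_funD; exact: me.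
  - move=> xi _; rewrite -EFinD -EFinM lee_fin /ftr /fti.
    move: (ctr _ a _) (str _ a _) (ctr _ b _) (str _ b _) => p q r s.
    rewrite -subr_ge0 (_ : _ - _ = (p - s) ^+ 2 + (r + q) ^+ 2); last by ring.
    by rewrite addr_ge0// sqr_ge0.
rewrite ge0_integralZl//; last 2 first.
- by apply: emeasurable_funD; exact: me.
- by move=> xi _; rewrite -EFinD lee_fin addr_ge0.
rewrite ge0_integralD//; last 4 first.
- by move=> xi _; rewrite lee_fin.
- exact: me.
- by move=> xi _; rewrite lee_fin.
- exact: me.
have -> : bessel_const = 2 * (2 * (2 ^+ (m + n) * 32 ^+ m)) by rewrite /bessel_const; ring.
rewrite [(2 * (2 * _))%:E]EFinM -muleA; apply: lee_wpmul2l => //.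
have c0 : 0 <= 2 ^+ (m + n) * 32 ^+ m :> R by rewrite mulr_ge0 ?exprn_ge0.
have i0 c : (0 <= \int[W]_z (c z ^+ 2)%:E :> \bar R)%E by apply: integral_ge0 => z _; rewrite lee_fin sqr_ge0.
have c2 : 2 ^+ (m + n) * 32 ^+ m <= 2 * (2 ^+ (m + n) * 32 ^+ m) :> R by lra.
rewrite ge0_muleDr//; apply: leeD.
  by apply: (le_trans (bessel l0 B ja)); apply: lee_wpmul2r.
by apply: (le_trans (bessel l0 B jb)); apply: lee_wpmul2r.
Qed.

Definition box (r : R) (z : X) : R := if [forall i, `|tnth z.1 i| <= r] then 1 else 0.

Lemma measurable_box r : measT (box r).
Proof.
rewrite (_ : box r = \1_[set z : X | forall i, `|tnth z.1 i| <= r]); last first.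
  apply/funext => z; rewrite /box indicE; case: forallP => h; first by rewrite mem_set.
  by rewrite memNset.
by apply: measurable_indic; exact: measurable_phys_box.
Qed.

Lemma sqint_box r : 0 <= r -> sqint W (box r).
Proof.
move=> r0; apply: (@sqint_bounded R m n lam l0 (box r) 1 r) => //; first exact: measurable_box.
  by move=> z; rewrite /box; case: ifP; rewrite ?normr1 ?normr0.
by move=> z h; rewrite /box; case: forallP.
Qed.

Lemma fourier_truncate r (f : X -> R[i]) (zeta : m.-tuple Rm) k : 0 <= r ->
  sqint W (fun z => complex.Re (f z)) -> sqint W (fun z => complex.Im (f z)) ->
  fourier_integral lam (truncate r f) zeta k =
  (ftr (fun z => complex.Re (f z) * box r z) (fun z => complex.Im (f z) * box r z) (zeta, k) +i*
   fti (fun z => complex.Re (f z) * box r z) (fun z => complex.Im (f z) * box r z) (zeta, k))%C.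
Proof.
move=> r0 sr si; have sb := sqint_box r0.
have ja := sqint_mul sr sb; have jb := sqint_mul si sb.
have mp := measurable_phase_at (zeta, k).
rewrite /fourier_integral /cintegral /ftr /fti; congr Complex.
  rewrite /ctr /str -(RintD (integrable_mulcos ja mp) (integrable_mulsin jb mp)).
  congr Rintegral; apply/funext => z; rewrite /truncate /box /cis cosN sinN /phase /=.
  by case: ifP => _; case: (f z) => x y /=; ring.
rewrite /ctr /str -(RintB (integrable_mulcos jb mp) (integrable_mulsin ja mp)).
congr Rintegral; apply/funext => z; rewrite /truncate /box /cis cosN sinN /phase /=.
by case: ifP => _; case: (f z) => x y /=; ring.
Qed.
End transform_pair.

(** * The transform of a Littlewood-Paley projection *)

Section projected_transform.
Context (R : realType) (m n : nat) (lam : R) (eta : R -> R).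
Hypotheses (l0 : 0 < lam) (heta : is_cutoff eta).
Local Notation Rm := (measurableTypeR R).
Local Notation X := (phys_point R m n).
Local Notation Fq := (frequency R m n).
Local Notation W := (waveguide m n lam).
Local Notation fm := (freqm m n lam).
Local Notation cst0 := (@cst0 m).
Local Notation w0 k := (win eta k.+1%:R cst0).
Local Notation bx k := (@box R m n k.+1%:R).
Local Notation reF f := (fun z => complex.Re (f z)).
Local Notation imF f := (fun z => complex.Im (f z)).

(** The bridge between the sharp truncation in the definition of the Fourier transform and the
    smooth windows of [has_ft]: at each point both equal 1 from some scale on, and dominated
    convergence applies. Bessel's inequality then carries this over to the transforms. *)
Lemma window_tail (v : X -> R) : sqint W v ->
  vanish (fun k => \int[W]_z ((v z * w0 k z - v z * bx k z) ^+ 2)%:E)%E.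
Proof.
move=> [mv jv]; have [M M0 hM] := win_bounded n heta cst0.
pose g k z := (v z * w0 k z - v z * bx k z) ^+ 2.
have mg k : measT (g k).
  apply: measurable_funX; apply: measurable_funB; apply: measurable_funM => //.
    exact: measurable_win.
  exact: measurable_box.
have jh := integrableZl measurableT ((M + 1) ^+ 2) jv.
have b1 k z : `|bx k z| <= 1 by rewrite /box; case: ifP; rewrite ?normr1 ?normr0.
suff h : vanish (fun k => \int[W]_z `|g k z|%:E)%E.
  apply: (vanish_le h) => k; apply: eq_le; apply: eq_integral => z _.
  by rewrite ger0_norm// sqr_ge0.
apply: (@dominated_vanish _ _ _ W g (fun z => (M + 1) ^+ 2 * v z ^+ 2)) => //.
  move=> k z; rewrite /g ger0_norm ?sqr_ge0// -mulrBr exprMn mulrC ler_wpM2r ?sqr_ge0//.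
  rewrite -[leLHS]real_normK ?num_real// ler_pXn2r ?nnegrE//; last by rewrite addr_ge0.
  by apply: (le_trans (ler_normB _ _)); apply: lerD.
apply: aeW => z.
pose S := \sum_(i < m) `|tnth z.1 i|.
have S0 : 0 <= S by apply: sumr_ge0.
have hS i : `|tnth z.1 i| <= S by rewrite /S (bigD1 i)//= lerDl sumr_ge0.
apply: cvg_near_cst; exists (Num.bound S) => // k /= hk.
have Sk : S <= k.+1%:R.
  by apply: (le_trans (ltW (archi_boundP S0))); rewrite ler_nat leqW.
have kp : 0 < k.+1%:R :> R by rewrite ltr0n.
have [_ _ _ eta1 _] := heta.
rewrite /g /win /box; case: forallP => [_|]; last by case=> i; apply: le_trans Sk.
rewrite big1 ?mulr1 ?subrr ?expr0n// => i _.
by rewrite /cst0 /=; apply: eta1; rewrite normrM normfV (gtr0_norm kp) ler_pdivrMr// mul1r; apply: le_trans Sk.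
Qed.

Definition ftdist (B : R) (P Q : Fq -> R) : \bar R := (\int[fm]_(xi in fbox B) (P xi ^+ 2 + Q xi ^+ 2)%:E)%E.

Lemma ftdist_le B (P Q P' Q' : Fq -> R) : measT P -> measT Q ->
  measT P' -> measT Q' ->
  (forall xi, P xi ^+ 2 + Q xi ^+ 2 <= P' xi ^+ 2 + Q' xi ^+ 2) -> (ftdist B P Q <= ftdist B P' Q')%E.
Proof.
move=> m1 m2 m3 m4 h; have mB := @measurable_fbox R m n B.
apply: ge0_le_integral => //.
- by move=> xi _; rewrite lee_fin addr_ge0// sqr_ge0.
- by apply/measurable_funTS/measurable_EFinP; apply: measurable_funD; exact: measurable_funX.
- by apply/measurable_funTS/measurable_EFinP; apply: measurable_funD; exact: measurable_funX.
- by move=> xi _; rewrite lee_fin.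
Qed.

Lemma ftdistD B (P Q P' Q' : Fq -> R) : measT P -> measT Q ->
  measT P' -> measT Q' ->
  (ftdist B (fun xi => P xi + P' xi)%R (fun xi => Q xi + Q' xi)%R <=
   2%:E * ftdist B P Q + 2%:E * ftdist B P' Q')%E.
Proof.
move=> m1 m2 m3 m4; have mB := @measurable_fbox R m n B.
have e0 p q : (0 <= (p ^+ 2 + q ^+ 2 : R)%:E)%E by rewrite lee_fin addr_ge0// sqr_ge0.
have me (p q : Fq -> R) : measT p -> measT q ->
   measurable_fun (fbox B) (EFin \o (fun xi : Fq => p xi ^+ 2 + q xi ^+ 2)).
  by move=> mp mq; apply/measurable_funTS/measurable_EFinP; apply: measurable_funD; exact: measurable_funX.
rewrite /ftdist -!ge0_integralZl//; try exact: me.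
rewrite -ge0_integralD//; last 4 first.
- by move=> xi _; rewrite mule_ge0.
- by apply: measurable_funeM; exact: me.
- by move=> xi _; rewrite mule_ge0.
- by apply: measurable_funeM; exact: me.
apply: ge0_le_integral => //.
- by apply: me; exact: measurable_funD.
- by apply: emeasurable_funD; apply: measurable_funeM; exact: me.
move=> xi _; rewrite -!EFinM -EFinD lee_fin -subr_ge0.
rewrite (_ : _ - _ = (P xi - P' xi) ^+ 2 + (Q xi - Q' xi) ^+ 2); last by ring.
by rewrite addr_ge0// sqr_ge0.
Qed.

(** Shaped for [lp_transform]: the two pieces of a projection each come with their own transform of
    the function, so the second must be exchanged for the first under the symbol [c]. The five pairs
    are the window error, the two pieces and the two transforms of the function. *)
Lemma ftdist_combine B (P Q p1 q1 p2 q2 p3 q3 p4 q4 c : Fq -> R) :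
  (forall g, g \in [:: P; Q; p1; q1; p2; q2; p3; q3; p4; q4; c] -> measT g) ->
  (forall xi, 0 <= c xi <= 1) ->
  (ftdist B (fun xi => P xi + ((- p1 xi + p2 xi) + (c xi * p3 xi + - (c xi * p4 xi))))%R
            (fun xi => Q xi + ((- q1 xi + q2 xi) + (c xi * q3 xi + - (c xi * q4 xi))))%R <=
   2%:E * ftdist B P Q + 2%:E * (2%:E * (2%:E * ftdist B p1 q1 + 2%:E * ftdist B p2 q2) +
      2%:E * (2%:E * ftdist B p3 q3 + 2%:E * ftdist B p4 q4)))%E.
Proof.
move=> mm c01; have key (p q p' q' : Fq -> R) x y : measT p -> measT q ->
    measT p' -> measT q' -> (ftdist B p q <= x)%E -> (ftdist B p' q' <= y)%E ->
    (ftdist B (fun xi => p xi + p' xi)%R (fun xi => q xi + q' xi)%R <= 2%:E * x + 2%:E * y)%E.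
  move=> h1 h2 h3 h4 hx hy; apply: (le_trans (ftdistD _ h1 h2 h3 h4)).
  by apply: leeD; apply: lee_wpmul2l.
have mP : measT P by apply: mm; rewrite !inE eqxx.
have mQ : measT Q by apply: mm; rewrite !inE eqxx ?orbT.
have m1 : measT p1 by apply: mm; rewrite !inE eqxx ?orbT.
have n1 : measT q1 by apply: mm; rewrite !inE eqxx ?orbT.
have m2 : measT p2 by apply: mm; rewrite !inE eqxx ?orbT.
have n2 : measT q2 by apply: mm; rewrite !inE eqxx ?orbT.
have m3 : measT p3 by apply: mm; rewrite !inE eqxx ?orbT.
have n3 : measT q3 by apply: mm; rewrite !inE eqxx ?orbT.
have m4 : measT p4 by apply: mm; rewrite !inE eqxx ?orbT.
have n4 : measT q4 by apply: mm; rewrite !inE eqxx ?orbT.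
have mc : measT c by apply: mm; rewrite !inE eqxx ?orbT.
have mN (p : Fq -> R) : measT p -> measT (fun xi => - p xi).
  by move=> mp; exact: (measurableT_comp (@oppr_measurable R setT) mp).
have mM (p : Fq -> R) : measT p -> measT (fun xi => c xi * p xi).
  by move=> mp; exact: measurable_funM.
have mD (p q : Fq -> R) : measT p -> measT q -> measT (fun xi => p xi + q xi).
  by move=> mp mq; exact: measurable_funD.
have cs1 x xi : (c xi * x) ^+ 2 <= x ^+ 2.
  have /andP[c0 c1] := c01 xi; rewrite exprMn; apply: ler_piMl; first exact: sqr_ge0.
  by rewrite expr_le1.
have b3 : (ftdist B (fun xi => c xi * p3 xi)%R (fun xi => c xi * q3 xi)%R <= ftdist B p3 q3)%E.
  by apply: ftdist_le => //; [exact: mM|exact: mM|move=> xi; apply: lerD; exact: cs1].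
have b4 : (ftdist B (fun xi => - (c xi * p4 xi))%R (fun xi => - (c xi * q4 xi))%R <= ftdist B p4 q4)%E.
  apply: ftdist_le => //; [exact: mN _ (mM _ _)|exact: mN _ (mM _ _)|].
  by move=> xi; rewrite !sqrrN; apply: lerD; exact: cs1.
have b1 : (ftdist B (fun xi => - p1 xi)%R (fun xi => - q1 xi)%R <= ftdist B p1 q1)%E.
  by apply: ftdist_le => //; [exact: mN|exact: mN|move=> xi; rewrite !sqrrN].
have k12 := key _ _ _ _ _ _ (mN _ m1) (mN _ n1) m2 n2 b1 (lexx _).
have k34 := key _ _ _ _ _ _ (mM _ m3) (mM _ n3) (mN _ (mM _ m4)) (mN _ (mM _ n4)) b3 b4.
have k14 := key _ _ _ _ _ _ (mD _ _ (mN _ m1) m2) (mD _ _ (mN _ n1) n2)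
  (mD _ _ (mM _ m3) (mN _ (mM _ m4))) (mD _ _ (mM _ n3) (mN _ (mM _ n4))) k12 k34.
exact: (key _ _ _ _ _ _ mP mQ (mD _ _ (mD _ _ (mN _ m1) m2) (mD _ _ (mM _ m3) (mN _ (mM _ m4))))
  (mD _ _ (mD _ _ (mN _ n1) n2) (mD _ _ (mM _ n3) (mN _ (mM _ n4)))) (lexx _) k14).
Qed.

Lemma fourier_distance (f : X -> R[i]) (F : m.-tuple Rm -> n.-tuple int -> R[i]) B :
  sqint W (reF f) -> sqint W (imF f) -> is_fourier lam f F ->
  vanish (fun k => ftdist B
    (fun xi => complex.Re (F xi.1 xi.2) - ftr lam (fun z => complex.Re (f z) * bx k z) (fun z => complex.Im (f z) * bx k z) xi)
    (fun xi => complex.Im (F xi.1 xi.2) - fti lam (fun z => complex.Re (f z) * bx k z) (fun z => complex.Im (f z) * bx k z) xi)).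
Proof.
move=> sr si [[mF _] cF].
have v0 : vanish (fun k => freq_norm_sq lam (fun zeta k' => F zeta k' - fourier_integral lam (truncate k%:R f) zeta k')).
  apply: cvg_vanish cF => r; apply: esum_ge0 => k _; rewrite mule_ge0//.
    by rewrite lee_fin invr_ge0 exprn_ge0// ltW.
  by apply: integral_ge0 => x _; rewrite lee_fin sqr_ge0.
have v1 : vanish (fun k => freq_norm_sq lam (fun zeta k' => F zeta k' - fourier_integral lam (truncate k.+1%:R f) zeta k')).
  by move=> e /v0[K hK]; exists K => k Kk; apply: hK; exact: leqW.
apply: (vanish_le v1) => k.
have sb := @sqint_box R m n lam l0 _ (ler0n R k.+1).
have ja := sqint_mul sr sb; have jb := sqint_mul si sb.
have [mf1 mf2] := measurable_ft lam (integrable_measurable ja) (integrable_measurable jb).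
have mB := @measurable_fbox R m n B.
have mFr : measT (fun xi : Fq => complex.Re (F xi.1 xi.2)).
  by apply: measurable_freq_fun => k'; exact: (mF k').1.
have mFi : measT (fun xi : Fq => complex.Im (F xi.1 xi.2)).
  by apply: measurable_freq_fun => k'; exact: (mF k').2.
set a := (fun z => _ * _) in ja mf1 mf2 *; set b := (fun z => complex.Im _ * _) in jb mf1 mf2 *.
have FE zeta k' : F zeta k' - fourier_integral lam (truncate k.+1%:R f) zeta k' =
   ((complex.Re (F zeta k') - ftr lam a b (zeta, k')) +i* (complex.Im (F zeta k') - fti lam a b (zeta, k')))%C.
  by rewrite (fourier_truncate l0 _ _ (ler0n R k.+1) sr si); case: (F zeta k').
have mG k' : cmeasurable (fun zeta => F zeta k' - fourier_integral lam (truncate k.+1%:R f) zeta k').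
  have mk : measT (fun x : m.-tuple Rm => (x, k')) by mea.
  split; under eq_fun do rewrite FE /=; apply: measurable_funB.
  - exact: (mF k').1.
  - exact: (measurableT_comp mf1 mk).
  - exact: (mF k').2.
  - exact: (measurableT_comp mf2 mk).
apply: (le_trans _ (freq_integral_le l0 mG)).
apply: (@le_trans _ _ (\int[fm]_xi ((complex.Re (F xi.1 xi.2) - ftr lam a b xi) ^+ 2 + (complex.Im (F xi.1 xi.2) - fti lam a b xi) ^+ 2)%:E)%E).
  apply: ge0_subset_integral => //.
    by apply/measurable_EFinP; apply: measurable_funD; apply: measurable_funX; exact: measurable_funB.
  by move=> xi _; rewrite lee_fin addr_ge0// sqr_ge0.
apply: eq_le; apply: eq_integral => -[x k'] _.
by rewrite FE /=.
Qed.

Local Notation cs N xi := (cutoff_symbol lam eta N xi.1 xi.2).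
Local Notation large0 := (@large_freq R m n lam (fun=> 0) (fun=> 0)).
Local Notation small := (@small_freq R m n lam).

Lemma symbol_bounds N (xi : Fq) : 0 <= cs N xi <= 1.
Proof.
have [_ _ eta01 _ _] := heta; rewrite /cutoff_symbol.
have h1 k (g : 'I_k -> R) : 0 <= \prod_(i < k) eta (g i) <= 1.
  apply/andP; split; first by apply: prodr_ge0 => i _; have /andP[] := eta01 (g i).
  rewrite -[leRHS](@big1 _ 1 *%R 'I_k (index_enum _) predT (fun=> 1))//.
  by apply: ler_prod => i _; exact: eta01.
have /andP[p0 p1] := h1 m (fun i => tnth xi.1 i / N).
have /andP[q0 q1] := h1 n (fun j => (tnth xi.2 j)%:~R / lam / N).
by rewrite mulr_ge0//= -[leRHS]mulr1 ler_pM.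
Qed.

Lemma symbol_out N N' (xi : Fq) : 0 < N -> N <= N' -> ~ small N' xi -> cs N xi = 0.
Proof.
move=> N0 NN' /not_andP hs; have [_ _ _ _ eta0] := heta.
have e0 x : 2 * N' < `|x| -> eta (x / N) = 0.
  move=> h; apply: eta0; rewrite normrM normfV (gtr0_norm N0) ler_pdivlMr//.
  by apply: le_trans (ltW h); rewrite ler_pM2l.
rewrite /cutoff_symbol; case: hs => /existsNP[i /negP]; rewrite -ltNge => h.
  by rewrite (bigD1 i)//= e0// !mul0r.
by rewrite [X in _ * X](bigD1 i)//= e0// mul0r mulr0.
Qed.

Lemma symbol_in N N' (xi : Fq) : 0 < N -> N' / 2 <= N -> ~ large0 N' xi -> cs N xi = 1.
Proof.
move=> N0 NN' /not_orP[h1 h2]; have [_ _ _ eta1 _] := heta.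
have e1 x : `|2 * 0 - x| < N' / 2 -> eta (x / N) = 1.
  move=> h; apply: eta1; rewrite normrM normfV (gtr0_norm N0) ler_pdivrMr// mul1r.
  by apply: le_trans NN'; apply: ltW; move: h; rewrite mulr0 sub0r normrN.
rewrite /cutoff_symbol !big1 ?mulr1// => i _; apply: e1; rewrite ltNge; apply/negP => h.
  by apply: h2; exists i.
by apply: h1; exists i.
Qed.

Lemma measurable_symbol N : measT (fun xi : Fq => cs N xi).
Proof.
have me : measT (eta : Rm -> R).
  by apply: continuous_measurable_fun; exact: (@cutoff_continuous _ _ heta 0).
apply: measurable_funM.
  apply: (measurableT_comp (f := fun t : m.-tuple Rm => \prod_(i < m) eta (tnth t i / N))); last by mea.
  apply: (@measurable_tensor _ Rm _ _ (fun i x => eta (x / N))) => i.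
  by apply: (measurableT_comp me); mea.
apply: (measurableT_comp (f := fun t : n.-tuple int => \prod_(i < n) eta ((tnth t i)%:~R / lam / N))); last by mea.
by apply: (@measurable_tensor _ int _ _ (fun i x => eta (x%:~R / lam / N))) => i; exact: measurable_on_int.
Qed.

Lemma fourier_bound (f : X -> R[i]) (F : m.-tuple Rm -> n.-tuple int -> R[i]) B :
  sqint W (reF f) -> sqint W (imF f) -> is_fourier lam f F ->
  (ftdist B (fun xi => complex.Re (F xi.1 xi.2)) (fun xi => complex.Im (F xi.1 xi.2)) <=
    (2 * bessel_const R m n)%:E * n2 W f)%E.
Proof.
move=> sr si hF; have v := vanishZ (ler0n R 2) (fourier_distance B sr si hF).
have [[mF _] _] := hF.
have mFr : measT (fun xi : Fq => complex.Re (F xi.1 xi.2)).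
  by apply: measurable_freq_fun => k'; exact: (mF k').1.
have mFi : measT (fun xi : Fq => complex.Im (F xi.1 xi.2)).
  by apply: measurable_freq_fun => k'; exact: (mF k').2.
apply: (vanish_add_cst v) => k.
have sb := @sqint_box R m n lam l0 _ (ler0n R k.+1).
have ja := sqint_mul sr sb; have jb := sqint_mul si sb.
have [mf1 mf2] := measurable_ft lam (integrable_measurable ja) (integrable_measurable jb).
set a := (fun z => _ * _) in ja mf1 mf2 *; set b := (fun z => complex.Im _ * _) in jb mf1 mf2 *.
apply: (@le_trans _ _ (ftdist B
  (fun xi => complex.Re (F xi.1 xi.2) - ftr lam a b xi + ftr lam a b xi)%R
  (fun xi => complex.Im (F xi.1 xi.2) - fti lam a b xi + fti lam a b xi)%R)).
  by apply: eq_le; congr (ftdist B _ _); apply/funext => xi; rewrite subrK.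
apply: (le_trans (ftdistD _ _ _ _ _)) => //; try exact: measurable_funB.
apply: leeD => //.
rewrite [(2 * _)%:E]EFinM -muleA; apply: lee_wpmul2l => //.
apply: (le_trans (bessel_pair l0 B ja jb)); apply: lee_wpmul2l; first by rewrite lee_fin bessel_const_ge0.
have [ma _] := sr; have [mb _] := si.
rewrite /n2 ge0_intD; try exact: measurable_funX; try by move=> ?; exact: sqr_ge0.
have mbx := @measurable_box R m n k.+1%:R.
have bx1 x z : (x * bx k z) ^+ 2 <= x ^+ 2.
  by rewrite /box; case: ifP => _; rewrite ?mulr1// mulr0 expr0n sqr_ge0.
apply: leeD; apply: ge0_le_int; try exact: measurable_funX; try (by move=> z; exact: sqr_ge0); try by move=> z; exact: bx1.
all: by apply: measurable_funX; exact: measurable_funM.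
Qed.

Lemma measurable_fourier (f : X -> R[i]) (F : m.-tuple Rm -> n.-tuple int -> R[i]) : is_fourier lam f F ->
  measT (fun xi : Fq => complex.Re (F xi.1 xi.2)) /\
  measT (fun xi : Fq => complex.Im (F xi.1 xi.2)).
Proof.
by move=> [[mF _] _]; split; apply: measurable_freq_fun => k; [exact: (mF k).1|exact: (mF k).2].
Qed.

(** The symbol of the projection is the difference of the cutoffs at [N] and [N / 2]. Both vanish
    when some coordinate exceeds [2 * N], and both equal 1 when all coordinates are below [N / 2];
    this yields the two support conditions. The norm bound rests on Bessel's inequality alone. *)
Lemma lp_transform N (f pf : X -> R[i]) : 0 < N -> in_L2 W f -> is_LP lam eta N f pf ->
  exists F : (Fq -> R) * (Fq -> R),
  [/\ measT F.1 /\ measT F.2, has_ft lam eta pf F,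
    forall xi, ~ small N xi -> F.1 xi = 0 /\ F.2 xi = 0,
    forall xi, ~ large0 N xi -> F.1 xi = 0 /\ F.2 xi = 0 &
    (\int[fm]_xi (F.1 xi ^+ 2 + F.2 xi ^+ 2)%:E <= (2 * bessel_const R m n)%:E * n2 W f)%E].
Proof.
move=> N0 Lf [h1 [h2 [[L1 [F [hF hF1]]] [L2 [F' [hF' hF2]]] ->]]].
have [sfr sfi _] := in_L2_sqint Lf.
have [s1r s1i _] := in_L2_sqint L1; have [s2r s2i _] := in_L2_sqint L2.
have N2 : 0 < N / 2 by rewrite divr_gt0.
have N2N : N / 2 <= N by rewrite ler_pdivrMr//; lra.
have [mFr mFi] := measurable_fourier hF; have [mFr' mFi'] := measurable_fourier hF'.
have mS M := measurable_symbol M.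
pose S (xi : Fq) := cs N xi - cs (N / 2) xi.
pose G : (Fq -> R) * (Fq -> R) :=
  (fun xi => S xi * complex.Re (F xi.1 xi.2), fun xi => S xi * complex.Im (F xi.1 xi.2)).
have mG1 : measT G.1 by apply: measurable_funM => //; exact: measurable_funB.
have mG2 : measT G.2 by apply: measurable_funM => //; exact: measurable_funB.
have sG xi : ~ small N xi -> S xi = 0.
  move=> h; rewrite /S (symbol_out N0 (lexx _) h).
  by rewrite (@symbol_out (N / 2) N) ?subrr.
have lG xi : ~ large0 N xi -> S xi = 0.
  move=> h; rewrite /S (@symbol_in N N)// (@symbol_in (N / 2) N)// subrr//.
have S1 xi : S xi ^+ 2 <= 1.
  have /andP[a0 a1] := symbol_bounds N xi; have /andP[b0 b1] := symbol_bounds (N / 2) xi.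
  rewrite -[leLHS]real_normK ?num_real// expr_le1// ler_norml /S; apply/andP; split; lra.
exists G; split => //.
- move=> B.
  have sdr : sqint W (fun z => complex.Re (h1 z) - complex.Re (h2 z)) by exact: sqint_sub.
  have sdi : sqint W (fun z => complex.Im (h1 z) - complex.Im (h2 z)) by exact: sqint_sub.
  have v1 := fourier_distance B s1r s1i hF1; have v2 := fourier_distance B s2r s2i hF2.
  have v3 := fourier_distance B sfr sfi hF; have v4 := fourier_distance B sfr sfi hF'.
  have K0 := bessel_const_ge0 R m n.
  have v5 := vanishZ K0 (vanishD (window_tail sdr) (window_tail sdi)).
  have v12 := vanishD (vanishZ (ler0n R 2) v1) (vanishZ (ler0n R 2) v2).
  have v34 := vanishD (vanishZ (ler0n R 2) v3) (vanishZ (ler0n R 2) v4).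
  have v14 := vanishD (vanishZ (ler0n R 2) v12) (vanishZ (ler0n R 2) v34).
  apply: (vanish_le (vanishD (vanishZ (ler0n R 2) v5) (vanishZ (ler0n R 2) v14))) => k.
  have kp : 0 < k.+1%:R :> R by rewrite ltr0n.
  have sb := @sqint_box R m n lam l0 _ (ler0n R k.+1); have sw := sqint_win n l0 heta cst0 kp.
  have jb g : sqint W g -> W.-intT ((fun z => g z * bx k z)) by move=> sg; exact: sqint_mul.
  have jw g : sqint W g -> W.-intT ((fun z => g z * w0 k z)) by move=> sg; exact: sqint_mul.
  have mt p q : sqint W p -> sqint W q ->
      measT (ftr lam (fun z => p z * bx k z) (fun z => q z * bx k z)) /\
      measT (fti lam (fun z => p z * bx k z) (fun z => q z * bx k z)).
    by move=> sp sq; apply: measurable_ft; exact: integrable_measurable (jb _ _).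
  have [m1 m1'] := mt _ _ s1r s1i; have [m2 m2'] := mt _ _ s2r s2i; have [m3 m3'] := mt _ _ sfr sfi.
  pose ja := integrable_B (jw _ sdr) (jb _ sdr); pose jc := integrable_B (jw _ sdi) (jb _ sdi).
  have [m5 m5'] := measurable_ft lam (integrable_measurable ja) (integrable_measurable jc).
  have hb xi := ftB xi (jw _ sdr) (jw _ sdi) (jb _ sdr) (jb _ sdi).
  have hd xi := ftB xi (jb _ s1r) (jb _ s1i) (jb _ s2r) (jb _ s2i).
  have b5 := bessel_pair l0 B ja jc.
  have bxB p q : (fun z : X => (p z - q z) * bx k z) = (fun z => p z * bx k z - q z * bx k z).
    by apply/funext => z; rewrite mulrBl.
  have hbox xi : ftr lam (fun z => (complex.Re (h1 z) - complex.Re (h2 z)) * bx k z)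
      (fun z => (complex.Im (h1 z) - complex.Im (h2 z)) * bx k z) xi =
      ftr lam (fun z => complex.Re (h1 z) * bx k z) (fun z => complex.Im (h1 z) * bx k z) xi -
      ftr lam (fun z => complex.Re (h2 z) * bx k z) (fun z => complex.Im (h2 z) * bx k z) xi.
    by rewrite (bxB (reF h1) (reF h2)) (bxB (imF h1) (imF h2)); exact: (hd xi).1.
  have hboy xi : fti lam (fun z => (complex.Re (h1 z) - complex.Re (h2 z)) * bx k z)
      (fun z => (complex.Im (h1 z) - complex.Im (h2 z)) * bx k z) xi =
      fti lam (fun z => complex.Re (h1 z) * bx k z) (fun z => complex.Im (h1 z) * bx k z) xi -
      fti lam (fun z => complex.Re (h2 z) * bx k z) (fun z => complex.Im (h2 z) * bx k z) xi.
    by rewrite (bxB (reF h1) (reF h2)) (bxB (imF h1) (imF h2)); exact: (hd xi).2.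
  have mcs (g : Fq -> R) : measT g -> forall M, measT (fun xi => cs M xi * g xi).
    by move=> mg M; exact: measurable_funM (mS M) mg.
  have ReM (x : R) (w : R[i]) : complex.Re (x%:C%C * w) = x * complex.Re w by case: w => a b /=; ring.
  have ImM (x : R) (w : R[i]) : complex.Im (x%:C%C * w) = x * complex.Im w by case: w => a b /=; ring.
  have two0 : (0 <= 2%:E :> \bar R)%E by [].
  pose P1 (c : Fq -> R) (g : m.-tuple Rm -> n.-tuple int -> R[i]) (h : X -> R[i]) xi :=
    complex.Re ((c xi)%:C%C * g xi.1 xi.2) - ftr lam (fun z => complex.Re (h z) * bx k z) (fun z => complex.Im (h z) * bx k z) xi.
  pose Q1 (c : Fq -> R) (g : m.-tuple Rm -> n.-tuple int -> R[i]) (h : X -> R[i]) xi :=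
    complex.Im ((c xi)%:C%C * g xi.1 xi.2) - fti lam (fun z => complex.Re (h z) * bx k z) (fun z => complex.Im (h z) * bx k z) xi.
  pose P3 (g : m.-tuple Rm -> n.-tuple int -> R[i]) xi :=
    complex.Re (g xi.1 xi.2) - ftr lam (fun z => complex.Re (f z) * bx k z) (fun z => complex.Im (f z) * bx k z) xi.
  pose Q3 (g : m.-tuple Rm -> n.-tuple int -> R[i]) xi :=
    complex.Im (g xi.1 xi.2) - fti lam (fun z => complex.Re (f z) * bx k z) (fun z => complex.Im (f z) * bx k z) xi.
  set P5 := ftr lam _ _ in m5 b5 hb; set Q5 := fti lam _ _ in m5' b5 hb.
  have mm g : g \in [:: P5; Q5; P1 (fun xi => cs N xi) F h1; Q1 (fun xi => cs N xi) F h1;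
      P1 (fun xi => cs (N / 2) xi) F' h2; Q1 (fun xi => cs (N / 2) xi) F' h2; P3 F; Q3 F; P3 F'; Q3 F';
      fun xi => cs (N / 2) xi] -> measT g.
    rewrite !inE => /orP[/eqP->|/orP[/eqP->|/orP[/eqP->|/orP[/eqP->|/orP[/eqP->|/orP[/eqP->|
      /orP[/eqP->|/orP[/eqP->|/orP[/eqP->|/orP[/eqP->|/eqP->]]]]]]]]]] //.
    - by apply: measurable_funB m1; under eq_fun do rewrite ReM; exact: mcs.
    - by apply: measurable_funB m1'; under eq_fun do rewrite ImM; exact: mcs.
    - by apply: measurable_funB m2; under eq_fun do rewrite ReM; exact: mcs.
    - by apply: measurable_funB m2'; under eq_fun do rewrite ImM; exact: mcs.
    - by apply: measurable_funB m3.
    - by apply: measurable_funB m3'.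
    - by apply: measurable_funB m3.
    - by apply: measurable_funB m3'.
  (* The windowed transform minus [G] telescopes: window against box for [h1 - h2], then box against
     limit for [h1] and [h2], and finally the difference of [F] and [F'] under the symbol at
     [N / 2], through the box transform of [f]. *)
  have c4 := ftdist_combine B mm (symbol_bounds (N / 2)).
  have c5 := le_trans c4 (leeD (lee_wpmul2l two0 b5) (lexx _)).
  apply: (le_trans _ c5).
  rewrite /ftdist le_eqVlt; apply/orP; left; apply/eqP; apply: eq_integral => xi _.
  have [e5 e5'] := hb xi.
  rewrite /P1 /Q1 /P3 /Q3 e5 e5' hbox hboy /= !ReM !ImM /wct /wst.
  have ReB (w w' : R[i]) : complex.Re (w - w') = complex.Re w - complex.Re w' by case: w w' => [? ?] [? ?].
  have ImB (w w' : R[i]) : complex.Im (w - w') = complex.Im w - complex.Im w' by case: w w' => [? ?] [? ?].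
  rewrite (_ : (fun z => complex.Re (h1 z - h2 z) * w0 k z) = fun z => (complex.Re (h1 z) - complex.Re (h2 z)) * w0 k z); last by apply/funext => z; rewrite ReB.
  rewrite (_ : (fun z => complex.Im (h1 z - h2 z) * w0 k z) = fun z => (complex.Im (h1 z) - complex.Im (h2 z)) * w0 k z); last by apply/funext => z; rewrite ImB.
  rewrite -/(ftr lam _ _ xi) -/(fti lam _ _ xi) /S.
  by congr EFin; congr (_ ^+ 2 + _ ^+ 2); ring.
- by move=> xi /sG h; rewrite /G /= h !mul0r.
- by move=> xi /lG h; rewrite /G /= h !mul0r.
(* [fbox] bounds the integers [k] rather than [k / lam], so this [B] bounds both [2 * N] and
   [2 * N * lam] and the box contains the support of [G]. *)
pose B := 2 * N * (lam + 1).
apply: (le_trans _ (fourier_bound B sfr sfi hF)).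
rewrite /ftdist [leRHS]integral_mkcond; apply: ge0_le_integral => //.
- by move=> xi _; rewrite lee_fin addr_ge0// sqr_ge0.
- by apply/measurable_EFinP; apply: measurable_funD; exact: measurable_funX.
- apply/(measurable_restrictT _ (@measurable_fbox R m n B)).
  by apply/measurable_funTS/measurable_EFinP; apply: measurable_funD; exact: measurable_funX.
move=> xi _; rewrite patchE; case: ifPn => [_|/negP h].
  by rewrite lee_fin /G /= !exprMn; apply: lerD; apply: ler_piMl => //; exact: sqr_ge0.
rewrite lee_fin /G /= sG ?mul0r ?expr0n ?addr0// => -[s1 s2]; apply: h; rewrite inE; split => [i|j].
  by apply: (le_trans (s1 i)); rewrite /B ler_peMr ?mulr_ge0 ?lerDr// ltW.
apply: (@le_trans _ _ (2 * N * lam)); last by rewrite /B ler_pM2l ?mulr_gt0// lerDl.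
by rewrite -ler_pdivrMr// -[X in _ / X](gtr0_norm l0) -normfV -normrM.
Qed.
End projected_transform.

(** * Boxes determine functions *)

Section boxes.
Context (R : realType) (m n : nat).
Local Notation Rm := (measurableTypeR R).
Local Notation X := (phys_point R m n).

Definition zcoord (z : X) (s : 'I_m + 'I_n) : R :=
  match s with inl i => tnth z.1 i | inr j => tnth z.2 j end.

Definition rbox (a b : 'I_m + 'I_n -> R) : set X := [set z | forall s, a s < zcoord z s < b s].

Lemma measurable_coord s : measT (zcoord^~ s).
Proof.
case: s => i /=; first by apply: (measurableT_comp (measurable_tnth i)); exact: measurable_fst.
by apply: (measurableT_comp (measurable_tnth i)); exact: measurable_snd.
Qed.

Lemma measurable_rbox a b : measurable (rbox a b).
Proof.
apply: (@measurable_all _ _ _ (fun s => [set z : X | a s < zcoord z s < b s])) => s.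
rewrite (_ : [set z | _] = setT `&` (zcoord^~ s) @^-1` `]a s, b s[%classic).
  by apply: (measurable_coord s measurableT); exact: measurable_itv.
by apply/seteqP; split => z; rewrite /= ?in_itv //= => -[].
Qed.

Let rboxes := [set B | exists a b, B = rbox a b].

Lemma norm_coord_bound (z : X) : exists N : nat, forall s, `|zcoord z s| < N%:R.
Proof.
pose S := \sum_s `|zcoord z s|; exists (Num.bound S) => s.
have S0 : 0 <= S by apply: sumr_ge0.
apply: le_lt_trans (archi_boundP S0).
by rewrite /S (bigD1 s)//= lerDl sumr_ge0.
Qed.

Lemma rbox_generate : @measurable _ X = <<s rboxes>>.
Proof.
have mid : measT (id : g_sigma_algebraType rboxes -> X).
  have mc s : measT (zcoord^~ s : g_sigma_algebraType rboxes -> Rm).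
    apply: (@measurability _ _ (g_sigma_algebraType rboxes) Rm setT (zcoord^~ s) (@RGenOInfty.G R) (@RGenOInfty.measurableE R)) => _ [_ [x ->] <-]; rewrite setTI.
    rewrite (_ : _ @^-1` _ = \bigcup_N rbox (fun s' => if s' == s then x else - N%:R) (fun=> N%:R)).
      apply: bigcup_measurable => N _; apply: sub_sigma_algebra.
      by exists (fun s' => if s' == s then x else - N%:R), (fun=> N%:R).
    apply/seteqP; split => z /=; last by move=> [N _ /(_ s)]; rewrite in_itv /= eqxx andbT => /andP[].
    rewrite in_itv /= andbT => xz.
    have [N hN] := norm_coord_bound z; exists N => // s'.
    have := hN s'; rewrite ltr_norml => /andP[h1 h2]; rewrite h2 andbT.
    by case: eqP => // ->.
  apply/measurable_fun_pairP; split; apply/measurable_fun_tnthP => i; [exact: (mc (inl i))|exact: (mc (inr i))].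
apply/seteqP; split => [A mA|].
  by have := mid measurableT A mA; rewrite setTI preimage_id.
by apply: smallest_sub => [|_ [a [b ->]]]; [exact: sigma_algebra_measurable|exact: measurable_rbox].
Qed.

Lemma rbox_setI : setI_closed rboxes.
Proof.
move=> _ _ [a [b ->]] [a' [b' ->]].
exists (fun s => Num.max (a s) (a' s)), (fun s => Num.min (b s) (b' s)).
apply/seteqP; split => z /= => [[h h'] s|h].
  by rewrite gt_max lt_min; have /andP[-> ->] := h s; have /andP[-> ->] := h' s.
by split => s; have := h s; rewrite gt_max lt_min => /andP[/andP[h1 h2] /andP[h3 h4]]; rewrite ?h1 ?h2 ?h3 ?h4.
Qed.

(** Open boxes are stable under intersection and generate the measurable sets, so a vanishing
    integral over each box spreads to all measurable sets by Dynkin's theorem. *)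
Lemma rbox_null (mu : {measure set X -> \bar R}) (h : X -> R) : mu.-intT (h) ->
  (\int[mu]_z (h z)%:E = 0)%E -> (forall a b, \int[mu]_(z in rbox a b) (h z)%:E = 0)%E ->
  {ae mu, forall z, h z = 0}.
Proof.
move=> jh h0 hb; have mh := integrable_measurable jh.
have mhE : measT (EFin \o h) by exact/measurable_EFinP.
have E0 E : measurable E -> (\int[mu]_(z in E) (h z)%:E = 0)%E.
  move=> mE; apply: (@dynkin_induction _ _ rboxes (fun E => \int[mu]_(z in E) (h z)%:E = 0)%E
    rbox_generate rbox_setI h0).
  - by move=> _ [a [b ->]]; exact: hb.
  - move=> S mS hS; have mSc := measurableC mS.
    have : (\int[mu]_(z in S `|` ~` S) (h z)%:E = \int[mu]_(z in S) (h z)%:E + \int[mu]_(z in ~` S) (h z)%:E)%E.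
      apply: integral_setU => //; first by rewrite setUv.
      by apply/disj_setPS => z [? []].
    by rewrite setUv h0 hS add0e => <-.
  - move=> F mF tF hF; rewrite integral_bigcup//; first by rewrite eseries0.
    by apply: integrableS jh => //; exact: bigcup_measurable.
  - by rewrite -rbox_generate.
have := @integral_ae_eq _ _ _ mu setT measurableT (cst 0%E) (EFin \o h) jh (@measurable_cst _ _ _ _ _ _).
move=> /(_ _)/wrap[E _ mE|]; first by rewrite integral0; exact: E0.
by apply: filterS => z /(_ I) [].
Qed.

(** Only integrability on boxes is assumed: the difference is cut to a centred box of side [2 N], on
    which intersecting with a test box gives a box again, and [N] runs over the integers. *)
Lemma box_unique (mu : {measure set X -> \bar R}) (p q : X -> R) :
  (forall a b, mu.-intT ((fun z => \1_(rbox a b) z * p z))) ->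
  (forall a b, mu.-intT ((fun z => \1_(rbox a b) z * q z))) ->
  (forall a b, \int[mu]_z (\1_(rbox a b) z * p z) = \int[mu]_z (\1_(rbox a b) z * q z)) ->
  {ae mu, forall z, p z = q z}.
Proof.
move=> jp jq pq.
have nullN (N : nat) : {ae mu, forall z, \1_(rbox (fun=> - N%:R) (fun=> N%:R)) z * p z -
    \1_(rbox (fun=> - N%:R) (fun=> N%:R)) z * q z = 0}.
  set A : 'I_m + 'I_n -> R := fun=> - N%:R; set B : 'I_m + 'I_n -> R := fun=> N%:R.
  have jd := integrable_B (jp A B) (jq A B).
  apply: rbox_null => //.
    by rewrite -(EFinRint jd) (RintB (jp A B) (jq A B)) pq subrr.
  move=> a b; rewrite integral_mkcond.
  have [a' [b' ab]] : exists a' b', rbox A B `&` rbox a b = rbox a' b'.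
    by apply: rbox_setI; [exists A, B|exists a, b].
  have e z : \1_(rbox a b) z * \1_(rbox A B) z = \1_(rbox a' b') z :> R.
    by rewrite -ab mulrC indicI.
  rewrite (_ : patch _ _ _ = EFin \o (fun z => \1_(rbox a' b') z * p z - \1_(rbox a' b') z * q z)).
    have jd' := integrable_B (jp a' b') (jq a' b').
    by rewrite -(EFinRint jd') (RintB (jp a' b') (jq a' b')) pq subrr.
  apply/funext => z; rewrite /patch /= -e !indicE; case: ifP => _ /=; first by rewrite !mul1r.
  by rewrite !mul0r subrr.
have := ae_foralln nullN; apply: filterS => z hz.
have [N hN] := norm_coord_bound z; have := hz N.
rewrite indicE mem_set ?mul1r; first by move/eqP; rewrite subr_eq0 => /eqP.
by move=> s; rewrite -ltr_norml.
Qed.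
End boxes.

Lemma power_coord_null d (T : measurableType d) (R : realType) (mu : {sigma_finite_measure set T -> \bar R})
    n (i : 'I_n) (N : set T) : measurable N -> mu N = 0%E ->
  power_measure mu n [set t | N (tnth t i)] = 0%E.
Proof.
move=> mN N0.
have mS k (j : 'I_k) : measurable [set t : k.-tuple T | N (tnth t j)].
  rewrite (_ : [set t | _] = setT `&` (fun t : k.-tuple T => tnth t j) @^-1` N); last by rewrite setTI.
  exact: (measurable_tnth j measurableT).
have indE k (j : 'I_k) : (power_measure mu k [set t | N (tnth t j)] =
    \int[power_measure mu k]_t (\1_N (tnth t j))%:E)%E.
  rewrite -[LHS](_ : \int[power_measure mu k]_t (\1_[set t | N (tnth t j)] t)%:E = _)%E.
    by apply: eq_integral => t _; rewrite !indicE.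
  exact: (etrans (integral_indic (power_measure mu k) measurableT (mS k j)) (congr1 _ (setIT _))).
have mi : measT (\1_N : T -> R) by exact: measurable_indic.
have mI k (j : 'I_k) : measT (fun t : k.-tuple T => (\1_N (tnth t j))%:E : \bar R).
  by apply/measurable_EFinP; apply: (measurableT_comp mi); exact: measurable_tnth.
elim: n i => [[] //|n IH] i; rewrite indE.
have tn x (t : n.-tuple T) j : tnth (Defs.cons_tuple (x, t)) (lift ord0 j) = tnth t j.
  by rewrite (tnth_nth x) /= (tnth_nth x).
case: (unliftP ord0 i) => [j ->|->].
  rewrite cons_tonelli//; apply: integral0_eq => x _.
  rewrite -[RHS](IH j) indE; apply: eq_integral => t _; rewrite tn//.
rewrite cons_tonelli2//; apply: integral0_eq => t _.
rewrite -[RHS]N0 -[RHS](_ : \int[mu]_x (\1_N x)%:E = _)%E; last by rewrite integral_indic// ?setIT ?setTI.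
by apply: eq_integral => x _; rewrite (tnth_nth x).
Qed.

Lemma dominated_Rint d (T : measurableType d) (R : realType) (mu : {measure set T -> \bar R})
    (g : nat -> T -> R) (f h : T -> R) :
  (forall k, measT (g k)) -> measT f -> mu.-intT (h) ->
  (forall k x, `|g k x| <= h x) -> {ae mu, forall x, g ^~ x @ \oo --> f x} ->
  (fun k => \int[mu]_x g k x) @ \oo --> \int[mu]_x f x.
Proof.
move=> mg mf jh gh g0.
have g0' : {ae mu, forall x, [set: T] x -> (fun k => (EFin \o g k) x) @ \oo --> (EFin \o f) x}.
  by apply: filterS g0 => x hx _; apply: cvg_EFin; [exact: nearW|exact: hx].
have gh' : {ae mu, forall x k, [set: T] x -> (`|(EFin \o g k) x| <= (h x)%:E)%E}.
  by apply: aeW => x k _ /=; rewrite lee_fin.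
have mg' k : measT (EFin \o g k) by exact/measurable_EFinP.
have mf' : measT (EFin \o f) by exact/measurable_EFinP.
have [jf _ h0] := dominated_convergence measurableT mg' mf' g0' jh gh'.
apply: fine_cvg; rewrite -/(Rintegral _ _ _) (EFinRint jf); exact: h0.
Qed.

Lemma near_side (R : realType) (x a w : R) : `|w| < `|x - a| -> (a < x - w) = (a < x) /\ (x - w < a) = (x < a).
Proof.
have [xa|xa|->] := ltgtP x a; last by rewrite subrr normr0 normr_lt0.
  rewrite (_ : `|x - a| = a - x); last by rewrite ltr0_norm ?subr_lt0// opprB.
  by rewrite ltr_norml => /andP[h1 h2]; split; [apply/negbTE; rewrite -leNgt|]; lra.
rewrite (_ : `|x - a| = x - a); last by rewrite gtr0_norm ?subr_gt0.
by rewrite ltr_norml => /andP[h1 h2]; split; [|apply/negbTE; rewrite -leNgt]; lra.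
Qed.

(** * Smoothing an interval by the Fejer kernel on the line *)

Section approximate_identity.
Context (R : realType).
Local Notation leb := (lebesgue R).
Local Notation Rm := (measurableTypeR R).

Let fu (u : Rm) : R := fej 1 (2 * pi * u).

Let mfej K : 0 < K -> measT (fun u : Rm => fej K (2 * pi * u)).
Proof. by move=> K0; apply: (measurableT_comp (continuous_fej K0)); mea. Qed.

Let fu0 u : 0 <= fu u. Proof. exact: fej_ge0. Qed.

Let ifu : leb.-intT (fu).
Proof.
apply/integrableP; split; first by apply/measurable_EFinP; exact: mfej.
apply: (@le_lt_trans _ _ 32%:E); last exact: ltry.
rewrite (eq_integral (fun u : Rm => (fej 1 (2 * pi * (u - 0)))%:E)); first exact: fej_mass.
by move=> u _; rewrite subr0 /= ger0_norm.
Qed.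

Definition fejc : R := \int[leb]_u fu u.

(** For [u] in [[0, 1/8]], put [x = pi * u]. The mean value theorem gives
    [sin x >= x * cos (pi / 8)], so the integrand is at least [cos (pi / 8) ^+ 2] there. Positivity
    is needed in order to divide by [fejc ^+ m]. *)
Lemma fejc_gt0 : 0 < fejc.
Proof.
have p0 := pi_gt0 R.
have c0 : 0 < cos (pi / 8 : R) by apply: cos_gt0_pihalf; apply/andP; split; lra.
have h u : 0 <= u <= 8^-1 -> cos (pi / 8) ^+ 2 <= fu u.
  move=> /andP[u0 u1]; rewrite /fu /fej; case: eqP => [_|/eqP s0].
    by apply: exprn_ile1; [exact: ltW|exact: cos_le1].
  have up : 0 < u by rewrite lt0r u0 andbT; apply: contraNneq s0 => ->; rewrite mulr0.
  pose x := pi * u; have x0 : 0 < x by rewrite mulr_gt0.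
  have xp : x <= pi / 8 by rewrite /x ler_pM2l.
  have [y + yE] : exists2 y, y \in `]0, x[ & sin x - sin 0 = cos y * (x - 0).
    by apply: MVT => //; apply: continuous_subspaceT => y; exact: continuous_sin.
  rewrite in_itv /= => /andP[y0 yx].
  have cy : cos (pi / 8) <= cos y.
    rewrite ltW// ltr_cos ?in_itv /=; [lra| |]; apply/andP; split; lra.
  have sx : cos (pi / 8) * x <= sin x.
    by move: yE; rewrite sin0 !subr0 => ->; rewrite ler_pM2r.
  have cE : cos (1 * (2 * pi * u)) = 1 - 2 * sin x ^+ 2.
    by rewrite (_ : 1 * _ = x + x) ?cosD -?expr2 ?cos2sin2; [ring|rewrite /x; ring].
  have e4 : 1 * (2 * pi * u) ^+ 2 = 4 * x ^+ 2 by rewrite /x; ring.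
  have e5 : 2 * (1 - (1 - 2 * sin x ^+ 2)) = 4 * sin x ^+ 2 by ring.
  rewrite cE e5 e4 -mulf_div divff ?mul1r ?pnatr_eq0//.
  by rewrite ler_pdivlMr ?exprn_gt0// -exprMn ler_pXn2r ?nnegrE ?(le_trans _ sx)// mulr_ge0// ltW.
rewrite -lte_fin /fejc (EFinRint ifu).
apply: (@lt_le_trans _ _ (cos (pi / 8) ^+ 2 * 8^-1)%:E); first by rewrite lte_fin mulr_gt0// exprn_gt0.
apply: (@le_trans _ _ (\int[leb]_(u in `[0%R, 8^-1%R]) (cos (pi / 8) ^+ 2)%:E)%E).
  by rewrite integral_cst// [X in (_ * X)%E]itv_leb// subr0.
apply: (@le_trans _ _ (\int[leb]_(u in `[0%R, 8^-1%R]) (fu u)%:E)%E).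
  apply: ge0_le_integral => //.
  - by move=> u _; rewrite lee_fin sqr_ge0.
  - by apply/measurable_funTS/measurable_EFinP; exact: mfej.
apply: ge0_subset_integral => //; first by apply/measurable_EFinP; exact: mfej.
by move=> u _; rewrite lee_fin.
Qed.

Lemma fej_scale (K s : R) : 0 < K -> fej K s = K * fej 1 (K * s).
Proof.
move=> K0; rewrite /fej mulf_eq0 (gt_eqF K0) /=; case: (eqVneq s 0) => [_|s0]; first by rewrite mulr1.
by rewrite !mul1r; field; rewrite s0 gt_eqF.
Qed.

Definition psi1 (K a b x : R) : R := \int[leb]_x' (\1_(`]a, b[%classic : set Rm) x' * fej K (2 * pi * (x - x'))).

Lemma psi1E K a b x : 0 < K -> psi1 K a b x = \int[leb]_u (\1_(`]a, b[%classic : set Rm) (x - u / K) * fu u).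
Proof.
move=> K0; congr fine.
have s0 : - K^-1 != 0 by rewrite oppr_eq0 invr_eq0 gt_eqF.
pose f (x' : Rm) : \bar R := (\1_(`]a, b[%classic : set Rm) x' * fej K (2 * pi * (x - x')))%:E.
have mI : measT (\1_(`]a, b[%classic : set Rm) : Rm -> R) by apply: measurable_indic.
have mf : measT f.
  apply/measurable_EFinP; apply: measurable_funM => //.
  by apply: (measurableT_comp (continuous_fej K0)); mea.
have f0 x' : (0 <= f x')%E by rewrite lee_fin mulr_ge0 ?fej_ge0// indicE.
rewrite -[LHS](leb_affine x s0 mf f0) normrN gtr0_norm ?invr_gt0//.
rewrite -ge0_integralZl//; last 2 first.
- by apply: (measurableT_comp mf); mea.
- by rewrite lee_fin invr_ge0 ltW.
apply: eq_integral => u _; rewrite -EFinM /f; congr EFin.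
rewrite (_ : - K^-1 * u + x = x - u / K); last by rewrite addrC mulNr mulrC.
rewrite (_ : x - (x - u / K) = u / K); last by ring.
rewrite (fej_scale _ K0) (_ : K * (2 * pi * (u / K)) = 2 * pi * u); last by field; rewrite gt_eqF.
by rewrite mulrCA [X in _ * X]mulrA mulVf ?mul1r ?gt_eqF.
Qed.

Let mIx K a b x : measT (fun u : Rm => \1_(`]a, b[%classic : set Rm) (x - u / K) * fu u).
Proof.
apply: measurable_funM; last exact: mfej.
apply: (measurableT_comp (f := \1_(`]a, b[%classic : set Rm) : Rm -> R)); last by mea.
by apply: measurable_indic.
Qed.

(** After rescaling, the kernel is fixed and the indicator is evaluated at [x - u / K]; for each [u]
    this is eventually its value at [x], because [x] is not an endpoint. *)
Lemma psi1_cvg a b x : x != a -> x != b ->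
  (fun K : nat => psi1 K.+1%:R a b x) @ \oo --> fejc * \1_(`]a, b[%classic : set Rm) x.
Proof.
move=> xa xb.
have -> : (fun K : nat => psi1 K.+1%:R a b x) = (fun K => \int[leb]_u (\1_(`]a, b[%classic : set Rm) (x - u / K.+1%:R) * fu u)).
  by apply/funext => K; rewrite psi1E// ltr0n.
have -> : fejc * \1_(`]a, b[%classic : set Rm) x = \int[leb]_u (\1_(`]a, b[%classic : set Rm) x * fu u).
  by rewrite mulrC RintegralZl.
apply: (@dominated_Rint _ _ _ leb _ _ fu) => //.
- by apply: measurable_funM; [exact: measurable_cst|exact: mfej].
- move=> K u; rewrite normrM (ger0_norm (fu0 u)) ler_piMl// indicE.
  by case: (_ \in _); rewrite ?normr1 ?normr0.
apply: aeW => u; apply: cvg_near_cst.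
pose de := Num.min `|x - a| `|x - b|.
have de0 : 0 < de by rewrite lt_min !normr_gt0 !subr_eq0 xa xb.
have ud0 : 0 <= `|u| / de by rewrite divr_ge0// ltW.
exists (Num.bound (`|u| / de)) => // K /= hK.
have K0 : 0 < K.+1%:R :> R by rewrite ltr0n.
have ude : `|u / K.+1%:R| < de.
  rewrite normrM normfV (gtr0_norm K0) ltr_pdivrMr// mulrC -ltr_pdivrMr//.
  by apply: (lt_le_trans (archi_boundP ud0)); rewrite ler_nat leqW.
congr (_ * _); rewrite !indicE; congr (_%:R); congr nat_of_bool.
move: ude; rewrite lt_min => /andP[]; set w := u / _ => wa wb.
have [e1 _] := near_side wa; have [_ e2] := near_side wb.
by apply/idP/idP => /set_mem /=; rewrite in_itv /= => h; apply/mem_set; rewrite /= in_itv /=; move: h; rewrite e1 e2.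
Qed.

Lemma psi1_ge0 K a b x : 0 < K -> 0 <= psi1 K a b x.
Proof. by move=> K0; apply: Rint_ge0 => x'; rewrite mulr_ge0 ?fej_ge0// indicE. Qed.

Lemma psi1_le K a b x : 0 < K -> psi1 K a b x <= fejc.
Proof.
move=> K0; rewrite psi1E// /fejc.
have d u : `|\1_(`]a, b[%classic : set Rm) (x - u / K) * fu u| <= `|fu u|.
  by rewrite normrM ler_piMl// indicE; case: (_ \in _); rewrite ?normr1 ?normr0.
apply: le_Rintegral => //; first exact: (integrable_dom (mIx K a b x) ifu d).
by move=> u _; apply: le_trans (le_trans (ler_norm _) (d u)) _; rewrite ger0_norm.
Qed.

(** A majorant comparable to [1 / (1 + x ^ 2)]. One Fejer kernel has zeros and cannot dominate;
    adding the copy shifted by half a period fills them, and integrability is inherited from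
    [fej_mass]. *)
Definition tail (x : Rm) : R := fu x + fu (x + 2^-1).

(** With [s = 2 * pi * x] the two numerators [1 - cos s] and [1 + cos s] add up to 2, and the
    squares of [s] and [s + pi] are at most [2 * (s ^+ 2 + pi ^+ 2)]. Where one denominator
    vanishes, that kernel equals 1, which already exceeds the bound. *)
Lemma tail_lower x : 2 / (4 * pi ^+ 2 * x ^+ 2 + pi ^+ 2) <= tail x.
Proof.
have p0 := pi_gt0 R; have pp : 0 < pi ^+ 2 :> R by rewrite exprn_gt0.
have D0 : 0 < 4 * pi ^+ 2 * x ^+ 2 + pi ^+ 2.
  by rewrite ltr_wpDl// mulr_ge0 ?sqr_ge0// mulr_ge0// sqr_ge0.
have D1 : 2 / (4 * pi ^+ 2 * x ^+ 2 + pi ^+ 2) <= 1.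
  rewrite ler_pdivrMr// mul1r; have := pi_ge2 R => p2.
  have : 2 ^+ 2 <= pi ^+ 2 :> R by rewrite ler_pXn2r ?nnegrE// ltW.
  have := mulr_ge0 (ltW pp) (sqr_ge0 x); rewrite -!mulrA; lra.
pose s := 2 * pi * x; have sE : 2 * pi * (x + 2^-1) = s + pi by rewrite /s; field.
have [s0|sn] := eqVneq s 0.
  apply: (le_trans D1); rewrite /tail [fu x](_ : _ = 1); last by rewrite /fu /fej -/s s0 eqxx.
  by rewrite lerDl.
have [q0|qn] := eqVneq (s + pi) 0.
  apply: (le_trans D1); rewrite /tail [fu (x + _)](_ : _ = 1); last by rewrite /fu /fej sE q0 eqxx.
  by rewrite lerDr.
rewrite /tail /fu sE -/s /fej (negbTE sn) (negbTE qn) !mul1r cosD cospi sinpi mulr0 subr0 mulrN1 opprK.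
have DE : 4 * pi ^+ 2 * x ^+ 2 + pi ^+ 2 = s ^+ 2 + pi ^+ 2 by rewrite /s; ring.
have c1 := cos_le1 s; have c2 := cos_geN1 s.
have b (t v : R) : 0 <= v -> t != 0 -> t ^+ 2 <= 2 * (s ^+ 2 + pi ^+ 2) -> v / (s ^+ 2 + pi ^+ 2) <= 2 * v / t ^+ 2.
  move=> v0 tn tD; have t2 : 0 < t ^+ 2 by rewrite exprn_even_gt0.
  by rewrite ler_pdivrMr -?DE// mulrAC ler_pdivlMr// DE -mulrA mulrCA ler_wpM2l.
rewrite DE (_ : 2 / _ = (1 - cos s) / (s ^+ 2 + pi ^+ 2) + (1 + cos s) / (s ^+ 2 + pi ^+ 2)); last first.
  by rewrite -mulrDl; congr (_ / _); ring.
apply: lerD; apply: b => //; try lra.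
by rewrite -subr_ge0 (_ : _ - _ = (s - pi) ^+ 2) ?sqr_ge0//; ring.
Qed.

Lemma integrable_tail : leb.-intT (tail).
Proof.
apply: integrable_D => //; apply/integrableP; split.
  apply/measurable_EFinP; apply: (measurableT_comp (mfej ltr01)).
  by mea.
apply: (@le_lt_trans _ _ 32%:E); last exact: ltry.
rewrite (eq_integral (fun u : Rm => (fej 1 (2 * pi * (u - - 2^-1)))%:E)); first exact: fej_mass.
by move=> u _; rewrite opprK /= ger0_norm.
Qed.

Lemma tail_ge0 x : 0 <= tail x. Proof. exact: addr_ge0. Qed.

Lemma tail_le2 x : tail x <= 2.
Proof. by have := fej_leT (2 * pi * x) (@ltr01 R); have := fej_leT (2 * pi * (x + 2^-1)) (@ltr01 R); rewrite /tail /fu; lra. Qed.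

(** A majorant independent of [K], required for dominated convergence on an unbounded space against
    functions known only to be in L2. *)
Lemma psi1_dom a b : exists2 C, 0 <= C & forall (K : nat) x, psi1 K.+1%:R a b x <= C * tail x.
Proof.
have p0 := pi_gt0 R; have pp : 0 < pi ^+ 2 :> R by rewrite exprn_gt0.
pose L := `|a| + `|b| + 1; have fc := ltW fejc_gt0.
have L0 : 0 < L by rewrite ltr_wpDl// addr_ge0.
(* [C1] compares [fejc] with [tail_lower] for [|x| <= 2 * L]. [C2] compares the decay
   [4 / (pi ^+ 2 * x ^+ 2)] over the interval with the lower bound [2 / (5 * pi ^+ 2 * x ^+ 2)] of
   the tail. *)
pose C1 := fejc * ((16 * pi ^+ 2 * L ^+ 2 + pi ^+ 2) / 2); pose C2 := 10 * (`|a| + `|b|).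
have C10 : 0 <= C1.
  rewrite mulr_ge0// divr_ge0// addr_ge0//; last exact: ltW.
  by rewrite mulr_ge0 ?sqr_ge0// mulr_ge0// ltW.
have C20 : 0 <= C2 by rewrite mulr_ge0// addr_ge0.
exists (C1 + C2) => [|K x]; first exact: addr_ge0.
have K0 : 0 < K.+1%:R :> R by rewrite ltr0n.
have tl := tail_lower x; have t0 := tail_ge0 x.
rewrite mulrDl; case: (lerP `|x| (2 * L)) => hx.
  apply: (@le_trans _ _ (C1 * tail x)); last by rewrite lerDl mulr_ge0.
  apply: (le_trans (psi1_le a b x K0)); rewrite /C1 -mulrA -[leLHS]mulr1 ler_wpM2l//.
  have x2 : x ^+ 2 <= 4 * L ^+ 2.
    have -> : 4 * L ^+ 2 = (2 * L) ^+ 2 by ring.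
    by rewrite -[leLHS]real_normK ?num_real// ler_pXn2r ?nnegrE// mulr_ge0// ltW.
  have E0 : 0 < 16 * pi ^+ 2 * L ^+ 2 + pi ^+ 2.
    by rewrite ltr_wpDl// mulr_ge0 ?sqr_ge0// mulr_ge0// ltW.
  have D0 : 0 < 4 * pi ^+ 2 * x ^+ 2 + pi ^+ 2.
    by rewrite ltr_wpDl// mulr_ge0 ?sqr_ge0// mulr_ge0// ltW.
  rewrite -ler_pdivrMl ?divr_gt0// mulr1 invf_div; apply: le_trans tl.
  rewrite ler_pM2l// lef_pV2 ?posrE// lerD2r.
  by have := ler_wpM2l (ltW pp) x2; rewrite -!mulrA; lra.
apply: (@le_trans _ _ (C2 * tail x)); last by rewrite lerDr mulr_ge0.
have xp : 0 < `|x| by apply: le_lt_trans hx; rewrite mulr_ge0// ltW.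
have x2 : 0 < x ^+ 2 by rewrite -[ltRHS]real_normK ?num_real// exprn_gt0.
have x1 : 1 <= x ^+ 2.
  rewrite -[leRHS]real_normK ?num_real// exprn_ege1//; apply: le_trans (ltW hx).
  by rewrite /L; have := normr_ge0 a; have := normr_ge0 b; lra.
pose M := 4 / (pi ^+ 2 * x ^+ 2); have M0 : 0 <= M by rewrite divr_ge0// mulr_ge0 ?ltW.
have MB x' : \1_(`]a, b[%classic : set Rm) x' * fej K.+1%:R (2 * pi * (x - x')) <= \1_(`]a, b[%classic : set Rm) x' * M.
  rewrite indicE; case: (boolP (x' \in _)) => [/set_mem /=|_]; last by rewrite !mul0r.
  rewrite in_itv /= => /andP[h1 h2]; rewrite !mul1r.
  have hd : `|x| / 2 <= `|x - x'|.
    have : `|x'| <= L.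
      rewrite ler_norml /L; have := ler_norm a; have := ler_norm b; have := ler_norm (- a); have := ler_norm (- b).
      by rewrite !normrN => *; apply/andP; split; have := normr_ge0 a; have := normr_ge0 b; lra.
    have := ler_distD 0 x x'; rewrite subr0 sub0r normrN; have := lerB_dist x x'; lra.
  have s2 : pi ^+ 2 * x ^+ 2 <= (2 * pi * (x - x')) ^+ 2.
    rewrite exprMn -[(x - x') ^+ 2]real_normK ?num_real//.
    apply: (@le_trans _ _ ((2 * pi) ^+ 2 * (`|x| / 2) ^+ 2)).
      have nx : `|x| ^+ 2 = x ^+ 2 by rewrite real_normK ?num_real.
      by rewrite -nx (_ : (2 * pi) ^+ 2 * _ = pi ^+ 2 * `|x| ^+ 2)//; field.
    by rewrite ler_pM2l ?exprn_gt0 ?mulr_gt0// ler_pXn2r ?nnegrE// ?divr_ge0// ltW.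
  have := fej_decay (2 * pi * (x - x')) K0; set s := 2 * pi * _ in s2 *.
  move=> fd; have f0 := fej_ge0 s K0; rewrite /M ler_pdivlMr; last exact: mulr_gt0.
  apply: (@le_trans _ _ (fej K.+1%:R s * (K.+1%:R * s ^+ 2))); last exact: fd.
  rewrite ler_wpM2l//; apply: (le_trans s2); rewrite ler_peMl ?sqr_ge0//.
  by rewrite ler1n.
have mI : measT (\1_(`]a, b[%classic : set Rm) : Rm -> R) by apply: measurable_indic.
have : psi1 K.+1%:R a b x <= M * (`|a| + `|b|).
  rewrite -lee_fin; apply: (@le_trans _ _ (\int[leb]_x' (M * \1_(`]a, b[%classic : set Rm) x')%:E)%E).
    rewrite /psi1 /Rintegral.
    have g0 x' : 0 <= \1_(`]a, b[%classic : set Rm) x' * fej K.+1%:R (2 * pi * (x - x')).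
      by rewrite mulr_ge0 ?fej_ge0// indicE.
    have mg : measT (fun x' : Rm => \1_(`]a, b[%classic : set Rm) x' * fej K.+1%:R (2 * pi * (x - x'))).
      by apply: measurable_funM => //; apply: (measurableT_comp (continuous_fej K0)); mea.
    set I := (\int[_]_x' _)%E; have -> : (fine I)%:E = I.
      rewrite fineK// ge0_fin_numE; last by apply: integral_ge0 => x' _; rewrite lee_fin.
      apply: (@le_lt_trans _ _ (\int[leb]_x' (fej K.+1%:R (2 * pi * (x' - x)))%:E)%E); last exact: le_lt_trans (fej_mass x K0) (ltry _).
      apply: ge0_le_int => //; first by apply: (measurableT_comp (continuous_fej K0)); mea.
      move=> x'; rewrite (_ : 2 * pi * (x' - x) = - (2 * pi * (x - x'))); last by ring.
      rewrite fejN indicE; case: (_ \in _); rewrite ?mul1r// mul0r; exact: fej_ge0.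
    apply: ge0_le_int => //; first by apply: measurable_funM => //; exact: measurable_cst.
    by move=> x'; rewrite [leRHS]mulrC; exact: MB.
  rewrite ge0_intZl//.
  rewrite [(M * _)%:E]EFinM; apply: lee_wpmul2l; first by rewrite lee_fin.
  rewrite integral_indic// ?setIT.
  have ab : (leb `[Num.min a b, Num.max a b]%classic <= (`|a| + `|b|)%:E)%E.
    apply: itv_leb_le; first by rewrite ge_min le_max lexx.
    by case: (leP a b) => _; have := ler_norm a; have := ler_norm b; have := ler_norm (- a); have := ler_norm (- b); rewrite !normrN; lra.
  apply: le_trans ab; apply: le_measure; rewrite ?inE//.
  by move=> y /=; rewrite !in_itv /= ge_min le_max => /andP[/ltW-> /ltW->]; rewrite orbT.
move=> h; apply: (le_trans h).
have : 2 / (5 * (pi ^+ 2 * x ^+ 2)) <= tail x.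
  have D5 : 0 < 5 * (pi ^+ 2 * x ^+ 2) by apply: mulr_gt0 => //; exact: mulr_gt0.
  have D0 : 0 < 4 * pi ^+ 2 * x ^+ 2 + pi ^+ 2.
    by rewrite ltr_wpDl// mulr_ge0 ?sqr_ge0// mulr_ge0// ltW.
  apply: le_trans tl; rewrite ler_pM2l// lef_pV2 ?posrE//.
  by have := ler_wpM2l (ltW pp) x1; rewrite mulr1 -!mulrA; lra.
have ab0 : 0 <= `|a| + `|b| by rewrite addr_ge0.
move=> /(ler_wpM2l C20); apply: le_trans; apply: eq_le.
have xn : x != 0 by rewrite -normr_gt0.
have qn : pi ^+ 2 * x ^+ 2 != 0 by rewrite mulf_neq0// expf_neq0// gt_eqF.
by rewrite /M /C2; move: (pi ^+ 2 * x ^+ 2) qn => q qn; field.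
Qed.
End approximate_identity.

Lemma cvg_of_bound (R : realType) (u : nat -> R) (l c : R) : 0 <= c -> (forall K, `|u K - l| <= c / K.+1%:R) ->
  u @ \oo --> l.
Proof.
move=> c0 h; apply/cvgrPdist_le => e e0.
have ce : 0 <= c / e by rewrite divr_ge0// ltW.
exists (Num.bound (c / e)) => // K /= hK; rewrite distrC; apply: (le_trans (h K)).
rewrite ler_pdivrMr ?ltr0n// mulrC -ler_pdivrMr//.
by apply: (le_trans (ltW (archi_boundP ce))); rewrite ler_nat leqW.
Qed.

(** * Smoothing an interval by the Fejer kernel on the torus *)

Section torus_identity.
Context (R : realType) (lam : R).
Hypothesis l0 : 0 < lam.
Local Notation Rm := (measurableTypeR R).
Local Notation T := (@interval_measure R `[0, lam]).
Local Notation leb := (@lebesgue_measure R).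

Definition torus_kernel (K : nat) (y y' : Rm) : R := lam^-1 * PF K (2 * pi * ((y - y') / lam)).

Local Notation k := torus_kernel.

Let mk K y : measT (k K y).
Proof.
apply: measurable_funM; first exact: measurable_cst.
by apply: (measurableT_comp (@measurable_PF R K)); mea.
Qed.

Let k0 K y y' : 0 <= k K y y'.
Proof. by rewrite mulr_ge0 ?PF_ge0// invr_ge0 ltW. Qed.

Let mass K y : (0 < K)%N -> (\int[T]_y' (k K y y')%:E = 1)%E.
Proof.
move=> K0; rewrite ge0_intZl; last 3 first.
- by rewrite invr_ge0 ltW.
- by apply: (measurableT_comp (@measurable_PF R K)); mea.
- by move=> y'; exact: PF_ge0.
rewrite (eq_integral (fun y' : Rm => (PF K (2 * pi * ((y' - y) / lam)))%:E)); last first.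
  by move=> y' _; rewrite -PFN; congr (PF _ _)%:E; field; rewrite gt_eqF.
rewrite [X in (_ * X)%E](_ : _ = lam%:E); last exact: torus_PF_mass.
by rewrite -EFinM mulVf ?gt_eqF.
Qed.

Definition psi2 (K : nat) (a b y : R) : R := \int[T]_y' (\1_(`]a, b[%classic : set Rm) y' * k K y y').

Lemma kernel_integrable K y (E : set Rm) : measurable E -> (0 < K)%N -> T.-intT ((fun y' => \1_E y' * k K y y')).
Proof.
move=> mE K0; apply/integrableP; split.
  by apply/measurable_EFinP; apply: measurable_funM => //; exact: measurable_indic.
apply: (@le_lt_trans _ _ (\int[T]_y' (k K y y')%:E)%E); last by rewrite mass// ltry.
apply: ge0_le_int => //.
  by apply: measurable_normr; apply: measurable_funM => //; exact: measurable_indic.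
by move=> y'; rewrite normrM (ger0_norm (k0 _ _ _)) ler_piMl// indicE; case: (_ \in _); rewrite ?normr1 ?normr0.
Qed.

Lemma psi2_bounds K a b y : (0 < K)%N -> 0 <= psi2 K a b y <= 1.
Proof.
move=> K0; apply/andP; split; first by apply: Rint_ge0 => y'; rewrite mulr_ge0// indicE.
have j := @kernel_integrable K y `]a, b[%classic (measurable_itv _) K0.
rewrite -lee_fin /psi2 (EFinRint j) -(mass y K0); apply: ge0_le_int => //.
- exact: integrable_measurable j.
- by move=> y'; rewrite mulr_ge0// indicE.
- by move=> y'; rewrite ler_piMl// indicE; case: (_ \in _).
Qed.

(** By [PF_decay] the kernel is small away from the multiples of the period. Distance [de] of [y]
    from both ends of [[0, lam]] is required because points of [E] near the opposite end are close
    to [y] on the torus. *)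
Lemma far_mass (E : set Rm) (y de : R) (K : nat) : measurable E -> 0 < de -> de <= y -> de <= lam - y ->
  (forall y', E y' -> de <= `|y - y'|) ->
  \int[T]_y' (\1_E y' * k K.+1 y y') <= sin (pi * de / lam) ^- 2 / K.+1%:R.
Proof.
move=> mE de0 dy dl far; have p0 := pi_gt0 R.
have K0 : 0 < K.+1%:R :> R by rewrite ltr0n.
have t0 : 0 < pi * de / lam by rewrite divr_gt0 ?mulr_gt0.
have t1 : pi * de / lam <= pi / 2.
  by rewrite ler_pdivrMr// -mulrA ler_pM2l//; lra.
have s0 : 0 < sin (pi * de / lam) by apply: sin_gt0_pi; rewrite t0 /=; lra.
pose M := sin (pi * de / lam) ^- 2 / K.+1%:R.
have M0 : 0 <= M by rewrite divr_ge0// ?invr_ge0 ?sqr_ge0// ltW.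
have j := kernel_integrable y mE (ltn0Sn K).
rewrite -lee_fin (EFinRint j).
have g0 y' : (0 <= (\1_E y' * k K.+1 y y')%:E)%E by rewrite lee_fin mulr_ge0// indicE.
have mg : measT (fun y' => (\1_E y' * k K.+1 y y')%:E) by apply/measurable_EFinP; exact: integrable_measurable j.
rewrite [leLHS](_ : _ = \int[leb]_(y' in `[0%R, lam]) (\1_E y' * k K.+1 y y')%:E)%E; last first.
  by rewrite /interval_measure ge0_integral_restr.
apply: (@le_trans _ _ (\int[leb]_(y' in `[0%R, lam]) (lam^-1 * M)%:E)%E); last first.
  rewrite integral_cst// [X in (_ * X)%E](itv_leb (ltW l0)) subr0 -EFinM lee_fin mulrAC mulVf ?mul1r//.
  by rewrite gt_eqF.
apply: ge0_le_integral => //; [exact: measurable_funTS|].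
move=> y' /=; rewrite in_itv /= => /andP[y0 y1]; rewrite lee_fin indicE.
case: (boolP (y' \in E)) => [/set_mem /far fd|_]; last first.
  by rewrite mul0r mulr_ge0// invr_ge0 ltW.
rewrite mul1r ler_pM2l ?invr_gt0//.
pose w := pi * `|y - y'| / lam.
have w0 : pi * de / lam <= w by rewrite ler_pM2r ?invr_gt0// ler_pM2l.
have w1 : w <= pi - pi * de / lam.
  rewrite ler_pdivrMr// mulrBl divfK ?gt_eqF// -mulrBr ler_pM2l// ler_norml; apply/andP; split; lra.
(* [w] lies between [pi * de / lam] and its supplement; written as a cosine around [pi / 2], the
   comparison is one of distances to [pi / 2]. *)
have sw : sin (pi * de / lam) <= sin w.
  rewrite -[sin (pi * _ / _)]cosBpihalf -[sin w]cosBpihalf.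
  have e z : cos (z - pi / 2) = cos `|z - pi / 2 : R|.
    by case: (ger0P (z - pi / 2)) => // _; rewrite cosN.
  rewrite !e; have [->|ne] := eqVneq `|w - pi / 2| `|pi * de / lam - pi / 2|; first exact: lexx.
  have h1 : `|w - pi / 2| <= `|pi * de / lam - pi / 2|.
    by rewrite [leRHS]ler0_norm ?subr_le0// ler_norml; apply/andP; split; lra.
  have h2 : `|pi * de / lam - pi / 2| <= pi.
    by rewrite ler0_norm ?subr_le0//; lra.
  rewrite ltW// ltr_cos ?in_itv /= ?normr_ge0 ?h2//; first by rewrite lt_neqAle ne.
  exact: le_trans h2.
have sq : sin (2 * pi * ((y - y') / lam) / 2) ^+ 2 = sin w ^+ 2.
  rewrite (_ : 2 * pi * ((y - y') / lam) / 2 = pi * (y - y') / lam); last by field; rewrite gt_eqF.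
  rewrite /w; case: (ger0P (y - y')) => _ //.
  by rewrite mulrN mulNr sinN sqrrN.
have := PF_decay (2 * pi * ((y - y') / lam)) (ltn0Sn K); rewrite sq => hP.
have sw2 : sin (pi * de / lam) ^+ 2 <= sin w ^+ 2 by rewrite ler_pXn2r ?nnegrE ?(le_trans (ltW s0))// ltW.
rewrite /M ler_pdivlMr// -[leRHS]mul1r ler_pdivlMr ?exprn_gt0//; apply: le_trans hP.
by rewrite -mulrA ler_wpM2l ?PF_ge0// ler_pM2l.
Qed.

(** The mass is exactly 1, so inside the interval the error is the mass of the complement; in both
    cases [far_mass] makes it of order [1 / K]. *)
Lemma psi2_cvg a b y : 0 < y -> y < lam -> y != a -> y != b ->
  (fun K => psi2 K.+1 a b y) @ \oo --> (\1_(`]a, b[%classic : set Rm) y : R).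
Proof.
move=> y0 yl ya yb.
pose de := Num.min (Num.min `|y - a| `|y - b|) (Num.min y (lam - y)).
have de0 : 0 < de by rewrite !lt_min !normr_gt0 !subr_eq0 ya yb y0 subr_gt0.
have [[da db] [dy dl]] : (de <= `|y - a| /\ de <= `|y - b|) /\ (de <= y /\ de <= lam - y).
  by rewrite /de; split; split; rewrite !ge_min lexx ?orbT.
have c0 : 0 <= sin (pi * de / lam) ^- 2 by rewrite invr_ge0 sqr_ge0.
apply: (cvg_of_bound c0) => K.
have mI : measurable (`]a, b[%classic : set Rm) by exact: measurable_itv.
have p0 : 0 <= psi2 K.+1 a b y by have /andP[] := psi2_bounds a b y (ltn0Sn K).
have side (x y' : R) : de <= `|y - x| -> `|y - y'| < de -> (x < y') = (x < y) /\ (y' < x) = (y < x).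
  move=> h1 h2; have [] := @near_side _ y x (y - y') (lt_le_trans h2 h1).
  by rewrite opprB addrC subrK.
have sideE y' : `|y - y'| < de -> (y' \in (`]a, b[%classic : set Rm)) = (y \in (`]a, b[%classic : set Rm)).
  move=> hy; have [e1 _] := side a y' da hy; have [_ e2] := side b y' db hy.
  by apply/idP/idP => /set_mem /=; rewrite in_itv /= => h; apply/mem_set; rewrite /= in_itv /=; move: h; rewrite e1 e2.
rewrite indicE; case: (boolP (y \in _)) => hy /=; last first.
  rewrite subr0 ger0_norm//; apply: far_mass => // y' /mem_set hy'; rewrite leNgt; apply/negP => /sideE h.
  by move: hy; rewrite -h hy'.
have mC := measurableC mI.
have -> : psi2 K.+1 a b y - 1 = - \int[T]_y' (\1_(~` `]a, b[%classic : set Rm) y' * k K.+1 y y').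
  apply/eqP; rewrite -subr_eq0 opprK addrAC subr_eq0; apply/eqP.
  have j1 := kernel_integrable y mI (ltn0Sn K); have j2 := kernel_integrable y mC (ltn0Sn K).
  rewrite -(RintD j1 j2) /Rintegral (eq_integral (fun y' => (k K.+1 y y')%:E)); first by rewrite mass.
  move=> y' _; rewrite -mulrDl !indicE in_setC; case: (_ \in _) => /=; by rewrite ?addr0 ?add0r mul1r.
rewrite normrN ger0_norm; last by apply: Rint_ge0 => y'; rewrite mulr_ge0// indicE.
apply: far_mass => // y' hy'; rewrite leNgt; apply/negP => /sideE h.
by apply: hy'; apply/set_mem; rewrite h.
Qed.
End torus_identity.

Lemma cvg_prodr (R : realType) k (u : 'I_k -> nat -> R) (l : 'I_k -> R) :
  (forall i, u i @ \oo --> l i) -> (fun K => \prod_(i < k) u i K) @ \oo --> \prod_(i < k) l i.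
Proof.
elim: k u l => [|k IH] u l h.
  by under eq_fun do rewrite big_ord0; rewrite big_ord0; exact: cvg_cst.
under eq_fun do rewrite big_ord_recl; rewrite big_ord_recl.
by apply: cvgM; [exact: h|apply: IH => i; exact: h].
Qed.

Lemma oscint_cst d (T : measurableType d) (R : realType) (mu : {measure set T -> \bar R}) (k : T -> R) :
  mu.-intT (k) -> oscint mu k (fun=> 0) (\int[mu]_x k x).
Proof.
move=> j; split => // c; under eq_integral do rewrite add0r.
have jc : mu.-intT ((fun x => k x * cos c)).
  by apply: (integrable_mulcos j); exact: measurable_cst.
by rewrite -(EFinRint jc) RintegralZr.
Qed.

(** * Smoothing in space as a weight in frequency *)

Section smoothing.
Context (R : realType) (m n : nat) (lam : R).
Hypothesis l0 : 0 < lam.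
Local Notation leb := (lebesgue R).
Local Notation Rm := (measurableTypeR R).
Local Notation X := (phys_point R m n).
Local Notation Fq := (frequency R m n).
Local Notation W := (waveguide m n lam).
Local Notation fm := (freqm m n lam).
Local Notation fw K := (@fweight R m n K.+1).
Local Notation fk K := (@fkernel R m n lam K.+1).
Local Notation ph := (@phase R m n lam).

Lemma fweight_integrable K : fm.-intT (fw K).
Proof.
have z : X := (nseq_tuple m 0, nseq_tuple n 0).
by have [] := oscint_fweight l0 z z (ltn0Sn K).
Qed.

Lemma fweight_ge0 K xi : 0 <= fw K xi.
Proof. by rewrite mulr_ge0//; apply: prodr_ge0 => i _; exact: tri_ge0. Qed.

Lemma fweight_le1 K xi : fw K xi <= 1.
Proof.
have t1 (x : R) : 0 <= tri K.+1%:R x <= 1 by rewrite tri_ge0 tri_le1// ltr0n.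
have p1 k (g : 'I_k -> R) : 0 <= \prod_(i < k) tri K.+1%:R (g i) <= 1.
  rewrite prodr_ge0 /=; last by move=> i _; have /andP[] := t1 (g i).
  rewrite -[leRHS](@big1 _ 1 *%R 'I_k (index_enum _) predT (fun=> 1))//.
  by apply: ler_prod => i _; exact: t1.
have /andP[a0 a1] := p1 m (tnth xi.1); have /andP[b0 b1] := p1 n (fun j => (tnth xi.2 j)%:~R).
by rewrite -[leRHS]mulr1; apply: ler_pM.
Qed.

Lemma fweight_out K xi : ~ fbox K.+1%:R xi -> fw K xi = 0.
Proof.
have t0 (x : R) : ~ (`|x| <= K.+1%:R) -> tri K.+1%:R x = 0.
  by move=> /negP; rewrite -ltNge => /ltW; apply: tri_out; rewrite ltr0n.
move=> /not_andP[/existsNP[i h]|/existsNP[j h]]; rewrite /fweight.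
  by rewrite (bigD1 i)//= t0// !mul0r.
by rewrite [X in _ * X](bigD1 j)//= /triw t0// mul0r mulr0.
Qed.

Lemma fweight_cvg xi : (fun K => fw K xi) @ \oo --> (1 : R).
Proof.
have t1 (x : R) : (fun K : nat => tri K.+1%:R x) @ \oo --> (1 : R).
  apply: (@cvg_of_bound _ _ _ `|x|) => // K.
  have K0 : 0 < K.+1%:R :> R by rewrite ltr0n.
  case: (leP `|x| K.+1%:R) => h.
    by rewrite tri_in// addrAC subrr sub0r normrN normrM normr_id normfV (gtr0_norm K0).
  by rewrite (tri_out K0 (ltW h)) sub0r normrN normr1 ler_pdivlMr// mul1r ltW.
have -> : (1 : R) = (\prod_(i < m) 1) * (\prod_(j < n) 1) by rewrite !big1_eq mul1r.
by apply: cvgM; apply: cvg_prodr => i; exact: t1.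
Qed.

Lemma fkernel_oscint K z z' : oscint fm (fw K) (fun xi => ph z xi - ph z' xi) (fk K z z').
Proof. exact: oscint_fweight. Qed.

Lemma fkernelC K z z' : fk K z z' = fk K z' z.
Proof.
rewrite /fkernel; congr (_ * _); apply: eq_bigr => i _.
  by rewrite -fejN; congr fej; ring.
by rewrite -PFN; congr (_ * PF _ _); field; rewrite gt_eqF.
Qed.

Lemma fkernel_bounded K : exists2 M, 0 <= M & forall z z', fk K z z' <= M.
Proof.
have j := fweight_integrable K.
exists (\int[fm]_xi fw K xi) => [|z z']; first by apply: Rint_ge0 => xi; exact: fweight_ge0.
have o' := oscint_cst j.
apply: le_trans (ler_norm _) _.
exact: (oscint_le (fkernel_oscint K z z') o' (@fweight_ge0 K) (fun=> lexx _) (fun=> erefl)).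
Qed.

Lemma measurable_fkernel K : measT (fun p : X * X => fk K p.1 p.2).
Proof.
rewrite (_ : (fun p => _) = fun p : X * X => \int[fm]_xi (fw K xi * cos (ph p.1 xi - ph p.2 xi))); last first.
  apply/funext => p; have [_ _ /(_ 0)] := fkernel_oscint K p.1 p.2.
  rewrite cos0 mulr1 /Rintegral (eq_integral (fun xi => (fw K xi * cos (ph p.1 xi - ph p.2 xi))%:E)) => [->//|xi _].
  by rewrite addr0.
apply: (@measurable_param_Rintegral _ _ _ _ R fm (fun q : (X * X) * Fq => fw K q.2 * cos (ph q.1.1 q.2 - ph q.1.2 q.2))).
apply: measurable_funM.
  by apply: (measurableT_comp (integrable_measurable (fweight_integrable K))); mea.
apply: measurable_cosD; apply: measurable_funB.
  by apply: (measurableT_comp (@measurable_phase R m n lam) (_ : measT (fun q : (X * X) * Fq => (q.1.1, q.2)))); mea.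
by apply: (measurableT_comp (@measurable_phase R m n lam) (_ : measT (fun q : (X * X) * Fq => (q.1.2, q.2)))); mea.
Qed.

Lemma sqint_fkernel K z' : sqint W (fun z => fk K z z').
Proof.
have mk : measT (fun z => fk K z z').
  by apply: (measurableT_comp (measurable_fkernel K) (_ : measT (fun z : X => (z, z')))); mea.
split => //; have [M M0 hM] := fkernel_bounded K.
have k0 z : 0 <= fk K z z' by exact: fkernel_ge0.
apply/integrableP; split; first by apply/measurable_EFinP; exact: measurable_funX.
apply: (@le_lt_trans _ _ (\int[W]_z (M * fk K z z')%:E)%E).
  rewrite (eq_integral (fun z => (fk K z z' ^+ 2)%:E)); last by move=> z _ /=; rewrite ger0_norm ?sqr_ge0.
  apply: ge0_le_int.
  - exact: measurable_funX.
  - by apply: measurable_funM => //; exact: measurable_cst.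
  - by move=> z; exact: sqr_ge0.
  - by move=> z; rewrite expr2 ler_wpM2r.
rewrite ge0_intZl//; apply: lte_mul_pinfty => //.
apply: (@le_lt_trans _ _ (32 ^+ m)%:E); last exact: ltry.
rewrite (eq_integral (fun z => (fk K z' z)%:E)); last by move=> z _; rewrite fkernelC.
exact: fkernel_mass.
Qed.

Lemma smoothing_integrable (al : X -> R) K z' c : W.-intT (al) ->
  fm.-intT ((fun xi => fw K xi * (ctr lam al xi * cos (ph z' xi - c) + str lam al xi * sin (ph z' xi - c)))).
Proof.
move=> jal; have jf := fweight_integrable K.
have mal := integrable_measurable jal; have mf := integrable_measurable jf.
have mpx : measT (ph z').
  by apply: (measurableT_comp (@measurable_phase R m n lam) (_ : measT (fun xi : Fq => (z', xi)))); mea.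
have jM := integrableZl measurableT (2 * \int[W]_z `|al z|) jf.
have jn : W.-intT ((fun z => `|al z|)).
  by apply: (integrable_dom _ jal) => [|z]; [exact: measurable_normr|rewrite normr_id].
apply: (integrable_dom _ jM).
  apply: measurable_funM => //; apply: measurable_funD; apply: measurable_funM.
  - exact: measurable_ctr.
  - by apply: measurable_cosD; apply: measurable_funB => //; exact: measurable_cst.
  - exact: measurable_str.
  - by apply: measurable_sinD; apply: measurable_funB => //; exact: measurable_cst.
move=> xi; have mz := @measurable_phase_at R m n lam xi.
have jc := integrable_mulcos jal mz; have js := integrable_mulsin jal mz.
have hc : `|ctr lam al xi| <= \int[W]_z `|al z|.
  apply: (le_trans (le_normr_Rintegral _ jc)) => //; apply: le_Rintegral => //.
    by apply: (integrable_dom _ jc) => [|z]; [apply: measurable_normr; exact: integrable_measurable jc|rewrite normr_id].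
  by move=> z _; rewrite normrM ler_piMr// ler_norml cos_geN1 cos_le1.
have hs : `|str lam al xi| <= \int[W]_z `|al z|.
  apply: (le_trans (le_normr_Rintegral _ js)) => //; apply: le_Rintegral => //.
    by apply: (integrable_dom _ js) => [|z]; [apply: measurable_normr; exact: integrable_measurable js|rewrite normr_id].
  by move=> z _; rewrite normrM ler_piMr// ler_norml sin_geN1 sin_le1.
have i0 : 0 <= \int[W]_z `|al z| by apply: Rint_ge0.
rewrite mulrC !normrM ler_wpM2r// (ger0_norm i0) (ger0_norm (ler0n R 2)).
apply: (le_trans (ler_normD _ _)); rewrite mulr_natl mulr2n !normrM; apply: lerD.
  by rewrite -[leRHS]mulr1; apply: ler_pM => //; rewrite ler_norml cos_geN1 cos_le1.
by rewrite -[leRHS]mulr1; apply: ler_pM => //; rewrite ler_norml sin_geN1 sin_le1.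
Qed.

(** Integrate [al z * fw K xi * cos (ph z xi - ph z' xi + c)] in both orders. The shift selects a
    part: [c = 0] gives the smoothed function, [c = pi / 2] gives zero. *)
Lemma smoothing_rotated (al : X -> R) K z' c : W.-intT (al) ->
  \int[fm]_xi (fw K xi * (ctr lam al xi * cos (ph z' xi - c) + str lam al xi * sin (ph z' xi - c))) =
  cos c * \int[W]_z (al z * fk K z z').
Proof.
move=> jal; have jf := fweight_integrable K.
have mal := integrable_measurable jal; have mf := integrable_measurable jf.
have mp2 : measT (fun q : X * Fq => ph q.1 q.2) by exact: measurable_phase.
have mpx : measT (ph z').
  by apply: (measurableT_comp mp2 (_ : measT (fun xi : Fq => (z', xi)))); mea.
have mth : measT (fun q : X * Fq => (ph q.1 q.2 - ph z' q.2) + c).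
  apply: measurable_funD => //; apply: measurable_funB => //.
  by apply: (measurableT_comp mpx); mea.
have jg := integrable_mulcos (integrable_tensor jal jf) mth.
have e1 := prod_fubini jg; have e2 := prod_fubini2 jg.
have [M M0 hM] := fkernel_bounded K.
have jk : W.-intT ((fun z => al z * fk K z z')).
  have jM := integrableZl measurableT M jal.
  apply: (integrable_dom _ jM).
    by apply: measurable_funM => //; exact: (sqint_fkernel K z').1.
  move=> z; rewrite mulrC [leLHS]normrM [leRHS]normrM ler_wpM2r// (ger0_norm M0).
  by rewrite (ger0_norm (fkernel_ge0 l0 z z' (ltn0Sn K))); exact: hM.
have in1 z : (\int[fm]_xi (al z * fw K xi * cos (ph z xi - ph z' xi + c))%:E = (cos c * (al z * fk K z z'))%:E)%E.
  have [_ _ /(_ c) o3] := fkernel_oscint K z z'.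
  have mt : measT (fun xi => ph z xi - ph z' xi + c).
    by apply: (measurableT_comp mth (_ : measT (fun xi : Fq => (z, xi)))); mea.
  rewrite (eq_integral (fun xi => (al z)%:E * (fw K xi * cos (ph z xi - ph z' xi + c))%:E)%E); last first.
    by move=> xi _; rewrite -EFinM; congr EFin; rewrite [RHS]mulrA.
  rewrite integralZl//; last exact: (integrable_mulcos jf mt).
  by rewrite o3 -EFinM; congr EFin; ring.
have in2 xi : (\int[W]_z (al z * fw K xi * cos (ph z xi - ph z' xi + c))%:E =
    (fw K xi * (ctr lam al xi * cos (ph z' xi - c) + str lam al xi * sin (ph z' xi - c)))%:E)%E.
  have mz := @measurable_phase_at R m n lam xi.
  have jc := integrable_mulcos jal mz; have js := integrable_mulsin jal mz.
  have jA := integrableZl measurableT (fw K xi * cos (ph z' xi - c)) jc.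
  have jB := integrableZl measurableT (fw K xi * sin (ph z' xi - c)) js.
  rewrite (eq_integral (fun z => ((fw K xi * cos (ph z' xi - c)) * (al z * cos (ph z xi)) +
     (fw K xi * sin (ph z' xi - c)) * (al z * sin (ph z xi)))%:E)); last first.
    by move=> z _; congr EFin; rewrite (_ : _ + c = ph z xi - (ph z' xi - c)) ?cosB; ring.
  rewrite -(EFinRint (integrable_D jA jB)) (RintD jA jB) !RintegralZl//.
  by congr EFin; rewrite /ctr /str; ring.
have jL := smoothing_integrable K z' c jal.
apply: EFin_inj; rewrite (EFinRint jL) -RintegralZl// (EFinRint (integrableZl measurableT (cos c) jk)).
rewrite -(eq_integral _ _ (fun z _ => in1 z)) -(eq_integral _ _ (fun xi _ => in2 xi)).
by rewrite -e1 -e2.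
Qed.

(** Synthesis with cosine and sine recovers the real part: the contribution of the imaginary part is
    the case [c = pi / 2], which vanishes. *)
Lemma smoothing_pair (vr vi : X -> R) K z' : W.-intT (vr) -> W.-intT (vi) ->
  \int[fm]_xi (fw K xi * (ftr lam vr vi xi * cos (ph z' xi) - fti lam vr vi xi * sin (ph z' xi))) =
  \int[W]_z (vr z * fk K z z').
Proof.
move=> jr ji; have j1 := smoothing_integrable K z' 0 jr; have j2 := smoothing_integrable K z' (pi / 2) ji.
have e1 := smoothing_rotated K z' 0 jr; have e2 := smoothing_rotated K z' (pi / 2) ji.
rewrite cos0 mul1r in e1; rewrite cos_pihalf mul0r in e2.
apply: (etrans _ (etrans (RintB j1 j2) (etrans (congr2 (fun p q : R => p - q) e1 e2) (subr0 _)))).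
congr Rintegral; apply/funext => xi.
rewrite subr0 cosB sinB cos_pihalf sin_pihalf /ftr /fti; ring.
Qed.
End smoothing.

(** * Recovering a function from its transform *)

Section inversion.
Context (R : realType) (m n : nat) (lam : R) (eta : R -> R).
Hypotheses (l0 : 0 < lam) (heta : is_cutoff eta).
Local Notation leb := (lebesgue R).
Local Notation Rm := (measurableTypeR R).
Local Notation X := (phys_point R m n).
Local Notation Fq := (frequency R m n).
Local Notation W := (waveguide m n lam).
Local Notation fm := (freqm m n lam).
Local Notation fw K := (@fweight R m n K.+1).
Local Notation fk K := (@fkernel R m n lam K.+1).
Local Notation ph := (@phase R m n lam).
Local Notation cst0 := (@cst0 m).
Local Notation w0 k := (win eta k.+1%:R cst0).

Lemma window_eventually (z : X) : \forall k \near \oo, w0 k z = 1.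
Proof.
pose S := \sum_(i < m) `|tnth z.1 i|.
have S0 : 0 <= S by apply: sumr_ge0.
exists (Num.bound S) => // k /= hk.
have Sk : S <= k.+1%:R by apply: (le_trans (ltW (archi_boundP S0))); rewrite ler_nat leqW.
have kp : 0 < k.+1%:R :> R by rewrite ltr0n.
have [_ _ _ eta1 _] := heta.
rewrite /win big1// => i _; rewrite /cst0 /=; apply: eta1.
rewrite normrM normfV (gtr0_norm kp) ler_pdivrMr// mul1r; apply: le_trans Sk.
by rewrite /S (bigD1 i)//= lerDl sumr_ge0.
Qed.

Definition inv_re (G : (Fq -> R) * (Fq -> R)) (z : X) : R := \int[fm]_xi (G.1 xi * cos (ph z xi) - G.2 xi * sin (ph z xi)).
Definition inv_im (G : (Fq -> R) * (Fq -> R)) (z : X) : R := \int[fm]_xi (G.1 xi * sin (ph z xi) + G.2 xi * cos (ph z xi)).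

Section fixed.
Variables (v : X -> R[i]) (G : (Fq -> R) * (Fq -> R)).
Local Notation vr := (fun z => complex.Re (v z)).
Local Notation vi := (fun z => complex.Im (v z)).
Hypotheses (sr : sqint W vr) (si : sqint W vi).
Hypotheses (jG1 : fm.-intT (G.1)) (jG2 : fm.-intT (G.2)).
Hypothesis hft : has_ft lam eta v G.

Let mph z : measT (ph z).
Proof. by apply: (measurableT_comp (@measurable_phase R m n lam) (_ : measT (fun xi : Fq => (z, xi)))); mea. Qed.

Definition wave_int z xi : R := G.1 xi * cos (ph z xi) - G.2 xi * sin (ph z xi).

Let jwave z : fm.-intT (wave_int z).
Proof. by apply: integrable_B; [exact: (integrable_mulcos jG1)|exact: (integrable_mulsin jG2)]. Qed.

Let jfwave K z : fm.-intT ((fun xi => fw K xi * wave_int z xi)).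
Proof.
apply: (integrable_dom _ (jwave z)).
  by apply: measurable_funM; [exact: integrable_measurable (fweight_integrable m n l0 K)|exact: integrable_measurable (jwave z)].
by move=> xi; rewrite normrM ler_piMl// ger0_norm ?fweight_ge0// fweight_le1.
Qed.

Let A1 k := ftr lam (fun z => vr z * w0 k z) (fun z => vi z * w0 k z).
Let A2 k := fti lam (fun z => vr z * w0 k z) (fun z => vi z * w0 k z).

(** Both sides are limits of the smoothed windowed function: the left one by dominated convergence
    in space, the right one because [fw K] is bounded with support in a frequency box, where
    [has_ft] gives L2 convergence, and the Cauchy-Schwarz inequality applies. *)
Lemma smoothed_eq K z' : \int[W]_z (vr z * fk K z z') = \int[fm]_xi (fw K xi * wave_int z' xi).
Proof.
pose s k := \int[W]_z (vr z * w0 k z * fk K z z').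
have jf := fweight_integrable m n l0 K; have mf := integrable_measurable jf.
have [mvr _] := sr; have [mvi _] := si.
have kp k : 0 < k.+1%:R :> R by rewrite ltr0n.
have jr k : W.-intT ((fun z => vr z * w0 k z)) by exact: integrable_win.
have ji k : W.-intT ((fun z => vi z * w0 k z)) by exact: integrable_win.
have [mk _] := sqint_fkernel l0 K z'.
have lim1 : s @ \oo --> \int[W]_z (vr z * fk K z z').
  have [M M0 hM] := win_bounded n heta cst0.
  have jvk := sqint_mul sr (sqint_fkernel l0 K z').
  have jvn : W.-intT ((fun z => `|vr z * fk K z z'|)).
    by apply: (integrable_dom _ jvk) => [|z]; [apply: measurable_normr; exact: measurable_funM|rewrite normr_id].
  apply: (@dominated_Rint _ _ _ W _ _ (fun z => M * `|vr z * fk K z z'|)).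
  - by move=> k; apply: measurable_funM => //; apply: measurable_funM => //; exact: measurable_win.
  - exact: measurable_funM.
  - exact: (integrableZl measurableT M jvn).
  - by move=> k z; rewrite mulrAC normrM mulrC ler_wpM2r.
  - apply: aeW => z; apply: cvg_near_cst; have := window_eventually z.
    by apply: filterS => k ->; rewrite mulr1.
have lim2 : s @ \oo --> \int[fm]_xi (fw K xi * wave_int z' xi).
  have [mA1 mA2] : (forall k, measT (A1 k)) /\ (forall k, measT (A2 k)).
    by split=> k; have [] := measurable_ft lam (integrable_measurable (jr k)) (integrable_measurable (ji k)).
  pose g k xi := (A1 k xi - G.1 xi) * cos (ph z' xi) - (A2 k xi - G.2 xi) * sin (ph z' xi).
  pose gb k xi := \1_(fbox K.+1%:R) xi * g k xi.
  have mg k : measT (g k).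
    apply: measurable_funB; apply: measurable_funM.
    - by apply: measurable_funB => //; exact: integrable_measurable jG1.
    - exact: measurable_cosD.
    - by apply: measurable_funB => //; exact: integrable_measurable jG2.
    - exact: measurable_sinD.
  have mB := @measurable_fbox R m n K.+1%:R.
  have mgb k : measT (gb k) by apply: measurable_funM => //; exact: measurable_indic.
  have jfA k : fm.-intT ((fun xi => fw K xi * (A1 k xi * cos (ph z' xi) - A2 k xi * sin (ph z' xi)))).
    have j1 := smoothing_integrable l0 K z' 0 (jr k); have j2 := smoothing_integrable l0 K z' (pi / 2) (ji k).
    have := integrable_B j1 j2; congr (fm.-intT (_)); apply/funext => xi.
    by rewrite subr0 cosB sinB cos_pihalf sin_pihalf /A1 /A2 /ftr /fti; ring.
  have sE k : s k - \int[fm]_xi (fw K xi * wave_int z' xi) = \int[fm]_xi (fw K xi * gb k xi).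
    rewrite /s -(smoothing_pair l0 K z' (jr k) (ji k)) -(RintB (jfA k) (jfwave K z')).
    congr Rintegral; apply/funext => xi; rewrite /gb indicE; case: (boolP (xi \in _)) => [_|/negP h].
      by rewrite mul1r /wave_int /g; ring.
    rewrite fweight_out ?mul0r ?subr0// => h'; apply: h; exact: mem_set.
  have sf : sqint fm (fw K).
    split => //; apply: (integrable_dom _ jf); first exact: measurable_funX.
    move=> xi; rewrite ger0_norm ?sqr_ge0// ger0_norm ?fweight_ge0// expr2 ler_piMl ?fweight_ge0//.
    exact: fweight_le1.
  pose x k := (\int[fm]_xi (gb k xi ^+ 2)%:E)%E.
  have vx : vanish x.
    apply: (vanish_le (hft K.+1%:R)) => k; rewrite /x [leRHS]integral_mkcond.
    apply: ge0_le_integral => //.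
    - by move=> xi _; rewrite lee_fin sqr_ge0.
    - by apply/measurable_EFinP; exact: measurable_funX.
    - apply/(measurable_restrictT _ mB); apply/measurable_funTS/measurable_EFinP.
      apply: measurable_funD; apply: measurable_funX; apply: measurable_funB.
      + exact: (mA1 k).
      + exact: integrable_measurable jG1.
      + exact: (mA2 k).
      + exact: integrable_measurable jG2.
    move=> xi _; rewrite patchE /gb indicE; case: ifP => _; last by rewrite mul0r expr0n.
    by rewrite mul1r lee_fin; exact: rotate_sqr_le.
  apply/cvgrPdist_le => e e0.
  pose C := \int[fm]_xi fw K xi ^+ 2.
  have C0 : 0 <= C by apply: Rint_ge0 => xi; exact: sqr_ge0.
  have [k0 hk0] := vx (e ^+ 2 / (C + 1)) (divr_gt0 (exprn_gt0 _ e0) (ltr_wpDl C0 ltr01)).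
  exists k0 => // k /= kk0; rewrite distrC sE.
  have hx := hk0 k kk0.
  have sg : sqint fm (gb k).
    split => //; apply/integrableP; split; first by apply/measurable_EFinP; exact: measurable_funX.
    apply: (@le_lt_trans _ _ (x k)); last exact: le_lt_trans hx (ltry _).
    apply: eq_le; apply: eq_integral => xi _ /=.
    by rewrite ger0_norm ?sqr_ge0.
  have cs := cauchy_schwarz sf sg.
  have xb : \int[fm]_xi gb k xi ^+ 2 <= e ^+ 2 / (C + 1) by rewrite -lee_fin (EFinRint sg.2).
  have h2 : `|\int[fm]_xi (fw K xi * gb k xi)| ^+ 2 <= e ^+ 2.
    rewrite real_normK ?num_real//; apply: (le_trans cs); apply: (le_trans (ler_wpM2l C0 xb)).
    by rewrite mulrCA ler_piMr ?sqr_ge0// ler_pdivrMr ?mul1r; lra.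
  by move: h2; rewrite ler_pXn2r ?nnegrE// ltW.
exact: (cvg_unique _ lim1 lim2).
Qed.
End fixed.

Section box_tests.
Variables (a b : 'I_m + 'I_n -> R).
Local Notation chi := (\1_(rbox a b) : X -> R).
Local Notation itv s := (`]a s, b s[%classic : set Rm).

Lemma rbox_tensor (z : X) : chi z = (\prod_(i < m) \1_(itv (inl i)) (tnth z.1 i)) * (\prod_(j < n) \1_(itv (inr j)) (tnth z.2 j)).
Proof.
rewrite indicE; case: (boolP (z \in rbox a b)) => [/set_mem h|/negP h].
  by rewrite !big1 ?mulr1// => i _; rewrite indicE mem_set//= in_itv /=; [exact: (h (inr i))|exact: (h (inl i))].
have /existsNP[s hs] : ~ forall s, a s < zcoord z s < b s by move=> hz; apply: h; exact: mem_set.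
case: s hs => i hs.
  by rewrite (bigD1 i)//= indicE memNset ?mul0r//= in_itv.
by rewrite [X in _ * X](bigD1 i)//= indicE memNset ?mul0r ?mulr0//= in_itv.
Qed.

Definition psi K (z : X) : R := (\prod_(i < m) psi1 K.+1%:R (a (inl i)) (b (inl i)) (tnth z.1 i)) *
  (\prod_(j < n) psi2 lam K.+1 (a (inr j)) (b (inr j)) (tnth z.2 j)).

(** With phase zero, the calculus of [oscint] is the product rule for integrals of tensor
    products. *)
Lemma psi_oscint K z : oscint W (fun z' => chi z' * fk K z z') (fun=> 0) (psi K z).
Proof.
have K0 : 0 < K.+1%:R :> R by rewrite ltr0n.
pose k1 (i : 'I_m) (x' : Rm) : R := \1_(itv (inl i)) x' * fej K.+1%:R (2 * pi * (tnth z.1 i - x')).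
pose k2 (j : 'I_n) (y' : Rm) : R := \1_(itv (inr j)) y' * torus_kernel lam K.+1 (tnth z.2 j) y'.
have o1 i : oscint leb (k1 i) (fun=> 0) (psi1 K.+1%:R (a (inl i)) (b (inl i)) (tnth z.1 i)).
  apply: oscint_cst.
  have jf : leb.-intT ((fun x' : Rm => fej K.+1%:R (2 * pi * (x' - tnth z.1 i)))).
    apply/integrableP; split.
      by apply/measurable_EFinP; apply: (measurableT_comp (continuous_fej K0)); mea.
    apply: (@le_lt_trans _ _ 32%:E); last exact: ltry.
    rewrite (eq_integral (fun x' : Rm => (fej K.+1%:R (2 * pi * (x' - tnth z.1 i)))%:E)); first exact: fej_mass.
    by move=> x' _ /=; rewrite ger0_norm ?fej_ge0.
  apply: (integrable_dom _ jf).
    apply: measurable_funM; first by apply: measurable_indic.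
    by apply: (measurableT_comp (continuous_fej K0)); mea.
  move=> x'; rewrite /k1 (_ : 2 * pi * (tnth z.1 i - x') = - (2 * pi * (x' - tnth z.1 i))); last by ring.
  by rewrite fejN normrM ler_piMl// indicE; case: (_ \in _); rewrite ?normr1 ?normr0.
have o2 j : oscint (@interval_measure R `[0, lam]) (k2 j) (fun=> 0) (psi2 lam K.+1 (a (inr j)) (b (inr j)) (tnth z.2 j)).
  by apply: oscint_cst; exact: (kernel_integrable l0 (tnth z.2 j) (measurable_itv _) (ltn0Sn K)).
have := oscint_prod (oscint_power o1) (oscint_power o2).
congr (oscint _ _ _ _); apply/funext => z' /=; last by rewrite !big1_eq addr0.
rewrite rbox_tensor /fkernel mulrACA -!big_split /=; congr (_ * _); apply: eq_bigr => i _ //.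
Qed.

Lemma psiE K z : \int[W]_z' (chi z' * fk K z z') = psi K z.
Proof.
have [j _ /(_ 0)] := psi_oscint K z; rewrite cos0 mulr1 addr0 => h.
apply: EFin_inj; rewrite (EFinRint j) -h; apply: eq_integral => z' _.
by rewrite cos0 mulr1.
Qed.

Lemma psi_ge0 K z : 0 <= psi K z.
Proof.
rewrite mulr_ge0//; apply: prodr_ge0 => i _; first by apply: psi1_ge0; rewrite ltr0n.
by have /andP[] := psi2_bounds l0 (a (inr i)) (b (inr i)) (tnth z.2 i) (ltn0Sn K).
Qed.

Let mchi : measT chi.
Proof. by apply: measurable_indic; exact: measurable_rbox. Qed.

Lemma measurable_psi K : measT (psi K).
Proof.
rewrite (_ : psi K = fun z => \int[W]_z' (chi z' * fk K z z')); last by apply/funext => z; rewrite psiE.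
apply: (@measurable_param_Rintegral _ _ _ _ R W (fun p : X * X => chi p.2 * fk K p.1 p.2)).
by apply: measurable_funM; [apply: (measurableT_comp mchi); mea|exact: measurable_fkernel].
Qed.

(** A product of tails in the unbounded directions. Square integrability follows from [tail x <= 2],
    and the torus factors are at most 1. *)
Lemma psi_dom : exists2 D : X -> R, sqint W D & forall K z, psi K z <= D z.
Proof.
pose P (i : 'I_m) C := 0 <= C /\ forall (K : nat) x, psi1 K.+1%:R (a (inl i)) (b (inl i)) x <= C * tail x.
have /choice[C hC] : forall i, exists C, P i C.
  by move=> i; have [C C0 h] := @psi1_dom R (a (inl i)) (b (inl i)); exists C.
have mt : measT (@tail R) := integrable_measurable (@integrable_tail R).
exists (fun z => \prod_(i < m) (C i * tail (tnth z.1 i))) => [|K z]; last first.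
  rewrite -[leRHS]mulr1; apply: ler_pM.
  - by apply: prodr_ge0 => i _; apply: psi1_ge0; rewrite ltr0n.
  - apply: prodr_ge0 => i _.
    by have /andP[] := psi2_bounds l0 (a (inr i)) (b (inr i)) (tnth z.2 i) (ltn0Sn K).
  - by apply: ler_prod => i _; rewrite psi1_ge0 ?ltr0n//=; have [_] := hC i; apply.
  - rewrite -[leRHS](@big1 _ 1 *%R 'I_n (index_enum _) predT (fun=> 1))//.
    by apply: ler_prod => i _; exact: psi2_bounds.
have mD : measT (fun t : m.-tuple Rm => \prod_(i < m) (C i * tail (tnth t i))).
  apply: (@measurable_tensor _ Rm _ _ (fun i x => C i * tail x)) => i.
  by apply: measurable_funM => //; exact: measurable_cst.
have mDz : measT (fun z : X => \prod_(i < m) (C i * tail (tnth z.1 i))).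
  by apply: (measurableT_comp mD); exact: measurable_fst.
split => //; apply/integrableP; split; first by apply/measurable_EFinP; exact: measurable_funX.
pose cc (i : 'I_m) : R := C i ^+ 2 * (2 * \int[leb]_x tail x).
have tl0 := @tail_ge0 R; have it0 : 0 <= \int[leb]_x tail x by apply: Rint_ge0 => x; exact: tl0.
have h1 : (\int[power_measure leb m]_t (\prod_(i < m) ((C i * tail (tnth t i)) ^+ 2))%:E <= (\prod_(i < m) cc i)%:E)%E.
  apply: (@power_tensor_le _ _ _ leb _ (fun i x => (C i * tail x) ^+ 2)).
  - by move=> i; apply: measurable_funX; apply: measurable_funM => //; exact: measurable_cst.
  - by move=> i x; exact: sqr_ge0.
  - by move=> i; rewrite mulr_ge0 ?sqr_ge0// mulr_ge0.
  - move=> i; rewrite /cc; apply: (@le_trans _ _ (\int[leb]_x (C i ^+ 2 * (2 * tail x))%:E)%E).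
      apply: ge0_le_int.
      + by apply: measurable_funX; apply: measurable_funM => //; exact: measurable_cst.
      + by apply: measurable_funM; [exact: measurable_cst|apply: measurable_funM => //; exact: measurable_cst].
      + by move=> x; exact: sqr_ge0.
      + by move=> x; rewrite exprMn ler_wpM2l ?sqr_ge0// expr2 ler_wpM2r// tail_le2.
    rewrite ge0_intZl ?sqr_ge0//; last 2 first.
    - by apply: measurable_funM => //; exact: measurable_cst.
    - by move=> x; rewrite mulr_ge0.
    by rewrite (ge0_intZl _ (ler0n R 2) mt tl0) -(EFinRint (@integrable_tail R)) -!EFinM.
have h2 : (\int[power_measure (interval_measure `[0%R, lam]) n]_t (\prod_(j < n) (1 : R))%:E <= (\prod_(j < n) lam)%:E)%E.
  apply: (@power_tensor_le _ _ _ _ _ (fun _ _ => 1) (fun=> lam)) => //.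
  - by move=> i; exact: ltW.
  - move=> i; rewrite integral_cst// mul1e [X in (X <= _)%E](_ : _ = leb ([set: Rm] `&` `[0, lam]%classic))//.
    by rewrite setTI; apply: itv_leb_le; [exact: ltW|rewrite subr0].
apply: (@le_lt_trans _ _ ((\prod_(i < m) cc i) * (\prod_(j < n) lam))%:E); last exact: ltry.
apply: le_trans (prod_tensor_le _ _ _ _ h1 h2) => //.
- apply: ge0_le_integral => //.
  + by apply: measurableT_comp => //; apply/measurable_EFinP; exact: measurable_funX.
  + apply/measurable_EFinP; apply: measurable_funM; last exact: measurable_cst.
    apply: (measurableT_comp (f := fun t : m.-tuple Rm => \prod_(i < m) (C i * tail (tnth t i)) ^+ 2)); last exact: measurable_fst.
    apply: (@measurable_tensor _ Rm _ _ (fun i x => (C i * tail x) ^+ 2)) => i.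
    by apply: measurable_funX; apply: measurable_funM => //; exact: measurable_cst.
  + by move=> z _ /=; rewrite big1_eq mulr1 prodrXl ger0_norm ?sqr_ge0.
- apply: (@measurable_tensor _ Rm _ _ (fun i x => (C i * tail x) ^+ 2)) => i.
  by apply: measurable_funX; apply: measurable_funM => //; exact: measurable_cst.
- by move=> t; apply: prodr_ge0 => i _; exact: sqr_ge0.
- by move=> t; apply: prodr_ge0.
Qed.

Lemma coord_ae (N : 'I_m + 'I_n -> set Rm) : (forall s, measurable (N s)) -> (forall i, leb (N (inl i)) = 0%E) ->
  (forall j, interval_measure `[0, lam] (N (inr j)) = 0%E) -> {ae W, forall z s, ~ N s (zcoord z s)}.
Proof.
move=> mN N1 N2.
have h s : {ae W, forall z, ~ N s (zcoord z s)}.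
  exists [set z | N s (zcoord z s)]; split.
  - rewrite (_ : [set z | _] = setT `&` (fun z : X => zcoord z s) @^-1` N s); last by rewrite setTI.
    exact: (measurable_coord s measurableT (mN s)).
  - have mS k (j : 'I_k) M : measurable M -> measurable [set t : k.-tuple Rm | M (tnth t j)].
      move=> mM; rewrite (_ : [set t | _] = setT `&` (fun t : k.-tuple Rm => tnth t j) @^-1` M); last by rewrite setTI.
      exact: (measurable_tnth j measurableT).
    case: s => i.
      rewrite (_ : [set z | _] = [set t | N (inl i) (tnth t i)] `*` setT); last by apply/seteqP; split => z //= [].
      rewrite [LHS](product_measure1E _ _ (mS _ i _ (mN _)) measurableT).
      by rewrite [X in (X * _)%E](power_coord_null i (mN _) (N1 i)) mul0e.
    rewrite (_ : [set z | _] = setT `*` [set t | N (inr i) (tnth t i)]); last by apply/seteqP; split => z //= [].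
    rewrite [LHS](product_measure1E _ _ measurableT (mS _ i _ (mN _))).
    by rewrite [X in (_ * X)%E](power_coord_null i (mN _) (N2 i)) mule0.
  - by move=> z /= /contrapT.
pose P k z := if @unpickle ('I_m + 'I_n)%type k is Some s then ~ N s (zcoord z s) else True.
have : {ae W, forall z k, P k z}.
  by apply: ae_foralln => k; rewrite /P; case: (unpickle k) => [s|]; [exact: h|exact: aeW].
by apply: filterS => z hz s; have := hz (pickle s); rewrite /P pickleK.
Qed.

(** The exceptional points have a coordinate at an endpoint of its interval, or a torus coordinate
    at 0 or [lam]. Each continuous coordinate contributes a factor [fejc], each torus coordinate a
    factor 1. *)
Lemma psi_cvg : {ae W, forall z, (psi^~ z) @ \oo --> fejc R ^+ m * chi z}.
Proof.
pose N s : set Rm := match s with inl _ => [set a s; b s] | inr _ => [set a s; b s] `|` ~` `]0, lam[%classic end.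
have c2 (x y : R) : countable [set x; y] by apply: finite_set_countable; rewrite finite_setU.
have m2 (x y : R) : measurable ([set x; y] : set Rm) by apply: measurableU; exact: measurable_set1.
have : {ae W, forall z s, ~ N s (zcoord z s)}.
  apply: coord_ae => [[i|j]|i|j].
  - exact: m2.
  - by apply: measurableU => //; apply: measurableC; exact: measurable_itv.
  - by apply: countable_lebesgue_measure0; exact: c2.
  - rewrite [LHS](_ : _ = leb (N (inr j) `&` `[0, lam]%classic))//.
    apply: countable_lebesgue_measure0.
    apply: (@sub_countable _ _ _ ([set a (inr j); b (inr j)] `|` [set 0; lam])).
      apply: subset_card_le => y /= [[h|h] /=]; first by left.
      rewrite in_itv /= => /andP[y0 y1]; right; apply: contrapT => /not_orP[n0 n1]; apply: h => /=.
      by rewrite in_itv /= !lt_neqAle y0 y1 !andbT; apply/andP; split; apply/eqP => e; [apply: n0|apply: n1].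
    by apply: finite_set_countable; rewrite !finite_setU.
apply: filterS => z hz.
have -> : fejc R ^+ m * chi z = (\prod_(i < m) (fejc R * \1_(itv (inl i)) (tnth z.1 i))) * (\prod_(j < n) \1_(itv (inr j)) (tnth z.2 j)).
  by rewrite rbox_tensor big_split /= prodr_const card_ord mulrA.
apply: cvgM; apply: cvg_prodr => i.
  have := hz (inl i) => /= h; apply: psi1_cvg; apply/eqP => e; apply: h; [left|right]; exact: e.
have := hz (inr i) => /= h.
have : ~ (~` `]0, lam[%classic) (tnth z.2 i) by move=> h'; apply: h; right.
move=> /contrapT /=; rewrite in_itv /= => /andP[y0 y1].
by apply: psi2_cvg => //; apply/eqP => e; apply: h; left; [left|right]; exact: e.
Qed.

Lemma sqint_rbox : sqint W chi.
Proof.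
apply: (@sqint_bounded R m n lam l0 chi 1 (\sum_(i < m) (`|a (inl i)| + `|b (inl i)|))) => //.
- by apply: sumr_ge0 => i _; rewrite addr_ge0.
- by move=> z; rewrite indicE; case: (_ \in _); rewrite ?normr1 ?normr0.
move=> z h; rewrite indicE memNset// => hz; apply: h => i; have /= /andP[h1 h2] := hz (inl i).
rewrite (bigD1 i)//= ler_norml.
have s0 : 0 <= \sum_(i0 < m | i0 != i) (`|a (inl i0)| + `|b (inl i0)|) by apply: sumr_ge0 => j _; rewrite addr_ge0.
have := ler_norm (b (inl i)); have := ler_norm (- a (inl i)); rewrite normrN.
have := normr_ge0 (b (inl i)); have := normr_ge0 (a (inl i)).
by move=> *; apply/andP; split; lra.
Qed.

(** Moves the smoothing from [vr], known only to be in L2, onto the box, where it is the explicit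
    function [psi]. *)
Lemma box_smoothed (vr : X -> R) K : sqint W vr ->
  \int[W]_z (vr z * psi K z) = \int[W]_z' (chi z' * \int[W]_z (vr z * fk K z z')).
Proof.
move=> sr; have [mr _] := sr; have [D sD hD] := psi_dom.
pose f (p : X * X) : R := vr p.1 * (chi p.2 * fk K p.1 p.2).
have k0 z z' : 0 <= fk K z z' by exact: fkernel_ge0.
have c0 z : 0 <= chi z by rewrite indicE.
have mf : measT f.
  apply: measurable_funM; first by apply: (measurableT_comp mr); mea.
  by apply: measurable_funM; [apply: (measurableT_comp mchi); mea|exact: measurable_fkernel].
have jpsi : W.-intT ((fun z => vr z * psi K z)).
  apply: (integrable_dom _ (sqint_mul sr sD)); first by apply: measurable_funM => //; exact: measurable_psi.
  move=> z; rewrite [leLHS]normrM [leRHS]normrM ler_wpM2l// (ger0_norm (psi_ge0 K z)); apply: (le_trans (hD K z)); exact: ler_norm.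
have jchi z : W.-intT ((fun z' => chi z' * fk K z z')) by have [] := psi_oscint K z.
have cE z : (\int[W]_z' (chi z' * fk K z z')%:E = (psi K z)%:E)%E.
  exact: (etrans (esym (EFinRint (jchi z))) (congr1 EFin (psiE K z))).
have jf : (prod_measure W W).-intT (f).
  apply/integrableP; split; first exact/measurable_EFinP.
  rewrite prod_tonelli//; last by apply: measurableT_comp => //; exact/measurable_EFinP.
  rewrite (eq_integral (fun z => `|(vr z * psi K z)%:E|%E)); first by have /integrableP[] := jpsi.
  move=> z _; rewrite (eq_integral (fun z' => (`|vr z|%:E * (chi z' * fk K z z')%:E)%E)); last first.
    by move=> z' _; rewrite /f /= -EFinM normrM [X in _ * X]ger0_norm// mulr_ge0.
  by apply: (etrans (integralZl measurableT (jchi z) `|vr z|)); rewrite [X in (_ * X)%E]cE -EFinM /= normrM (ger0_norm (psi_ge0 K z)).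
have in1 z : (\int[W]_z' (f (z, z'))%:E = (vr z * psi K z)%:E)%E.
  rewrite (eq_integral (fun z' => ((vr z)%:E * (chi z' * fk K z z')%:E)%E)); last first.
    by move=> z' _; rewrite /f /= -EFinM.
  by apply: (etrans (integralZl measurableT (jchi z) (vr z))); rewrite [X in (_ * X)%E]cE -EFinM.
have in2 z' : (\int[W]_z (f (z, z'))%:E = (chi z' * \int[W]_z (vr z * fk K z z'))%:E)%E.
  have jv := sqint_mul sr (sqint_fkernel l0 K z').
  rewrite (eq_integral (fun z => ((chi z')%:E * (vr z * fk K z z')%:E)%E)); last first.
    by move=> z _; rewrite /f /= -EFinM mulrCA.
  apply: (etrans (integralZl measurableT jv (chi z'))).
  exact: (congr1 (fun x => ((chi z')%:E * x)%E) (esym (EFinRint jv))).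
congr fine; have e1 := prod_fubini jf; have e2 := prod_fubini2 jf.
rewrite -(eq_integral _ _ (fun z _ => in1 z)) -(eq_integral _ _ (fun z' _ => in2 z')).
by rewrite -e1 -e2.
Qed.
End box_tests.

Section inverse.
Variables (v : X -> R[i]) (G : (Fq -> R) * (Fq -> R)).
Local Notation vr := (fun z => complex.Re (v z)).
Local Notation vi := (fun z => complex.Im (v z)).
Hypotheses (sr : sqint W vr) (si : sqint W vi).
Hypotheses (jG1 : fm.-intT (G.1)) (jG2 : fm.-intT (G.2)).
Hypothesis hft : has_ft lam eta v G.

Let mGph : measT (fun p : X * Fq => wave_int G p.1 p.2).
Proof.
have mp := @measurable_phase R m n lam.
apply: measurable_funB; apply: measurable_funM.
- by apply: (measurableT_comp (integrable_measurable jG1)); mea.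
- exact: measurable_cosD.
- by apply: (measurableT_comp (integrable_measurable jG2)); mea.
- exact: measurable_sinD.
Qed.

Let I := \int[fm]_xi (`|G.1 xi| + `|G.2 xi|).

Let jI : fm.-intT ((fun xi => `|G.1 xi| + `|G.2 xi|)).
Proof.
have jn (g : Fq -> R) : fm.-intT (g) -> fm.-intT ((fun xi => `|g xi|)).
  move=> jg; apply: (integrable_dom _ jg) => [|xi]; last by rewrite normr_id.
  by apply: measurable_normr; exact: integrable_measurable jg.
by apply: integrable_D; exact: jn.
Qed.

Let wave_le z xi : `|wave_int G z xi| <= `|G.1 xi| + `|G.2 xi|.
Proof.
apply: (le_trans (ler_normB _ _)); rewrite !normrM; apply: lerD; apply: ler_piMr => //.
  by rewrite ler_norml cos_geN1 cos_le1.
by rewrite ler_norml sin_geN1 sin_le1.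
Qed.

Let weighted_le (c : Fq -> R) z : measT c -> (forall xi, 0 <= c xi <= 1) ->
  `|\int[fm]_xi (c xi * wave_int G z xi)| <= I.
Proof.
move=> mc c01.
have mw : measT (wave_int G z).
  by apply: (measurableT_comp mGph (_ : measT (fun xi : Fq => (z, xi)))); mea.
have cw xi : `|c xi * wave_int G z xi| <= `|G.1 xi| + `|G.2 xi|.
  have /andP[a0 a1] := c01 xi; apply: le_trans (wave_le z xi).
  by rewrite normrM ler_piMl// ger0_norm.
have j : fm.-intT ((fun xi => c xi * wave_int G z xi)).
  apply: (integrable_dom _ jI); first exact: measurable_funM.
  by move=> xi; rewrite [leRHS]ger0_norm ?addr_ge0.
have jn : fm.-intT ((fun xi => `|c xi * wave_int G z xi|)).
  by apply: (integrable_dom _ j) => [|xi]; [apply: measurable_normr; exact: integrable_measurable j|rewrite normr_id].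
by apply: (le_trans (le_normr_Rintegral _ j)) => //; exact: (le_Rintegral _ jn jI).
Qed.

Lemma measurable_inv_re : measT (inv_re G).
Proof. exact: (@measurable_param_Rintegral _ _ _ _ R fm (fun p : X * Fq => wave_int G p.1 p.2)). Qed.

(** The integrals of [vr] against the smoothed boxes have two limits: [psi_cvg] gives [fejc ^+ m]
    times the integral over the box, and [smoothed_eq] with weights increasing to 1 gives that of
    [inv_re]. Uniqueness of limits and [box_unique] conclude. *)
Lemma inversion_re : {ae W, forall z, fejc R ^+ m * vr z = inv_re G z}.
Proof.
have [mr _] := sr; have mU := measurable_inv_re.
have mf K := integrable_measurable (fweight_integrable m n l0 K).
have UI z : `|inv_re G z| <= I.
  have := @weighted_le (fun=> 1) z (@measurable_cst _ _ _ _ _ _); rewrite /inv_re.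
  under eq_Rintegral do rewrite mul1r.
  by apply => xi; rewrite ler01 lexx.
have I0 : 0 <= I by apply: Rint_ge0 => xi; rewrite addr_ge0.
have jc a b : W.-intT ((\1_(rbox a b) : X -> R)).
  have [mc j2] := sqint_rbox a b; apply: (integrable_dom _ j2) => // z.
  by rewrite indicE; case: (_ \in _); rewrite ?expr1n ?expr0n.
have jcI a b := integrableZl measurableT I (jc a b).
have jvc a b := sqint_mul (sqint_rbox a b) (sqint_scale (fejc R ^+ m) sr).
have mcU a b : measT (fun z => \1_(rbox a b) z * inv_re G z).
  by apply: measurable_funM => //; exact: (sqint_rbox a b).1.
apply: box_unique => a b; first exact: jvc.
  apply: (integrable_dom _ (jcI a b)) => // z.
  by rewrite mulrC !normrM ler_wpM2r// (ger0_norm I0).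
have [D sD hD] := psi_dom a b.
have mw z : measT (wave_int G z).
  by apply: (measurableT_comp mGph (_ : measT (fun xi : Fq => (z, xi)))); mea.
pose s K := \int[W]_z (vr z * psi a b K z).
have lim1 : s @ \oo --> \int[W]_z (\1_(rbox a b) z * (fejc R ^+ m * vr z)).
  have jD := sqint_mul sr sD.
  have jDn : W.-intT ((fun z => `|vr z * D z|)).
    apply: (integrable_dom _ jD) => [|z]; last by rewrite normr_id.
    by apply: measurable_normr; exact: integrable_measurable jD.
  apply: (@dominated_Rint _ _ _ W _ _ (fun z => `|vr z * D z|)) => //.
  - by move=> K; apply: measurable_funM => //; exact: measurable_psi.
  - exact: integrable_measurable (jvc a b).
  - move=> K z; rewrite [leLHS]normrM [leRHS]normrM ler_wpM2l// (ger0_norm (psi_ge0 a b K z)); apply: (le_trans (hD K z)); exact: ler_norm.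
  - apply: filterS (psi_cvg a b) => z hz; rewrite mulrA mulrC [_ * fejc R ^+ m]mulrC.
    by apply: cvgM => //; exact: cvg_cst.
have lim2 : s @ \oo --> \int[W]_z (\1_(rbox a b) z * inv_re G z).
  have -> : s = fun K => \int[W]_z' (\1_(rbox a b) z' * \int[fm]_xi (fw K xi * wave_int G z' xi)).
    apply/funext => K; rewrite /s (box_smoothed a b K sr); congr Rintegral; apply/funext => z'.
    by rewrite (smoothed_eq sr si jG1 jG2 hft).
  apply: (@dominated_Rint _ _ _ W _ _ (fun z => I * \1_(rbox a b) z)).
  - move=> K; apply: measurable_funM; first exact: (sqint_rbox a b).1.
    apply: (@measurable_param_Rintegral _ _ _ _ R fm (fun p : X * Fq => fw K p.2 * wave_int G p.1 p.2)).
    by apply: measurable_funM => //; apply: (measurableT_comp (mf K)); mea.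
  - exact: mcU.
  - exact: jcI.
  - move=> K z; rewrite normrM mulrC; apply: ler_pM => //.
      by apply: weighted_le => // xi; rewrite fweight_ge0 fweight_le1.
    by rewrite indicE; case: (_ \in _); rewrite ?normr1 ?normr0.
  - apply: aeW => z; apply: cvgM; first exact: cvg_cst.
    apply: (@dominated_Rint _ _ _ fm _ _ (fun xi => `|G.1 xi| + `|G.2 xi|)).
    + by move=> K; exact: measurable_funM.
    + exact: mw.
    + exact: jI.
    + move=> K xi; apply: le_trans (wave_le z xi); rewrite normrM ler_piMl//.
      by rewrite ger0_norm ?fweight_ge0// fweight_le1.
    + apply: aeW => xi; rewrite -[X in _ --> X]mul1r; apply: cvgM; [exact: fweight_cvg|exact: cvg_cst].
exact: (cvg_unique _ lim1 lim2).
Qed.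
End inverse.

(** The real case applied to [- i * v], whose real part is the imaginary part of [v] and whose
    transform is [- i] times that of [v]. *)
Lemma inversion_im (v : X -> R[i]) (G : (Fq -> R) * (Fq -> R)) :
  sqint W (fun z => complex.Re (v z)) -> sqint W (fun z => complex.Im (v z)) ->
  fm.-intT (G.1) -> fm.-intT (G.2) -> has_ft lam eta v G ->
  {ae W, forall z, fejc R ^+ m * complex.Im (v z) = inv_im G z}.
Proof.
move=> sr si j1 j2 h.
pose v' (z : X) : R[i] := Complex (complex.Im (v z)) (- complex.Re (v z)).
pose G' : (Fq -> R) * (Fq -> R) := (G.2, fun xi => - G.1 xi).
have sr' : sqint W (fun z => complex.Im (v' z)).
  have := sqint_scale (-1) sr; congr (sqint W _); apply/funext => z; by rewrite mulN1r.
have j1' : fm.-intT (G'.2).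
  have := integrableZl measurableT (-1) j1; congr (fm.-integrable setT _); apply/funext => xi /=.
  by rewrite -EFinM mulN1r.
have ctrN (g : X -> R) k xi : sqint W g -> wct lam eta k.+1%:R cst0 (fun z => - g z) xi = - wct lam eta k.+1%:R cst0 g xi.
  move=> sg; have jg : W.-intT ((fun z => g z * w0 k z)) by apply: integrable_win => //; rewrite ltr0n.
  have jw := integrable_mulcos jg (@measurable_phase_at R m n lam xi).
  by rewrite /wct /ctr -[RHS]mulN1r -(RintegralZl _ _ jw)//; congr Rintegral; apply/funext => z; ring.
have strN (g : X -> R) k xi : sqint W g -> wst lam eta k.+1%:R cst0 (fun z => - g z) xi = - wst lam eta k.+1%:R cst0 g xi.
  move=> sg; have jg : W.-intT ((fun z => g z * w0 k z)) by apply: integrable_win => //; rewrite ltr0n.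
  have jw := integrable_mulsin jg (@measurable_phase_at R m n lam xi).
  by rewrite /wst /str -[RHS]mulN1r -(RintegralZl _ _ jw)//; congr Rintegral; apply/funext => z; ring.
have h' : has_ft lam eta v' G'.
  move=> B; apply: (vanish_le (h B)) => k; apply: eq_le.
  apply: eq_integral => xi _; congr EFin; rewrite /= (ctrN _ _ _ sr) (strN _ _ _ sr); ring.
have := @inversion_re v' G' si sr' j2 j1' h'; apply: filterS => z /= ->.
by rewrite /inv_re /inv_im; congr Rintegral; apply/funext => xi /=; ring.
Qed.
End inversion.

(** * The estimate on bounded space-time boxes *)

Section localized_estimate.
Context (R : realType) (m n : nat) (lam : R) (eta : R -> R).
Hypotheses (l0 : 0 < lam) (heta : is_cutoff eta).
Local Notation leb := (lebesgue R).
Local Notation Rm := (measurableTypeR R).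
Local Notation X := (phys_point R m n).
Local Notation Fq := (frequency R m n).
Local Notation W := (waveguide m n lam).
Local Notation fm := (freqm m n lam).
Local Notation large0 := (@large_freq R m n lam (fun=> 0) (fun=> 0)).
Local Notation small := (@small_freq R m n lam).
Local Notation nu := (prod_measure leb W).

Lemma has_ft_ae (v f : X -> R[i]) F : in_L2 W v -> in_L2 W f -> {ae W, forall z, v z = f z} ->
  has_ft lam eta f F -> has_ft lam eta v F.
Proof.
move=> Lv Lf vf hf B; have [[mvr mvi] _] := Lv; have [[mfr mfi] _] := Lf.
have key (p q g : X -> R) : measT p -> measT q -> measT g ->
    {ae W, forall z, p z = q z} -> \int[W]_z (p z * g z) = \int[W]_z (q z * g z).
  move=> mp mq mg pq; congr fine; apply: ae_eq_integral => //.
  - by apply/measurable_EFinP; exact: measurable_funM.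
  - by apply/measurable_EFinP; exact: measurable_funM.
  - by apply: filterS pq => z -> _.
have er : {ae W, forall z, complex.Re (v z) = complex.Re (f z)} by apply: filterS vf => z ->.
have ei : {ae W, forall z, complex.Im (v z) = complex.Im (f z)} by apply: filterS vf => z ->.
have mw k := @measurable_win R m n eta heta k.+1%:R (@cst0 m).
have kc (p q : X -> R) k xi : measT p -> measT q -> {ae W, forall z, p z = q z} ->
    wct lam eta k.+1%:R (@cst0 m) p xi = wct lam eta k.+1%:R (@cst0 m) q xi /\
    wst lam eta k.+1%:R (@cst0 m) p xi = wst lam eta k.+1%:R (@cst0 m) q xi.
  move=> mp mq pq; have mz := @measurable_phase_at R m n lam xi.
  split; rewrite /wct /wst /ctr /str; under eq_Rintegral do rewrite -mulrA; under [RHS]eq_Rintegral do rewrite -mulrA.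
    by apply: key => //; apply: measurable_funM; [exact: mw|exact: measurable_cosD].
  by apply: key => //; apply: measurable_funM; [exact: mw|exact: measurable_sinD].
apply: (vanish_le (hf B)) => k; apply: eq_le; apply: eq_integral => xi _.
have [-> ->] := kc _ _ k xi mvr mfr er; have [-> ->] := kc _ _ k xi mvi mfi ei.
by [].
Qed.

Lemma fweight_lower K (xi : Fq) : fbox (K.+1%:R / 2) xi -> 2 ^- (m + n) <= fweight K.+1 xi.
Proof.
move=> [h1 h2]; have K0 : 0 < K.+1%:R :> R by rewrite ltr0n.
have p k (g : 'I_k -> R) : (forall i, `|g i| <= K.+1%:R / 2) -> 2 ^- k <= \prod_(i < k) tri K.+1%:R (g i).
  move=> hg; rewrite -exprVn -[leLHS](_ : \prod_(i < k) 2^-1 = _); last by rewrite prodr_const card_ord.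
  by apply: ler_prod => i _; rewrite invr_ge0 ler0n /=; exact: tri_half.
rewrite exprD invfM; apply: ler_pM; rewrite ?invr_ge0 ?exprn_ge0//; [exact: p|exact: p].
Qed.

(** On the bounded support, [|F| <= F ^+ 2 + 1], and the constant 1 is dominated by a multiple of an
    integrable triangle weight. *)
Lemma band_limited_integrable (F : Fq -> R) N : 0 <= N -> measT F ->
  (forall xi, ~ small N xi -> F xi = 0) -> fm.-intT ((fun xi => F xi ^+ 2)) ->
  fm.-intT (F).
Proof.
move=> N0 mF sF jF.
pose B := 2 * N * (lam + 1); have B0 : 0 <= B by rewrite !mulr_ge0// addr_ge0// ltW.
pose K := Num.bound (2 * B).
have KB : B <= K.+1%:R / 2.
  rewrite ler_pdivlMr// mulrC; apply: (le_trans (ltW (archi_boundP _))); first by rewrite mulr_ge0.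
  by rewrite ler_nat.
have jw := integrableZl measurableT (2 ^+ (m + n)) (fweight_integrable m n l0 K).
apply: (integrable_dom mF (integrable_D jF jw)) => xi.
have w0 := fweight_ge0 K xi; have p0 : 0 <= 2 ^+ (m + n) :> R by rewrite exprn_ge0.
have s0 : 0 <= F xi ^+ 2 + 2 ^+ (m + n) * fweight K.+1 xi := addr_ge0 (sqr_ge0 _) (mulr_ge0 p0 w0).
rewrite [leRHS](ger0_norm s0).
have [s|ns] := pselect (small N xi); last first.
  by rewrite [X in `|X|](sF _ ns) normr0.
have hb : fbox (K.+1%:R / 2) xi.
  have [s1 s2] := s; split => [i|j]; apply: le_trans KB.
    by apply: (le_trans (s1 i)); rewrite /B ler_peMr ?mulr_ge0 ?lerDr// ltW.
  apply: (@le_trans _ _ (2 * N * lam)); last by rewrite /B ler_wpM2l ?mulr_ge0// lerDl.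
  by rewrite -ler_pdivrMr// -[X in _ / X](gtr0_norm l0) -normfV -normrM.
have h1 : 1 <= 2 ^+ (m + n) * fweight K.+1 xi.
  by have := ler_wpM2l p0 (fweight_lower hb); rewrite divff// expf_neq0// pnatr_eq0.
have : `|F xi| <= F xi ^+ 2 + 1.
  by rewrite -[F xi ^+ 2]real_normK ?num_real//; have := sqr_ge0 (`|F xi| - 1); have := normr_ge0 (F xi); rewrite !expr2; lra.
by move=> h; apply: (le_trans h); rewrite lerD2l.
Qed.

(** The factors in order: undoing [fejc ^+ m] in both solutions, squared; the weight being at least
    1/2 in time and in each of [m] directions; the bilinear estimate without its [Q]; Bessel's
    inequality for the two data. *)
Definition local_const : R := fejc R ^+ m ^- 4 * (2 ^+ m.+1 * (2 * (32 * 32 ^+ m))) * (2 * bessel_const R m n) ^+ 2.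

Lemma local_const_ge0 : 0 <= local_const.
Proof.
rewrite mulr_ge0 ?sqr_ge0// mulr_ge0//; first by rewrite invr_ge0 exprn_ge0// exprn_ge0// ltW// fejc_gt0.
Qed.

Definition spacebox (T0 T : R) : set (Rm * X) := [set y | 0 <= y.1 <= T0 / 2 /\ forall i, `|tnth y.2.1 i| <= T / 2].

Lemma measurable_spacebox T0 T : measurable (spacebox T0 T).
Proof.
rewrite (_ : spacebox T0 T = `[0, T0 / 2]%classic `*` [set z : X | forall i, `|tnth z.1 i| <= T / 2]).
  by apply: measurableX; [exact: measurable_itv|exact: measurable_phys_box].
by apply/seteqP; split => y; rewrite /spacebox /= in_itv /=.
Qed.

Variables (N1 N2 : R) (f g pf pg : X -> R[i]) (u v : R -> X -> R[i]).
Hypotheses (N10 : 0 < N1) (N20 : 0 < N2) (Lf : in_L2 W f) (Lg : in_L2 W g).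
Hypotheses (hpf : is_LP lam eta N1 f pf) (hpg : is_LP lam eta N2 g pg).
Hypotheses (Hu : schrodinger_solution lam pf u) (Hv : schrodinger_solution lam pg v).

Definition density (y : Rm * X) : R := complex.Re (u y.1 y.2 * v y.1 y.2) ^+ 2 + complex.Im (u y.1 y.2 * v y.1 y.2) ^+ 2.

Let density_ge0 y : 0 <= density y. Proof. by rewrite addr_ge0// sqr_ge0. Qed.

Lemma densityE y : density y =
  (complex.Re (u y.1 y.2) * complex.Re (v y.1 y.2) - complex.Im (u y.1 y.2) * complex.Im (v y.1 y.2)) ^+ 2 +
  (complex.Re (u y.1 y.2) * complex.Im (v y.1 y.2) + complex.Im (u y.1 y.2) * complex.Re (v y.1 y.2)) ^+ 2.
Proof. by rewrite /density; case: (u _ _) (v _ _) => a b [c d]. Qed.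

Lemma measurable_density : measT density.
Proof.
have [mur mui] := solution_measurable Hu; have [mvr mvi] := solution_measurable Hv.
rewrite (funext densityE).
by apply: measurable_funD; apply: measurable_funX; [apply: measurable_funB|apply: measurable_funD]; apply: measurable_funM.
Qed.

Lemma in_L2_sub (p q : X -> R[i]) : in_L2 W p -> in_L2 W q -> in_L2 W (fun z => p z - q z).
Proof.
move=> Lp Lq; have [pr pi' _] := in_L2_sqint Lp; have [qr qi _] := in_L2_sqint Lq.
have ReB (w w' : R[i]) : complex.Re (w - w') = complex.Re w - complex.Re w' by case: w w' => [? ?] [? ?].
have ImB (w w' : R[i]) : complex.Im (w - w') = complex.Im w - complex.Im w' by case: w w' => [? ?] [? ?].
have sr := sqint_sub pr qr; have si := sqint_sub pi' qi.
have eR : (fun z => complex.Re (p z - q z)) = fun z => complex.Re (p z) - complex.Re (q z) by apply/funext => z; exact: ReB.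
have eI : (fun z => complex.Im (p z - q z)) = fun z => complex.Im (p z) - complex.Im (q z) by apply/funext => z; exact: ImB.
split; first by split; rewrite ?eR ?eI; [exact: sr.1|exact: si.1].
rewrite L2normE poweR_lty//.
rewrite [ltLHS](_ : _ = \int[W]_z ((complex.Re (p z) - complex.Re (q z)) ^+ 2 + (complex.Im (p z) - complex.Im (q z)) ^+ 2)%:E)%E.
  by rewrite -(EFinRint (integrable_D sr.2 si.2)) ltry.
by apply: eq_integral => z _; rewrite ReB ImB.
Qed.

Lemma evolved_inversion (N : R) (f' pf' : X -> R[i]) (u' : R -> X -> R[i]) : 0 < N -> in_L2 W f' ->
  is_LP lam eta N f' pf' -> schrodinger_solution lam pf' u' ->
  exists F : (Fq -> R) * (Fq -> R),
  [/\ fm.-intT (F.1) /\ fm.-intT (F.2),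
   forall xi, ~ small N xi -> F.1 xi = 0 /\ F.2 xi = 0,
   forall xi, ~ large0 N xi -> F.1 xi = 0 /\ F.2 xi = 0,
   (\int[fm]_xi (F.1 xi ^+ 2 + F.2 xi ^+ 2)%:E <= (2 * bessel_const R m n)%:E * n2 W f')%E &
   forall t, 0 <= t -> {ae W, forall z, fejc R ^+ m * complex.Re (u' t z) = ev_re lam F.1 F.2 (t, z) /\
      fejc R ^+ m * complex.Im (u' t z) = ev_im lam F.1 F.2 (t, z)}].
Proof.
move=> N0 Lf' hpf' Hu'; have Lpf' : in_L2 W pf'.
  by have [h1 [h2 [[L1 _] [L2 _] ->]]] := hpf'; exact: in_L2_sub.
have [F [[mF1 mF2] hF sF lF bF]] := lp_transform l0 heta N0 Lf' hpf'.
have [_ _ fin2] := in_L2_sqint Lf'.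
have j2 : fm.-intT ((fun xi => F.1 xi ^+ 2 + F.2 xi ^+ 2)).
  apply/integrableP; split.
    by apply/measurable_EFinP; apply: measurable_funD; exact: measurable_funX.
  apply: (@le_lt_trans _ _ ((2 * bessel_const R m n)%:E * n2 W f')%E).
    apply: le_trans bF; apply: eq_le; apply: eq_integral => xi _ /=.
    by rewrite ger0_norm// addr_ge0// sqr_ge0.
  by apply: lte_mul_pinfty => //; rewrite lee_fin mulr_ge0// bessel_const_ge0.
have j21 : fm.-intT ((fun xi => F.1 xi ^+ 2)).
  apply: (integrable_dom _ j2); first exact: measurable_funX.
  by move=> xi; rewrite !ger0_norm ?addr_ge0 ?sqr_ge0// lerDl sqr_ge0.
have j22 : fm.-intT ((fun xi => F.2 xi ^+ 2)).
  apply: (integrable_dom _ j2); first exact: measurable_funX.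
  by move=> xi; rewrite !ger0_norm ?addr_ge0 ?sqr_ge0// lerDr sqr_ge0.
have j1 := band_limited_integrable (ltW N0) mF1 (fun xi h => (sF xi h).1) j21.
have j1' := band_limited_integrable (ltW N0) mF2 (fun xi h => (sF xi h).2) j22.
exists F; split => // t t0.
have h0 := has_ft_ae (solution_L2 Hu' 0) Lpf' (solution_initial Hu') hF.
have ht := ft_evolve l0 heta Hu' t0 mF1 mF2 h0.
have ma : measT (fun xi => 4 * pi ^+ 2 * @nsq R m n lam xi * t).
  apply: measurable_funM; last exact: measurable_cst.
  by apply: measurable_funM; [exact: measurable_cst|exact: measurable_quad].
have jE1 : fm.-intT ((evolve lam t F).1).
  by apply: integrable_D; [exact: (integrable_mulcos j1)|exact: (integrable_mulsin j1')].
have jE2 : fm.-intT ((evolve lam t F).2).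
  by apply: integrable_B; [exact: (integrable_mulcos j1')|exact: (integrable_mulsin j1)].
have [sr si _] := in_L2_sqint (solution_L2 Hu' t).
have i1 := inversion_re l0 heta sr si jE1 jE2 ht; have i2 := inversion_im l0 heta sr si jE1 jE2 ht.
apply: filterS2 i1 i2 => z -> ->; split.
  rewrite /inv_re /ev_re; congr Rintegral; apply/funext => xi; rewrite /evphase /evolve /=.
  rewrite (_ : 4 * pi ^+ 2 * (t * nsq lam xi) = 4 * pi ^+ 2 * nsq lam xi * t); last by ring.
  by rewrite cosB sinB; ring.
rewrite /inv_im /ev_im; congr Rintegral; apply/funext => xi; rewrite /evphase /evolve /=.
rewrite (_ : 4 * pi ^+ 2 * (t * nsq lam xi) = 4 * pi ^+ 2 * nsq lam xi * t); last by ring.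
by rewrite cosB sinB; ring.
Qed.

(** On the half-size box the triangle weights are bounded below, so the weighted estimate for the
    explicit evolutions controls the plain integral of the solutions. *)
Lemma local_bound (T0 T Q : R) : 0 < T0 -> 0 < T -> 0 <= Q ->
  (forall w tau (j : nat), (fm ([set xi | large0 N1 (fsub w xi)] `&` small N2 `&`
     [set xi | (`|offset lam w tau xi| <= 2 ^+ j / T0)%R]) <= (Q * (2 ^+ j / T0))%:E)%E) ->
  (\int[nu]_(y in spacebox T0 T) (density y)%:E <= (local_const * Q)%:E * (n2 W f * n2 W g))%E.
Proof.
move=> T00 T_0 Q0 Hset; have mD := measurable_density.
have [F [[jF1 jF2] _ lF bF hF]] := evolved_inversion N10 Lf hpf Hu.
have [G [[jG1 jG2] sG _ bG hG]] := evolved_inversion N20 Lg hpg Hv.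
have bil := bilinear_smooth l0 jF1 jF2 jG1 jG2 lF sG T00 T_0 Q0 Hset.
set ff := (\int[fm]_xi (F.1 xi ^+ 2 + _)%:E)%E in bF bil; set gg := (\int[fm]_xi (G.1 xi ^+ 2 + _)%:E)%E in bG bil.
pose c := fejc R ^+ m; have c0 : 0 < c by rewrite exprn_gt0// fejc_gt0.
pose UV y := (ev_re lam F.1 F.2 y * ev_re lam G.1 G.2 y - ev_im lam F.1 F.2 y * ev_im lam G.1 G.2 y) ^+ 2 +
  (ev_re lam F.1 F.2 y * ev_im lam G.1 G.2 y + ev_im lam F.1 F.2 y * ev_re lam G.1 G.2 y) ^+ 2.
pose Yw := @Yweight R m n T0 T.
have UV0 y : 0 <= UV y by rewrite addr_ge0// sqr_ge0.
have Yw0 y : 0 <= Yw y by exact: Yweight_ge0.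
have jFm := (integrable_measurable jF1, integrable_measurable jF2).
have jGm := (integrable_measurable jG1, integrable_measurable jG2).
have mev (H1 H2 : Fq -> R) : measT H1 -> measT H2 ->
    measT (ev_re lam H1 H2) /\ measT (ev_im lam H1 H2).
  move=> m1 m2; have me : measT (fun q : (Rm * X) * Fq => evphase lam q.1 q.2).
    by apply: measurable_evphase; mea.
  have n1 : measT (fun q : (Rm * X) * Fq => H1 q.2) by apply: (measurableT_comp m1); mea.
  have n2' : measT (fun q : (Rm * X) * Fq => H2 q.2) by apply: (measurableT_comp m2); mea.
  have mc := measurable_cosD me; have ms := measurable_sinD me.
  split.
    apply: (@measurable_param_Rintegral _ _ _ _ R fm (fun q : (Rm * X) * Fq => H1 q.2 * cos (evphase lam q.1 q.2) - H2 q.2 * sin (evphase lam q.1 q.2))).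
    by apply: measurable_funB; exact: measurable_funM.
  apply: (@measurable_param_Rintegral _ _ _ _ R fm (fun q : (Rm * X) * Fq => H1 q.2 * sin (evphase lam q.1 q.2) + H2 q.2 * cos (evphase lam q.1 q.2))).
  by apply: measurable_funD; exact: measurable_funM.
have [mU1 mU2] := mev _ _ jFm.1 jFm.2; have [mV1 mV2] := mev _ _ jGm.1 jGm.2.
have mUV : measT UV.
  by apply: measurable_funD; apply: measurable_funX; [apply: measurable_funB|apply: measurable_funD]; exact: measurable_funM.
pose xi0 : Fq := (nseq_tuple m 0, nseq_tuple n 0).
have [jYw _ _] := oscint_Y l0 T00 T_0 (xi0, xi0) (xi0, xi0).
have mYw : measT Yw := integrable_measurable jYw.
pose M := c ^- 4 * 2 ^+ m.+1.
have M0 : 0 <= M by rewrite mulr_ge0 ?exprn_ge0// invr_ge0 exprn_ge0// ltW.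
have Yw1 y : spacebox T0 T y -> 1 <= 2 ^+ m.+1 * Yw y.
  move=> [/andP[y0 y1] hy].
  have h0 : 2^-1 <= tri T0 y.1 by apply: tri_half => //; rewrite ger0_norm.
  have h1 : 2 ^- m <= \prod_(i < m) tri T (tnth y.2.1 i).
    rewrite -exprVn -[leLHS](_ : \prod_(i < m) 2^-1 = _); last by rewrite prodr_const card_ord.
    by apply: ler_prod => i _; rewrite invr_ge0 ler0n /=; exact: tri_half.
  have h2 : 2^-1 * 2 ^- m <= Yw y.
    rewrite /Yw /Yweight [X in _ * (_ * X)]big1 ?mulr1//.
    by apply: ler_pM => //; rewrite invr_ge0 ?exprn_ge0.
  have := ler_wpM2l (exprn_ge0 m.+1 (ler0n R 2)) h2; apply: le_trans.
  by rewrite exprS -invfM divff// mulf_neq0// expf_neq0.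
have mE := measurable_spacebox T0 T.
apply: (@le_trans _ _ (\int[nu]_y (M * (Yw y * UV y))%:E)%E); last first.
  rewrite ge0_intZl//; last 2 first.
  - exact: measurable_funM.
  - by move=> y; exact: mulr_ge0.
  apply: (@le_trans _ _ (M%:E * ((2 * (32 * Q * 32 ^+ m))%:E * (ff * gg)))%E).
    by apply: lee_wpmul2l => //; exact: bil.
  have ff0 : (0 <= ff)%E by apply: integral_ge0 => xi _; rewrite lee_fin addr_ge0// sqr_ge0.
  have gg0 : (0 <= gg)%E by apply: integral_ge0 => xi _; rewrite lee_fin addr_ge0// sqr_ge0.
  have Q1 : 0 <= 2 * (32 * Q * 32 ^+ m) by rewrite !mulr_ge0 ?exprn_ge0.
  apply: (@le_trans _ _ (M%:E * ((2 * (32 * Q * 32 ^+ m))%:E *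
     (((2 * bessel_const R m n)%:E * n2 W f) * ((2 * bessel_const R m n)%:E * n2 W g))))%E).
    by apply: lee_wpmul2l => //; apply: lee_wpmul2l => //; exact: lee_pmul.
  apply: eq_le.
  rewrite (muleACA (2 * bessel_const R m n)%:E) !muleA -!EFinM /local_const /M -/c.
  by congr (_%:E * _ * _)%E; ring.
have mdE : measT ((fun y => (density y)%:E) \_ (spacebox T0 T)).
  by apply/(measurable_restrictT _ mE); apply/measurable_funTS/measurable_EFinP.
have pd0 y : (0 <= ((fun y => (density y)%:E) \_ (spacebox T0 T)) y)%E.
  by rewrite patchE; case: ifP => // _; rewrite lee_fin.
have mYUV : measT (fun y => (M * (Yw y * UV y))%:E).
  by apply/measurable_EFinP; apply: measurable_funM; [exact: measurable_cst|exact: measurable_funM].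
have YUV0 y : (0 <= (M * (Yw y * UV y))%:E)%E by rewrite lee_fin mulr_ge0// mulr_ge0.
(* The solutions are identified with the evolutions at each time, outside of a null set of space
   that depends on the time; hence the comparison is made time by time. *)
rewrite integral_mkcond [leLHS](prod_tonelli _ _ mdE pd0) [leRHS](prod_tonelli _ _ mYUV YUV0).
have mt (t : Rm) : measT (fun z : X => (t, z)) by apply: measurable_pairT; [exact: measurable_cst|exact: measurable_id].
apply: ge0_le_integral => //.
- by move=> t _; exact: integral_ge0.
- exact: (measurable_param_integral _ mdE).
- exact: (measurable_param_integral _ mYUV).
move=> t _; apply: ae_ge0_le_integral => //.
- exact: (measurableT_comp mdE (mt t)).
- exact: (measurableT_comp mYUV (mt t)).
have [t0|t0] := leP 0 t; last first.
  apply: aeW => z _; rewrite patchE memNset ?YUV0// => -[/andP[h _] _].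
  by move: t0; rewrite ltNge h.
apply: filterS2 (hF t t0) (hG t t0) => z [e1 e2] [e3 e4] _.
rewrite patchE; case: ifPn => [/set_mem hy|_]; last exact: YUV0.
rewrite lee_fin densityE /=.
have UVE : UV (t, z) = c ^+ 4 * ((complex.Re (u t z) * complex.Re (v t z) - complex.Im (u t z) * complex.Im (v t z)) ^+ 2 +
  (complex.Re (u t z) * complex.Im (v t z) + complex.Im (u t z) * complex.Re (v t z)) ^+ 2).
  by rewrite /UV -e1 -e2 -e3 -e4 -/c; ring.
rewrite UVE /M; set d := _ ^+ 2 + _ ^+ 2; have d0 : 0 <= d by rewrite addr_ge0// sqr_ge0.
rewrite (_ : c ^- 4 * 2 ^+ m.+1 * (Yw (t, z) * (c ^+ 4 * d)) = (2 ^+ m.+1 * Yw (t, z)) * d); last first.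
  by move: (2 ^+ m.+1) => p; field; rewrite gt_eqF.
by rewrite -[leLHS]mul1r ler_wpM2r//; exact: Yw1.
Qed.
End localized_estimate.

(** * From boxes to the whole time interval *)

Section spacetime_norm.
Context (R : realType) (m n : nat) (lam : R).
Local Notation leb := (lebesgue R).
Local Notation Rm := (measurableTypeR R).
Local Notation X := (phys_point R m n).
Local Notation W := (waveguide m n lam).
Local Notation nu := (prod_measure leb W).

Lemma spacetime_integral (I : interval R) (h : Rm * X -> \bar R) : measT h -> (forall y, 0 <= h y)%E ->
  (\int[spacetime m n lam I]_y h y = \int[nu]_(y in [set` I] `*` setT) h y)%E.
Proof.
move=> mh h0; have mI : measurable ([set` I] : set Rm) by exact: measurable_itv.
have mIT : measurable ([set` I] `*` [set: X]) by exact: measurableX.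
have mp : measT (h \_ ([set` I] `*` [set: X])).
  by apply/(measurable_restrictT _ mIT); exact: measurable_funTS.
have p0 y : (0 <= (h \_ ([set` I] `*` [set: X])) y)%E by rewrite patchE; case: ifP.
rewrite [LHS](prod_tonelli (interval_measure I) W mh h0) [RHS]integral_mkcond [RHS](prod_tonelli leb W mp p0).
have mg : measT (fun t : Rm => \int[W]_z h (t, z))%E := measurable_param_integral _ mh.
rewrite [LHS](_ : _ = \int[leb]_(t in [set` I]) \int[W]_z h (t, z))%E; last first.
  by rewrite /interval_measure ge0_integral_restr// => t; exact: integral_ge0.
rewrite integral_mkcond; apply: eq_integral => t _; rewrite patchE; case: ifPn => [/set_mem tI|/negP tI].
  by apply: eq_integral => z _; rewrite patchE mem_set.
by rewrite integral0_eq// => z _; rewrite patchE memNset// => -[/mem_set].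
Qed.

Lemma spacetime_norm_le (I : interval R) (E : nat -> set (Rm * X)) (h : Rm * X -> R[i]) (B : R) (p q : \bar R) :
  cmeasurable h -> 0 <= B -> (0 <= p)%E -> (0 <= q)%E ->
  {homo E : k k' / (k <= k')%N >-> (k <= k')%O} -> (forall k, measurable (E k)) -> \bigcup_k E k = [set` I] `*` setT ->
  (forall k, \int[nu]_(y in E k) (complex.Re (h y) ^+ 2 + complex.Im (h y) ^+ 2)%:E <= (B ^+ 2)%:E * (p * q))%E ->
  (L2norm (spacetime m n lam I) h <= B%:E * p `^ 2^-1 * q `^ 2^-1)%E.
Proof.
move=> [mr mi] B0 p0 q0 hE mE UE hB.
have mh : measT (fun y => (complex.Re (h y) ^+ 2 + complex.Im (h y) ^+ 2)%:E).
  by apply/measurable_EFinP; apply: measurable_funD; exact: measurable_funX.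
have h0 y : (0 <= (complex.Re (h y) ^+ 2 + complex.Im (h y) ^+ 2)%:E)%E by rewrite lee_fin addr_ge0// sqr_ge0.
have n2B : (n2 (spacetime m n lam I) h <= (B ^+ 2)%:E * (p * q))%E.
  rewrite /n2 (spacetime_integral I mh h0) -UE.
  have c := @ge0_nondecreasing_set_cvg_integral _ _ R E (fun y => (complex.Re (h y) ^+ 2 + complex.Im (h y) ^+ 2)%:E)
    nu hE mE (fun k => measurable_funTS mh) (fun _ y _ => h0 y).
  rewrite -(cvg_lim _ c)//; apply: lime_le; first by apply/cvg_ex; eexists; exact: c.
  by apply: nearW.
rewrite L2normE; apply: (le_trans (poweR_mono _ (n2_ge0 _ _) n2B)) => //.
rewrite poweRM ?mule_ge0 ?lee_fin ?sqr_ge0// poweRM// muleA; apply: lee_wpmul2r; first exact: poweR_ge0.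
apply: lee_wpmul2r; first exact: poweR_ge0.
by rewrite poweR_EFin lee_fin powR12_sqrt ?sqr_ge0// sqrtr_sqr ger0_norm.
Qed.

Lemma spacebox_nondecreasing (T0 T : nat -> R) : {homo T0 : k k' / (k <= k')%N >-> k <= k'} ->
  {homo T : k k' / (k <= k')%N >-> k <= k'} ->
  {homo (fun k => @spacebox R m n (T0 k) (T k)) : k k' / (k <= k')%N >-> (k <= k')%O}.
Proof.
move=> h0 h1 k k' kk'; apply/subsetPset => y [/andP[y0 y1] hy]; split.
  by rewrite y0 (le_trans y1)// ler_pM2r// h0.
by move=> i; apply: (le_trans (hy i)); rewrite ler_pM2r// h1.
Qed.
End spacetime_norm.

(** * Resonance windows as shells *)

Section resonant_sets.
Context (R : realType).
Local Notation leb := (lebesgue R).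
Local Notation Rm := (measurableTypeR R).
Local Notation Fq m n := (m.-tuple (measurableTypeR R) * n.-tuple int)%type.

Section completed_square.
Variables (m n : nat) (lam : R) (w : Fq m n).
Hypothesis l0 : 0 < lam.
Let b (i : 'I_m) : R := tnth w.1 i / 2.
Let c (j : 'I_n) : R := (tnth w.2 j)%:~R / lam / 2.
Let r0 : R := 2 * (\sum_(i < m) b i ^+ 2 + \sum_(j < n) c j ^+ 2).

(** The parallelogram identity [|w - xi| ^ 2 + |xi| ^ 2 = 2 |xi - w / 2| ^ 2 + |w| ^ 2 / 2]: the
    window is a shell centred at half the sum of the frequencies. *)
Lemma offsetE tau (xi : Fq m n) : offset lam w tau xi = 8 * pi ^+ 2 * (quad lam b c xi - (tau - r0) / 2).
Proof.
have s1 : \sum_(i < m) (tnth (fsub w xi).1 i - 0) ^+ 2 = \sum_(i < m) (tnth w.1 i - tnth xi.1 i) ^+ 2.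
  by apply: eq_bigr => i _; rewrite tnth_mktuple subr0.
have s2 : \sum_(j < n) ((tnth (fsub w xi).2 j)%:~R / lam - 0) ^+ 2 = \sum_(j < n) ((tnth w.2 j - tnth xi.2 j)%:~R / lam) ^+ 2.
  by apply: eq_bigr => j _; rewrite tnth_mktuple subr0.
have s3 : \sum_(i < m) (tnth xi.1 i - 0) ^+ 2 = \sum_(i < m) tnth xi.1 i ^+ 2.
  by apply: eq_bigr => i _; rewrite subr0.
have s4 : \sum_(j < n) ((tnth xi.2 j)%:~R / lam - 0) ^+ 2 = \sum_(j < n) ((tnth xi.2 j)%:~R / lam) ^+ 2.
  by apply: eq_bigr => j _; rewrite subr0.
rewrite /offset /nsq /quad s1 s2 s3 s4 /r0.
have e1 : \sum_(i < m) (tnth w.1 i - tnth xi.1 i) ^+ 2 + \sum_(i < m) tnth xi.1 i ^+ 2 =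
   2 * \sum_(i < m) (tnth xi.1 i - b i) ^+ 2 + 2 * \sum_(i < m) b i ^+ 2.
  by rewrite !mulr_sumr -!big_split; apply: eq_bigr => i _; rewrite /b /=; field.
have e2 : \sum_(j < n) ((tnth w.2 j - tnth xi.2 j)%:~R / lam) ^+ 2 + \sum_(j < n) ((tnth xi.2 j)%:~R / lam) ^+ 2 =
   2 * \sum_(j < n) ((tnth xi.2 j)%:~R / lam - c j) ^+ 2 + 2 * \sum_(j < n) c j ^+ 2.
  rewrite !mulr_sumr -!big_split; apply: eq_bigr => j _; rewrite /c /= intrB; field; exact: lt0r_neq0.
set A := \sum_(i < m) (tnth w.1 i - _) ^+ 2 in e1 *; set B := \sum_(i < m) tnth xi.1 i ^+ 2 in e1 *.
set A' := \sum_(j < n) ((_ - _)%:~R / lam) ^+ 2 in e2 *; set B' := \sum_(j < n) ((tnth xi.2 j)%:~R / lam) ^+ 2 in e2 *.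
rewrite (_ : A + A' + (B + B') - tau = (A + B) + (A' + B') - tau); last by ring.
by rewrite e1 e2; field.
Qed.

Lemma resonant_setE N1 N2 tau (e : R) : [set xi | @large_freq R m n lam (fun=> 0) (fun=> 0) N1 (fsub w xi)] `&` @small_freq R m n lam N2 `&`
   [set xi | `|offset lam w tau xi| <= e] =
  freq_set lam b c N1 N2 ((tau - r0) / 2) (e / (8 * pi ^+ 2)).
Proof.
have p0 : 0 < 8 * pi ^+ 2 :> R by rewrite mulr_gt0// exprn_gt0// pi_gt0.
have l1 xi i : `|2 * 0 - tnth (fsub w xi).1 i| = `|2 * b i - tnth xi.1 i| :> R.
  by rewrite tnth_mktuple mulr0 sub0r normrN /b; congr `| _ |; field.
have l2 xi j : `|2 * 0 - (tnth (fsub w xi).2 j)%:~R / lam| = `|2 * c j - (tnth xi.2 j)%:~R / lam| :> R.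
  by rewrite tnth_mktuple mulr0 sub0r normrN /c intrB; congr `| _ |; field; exact: lt0r_neq0.
apply/seteqP; split => xi [[h1 h2] h3]; split; try split => //.
- by case: h1 => [[i h]|[j h]]; [left; exists i; rewrite -l1|right; exists j; rewrite -l2].
- by move: h3; rewrite /= offsetE normrM (gtr0_norm p0) mulrC -ler_pdivlMr.
- by case: h2 => [[i h]|[j h]]; [left; exists i; rewrite l1|right; exists j; rewrite l2].
- by move: h3; rewrite /= => h3; rewrite offsetE [leLHS]normrM (gtr0_norm p0) mulrC -ler_pdivlMr.
Qed.
End completed_square.

Lemma pi_factor : 1 <= 8 * pi ^+ 2 :> R.
Proof.
have : 2 ^+ 2 <= pi ^+ 2 :> R by rewrite ler_pXn2r ?nnegrE ?pi_ge0 ?pi_ge2.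
lra.
Qed.

Lemma resonant_bound m n (lam N1 N2 T0 : R) : 1 <= lam -> 1 <= N2 -> N2 <= N1 -> 0 < T0 ->
  forall (w : Fq m.+2 n.+1) (tau : R) (j : nat),
  (freqm m.+2 n.+1 lam ([set xi | @large_freq R m.+2 n.+1 lam (fun=> 0%R) (fun=> 0%R) N1 (fsub w xi)] `&` @small_freq R m.+2 n.+1 lam N2 `&`
     [set xi | (`|offset lam w tau xi| <= 2 ^+ j / T0)%R]) <=
   (bound_const R m n * (N2 ^+ (m + n) * (lam^-1 + N2 ^+ 2 / N1)) * (2 ^+ j / T0))%:E)%E.
Proof.
move=> l1 N21 N12 T00 w tau j; have l0 : 0 < lam by exact: lt_le_trans ltr01 l1.
have p1 := pi_factor; have p0 : 0 < 8 * pi ^+ 2 :> R by exact: lt_le_trans ltr01 p1.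
have e0 : 0 < 2 ^+ j / T0 by rewrite divr_gt0// exprn_gt0.
have de0 : 0 < 2 ^+ j / T0 / (8 * pi ^+ 2) by rewrite divr_gt0.
rewrite (resonant_setE w l0); apply: (le_trans (set_bound _ _ _ l1 N21 N12 de0)).
have N20 : 0 <= N2 by exact: le_trans ler01 N21.
have N10 : 0 <= N1 by exact: le_trans N20 N12.
have q0 : 0 <= bound_const R m n * (N2 ^+ (m + n) * (lam^-1 + N2 ^+ 2 / N1)).
  by rewrite /bound_const !mulr_ge0 ?exprn_ge0 ?addr_ge0 ?invr_ge0 ?divr_ge0 ?exprn_ge0// ltW.
rewrite lee_fin mulrAC ler_wpM2l//.
by rewrite ler_pdivrMr// ler_peMr// ltW.
Qed.

Let one (T : Type) (x : T) : 1.-tuple T := Defs.cons_tuple (x, [tuple]).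

Let tnth_one (T : Type) (x : T) i : tnth (one x) i = x.
Proof. by rewrite (tnth_nth x) (ord1 i). Qed.

Let measurable_one d (T : measurableType d) : measT (@one T).
Proof.
apply: (measurableT_comp (@measurable_cons_tuple d T 0)).
by apply: measurable_pairT; [exact: measurable_id|exact: measurable_cst].
Qed.

Let measurable_ones : measT (fun p : Rm * int => (one p.1, one p.2) : Fq 1 1).
Proof.
apply: measurable_pairT.
  by apply: (measurableT_comp (@measurable_one _ Rm)); exact: measurable_fst.
by apply: (measurableT_comp (@measurable_one _ int)); exact: measurable_snd.
Qed.

Lemma freqm11 (lam : R) (S : set (Fq 1 1)) : measurable S ->
  freqm 1 1 lam S = prod_measure leb (lattice lam) [set p | S (one p.1, one p.2)].
Proof.
move=> mS.
have mP : measurable [set p : Rm * int | S (one p.1, one p.2)].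
  by rewrite -[X in measurable X]setTI; exact: measurable_ones.
have mi : measT (fun y : Fq 1 1 => (\1_S y)%:E : \bar R).
  by apply/measurable_EFinP; exact: measurable_indic.
have i0 (y : Fq 1 1) : (0 <= (\1_S y)%:E :> \bar R)%E by rewrite lee_fin indicE.
have mj : measT (fun p : Rm * int => (\1_S (one p.1, one p.2))%:E : \bar R) := measurableT_comp mi measurable_ones.
rewrite (_ : freqm 1 1 lam S = \int[freqm 1 1 lam]_y (\1_S y)%:E)%E; last first.
  exact: (esym (etrans (integral_indic (freqm 1 1 lam) measurableT mS) (congr1 _ (setIT _)))).
rewrite (_ : prod_measure _ _ _ = \int[prod_measure leb (lattice lam)]_p (\1_S (one p.1, one p.2))%:E)%E; last first.
  exact: (esym (etrans (integral_indic (prod_measure leb (lattice lam)) measurableT mP) (congr1 _ (setIT _)))).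
rewrite [LHS](prod_tonelli (power_measure leb 1) (power_measure (lattice lam) 1) mi i0).
rewrite [RHS](prod_tonelli leb (lattice lam) mj (fun p => i0 _)).
have mF : measT (fun t => \int[power_measure (lattice lam) 1]_k (\1_S (t, k))%:E)%E := measurable_param_integral _ mi.
rewrite [LHS](cons_tonelli leb mF); last by move=> t; exact: integral_ge0.
apply: eq_integral => x _; rewrite power0_integral.
have mk : measT (fun k => (\1_S (one x, k))%:E : \bar R).
  by apply: (measurableT_comp mi (_ : measT (fun k : 1.-tuple int => (one x, k)))); mea.
rewrite [LHS](cons_tonelli (lattice lam) mk)//.
by apply: eq_integral => k _; rewrite power0_integral.
Qed.

(** The windows [2 ^+ j / 2] are those of time weight [T0 = 2]. Each is enlarged to a shell of
    half-width [2 ^+ j], which is at least 1 as [set_bound_11] demands; the enlargement doubles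
    4096. *)
Lemma resonant_bound11 (lam N1 N2 : R) : 1 <= lam -> 1 <= N2 -> N2 <= N1 ->
  forall (w : Fq 1 1) (tau : R) (j : nat),
  (freqm 1 1 lam ([set xi | @large_freq R 1 1 lam (fun=> 0%R) (fun=> 0%R) N1 (fsub w xi)] `&` @small_freq R 1 1 lam N2 `&`
     [set xi | (`|offset lam w tau xi| <= 2 ^+ j / 2)%R]) <=
   (8192 * (lam^-1 + N2 / N1) * (2 ^+ j / 2))%:E)%E.
Proof.
move=> l1 N21 N12 w tau j; have l0 : 0 < lam by exact: lt_le_trans ltr01 l1.
have p1 := pi_factor; have p0 : 0 < 8 * pi ^+ 2 :> R by exact: lt_le_trans ltr01 p1.
rewrite (resonant_setE w l0); set b := fun i => _ : R; set c := fun i => _ : R; set s := (tau - _) / 2.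
have de1 : 1 <= 2 ^+ j :> R by rewrite exprn_ege1// ler1n.
have sub : freq_set lam b c N1 N2 s (2 ^+ j / 2 / (8 * pi ^+ 2)) `<=` freq_set lam b c N1 N2 s (2 ^+ j).
  move=> xi [h1 /= h2]; split => //=; apply: (le_trans h2).
  rewrite ler_pdivrMr// ler_pdivrMr// -mulrA ler_peMr//; lra.
apply: (measure_le_sub _ _ sub); [exact: measurable_freq_set|exact: measurable_freq_set|].
apply: (@le_trans _ _ (prod_measure leb (lattice lam) [set p | freq_set lam b c N1 N2 s (2 ^+ j) (one p.1, one p.2)])).
  by apply: eq_le; apply: freqm11; exact: measurable_freq_set.
have E : [set p | freq_set lam b c N1 N2 s (2 ^+ j) (one p.1, one p.2)] =
    freq_set11 lam (b ord0) (c ord0) s (2 ^+ j) N1 N2.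
  apply/seteqP; split => -[x k].
    move=> [[[/= h1 h2] h3] h4]; split => /=.
    - by have := h1 ord0; rewrite tnth_one.
    - by have := h2 ord0; rewrite tnth_one.
    - by apply/orP; case: h3 => [[i h]|[i h]]; [left|right]; move: h; rewrite /= tnth_one (ord1 i).
    - by move: h4; rewrite /= /quad !big_ord1 !tnth_one.
  move=> [/= h1 h2 h3 h4]; split; [split; [split => i /=; rewrite tnth_one//|]|].
    by case/orP: h3 => h; [left|right]; exists ord0; rewrite /= tnth_one.
  by rewrite /= /quad !big_ord1 !tnth_one.
rewrite E; have mE : measurable (freq_set11 lam (b ord0) (c ord0) s (2 ^+ j) N1 N2).
  rewrite -E -[X in measurable X]setTI; apply: measurable_ones => //; exact: measurable_freq_set.
apply: (le_trans (set_bound_11 l1 de1 N21 N12 mE)).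
rewrite lee_fin le_eqVlt; apply/orP; left; apply/eqP.
have -> : (8192 : R) = 2 * 4096 by rewrite -natrM.
by move: (4096 : R) (lam^-1 + N2 / N1) => p q; field.
Qed.
End resonant_sets.

(** * Conclusion *)

Section bilinear_bound.
Context (R : realType) (m n : nat) (lam : R) (eta : R -> R).
Hypotheses (l0 : 0 < lam) (heta : is_cutoff eta).
Local Notation X := (phys_point R m n).
Local Notation W := (waveguide m n lam).
Local Notation Fq := (frequency R m n).

Lemma bilinear_bound (I : interval R) (T0 T : nat -> R) (N1 N2 C0 q : R) (f g pf pg : X -> R[i])
    (u v : R -> X -> R[i]) : 0 < N1 -> 0 < N2 -> in_L2 W f -> in_L2 W g ->
  is_LP lam eta N1 f pf -> is_LP lam eta N2 g pg ->
  schrodinger_solution lam pf u -> schrodinger_solution lam pg v ->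
  {homo T0 : k k' / (k <= k')%N >-> k <= k'} -> {homo T : k k' / (k <= k')%N >-> k <= k'} ->
  (forall k, 0 < T0 k) -> (forall k, 0 < T k) -> \bigcup_k @spacebox R m n (T0 k) (T k) = [set` I] `*` setT ->
  0 <= C0 -> 0 <= q ->
  (forall k (w : Fq) (tau : R) (j : nat),
    (freqm m n lam ([set xi | @large_freq R m n lam (fun=> 0%R) (fun=> 0%R) N1 (fsub w xi)] `&` @small_freq R m n lam N2 `&`
     [set xi | (`|offset lam w tau xi| <= 2 ^+ j / T0 k)%R]) <= (C0 * q * (2 ^+ j / T0 k))%:E)%E) ->
  (L2norm (spacetime m n lam I) (fun tz => (u tz.1 tz.2 * v tz.1 tz.2)%R) <=
    ((local_const R m n * C0 + 1) * Num.sqrt q)%:E * L2norm W f * L2norm W g)%E.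
Proof.
move=> N10 N20 Lf Lg hpf hpg Hu Hv hT0 hT T00 T_0 UE C00 q0 Hset.
have [mur mui] := solution_measurable Hu; have [mvr mvi] := solution_measurable Hv.
have K0 : 0 <= local_const R m n * C0 by rewrite mulr_ge0// local_const_ge0.
pose B := (local_const R m n * C0 + 1) * Num.sqrt q.
have B0 : 0 <= B by rewrite mulr_ge0 ?addr_ge0 ?sqrtr_ge0.
apply: (@le_trans _ _ (B%:E * n2 W f `^ 2^-1 * n2 W g `^ 2^-1)%E); last by rewrite !L2normE.
have ReM (w w' : R[i]) : complex.Re (w * w') = complex.Re w * complex.Re w' - complex.Im w * complex.Im w'.
  by case: w w' => [? ?] [? ?].
have ImM (w w' : R[i]) : complex.Im (w * w') = complex.Re w * complex.Im w' + complex.Im w * complex.Re w'.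
  by case: w w' => [? ?] [? ?].
have mh : cmeasurable (fun tz : measurableTypeR R * X => u tz.1 tz.2 * v tz.1 tz.2).
  split; [under eq_fun do rewrite ReM; apply: measurable_funB|under eq_fun do rewrite ImM; apply: measurable_funD];
    exact: measurable_funM.
have key := @spacetime_norm_le R m n lam I (fun k => @spacebox R m n (T0 k) (T k))
  (fun tz => u tz.1 tz.2 * v tz.1 tz.2) B (n2 W f) (n2 W g) mh B0 (n2_ge0 _ _) (n2_ge0 _ _)
  (@spacebox_nondecreasing R m n T0 T hT0 hT) (fun k => @measurable_spacebox R m n (T0 k) (T k)) UE.
apply: key => k.
apply: (le_trans (local_bound l0 heta N10 N20 Lf Lg hpf hpg Hu Hv (T00 k) (T_0 k) (mulr_ge0 C00 q0) (Hset k))).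
apply: lee_wpmul2r; first by rewrite mule_ge0 ?n2_ge0.
(* The constant is not put under a root: [x <= (x + 1) ^+ 2] is enough, and it keeps the final
   constant positive. *)
rewrite lee_fin /B exprMn sqr_sqrtr// mulrA ler_wpM2r//.
have := sqr_ge0 (local_const R m n * C0); rewrite !expr2; lra.
Qed.
End bilinear_bound.

Theorem theorem1p1 (R : realType) (eta : R -> R) (heta : is_cutoff eta) :
  (exists C : R, 0 < C /\
    forall (lam N1 N2 : R), 1 <= lam ->
    is_dyadic N1 -> is_dyadic N2 -> 1 <= N2 -> N2 <= N1 ->
    forall f g pf pg : phys_point R 1 1 -> R[i],
    in_L2 (waveguide 1 1 lam) f -> in_L2 (waveguide 1 1 lam) g ->
    is_LP lam eta N1 f pf -> is_LP lam eta N2 g pg ->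
    forall u v : R -> phys_point R 1 1 -> R[i],
    schrodinger_solution lam pf u -> schrodinger_solution lam pg v ->
    (L2norm (spacetime 1 1 lam `[0%R, 1%R])
            (fun tz => (u tz.1 tz.2 * v tz.1 tz.2)%R)
     <= (C * Num.sqrt (lam^-1 + N2 / N1))%:E *
        L2norm (waveguide 1 1 lam) f * L2norm (waveguide 1 1 lam) g)%E)
  /\
  (forall m n : nat, (2 <= m)%N -> (1 <= n)%N ->
   let d := (m + n)%N in
   exists C : R, 0 < C /\
    forall (lam N1 N2 : R), 1 <= lam ->
    is_dyadic N1 -> is_dyadic N2 -> 1 <= N2 -> N2 <= N1 ->
    forall f g pf pg : phys_point R m n -> R[i],
    in_L2 (waveguide m n lam) f -> in_L2 (waveguide m n lam) g ->
    is_LP lam eta N1 f pf -> is_LP lam eta N2 g pg ->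
    forall u v : R -> phys_point R m n -> R[i],
    schrodinger_solution lam pf u -> schrodinger_solution lam pg v ->
    (L2norm (spacetime m n lam `[0%R, +oo[)
            (fun tz => (u tz.1 tz.2 * v tz.1 tz.2)%R)
     <= (C * Num.sqrt (N2 ^+ (d - 3) / lam + N2 ^+ (d - 1) / N1))%:E *
        L2norm (waveguide m n lam) f * L2norm (waveguide m n lam) g)%E).
Proof.
(* [spacebox] uses half of each size, so the boxes have radius [k.+1] and exhaust the space. *)
pose T (k : nat) : R := 2 * k.+1%:R.
have hT : {homo T : k k' / (k <= k')%N >-> k <= k'} by move=> k k' h; rewrite ler_pM2l// ler_nat.
have T0 k : 0 < T k by rewrite mulr_gt0// ltr0n.
have Th k : T k / 2 = k.+1%:R by rewrite /T mulrAC divff ?mul1r.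
have cover m (z : m.-tuple R) (t : R) : exists k : nat, `|t| <= k.+1%:R /\ forall i, `|tnth z i| <= k.+1%:R.
  pose S := `|t| + \sum_(i < m) `|tnth z i|.
  have S0 : 0 <= S by rewrite addr_ge0// sumr_ge0.
  have Sk : S <= (Num.bound S).+1%:R by apply: (le_trans (ltW (archi_boundP S0))); rewrite ler_nat.
  exists (Num.bound S); split => [|i]; apply: le_trans Sk; first by rewrite lerDl sumr_ge0.
  by rewrite /S (bigD1 i)//= addrCA lerDl addr_ge0// sumr_ge0.
split.
  have [C CE] : {C | C = (8192 : R)} by eexists.
  have C0 : 0 <= C by rewrite CE; exact: ler0n.
  exists (local_const R 1 1 * C + 1); split; first by rewrite ltr_wpDl// mulr_ge0// local_const_ge0.
  move=> lam N1 N2 l1 _ _ N21 N12 f g pf pg Lf Lg hpf hpg u v Hu Hv.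
  have l0 : 0 < lam by exact: lt_le_trans ltr01 l1.
  have N20 : 0 < N2 by exact: lt_le_trans ltr01 N21.
  have N10 : 0 < N1 by exact: lt_le_trans N20 N12.
  (* Time size 2 gives the interval [[0, 1]]; only the space boxes grow. *)
  apply: (bilinear_bound l0 heta N10 N20 Lf Lg hpf hpg Hu Hv (T0 := fun=> 2) (T := T) (fun _ _ _ => lexx _) hT (fun=> ltr0Sn _ _) T0 _ C0).
  - apply/seteqP; split => [[t z] [k _ [/= h _]]|[t z] [/= + _]].
      by split => //=; rewrite in_itv /=; rewrite divff in h.
    rewrite in_itv /= => h; have [k [_ hk]] := cover _ z.1 t; exists k => //; split => /=; first by rewrite divff.
    by move=> i; rewrite Th.
  - by rewrite addr_ge0 ?divr_ge0 ?invr_ge0// ltW.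
  - by move=> k w tau j; rewrite CE; exact: resonant_bound11.
case=> [|[|m]] [|n] // _ _ d.
have C0 : 0 <= bound_const R m n by rewrite /bound_const !mulr_ge0 ?exprn_ge0.
exists (local_const R m.+2 n.+1 * bound_const R m n + 1); split; first by rewrite ltr_wpDl// mulr_ge0// local_const_ge0.
move=> lam N1 N2 l1 _ _ N21 N12 f g pf pg Lf Lg hpf hpg u v Hu Hv.
have l0 : 0 < lam by exact: lt_le_trans ltr01 l1.
have N20 : 0 < N2 by exact: lt_le_trans ltr01 N21.
have N10 : 0 < N1 by exact: lt_le_trans N20 N12.
have -> : N2 ^+ (d - 3) / lam + N2 ^+ (d - 1) / N1 = N2 ^+ (m + n) * (lam^-1 + N2 ^+ 2 / N1).
  rewrite (_ : (d - 3 = m + n)%N); last by rewrite /d; lia.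
  rewrite (_ : (d - 1 = m + n + 2)%N); last by rewrite /d; lia.
  by rewrite [N2 ^+ (m + n + 2)]exprD mulrDr mulrA.
(* Time grows together with space, which the window bound allows because it holds at every [T0]. *)
apply: (bilinear_bound l0 heta N10 N20 Lf Lg hpf hpg Hu Hv (T0 := T) (T := T) hT hT T0 T0 _ C0).
- apply/seteqP; split => [[t z] [k _ [/= h _]]|[t z] [/= + _]].
    by split => //=; rewrite in_itv /= andbT; case/andP: h.
  rewrite in_itv /= andbT => t0; have [k [tk hk]] := cover _ z.1 t; exists k => //; split => /=.
    by rewrite t0 Th -[X in X <= _]ger0_norm.
  by move=> i; rewrite Th.
- by rewrite mulr_ge0 ?exprn_ge0 ?addr_ge0 ?divr_ge0 ?invr_ge0 ?exprn_ge0// ltW.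
- by move=> k w tau j; exact: resonant_bound.
Qed.
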